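(* Let $H\in(1/4,1/3)$, $\alpha\in(1/4,H)$ and $\gamma\in(1/3,1/2)$ with $2\alpha+\gamma>1$. Let $(b^H,w)$ be the mixed fractional Brownian motion in $\mathbb R^{d+e}$ and $(u,v)\in\mathcal H=\mathcal H^{H,d}\oplus\mathcal H^{\frac12,e}$. Then almost surely the translation $(b^H+u,w+v)$ is lifted to an anisotropic geometric rough path $$(\mathcal T\Sigma^1,\mathcal T\Sigma^2,(B^H+U)^3)\in G\hat\Omega_{\alpha,\gamma}(\mathbb R^{d+e}),$$ where $\mathcal T\Sigma^1_{s,t}=(b^H+u,w+v)_{s,t}$, $$\mathcal T\Sigma^2=\begin{pmatrix}B^{H,2}+I[b^H,u]+I[u,b^H]+U^2& I[b^H,w]+I[b^H,v]+I[u,w]+I[u,v]\\ I[w,b^H]+I[w,u]+I[v,b^H]+I[v,u]& W^2+I[w,v]+I[v,w]+V^2\end{pmatrix},$$ and $(B^H+U)^3$ is the third level of the geometric rough path over $b^H+u$. Consequently it is also lifted to a geometric rough path $\mathcal T\Sigma=(\mathcal T\Sigma^1,\mathcal T\Sigma^2,\mathcal T\Sigma^3):=\mathbf{Ext}(\mathcal T\Sigma^1,\mathcal T\Sigma^2,(B^H+U)^3)\in G\Omega_\alpha(\mathbb R^{d+e})$.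
   Context: **Noise.** $b^H$ is a $d$-dimensional fractional Brownian motion with Hurst parameter $H$, $w$ an independent $e$-dimensional standard Brownian motion, on $[0,T]$, starting from $0$. $\mathcal H^{H,d}$, $\mathcal H^{\frac12,e}$ are their Cameron–Martin spaces; elements of both have finite $q$-variation for $(H+\frac12)^{-1}<q<2$. $\Delta_T=\{0\le s\le t\le T\}$, $x_{s,t}=x_t-x_s$, and $\|\psi\|_{\eta}=\sup_{s<t}|\psi_{s,t}|/(t-s)^\eta$ for $\psi$ on $\Delta_T$. **Geometric rough paths.** For $x\in\mathcal C_0^1([0,T],\mathcal V)$ let $S_3(x)=(S^1,S^2,S^3)$, $S^k_{s,t}=\int_{s<t_1<\dots<t_k<t}dx_{t_1}\otimes\cdots\otimes dx_{t_k}$. $G\Omega_\alpha(\mathcal V)$ ($1/4<\alpha\le1/3$) is the closure of $\{S_3(x)\}$ under $\rho_\alpha(\mathbf X,\tilde{\mathbf X})=\sum_{i=1}^3\|X^i-\tilde X^i\|_{i\alpha}$. **Anisotropic rough paths.** Let $\mathcal V=\mathcal V_1\oplus\mathcal V_2$ (here $\mathcal V_1=\mathbb R^d$, $\mathcal V_2=\mathbb R^e$). An anisotropic rough path of roughness $(\alpha,\gamma)$ is a continuous map $(\Xi^1,\Xi^2,B^3):\Delta_T\to\mathcal V\oplus\mathcal V^{\otimes2}\oplus\mathcal V_1^{\otimes3}$, with $\Xi^1=(B^1,W^1)$ and $\Xi^2$ having blocks $B^2\in\mathcal V_1^{\otimes2}$, $I[B,W]\in\mathcal V_1\otimes\mathcal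 V_2$, $I[W,B]\in\mathcal V_2\otimes\mathcal V_1$, $W^2\in\mathcal V_2^{\otimes2}$, such that $\|B^1\|_\alpha,\|B^2\|_{2\alpha},\|B^3\|_{3\alpha},\|W^1\|_\gamma,\|W^2\|_{2\gamma},\|I[B,W]\|_{\alpha+\gamma},\|I[W,B]\|_{\alpha+\gamma}<\infty$ and Chen's relations hold: $\Xi^1_{s,t}=\Xi^1_{s,u}+\Xi^1_{u,t}$, $\Xi^2_{s,t}=\Xi^2_{s,u}+\Xi^2_{u,t}+\Xi^1_{s,u}\otimes\Xi^1_{u,t}$, $B^3_{s,t}=B^3_{s,u}+B^3_{u,t}+B^1_{s,u}\otimes B^2_{u,t}+B^2_{s,u}\otimes B^1_{u,t}$. For $z\in\mathcal C_0^1(\mathcal V)$, $\hat S(z)$ is its natural lift by Riemann–Stieltjes integrals; $G\hat\Omega_{\alpha,\gamma}(\mathcal V)$ is the closure of $\{\hat S(z)\}$ in the metric whose value at $(\Xi^1,\Xi^2,B^3)$ and $(\tilde\Xi^1,\tilde\Xi^2,\tilde B^3)$ is $\|B^1-\tilde B^1\|_\alpha+\|B^2-\tilde B^2\|_{2\alpha}+\|B^3-\tilde B^3\|_{3\alpha}+\|W^1-\tilde W^1\|_\gamma+\|W^2-\tilde W^2\|_{2\gamma}+\|I[B,W]-I[\tilde B,\tilde W]\|_{\alpha+\gamma}+\|I[W,B]-I[\tilde W,\tilde B]\|_{\alpha+\gamma}$. **Ext.** For $(\Xi^1,\Xi^2,B^3)\in G\hat\Omega_{\alpha,\gamma}(\mathcal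 V)$, $\mathbf{Ext}(\Xi^1,\Xi^2,B^3)=(\Xi^1,\Xi^2,\Xi^3)$, where the $\mathcal V_1^{\otimes3}$ block of $\Xi^3$ is $B^3$, the $\mathcal V_2^{\otimes 3}$ block is the third level $W^3$ of the (Lyons) extension of $(W^1,W^2)$, and for $(i,j,k)\ne(1,1,1),(2,2,2)$ the $\mathcal V_i\otimes\mathcal V_j\otimes\mathcal V_k$ block is that of $\lim\sum_l(\Xi^1_{s,t_{l-1}}\otimes\Xi^2_{t_{l-1},t_l}+\Xi^2_{s,t_{l-1}}\otimes\Xi^1_{t_{l-1},t_l})$ over partitions $s=t_0<\dots<t_N=t$ with mesh to $0$. **Entries of $\mathcal T\Sigma^2$.** $I[x,y]_{s,t}=\int_s^tx_{s,r}\otimes dy_r$, in the Young sense whenever $x$ or $y$ is one of $u,v$; $I[b^H,w]$ is an Itô integral and $I[w,b^H]_{s,t}=w_{s,t}\otimes b^H_{s,t}-\int_s^t d^{\rm Itô}w_r\otimes b^H_{s,r}$. $(B^{H,1},B^{H,2},B^{H,3})$ is the canonical geometric rough path over $b^H$ (a.s. limit of $S_3$ of dyadic piecewise linear approximations), $W^2$ the Stratonovich iterated integral of $w$, $U^2=I[u,u]$, $V^2=I[v,v]$. **Third level over $b^H+u$.** With $b=b^H$, $B^2=B^{H,2}$, $U^3$ the third iterated Young integral of $u$, $(B^H+U)^3_{s,t}=B^{H,3}_{s,t}+U^3_{s,t}+\int_s^tU^2_{s,r}\otimes db_r+\int_s^tI[u,b]_{s,r}\otimes du_r+\int_s^tI[b,u]_{s,r}\otimes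 du_r+\int_s^tb_{s,r}\otimes du_r\otimes b_{r,t}+\int_s^tB^2_{s,r}\otimes du_r+\int_s^tdu_r\otimes B^2_{r,t}$ (Young integrals). *)

(* Defs.v *)
From HB Require Import structures.
From mathcomp Require Import all_boot all_order all_algebra.
From mathcomp Require Import all_classical all_reals all_analysis.

Set Implicit Arguments.
Unset Strict Implicit.
Unset Printing Implicit Defensive.

Import Order.TTheory GRing.Theory Num.Theory.
Import numFieldNormedType.Exports.

Local Open Scope classical_set_scope.
Local Open Scope ring_scope.

(* A vector space with coordinates indexed by a finite type I is I -> R, so
   that V1 (+) V2 is I + J -> R, V (x) W is I * J -> R and a 3-tensor is
   I * I * I -> R.  Paths and two-parameter maps are total functions of their
   (real) time arguments; only the values on [0, T], resp. on Delta_T, matter. *)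
Notation path_in R I := (R -> I -> R) (only parsing).
Notation two_param R I := (R -> R -> I -> R) (only parsing).
Notation process R Omega I := (R -> Omega -> I -> R) (only parsing).

Definition sample {R : realType} {Omega I : Type}
  (X : process R Omega I) (omega : Omega) : path_in R I :=
  fun t => X t omega.

Definition incr {R : realType} {I : Type} (x : path_in R I) : two_param R I :=
  fun s t i => x t i - x s i.

(* The points s = t_0 < ... < t_N = t of an [itv_partition s t p], N = size p. *)
Definition part_point {R : realType} (s t : R) (p : seq R) (l : nat) : R :=
  nth t (s :: p) l.

Definition mesh {R : realType} (s t : R) (p : seq R) : R :=
  \big[Num.max/0]_(0 <= l < size p)
    (part_point s t p l.+1 - part_point s t p l).

Definition mesh0 {R : realType} (s t : R) : set_system (seq R) :=
  filter_from [set delta : R | 0 < delta]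
    (fun delta => [set p | itv_partition s t p /\ mesh s t p < delta]).

Definition tagged_mesh0 {R : realType} (s t : R) :
    set_system (seq R * (nat -> R)) :=
  filter_from [set delta : R | 0 < delta]
    (fun delta => [set px | [/\ itv_partition s t px.1, mesh s t px.1 < delta &
      forall l, (l < size px.1)%N ->
        part_point s t px.1 l <= px.2 l <= part_point s t px.1 l.+1]]).

Definition RS_sum {R : realType} (f g : R -> R) (s t : R)
    (px : seq R * (nat -> R)) : R :=
  \sum_(0 <= l < size px.1)
    f (px.2 l) * (g (part_point s t px.1 l.+1) - g (part_point s t px.1 l)).

Definition RS_integrable {R : realType} (f g : R -> R) (s t : R) : Prop :=
  cvg (RS_sum f g s t @ tagged_mesh0 s t).

(* \int_s^t f dg; junk unless [RS_integrable f g s t].  It is the Young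
   integral when f and g have complementary variation. *)
Definition RS_integral {R : realType} (f g : R -> R) (s t : R) : R :=
  lim (RS_sum f g s t @ tagged_mesh0 s t).

(* I[x,y]_{s,t} = \int_s^t x_{s,r} (x) dy_r *)
Definition iint {R : realType} {I J : Type} (x : path_in R I) (y : path_in R J) :
    two_param R (I * J) :=
  fun s t ij => RS_integral (fun r => incr x s r ij.1) (y^~ ij.2) s t.

(* \int_s^t A_{s,r} (x) dy_r *)
Definition iint_r {R : realType} {I J K : Type}
    (A : two_param R (I * J)) (y : path_in R K) : two_param R (I * J * K) :=
  fun s t ijk => RS_integral (fun r => A s r ijk.1) (y^~ ijk.2) s t.

(* \int_s^t dx_r (x) A_{r,t} *)
Definition iint_l {R : realType} {I J K : Type}
    (x : path_in R I) (A : two_param R (J * K)) : two_param R (I * J * K) :=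
  fun s t ijk =>
    RS_integral (fun r => A r t (ijk.1.2, ijk.2)) (x^~ ijk.1.1) s t.

(* \int_s^t x_{s,r} (x) dy_r (x) z_{r,t} *)
Definition iint_m {R : realType} {I J K : Type}
    (x : path_in R I) (y : path_in R J) (z : path_in R K) :
    two_param R (I * J * K) :=
  fun s t ijk =>
    RS_integral (fun r => incr x s r ijk.1.1 * incr z r t ijk.2)
      (y^~ ijk.1.2) s t.

Definition iint_ok {R : realType} {I J : Type} (T : R)
    (x : path_in R I) (y : path_in R J) : Prop :=
  forall s t i j, 0 <= s -> s <= t -> t <= T ->
    RS_integrable (fun r => incr x s r i) (y^~ j) s t.

Definition iint_r_ok {R : realType} {I J K : Type} (T : R)
    (A : two_param R (I * J)) (y : path_in R K) : Prop :=
  forall s t ij k, 0 <= s -> s <= t -> t <= T ->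
    RS_integrable (fun r => A s r ij) (y^~ k) s t.

Definition iint_l_ok {R : realType} {I J K : Type} (T : R)
    (x : path_in R I) (A : two_param R (J * K)) : Prop :=
  forall s t i jk, 0 <= s -> s <= t -> t <= T ->
    RS_integrable (fun r => A r t jk) (x^~ i) s t.

Definition iint_m_ok {R : realType} {I J K : Type} (T : R)
    (x : path_in R I) (y : path_in R J) (z : path_in R K) : Prop :=
  forall s t i j k, 0 <= s -> s <= t -> t <= T ->
    RS_integrable (fun r => incr x s r i * incr z r t k) (y^~ j) s t.

Definition tnorm {R : realType} {I : finType} (a : I -> R) : R :=
  Num.sqrt (\sum_i a i ^+ 2).

Definition hnorm {R : realType} {I : finType} (T eta : R)
    (psi : two_param R I) : \bar R :=
  ereal_sup [set (tnorm (psi st.1 st.2) / (st.2 - st.1) `^ eta)%:E |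
    st in [set st : R * R | [/\ 0 <= st.1, st.1 < st.2 & st.2 <= T]]].
Arguments hnorm {R I} (T eta)%_R psi%_R.

Definition continuous_two {R : realType} {I : Type} (T : R)
    (psi : two_param R I) : Prop :=
  forall i, {within [set st : R * R | [/\ 0 <= st.1, st.1 <= st.2 & st.2 <= T]],
    continuous (fun st : R * R => psi st.1 st.2 i)}.

Definition chen1 {R : realType} {I : Type} (T : R) (X1 : two_param R I) : Prop :=
  forall s u t i, 0 <= s -> s <= u -> u <= t -> t <= T ->
    X1 s t i = X1 s u i + X1 u t i.

Definition chen2 {R : realType} {I : Type} (T : R)
    (X1 : two_param R I) (X2 : two_param R (I * I)) : Prop :=
  forall s u t i j, 0 <= s -> s <= u -> u <= t -> t <= T ->
    X2 s t (i, j) = X2 s u (i, j) + X2 u t (i, j) + X1 s u i * X1 u t j.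

Definition chen3 {R : realType} {I : Type} (T : R) (X1 : two_param R I)
    (X2 : two_param R (I * I)) (X3 : two_param R (I * I * I)) : Prop :=
  forall s u t i j k, 0 <= s -> s <= u -> u <= t -> t <= T ->
    X3 s t (i, j, k) = X3 s u (i, j, k) + X3 u t (i, j, k)
      + X1 s u i * X2 u t (j, k) + X2 s u (i, j) * X1 u t k.

(* C^1 paths on [0, T] are the restrictions of C^1 functions on the line. *)
Definition is_C1_0 {R : realType} {I : Type} (x : path_in R I) : Prop :=
  forall i, [/\ x 0 i = 0, forall t, derivable (x^~ i) t 1 &
    continuous (derive1 (x^~ i))].

Record rough3 (R : realType) (I : Type) := Rough3 {
  lev1 : two_param R I;
  lev2 : two_param R (I * I);
  lev3 : two_param R (I * I * I) }.

Definition S3 {R : realType} {I : Type} (x : path_in R I) : rough3 R I :=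
  Rough3 (incr x) (iint x x) (iint_r (iint x x) x).

Definition rho {R : realType} {I : finType} (T alpha : R)
    (X Y : rough3 R I) : \bar R :=
  (hnorm T alpha (lev1 X - lev1 Y)
   + hnorm T (2 * alpha) (lev2 X - lev2 Y)
   + hnorm T (3 * alpha) (lev3 X - lev3 Y))%E.

Definition rough_path {R : realType} {I : finType} (T alpha : R)
    (X : rough3 R I) : Prop :=
  [/\ [/\ continuous_two T (lev1 X), continuous_two T (lev2 X)
        & continuous_two T (lev3 X)],
      [/\ (hnorm T alpha (lev1 X) < +oo)%E,
          (hnorm T (2 * alpha) (lev2 X) < +oo)%E
        & (hnorm T (3 * alpha) (lev3 X) < +oo)%E]
    & [/\ chen1 T (lev1 X), chen2 T (lev1 X) (lev2 X)
        & chen3 T (lev1 X) (lev2 X) (lev3 X)]].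

(* The closure of the lifts of C^1 paths, taken inside the set of rough paths. *)
Definition geometric_rough_path {R : realType} {I : finType} (T alpha : R)
    (X : rough3 R I) : Prop :=
  rough_path T alpha X /\
  forall eps : R, 0 < eps ->
    exists2 x : path_in R I, is_C1_0 x & (rho T alpha (S3 x) X < eps%:E)%E.

Record aniso (R : realType) (I J : Type) := Aniso {
  Xi1 : two_param R (I + J);
  Xi2 : two_param R ((I + J) * (I + J));
  Xi3 : two_param R (I * I * I) }.

Section Blocks.
Context {R : realType} {I J : Type}.
Definition block1 (A : two_param R (I + J)) : two_param R I :=
  fun s t i => A s t (inl i).
Definition block2 (A : two_param R (I + J)) : two_param R J :=
  fun s t j => A s t (inr j).
Definition block11 (A : two_param R ((I + J) * (I + J))) : two_param R (I * I) :=
  fun s t ij => A s t (inl ij.1, inl ij.2).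
Definition block12 (A : two_param R ((I + J) * (I + J))) : two_param R (I * J) :=
  fun s t ij => A s t (inl ij.1, inr ij.2).
Definition block21 (A : two_param R ((I + J) * (I + J))) : two_param R (J * I) :=
  fun s t ij => A s t (inr ij.1, inl ij.2).
Definition block22 (A : two_param R ((I + J) * (I + J))) : two_param R (J * J) :=
  fun s t ij => A s t (inr ij.1, inr ij.2).
Definition pair_path (x : path_in R I) (y : path_in R J) : path_in R (I + J) :=
  fun t k => match k with inl i => x t i | inr j => y t j end.
Definition block_tensor (A11 : two_param R (I * I)) (A12 : two_param R (I * J))
    (A21 : two_param R (J * I)) (A22 : two_param R (J * J)) :
    two_param R ((I + J) * (I + J)) :=
  fun s t kl => match kl with
    | (inl i, inl i') => A11 s t (i, i')
    | (inl i, inr j) => A12 s t (i, j)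
    | (inr j, inl i) => A21 s t (j, i)
    | (inr j, inr j') => A22 s t (j, j')
    end.
End Blocks.

Definition aniso_dist {R : realType} {I J : finType} (T alpha gamma : R)
    (X Y : aniso R I J) : \bar R :=
  (hnorm T alpha (block1 (Xi1 X) - block1 (Xi1 Y))
   + hnorm T (2 * alpha) (block11 (Xi2 X) - block11 (Xi2 Y))
   + hnorm T (3 * alpha) (Xi3 X - Xi3 Y)
   + hnorm T gamma (block2 (Xi1 X) - block2 (Xi1 Y))
   + hnorm T (2 * gamma) (block22 (Xi2 X) - block22 (Xi2 Y))
   + hnorm T (alpha + gamma) (block12 (Xi2 X) - block12 (Xi2 Y))
   + hnorm T (alpha + gamma) (block21 (Xi2 X) - block21 (Xi2 Y)))%E.

Definition aniso_rough_path {R : realType} {I J : finType} (T alpha gamma : R)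
    (X : aniso R I J) : Prop :=
  [/\ [/\ continuous_two T (Xi1 X), continuous_two T (Xi2 X)
        & continuous_two T (Xi3 X)],
      [/\ (hnorm T alpha (block1 (Xi1 X)) < +oo)%E,
          (hnorm T (2 * alpha) (block11 (Xi2 X)) < +oo)%E
        & (hnorm T (3 * alpha) (Xi3 X) < +oo)%E],
      [/\ (hnorm T gamma (block2 (Xi1 X)) < +oo)%E,
          (hnorm T (2 * gamma) (block22 (Xi2 X)) < +oo)%E,
          (hnorm T (alpha + gamma) (block12 (Xi2 X)) < +oo)%E
        & (hnorm T (alpha + gamma) (block21 (Xi2 X)) < +oo)%E]
    & [/\ chen1 T (Xi1 X), chen2 T (Xi1 X) (Xi2 X)
        & chen3 T (block1 (Xi1 X)) (block11 (Xi2 X)) (Xi3 X)]].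

Definition aniso_lift {R : realType} {I J : Type} (z : path_in R (I + J)) :
    aniso R I J :=
  let x : path_in R I := fun t i => z t (inl i) in
  Aniso (incr z) (iint z z) (lev3 (S3 x)).

Definition geometric_aniso {R : realType} {I J : finType} (T alpha gamma : R)
    (X : aniso R I J) : Prop :=
  aniso_rough_path T alpha gamma X /\
  forall eps : R, 0 < eps ->
    exists2 z : path_in R (I + J), is_C1_0 z &
      (aniso_dist T alpha gamma (aniso_lift z) X < eps%:E)%E.

(* For gamma > 1/3, Lyons' extension theorem: the third level is the unique
   multiplicative one with finite 3 gamma-Hoelder norm. *)
Definition lyons_third {R : realType} {J : finType} (T gamma : R)
    (W1 : two_param R J) (W2 : two_param R (J * J))
    (W3 : two_param R (J * J * J)) : Prop :=
  [/\ continuous_two T W3, chen3 T W1 W2 W3 & (hnorm T (3 * gamma) W3 < +oo)%E].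

Definition ext_sum {R : realType} {K : Type} (X1 : two_param R K)
    (X2 : two_param R (K * K)) (i j k : K) (s t : R) (p : seq R) : R :=
  \sum_(0 <= l < size p)
    (X1 s (part_point s t p l) i
       * X2 (part_point s t p l) (part_point s t p l.+1) (j, k)
     + X2 s (part_point s t p l) (i, j)
       * X1 (part_point s t p l) (part_point s t p l.+1) k).

(* [is_Ext T gamma X Z] : Ext(X) = Z.  This determines Z on Delta_T. *)
Definition is_Ext {R : realType} {I J : finType} (T gamma : R)
    (X : aniso R I J) (Z : rough3 R (I + J)%type) : Prop :=
  [/\ lev1 Z = Xi1 X, lev2 Z = Xi2 X,
      (forall s t i j k, 0 <= s -> s <= t -> t <= T ->
         lev3 Z s t (inl i, inl j, inl k) = Xi3 X s t (i, j, k)),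
      lyons_third T gamma (block2 (Xi1 X)) (block22 (Xi2 X))
        (fun s t ijk => lev3 Z s t (inr ijk.1.1, inr ijk.1.2, inr ijk.2))
    & forall s t (i j k : I + J), 0 <= s -> s <= t -> t <= T ->
        match i, j, k with
        | inl _, inl _, inl _ | inr _, inr _, inr _ => True
        | _, _, _ =>
            ext_sum (Xi1 X) (Xi2 X) i j k s t @ mesh0 s t --> lev3 Z s t (i, j, k)
        end].

(* [normal_prob m 0] is not a Dirac mass in the library. *)
Definition gaussian_rv {d : measure_display} {Omega : measurableType d}
    {R : realType} (P : probability Omega R) (X : Omega -> R) : Prop :=
  exists m sigma : R, forall A : set R, measurable A ->
    P (X @^-1` A) = if sigma == 0 then \d_m A else normal_prob m sigma A.

(* Cov X^i_s X^j_t = delta_ij K(s,t): the components are i.i.d. processes. *)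
Definition centered_gaussian_process {d : measure_display}
    {Omega : measurableType d} {R : realType} (P : probability Omega R)
    {I : finType} (T : R) (K : R -> R -> R) (X : process R Omega I) : Prop :=
  [/\ (forall t i, 0 <= t <= T -> measurable_fun setT (fun omega => X t omega i)),
      (forall n (c ts : 'I_n -> R) (is_ : 'I_n -> I),
         (forall k, 0 <= ts k <= T) ->
         gaussian_rv P (fun omega => \sum_k c k * X (ts k) omega (is_ k))),
      (forall t i, 0 <= t <= T -> expectation P (fun omega => X t omega i) = 0%E)
    & (forall s t i j, 0 <= s <= T -> 0 <= t <= T ->
         expectation P (fun omega => X s omega i * X t omega j) =
           (if i == j then K s t else 0)%:E)].

Definition continuous_from0 {d : measure_display} {Omega : measurableType d}
    {R : realType} (P : probability Omega R) {I : finType} (T : R)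
    (X : process R Omega I) : Prop :=
  {ae P, forall omega, forall i,
    X 0 omega i = 0 /\ {within `[0, T], continuous (fun t => X t omega i)}}.

Definition fractional_brownian {d : measure_display} {Omega : measurableType d}
    {R : realType} (P : probability Omega R) {I : finType} (T H : R)
    (X : process R Omega I) : Prop :=
  centered_gaussian_process P T
    (fun s t => (s `^ (2 * H) + t `^ (2 * H) - `|t - s| `^ (2 * H)) / 2) X
  /\ continuous_from0 P T X.

Definition brownian {d : measure_display} {Omega : measurableType d}
    {R : realType} (P : probability Omega R) {I : finType} (T : R)
    (X : process R Omega I) : Prop :=
  centered_gaussian_process P T (fun s t => Num.min s t) X
  /\ continuous_from0 P T X.

Definition process_sigma {d : measure_display} {Omega : measurableType d}
    {R : realType} {I : Type} (T : R) (X : process R Omega I) :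
    set (set Omega) :=
  <<s [set A | exists t i (B : set R), [/\ 0 <= t <= T, measurable B &
         A = (fun omega => X t omega i) @^-1` B]] >>.

Definition independent_processes {d : measure_display}
    {Omega : measurableType d} {R : realType} (P : probability Omega R)
    {I J : Type} (T : R) (X : process R Omega I) (Y : process R Omega J) : Prop :=
  forall A B, process_sigma T X A -> process_sigma T Y B ->
    P (A `&` B) = (P A * P B)%E.

Definition mixed_fbm {d : measure_display} {Omega : measurableType d}
    {R : realType} (P : probability Omega R) {I J : finType} (T H : R)
    (b : process R Omega I) (w : process R Omega J) : Prop :=
  [/\ fractional_brownian P T H b, brownian P T w
    & independent_processes P T b w].

(* The L^2-closed linear span of the X^i_t, t in [0, T]. *)
Definition first_chaos {d : measure_display} {Omega : measurableType d}
    {R : realType} (P : probability Omega R) {I : Type} (T : R)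
    (X : process R Omega I) (Z : Omega -> R) : Prop :=
  measurable_fun setT Z /\
  forall eps : R, 0 < eps ->
    exists n (c ts : 'I_n -> R) (is_ : 'I_n -> I),
      (forall k, 0 <= ts k <= T) /\
      (expectation P (fun omega =>
          (Z omega - \sum_k c k * X (ts k) omega (is_ k)) ^+ 2)%R < eps%:E)%E.

(* Cameron-Martin space of the law of a centred Gaussian process X. *)
Definition cameron_martin {d : measure_display} {Omega : measurableType d}
    {R : realType} (P : probability Omega R) {I : Type} (T : R)
    (X : process R Omega I) (h : path_in R I) : Prop :=
  exists2 Z, first_chaos P T X Z &
    forall t i, 0 <= t <= T ->
      (h t i)%:E = expectation P (fun omega => Z omega * X t omega i).

Definition ito_sum {R : realType} (f g : R -> R) (s t : R) (p : seq R) : R :=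
  \sum_(0 <= l < size p)
    f (part_point s t p l) * (g (part_point s t p l.+1) - g (part_point s t p l)).

Definition stratonovich_sum {R : realType} (f g : R -> R) (s t : R)
    (p : seq R) : R :=
  \sum_(0 <= l < size p)
    (f (part_point s t p l) + f (part_point s t p l.+1)) / 2
      * (g (part_point s t p l.+1) - g (part_point s t p l)).

(* A_{s,t} is the L^2-limit of [sum (x_{s,.}) y s t p] as the mesh of the
   (deterministic) partition p goes to 0, in a version that is a.s. continuous
   in (s,t). *)
Definition stochastic_iint {d : measure_display} {Omega : measurableType d}
    {R : realType} (P : probability Omega R) {I J : finType}
    (sum : (R -> R) -> (R -> R) -> R -> R -> seq R -> R) (T : R)
    (x : process R Omega I) (y : process R Omega J)
    (A : Omega -> two_param R (I * J)) : Prop :=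
  (forall s t i j, 0 <= s -> s <= t -> t <= T ->
     measurable_fun setT (fun omega => A omega s t (i, j)) /\
     (fun p => expectation P (fun omega =>
         (sum (fun r => incr (sample x omega) s r i)
              (fun r => y r omega j) s t p - A omega s t (i, j)) ^+ 2))
       @ mesh0 s t --> 0%E)
  /\ {ae P, forall omega, continuous_two T (A omega)}.

Definition ito_iint {d : measure_display} {Omega : measurableType d}
    {R : realType} (P : probability Omega R) {I J : finType} :=
  @stochastic_iint d Omega R P I J ito_sum.

Definition stratonovich_iint {d : measure_display} {Omega : measurableType d}
    {R : realType} (P : probability Omega R) {I J : finType} :=
  @stochastic_iint d Omega R P I J stratonovich_sum.

(* I[w,b]_{s,t} = w_{s,t} (x) b_{s,t} - \int_s^t d^Ito w_r (x) b_{s,r},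
   where the (j,i) entry of the last integral is the (i,j) entry of I[b,w]. *)
Definition ito_flip {R : realType} {I J : Type}
    (b : path_in R I) (w : path_in R J) (Ibw : two_param R (I * J)) :
    two_param R (J * I) :=
  fun s t ji => incr w s t ji.1 * incr b s t ji.2 - Ibw s t (ji.2, ji.1).

(* Linear interpolation of x at the points k T / 2^n. *)
Definition dyadic {R : realType} {I : Type} (T : R) (n : nat)
    (x : path_in R I) : path_in R I :=
  fun t i =>
    let tau := t * 2 ^+ n / T in
    let k := Num.truncn tau in
    x (k%:R * T / 2 ^+ n) i
      + (tau - k%:R) * (x (k.+1%:R * T / 2 ^+ n) i - x (k%:R * T / 2 ^+ n) i).

Definition canonical_rough_path {d : measure_display}
    {Omega : measurableType d} {R : realType} (P : probability Omega R)
    {I : finType} (T alpha : R) (b : process R Omega I)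
    (B : Omega -> rough3 R I) : Prop :=
  {ae P, forall omega, geometric_rough_path T alpha (B omega) /\
    (fun n => rho T alpha (S3 (dyadic T n (sample b omega))) (B omega))
      @ \oo --> 0%E}.

Section Translation.
Context {R : realType} {I J : Type}.
Variables (b u : path_in R I) (w v : path_in R J).
Variables (B : rough3 R I) (Ibw : two_param R (I * J))
  (W2 : two_param R (J * J)).

Definition transl1 : two_param R (I + J) := incr (pair_path (b + u) (w + v)).

Definition transl2 : two_param R ((I + J) * (I + J)) :=
  block_tensor
    (lev2 B + iint b u + iint u b + iint u u)
    (Ibw + iint b v + iint u w + iint u v)
    (ito_flip b w Ibw + iint w u + iint v b + iint v u)
    (W2 + iint w v + iint v w + iint v v).

Definition transl3 : two_param R (I * I * I) :=
  lev3 B + iint_r (iint u u) u + iint_r (iint u u) b + iint_r (iint u b) u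
  + iint_r (iint b u) u + iint_m b u b + iint_r (lev2 B) u + iint_l u (lev2 B).

(* [RS_integral] is total, so the existence of the Young integrals occurring in
   [transl2] and [transl3] is a separate statement. *)
Definition young_integrals_exist (T : R) : Prop :=
  [/\ [/\ iint_ok T b u, iint_ok T u b & iint_ok T u u],
      [/\ iint_ok T b v, iint_ok T u w & iint_ok T u v],
      [/\ iint_ok T w u, iint_ok T v b & iint_ok T v u],
      [/\ iint_ok T w v, iint_ok T v w & iint_ok T v v]
    & [/\ iint_r_ok T (iint u u) u /\ iint_r_ok T (iint u u) b,
          iint_r_ok T (iint u b) u /\ iint_r_ok T (iint b u) u,
          iint_m_ok T b u b, iint_r_ok T (lev2 B) u & iint_l_ok T u (lev2 B)]].
End Translation.

(* Main.v *)
(** The lift is obtained as the limit of the lifts of dyadic interpolations, which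
    are Lipschitz and are finally mollified to C^1 paths.

    A Cameron-Martin path has the form u_t = E[Z X_t].  As disjoint increments of X
    are nonpositively correlated (x^(2H) is concave), a duality argument bounds the
    sums of |u_{t_j,t_{j+1}}|^2 / (t_{j+1} - t_j)^(2H) by 2 E[Z^2], so that
    |u_{s,t}| <= C (t - s)^H w(s,t)^(1/2) with a superadditive w.  Against an
    a-Hoelder path with a + H > 1/2 the defect of Riemann sums is then bounded by
    (t - s)^(a + H) w(s,t)^(1/2), which is summable: by sewing, all the Young
    integrals of the second and third level exist and depend continuously on the
    paths.  Hence the translated lift converges as soon as the lift of (b, w) does,
    and its extension to the third level is a sewing limit as well, because
    2 alpha + gamma > 1.

    For (b, w), the levels over b converge by the definition of the canonical rough
    path.  Over a dyadic interval, the increment between two consecutive dyadic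
    approximations of I[b,w] (or of an off-diagonal entry of W^2) is a decoupled
    quadratic form sum M_l eta_l in Gaussian variables.  Its moments of high order
    are summable, so that it decays geometrically almost surely, and chaining
    turns this into convergence in the Hoelder norm; the limit is identified in
    L^2. *)

From HB Require Import structures.
Require Import Defs.
From mathcomp Require Import all_boot all_order all_algebra.
From mathcomp Require Import all_classical all_reals all_analysis.
From mathcomp Require Import measurable_realfun.
From mathcomp Require Import ring lra zify.

Set Implicit Arguments.
Unset Strict Implicit.
Unset Printing Implicit Defensive.

Import Order.TTheory GRing.Theory Num.Theory.
Import numFieldNormedType.Exports.

Local Open Scope classical_set_scope.
Local Open Scope ring_scope.

(** * Partitions, sewing and Young integrals *)

(** Hoelder exponents alone cannot give the integrals against a Cameron-Martin path: those of b and
    u may be close to 1/4, so that their sum is far below 1. Finite variation of u would give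
    existence, but bounds in variation do not control the Hoelder distances. The factor w(s,t)^(1/2)
    settles both: it counts as an additional exponent 1/2 when increments are summed over a
    partition, and it is merely bounded when increments are compared pointwise. Most identities
    between iterated integrals are proved for Lipschitz paths only, where they follow from
    uniqueness (an additive function of exponent above 1 vanishes), and then pass to the limit. On
    the probabilistic side, Gaussian variables enter through their moments, which factorise by
    comparison of polynomial coefficients. The stochastic integrals are known only as L^2 limits.
    Almost surely this makes them cluster values of the dyadic integrals, and the geometric decay of
    the increments turns a cluster value into the limit. *)

Section Partitions.
Context {R : realType}.
Implicit Types (s t u v x y : R) (p q : seq R) (A th : R -> R -> R).

(** Recursive form of the indexed sums in the statement. Removing the first point moves the left end
    point, so inductions on partitions need no index arithmetic. *)
Fixpoint psum A s p := if p is x :: p' then A s x + psum A x p' else 0.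

Lemma psumE A s t p : psum A s p =
  \sum_(0 <= l < size p) A (part_point s t p l) (part_point s t p l.+1).
Proof.
elim: p s => [|x p IH] s /=; first by rewrite big_geq.
by rewrite big_nat_recl //= IH.
Qed.

Lemma mesh_cons s t x p : mesh s t (x :: p) = Num.max (x - s) (mesh x t p).
Proof. by rewrite /mesh /= big_nat_recl. Qed.

Lemma mesh_nil s t : mesh s t [::] = 0.
Proof. by rewrite /mesh big_geq. Qed.

Lemma mesh_ltP s t p delta : 0 < delta ->
  (mesh s t p < delta) = path (fun x y => y - x < delta) s p.
Proof.
move=> d0; elim: p s => [|x p IH] s; first by rewrite mesh_nil d0.
by rewrite mesh_cons gt_max IH.
Qed.

Lemma psum_cat A s p q : psum A s (p ++ q) = psum A s p + psum A (last s p) q.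
Proof. by elim: p s => [|x p IH] s /=; rewrite ?add0r // IH addrA. Qed.

Lemma psumB A B s p :
  psum A s p - psum B s p = psum (fun u v => A u v - B u v) s p.
Proof.
by elim: p s => [|x p IH] s /=; rewrite ?subr0 // -IH opprD addrACA.
Qed.

Lemma psumZ c A s p : psum (fun u v => c * A u v) s p = c * psum A s p.
Proof. by elim: p s => [|x p IH] s /=; rewrite ?mulr0 // IH mulrDr. Qed.

Lemma itvp_cons s t x p :
  itv_partition s t (x :: p) <-> s < x /\ itv_partition x t p.
Proof.
split; first by move=> [/= /andP[sx px] l]; split.
by move=> [sx [px l]]; split => //=; rewrite sx.
Qed.

Lemma itvp_le s t p : itv_partition s t p -> s <= t.
Proof. exact: itv_partition_le. Qed.

Lemma psum_le A B s t p S E : S <= s -> t <= E ->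
  itv_partition s t p ->
  (forall u v, S <= u -> u < v -> v <= E -> A u v <= B u v) ->
  psum A s p <= psum B s p.
Proof.
move=> Ss tE + AB; elim: p s Ss => [|x p IH] s Ss //=.
move=> /itvp_cons[sx xp]; have xt := itvp_le xp.
rewrite lerD// ?AB ?(le_trans xt)//; apply: IH => //.
exact: le_trans Ss (ltW sx).
Qed.

Lemma ler_norm_psum A s p : `|psum A s p| <= psum (fun u v => `|A u v|) s p.
Proof.
elim: p s => [|x p IH] s /=; first by rewrite normr0.
by rewrite (le_trans (ler_normD _ _))// lerD2l.
Qed.

Lemma psum_tel (f : R -> R) s t p : itv_partition s t p ->
  psum (fun u v => f v - f u) s p = f t - f s.
Proof.
elim: p s => [|x p IH] s /=.
  by move=> /itv_partition_nil ->; rewrite subrr.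
by move=> /itvp_cons[_ /IH ->]; ring.
Qed.

Definition superadd (S E : R) th :=
  [/\ forall u v, S <= u -> u <= v -> v <= E -> 0 <= th u v &
   forall u m v, S <= u -> u <= m -> m <= v -> v <= E ->
     th u m + th m v <= th u v].

Lemma superadd_sub S E S' E' th : S <= S' -> E' <= E ->
  superadd S E th -> superadd S' E' th.
Proof.
move=> SS EE [th0 thD]; split=> *; [apply: th0|apply: thD] => //;
  by [exact: le_trans SS _|exact: le_trans EE].
Qed.

Lemma superadd_diag S E th u : superadd S E th -> S <= u -> u <= E ->
  th u u = 0.
Proof.
move=> [th0 thD] Su uE.
have := thD u u u Su (lexx _) (lexx _) uE.
have := th0 u u Su (lexx _) uE; lra.
Qed.

Lemma superadd_le S E th u v u' v' : superadd S E th ->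
  S <= u' -> u' <= u -> u <= v -> v <= v' -> v' <= E -> th u v <= th u' v'.
Proof.
move=> [th0 thD] Su uu uv vv vE.
have := thD u' u v' Su uu (le_trans uv vv) vE.
have := thD u v v' (le_trans Su uu) uv vv vE.
have := th0 u' u Su uu (le_trans uv (le_trans vv vE)).
have := th0 v v' (le_trans (le_trans Su uu) uv) vv vE; lra.
Qed.

Lemma psum_superadd S E th s t p : superadd S E th -> S <= s -> t <= E ->
  itv_partition s t p -> psum th s p <= th s t.
Proof.
move=> sth Ss tE; elim: p s Ss => [|x p IH] s Ss /=.
  by move=> /itv_partition_nil st; rewrite -st (superadd_diag sth) // st.
move=> /itvp_cons[sx xp]; have xt := itvp_le xp.
have := IH x (le_trans Ss (ltW sx)) xp.
case: sth => _ /(_ s x t Ss (ltW sx) xt tE); lra.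
Qed.

(* The cell of a partition at which a superadditive function passes half of its
   total value; both remaining sides carry at most half. *)
Lemma partition_halve S E th s t r p : superadd S E th -> S <= s -> t <= E ->
  s <= r -> th s r <= th s t / 2 -> p != [::] -> itv_partition r t p ->
  exists p1 x p2, [/\ p = p1 ++ x :: p2, th s (last r p1) <= th s t / 2 &
    th x t <= th s t / 2].
Proof.
move=> sth Ss tE; elim: p r => [//|x p IH] r sr hr _ /itvp_cons[rx xp].
have xt := itvp_le xp.
have [th0 thD] := sth.
have [hx|hx] := leP (th s x) (th s t / 2); last first.
  exists [::], x, p; split => //.
  have := thD s x t Ss (le_trans sr (ltW rx)) xt tE; lra.
have [p0|p0] := eqVneq p [::].
  exists [::], x, p; split => //.
  have xt' : x = t by move: xp; rewrite p0 => /itv_partition_nil.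
  have st := le_trans sr (le_trans (ltW rx) xt).
  by rewrite xt' (superadd_diag sth) ?divr_ge0 ?th0 // (le_trans Ss).
have [p1 [y [p2 [-> h1 h2]]]] := IH x (le_trans sr (ltW rx)) hx p0 xp.
by exists (x :: p1), y, p2.
Qed.

Lemma itvp_cat s t p1 x p2 : itv_partition s t (p1 ++ x :: p2) ->
  [/\ itv_partition s (last s p1) p1, last s p1 < x & itv_partition x t p2].
Proof.
elim: p1 s => [|y p1 IH] s /=.
  by move=> /itvp_cons[sx xp]; split => //; split => //=.
by move=> /itvp_cons[sy /IH[h1 h2 h3]]; split => //; apply/itvp_cons.
Qed.

(** The solution of K = 2 + 2 K 2^(- beta): two defects at the cell of [partition_halve], and two
    remaining pieces whose control is at most half. *)
Definition sewK (beta : R) : R := 2 / (1 - 2 `^ (1 - beta)).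

Lemma powRDp (x r s : R) : 0 < x -> x `^ (r + s) = x `^ r * x `^ s.
Proof. by move=> x0; rewrite powRD //; apply/implyP => _; rewrite gt_eqF. Qed.

Lemma two_powR_lt1 (c : R) : c < 0 -> 2 `^ c < 1.
Proof.
move=> c0; rewrite -[c]opprK powRN invf_lt1 ?powR_gt0 //.
rewrite -[ltLHS](_ : 1 `^ (- c) = 1); last by rewrite powR1.
by rewrite gt0_ltr_powR ?nnegrE // ?oppr_gt0 // ltr1n.
Qed.

Lemma powR_half (x c : R) : 0 <= x -> (x / 2) `^ c = x `^ c * 2 `^ (- c).
Proof.
move=> x0; rewrite powRM ?invr_ge0 //; congr (_ * _).
by rewrite -(@powR_inv1 _ 2) // -powRrM mulN1r.
Qed.

Lemma sewK_gt0 beta : 1 < beta -> 0 < sewK beta.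
Proof. by move=> b1; rewrite divr_gt0 // subr_gt0 two_powR_lt1 //; lra. Qed.

(** Take out the cell where the control passes half of its total. The pieces on its two sides are
    shorter and carry at most half of the control each, so induction on the size applies to both.
    Reattaching the cell costs two defects, each at most the full power of the control. *)
Lemma sewing_bound S E th A (beta : R) s t p : 1 < beta ->
  superadd S E th -> S <= s -> t <= E ->
  (forall u m v, S <= u -> u <= m -> m <= v -> v <= E ->
     `|A u v - A u m - A m v| <= th u v `^ beta) ->
  itv_partition s t p ->
  `|psum A s p - A s t| <= sewK beta * th s t `^ beta.
Proof.
move=> b1 sth Ss tE Ath; have [n] := ubnP (size p).
elim: n s t p Ss tE => [//|n IH] s t p Ss tE sn pp.
have st := itvp_le pp; have [th0 thD] := sth.
have k0 := sewK_gt0 b1.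
have b0 : 0 <= beta by lra.
have [p0|p0] := eqVneq p [::].
  move: pp; rewrite p0 => /itv_partition_nil ts; rewrite -ts /= sub0r normrN.
  have sE : s <= E by rewrite ts.
  have := Ath s s s Ss (lexx _) (lexx _) sE.
  rewrite subrr sub0r normrN (superadd_diag sth) // powR0 ?mulr0 //.
  by rewrite gt_eqF //; lra.
have h0 : th s s <= th s t / 2.
  by rewrite (superadd_diag sth) ?divr_ge0 ?th0 //; exact: le_trans tE.
have [p1 [x [p2 [pE h1 h2]]]] := partition_halve sth Ss tE (lexx _) h0 p0 pp.
set l := last s p1 in h1.
have [pp1 lx pp2] : [/\ itv_partition s l p1, l < x & itv_partition x t p2].
  by apply: itvp_cat; rewrite -pE.
have sl := itvp_le pp1; have xt := itvp_le pp2.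
have Sl := le_trans Ss sl; have Sx := le_trans Sl (ltW lx).
have xE := le_trans xt tE; have lE := le_trans (ltW lx) xE.
have s1 : (size p1 < n)%N.
  by move: sn; rewrite pE size_cat /= addnS ltnS; apply: leq_ltn_trans; rewrite leq_addr.
have s2 : (size p2 < n)%N.
  by move: sn; rewrite pE size_cat /= addnS ltnS; apply: leq_ltn_trans; rewrite leq_addl.
have I1 := IH s l p1 Ss lE s1 pp1.
have I2 := IH x t p2 Sx tE s2 pp2.
have -> : psum A s p = psum A s p1 + (A l x + psum A x p2).
  by rewrite pE psum_cat.
have D1 := Ath s l t Ss sl (le_trans (ltW lx) xt) tE.
have D2 : `|A l t - A l x - A x t| <= th s t `^ beta.
  apply: le_trans (Ath l x t Sl (ltW lx) xt tE) _.
  have lt := le_trans (ltW lx) xt.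
  by rewrite ge0_ler_powR ?nnegrE ?th0 // (superadd_le sth).
have half a : 0 <= a -> a <= th s t / 2 ->
    sewK beta * a `^ beta <= sewK beta * (th s t `^ beta * 2 `^ (- beta)).
  move=> a0 ah; rewrite ler_pM2l // -powR_half ?th0 //.
  by rewrite ge0_ler_powR ?nnegrE // divr_ge0 ?th0.
have H1 := half _ (th0 _ _ Ss sl lE) h1.
have H2 := half _ (th0 _ _ Sx xt tE) h2.
have KE : 2 + 2 * (sewK beta * 2 `^ (- beta)) = sewK beta.
  have -> : 2 * (sewK beta * 2 `^ (- beta)) = sewK beta * 2 `^ (1 - beta).
    by rewrite powRDp ?powRr1 //; ring.
  rewrite /sewK; field.
  by rewrite subr_eq0 eq_sym lt_eqF // two_powR_lt1 //; lra.
suff: `|psum A s p1 + (A l x + psum A x p2) - A s t| <=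
  (2 + 2 * (sewK beta * 2 `^ (- beta))) * th s t `^ beta by rewrite KE.
have -> : psum A s p1 + (A l x + psum A x p2) - A s t =
   (psum A s p1 - A s l) + (psum A x p2 - A x t)
   + (- (A s t - A s l - A l t)) + (- (A l t - A l x - A x t)) by ring.
rewrite (le_trans (ler_normD _ _)) // (le_trans (lerD (ler_normD _ _) (lexx _))) //.
rewrite (le_trans (lerD (lerD (ler_normD _ _) (lexx _)) (lexx _))) // !normrN.
lra.
Qed.

End Partitions.

(** * Refinements of partitions and limits as the mesh tends to 0 *)

Section Refinement.
Context {R : realType}.
Implicit Types (s t u v x y : R) (p q r : seq R) (A B w : R -> R -> R).

Lemma itvp_insert s t x p : itv_partition s t p -> s < x -> x <= t ->
  exists r, [/\ itv_partition s t r, x \in r & {subset p <= r}].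
Proof.
elim: p s => [|y p IH] s.
  by move=> /itv_partition_nil -> sx xt; have := lt_le_trans sx xt; rewrite ltxx.
move=> /itvp_cons[sy yp] sx xt.
have [xy|yx|xy] := ltgtP x y.
- exists (x :: y :: p); split => //; last by move=> z zp; rewrite inE zp orbT.
    by apply/itvp_cons; split => //; apply/itvp_cons.
  by rewrite inE eqxx.
- have [r [h1 h2 h3]] := IH y yp yx xt; exists (y :: r); split => //.
  + exact/itvp_cons.
  + by rewrite inE h2 orbT.
  + by move=> z; rewrite !inE => /orP[->//|/h3 ->]; rewrite orbT.
- by exists (y :: p); split; [exact/itvp_cons|rewrite xy inE eqxx|].
Qed.

Lemma itvp_mem s t p x : itv_partition s t p -> x \in p -> s < x <= t.
Proof.
elim: p s => [//|y p IH] s /itvp_cons[sy yp]; rewrite inE => /orP[/eqP ->|xp].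
  by rewrite sy (itvp_le yp).
by have /andP[yx ->] := IH y yp xp; rewrite (lt_trans sy yx).
Qed.

Lemma common_refinement s t p q : itv_partition s t p -> itv_partition s t q ->
  exists r, [/\ itv_partition s t r, {subset p <= r} & {subset q <= r}].
Proof.
move=> pp qq.
suff : forall q', (forall x, x \in q' -> s < x <= t) ->
    exists r, [/\ itv_partition s t r, {subset p <= r} & {subset q' <= r}].
  by apply=> x; exact: itvp_mem.
elim=> [|x q' IH] h; first by exists p; split.
have [|r [h1 h2 h3]] := IH; first by move=> y yq; apply: h; rewrite inE yq orbT.
have /andP[sx xt] : s < x <= t by apply: h; rewrite inE eqxx.
have [r' [k1 k2 k3]] := itvp_insert h1 sx xt.
exists r'; split => //; first by move=> y /h2/k3.
by move=> y; rewrite inE => /orP[/eqP ->|/h3/k3].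
Qed.

(** The finer partition p induces a partition of every cell of q, and the hypothesis compares A over
    that cell with its sum over the induced partition. *)
Lemma refinement_bound S E A B s t p q : S <= s -> t <= E ->
  (forall u v r, S <= u -> v <= E -> itv_partition u v r ->
     `|psum A u r - A u v| <= B u v) ->
  itv_partition s t p -> itv_partition s t q -> {subset q <= p} ->
  `|psum A s p - psum A s q| <= psum B s q.
Proof.
move=> + tE AB; elim: q s p => [|x q IH] s p Ss pp.
  move=> /itv_partition_nil st; move: pp; rewrite st => /itv_partitionxx ->.
  by rewrite subrr normr0.
move=> /itvp_cons[sx xq] qp.
have xp : x \in p by apply: qp; rewrite inE eqxx.
case/splitPr: xp pp qp => p1 p2 pp qp.
have [h1 h2 h3] := itvp_cat pp.
have h4 : itv_partition s x (rcons p1 x).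
  by case: h1 => h1 _; split; rewrite ?last_rcons // rcons_path h1.
rewrite -cat_rcons psum_cat last_rcons /=.
have -> : psum A s (rcons p1 x) + psum A x p2 - (A s x + psum A x q) =
   (psum A s (rcons p1 x) - A s x) + (psum A x p2 - psum A x q) by ring.
rewrite (le_trans (ler_normD _ _)) // lerD //.
  by apply: AB => //; exact: le_trans (itvp_le xq) tE.
apply: IH => //; first exact: le_trans Ss (ltW sx).
move=> y yq; have /andP[xy _] := itvp_mem xq yq.
have : y \in p1 ++ x :: p2 by apply: qp; rewrite inE yq orbT.
rewrite mem_cat inE => /or3P[yp1|/eqP yx|//].
  have /andP[_ yl] := itvp_mem h1 yp1.
  by have := lt_trans (le_lt_trans yl h2) xy; rewrite ltxx.
by move: xy; rewrite yx ltxx.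
Qed.

Lemma itvp_mesh s t delta : s <= t -> 0 < delta ->
  exists2 p, itv_partition s t p & path (fun x y => y - x < delta) s p.
Proof.
move=> st d0.
have [n] : exists n, t - s < n%:R * (delta / 2).
  have := archi_boundP (divr_ge0 (ltW d0) (ler0n R 2)).
  exists (Num.bound ((t - s) / (delta / 2))).
  rewrite -ltr_pdivrMr ?divr_gt0 //; apply: archi_boundP.
  by rewrite !divr_ge0 ?subr_ge0 // ltW.
elim: n s st => [|n IH] s st; first by rewrite mul0r subr_lt0 ltNge st.
move=> h; have [ts|ts] := ltP (t - s) delta.
  have [->|sNt] := eqVneq s t; first by exists [::].
  exists [:: t]; last by rewrite /= ts.
  by apply/itvp_cons; split; rewrite // lt_neqAle sNt.
have h1 : s + delta / 2 <= t by lra.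
have h2 : t - (s + delta / 2) < n%:R * (delta / 2).
  by move: h; rewrite -natr1 mulrDl mul1r; lra.
have [p p1 p2] := IH _ h1 h2.
exists (s + delta / 2 :: p); last by rewrite /= p2 andbT; lra.
by apply/itvp_cons; split => //; lra.
Qed.

Lemma mesh0_proper s t : s <= t -> ProperFilter (mesh0 s t).
Proof.
move=> st; apply: filter_from_proper.
  apply: filter_from_filter; first by exists 1 => /=.
  move=> i j /= i0 j0; exists (Num.min i j); first by rewrite /= lt_min i0.
  by move=> p [/= pp]; rewrite lt_min => /andP[].
move=> i /= i0; have [p pp pm] := itvp_mesh st i0.
by exists p => /=; rewrite mesh_ltP.
Qed.

Lemma part_point_le s t p l : itv_partition s t p -> (l < size p)%N ->
  [/\ s <= part_point s t p l, part_point s t p l < part_point s t p l.+1 &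
     part_point s t p l.+1 <= t].
Proof.
elim: p s l => [//|x p IH] s [|l] /itvp_cons[sx xp] lp.
  by rewrite /part_point /=; split => //; exact: itvp_le xp.
have [h1 h2 h3] := IH x l xp lp.
split; [|exact: h2|exact: h3].
exact: le_trans (ltW sx) h1.
Qed.

Definition left_tags s t p := (p, part_point s t p).

Lemma left_tagsP s t p : itv_partition s t p ->
  forall l, (l < size p)%N ->
   part_point s t p l <= (left_tags s t p).2 l <= part_point s t p l.+1.
Proof. by move=> pp l lp; have [_ h _] := part_point_le pp lp; rewrite lexx ltW. Qed.

Lemma tagged_mesh0_proper s t : s <= t -> ProperFilter (tagged_mesh0 s t).
Proof.
move=> st; apply: filter_from_proper.
  apply: filter_from_filter; first by exists 1 => /=.
  move=> i j /= i0 j0; exists (Num.min i j); first by rewrite /= lt_min i0.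
  by move=> p [/= pp]; rewrite lt_min => /andP[].
move=> i /= i0; have [p pp pm] := itvp_mesh st i0.
exists (left_tags s t p) => /=; rewrite mesh_ltP //; split => //.
exact: left_tagsP.
Qed.

Lemma cauchy_filter_cvg (T : Type) (F : set_system T) (f : T -> R) :
  ProperFilter F ->
  (forall e : R, 0 < e ->
     exists2 U, F U & forall a b, U a -> U b -> `|f a - f b| < e) ->
  cvg (f @ F).
Proof.
move=> FF h; apply/cauchy_cvgP; apply/cauchy_exP => e e0.
have [U FU hU] := h e e0; have [x Ux] := filter_ex FU.
exists (f x); apply: (@filterS _ F _ U) => // y Uy.
by rewrite /= -ball_normE /=; exact: hU.
Qed.

Lemma cvg_near_lt (T : Type) (F : set_system T) (f : T -> R) (l e : R) :
  Filter F -> f @ F --> l -> 0 < e -> F [set a | `|f a - l| < e].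
Proof.
move=> FF /cvgrPdist_lt h e0; have := h e e0.
by apply: filterS => x /=; rewrite distrC.
Qed.

Lemma lim_norm_le (T : Type) (F : set_system T) (f : T -> R) (l c C : R) :
  ProperFilter F -> f @ F --> l -> F [set a | `|f a - c| <= C] -> `|l - c| <= C.
Proof.
move=> FF fl h; rewrite leNgt; apply/negP => lt.
have e0 : 0 < `|l - c| - C by rewrite subr_gt0.
have [x [/= h1 h2]] := filter_ex (filterI h (cvg_near_lt FF fl e0)).
have := ler_distD (f x) l c; rewrite [`|l - f x|]distrC.
lra.
Qed.

End Refinement.

(** * Sewing with square roots of controls *)

Section Sewing.
Context {R : realType}.
Implicit Types (s t u v x y a C delta : R) (p q r : seq R) (A B w : R -> R -> R).

(* A Cameron-Martin increment is bounded by (t - s)^a w(s,t)^(1/2) with w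
   superadditive, and the square root makes such bounds summable as soon as
   a > 1/2. *)
Definition cbound w a C s t := C * (t - s) `^ a * Num.sqrt (w s t).

Definition germ (S E : R) w a C A :=
  forall u m v, S <= u -> u <= m -> m <= v -> v <= E ->
    `|A u v - A u m - A m v| <= cbound w a C u v.

Lemma cbound_ge0 w a C s t : 0 <= C -> 0 <= cbound w a C s t.
Proof. by move=> C0; rewrite !mulr_ge0 ?powR_ge0 ?sqrtr_ge0. Qed.

Lemma cbound_le S E w a C u v u' v' : superadd S E w -> 0 <= a -> 0 <= C ->
  S <= u' -> u' <= u -> u <= v -> v <= v' -> v' <= E ->
  cbound w a C u v <= cbound w a C u' v'.
Proof.
move=> sw a0 C0 Su uu uv vv vE.
rewrite /cbound ler_pM ?mulr_ge0 ?powR_ge0 ?sqrtr_ge0 //.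
  rewrite ler_wpM2l // ge0_ler_powR ?nnegrE ?subr_ge0 ?lerB //.
  by rewrite (le_trans uu) // (le_trans uv).
by rewrite ler_wsqrtr // (superadd_le sw).
Qed.

(** The control constructed in [sewing_control] takes the value 2 c at (s,t); its power a + 1/2
    produces the second factor. *)
Definition sewC a : R := sewK (a + 2^-1) * 2 `^ (a + 2^-1).

Lemma sewC_ge0 a : 2^-1 < a -> 0 <= sewC a.
Proof. by move=> a2; rewrite mulr_ge0 ?powR_ge0 // ltW // sewK_gt0 //; lra. Qed.

(** Reduction to [sewing_bound]. With x = (v - u) / (t - s) and y = w(u,v) / w(s,t), the bound x^a
    y^(1/2) is at most (x + y)^(a + 1/2), and x + y is superadditive. The exponent a + 1/2 exceeds
    1. *)
Lemma sewing_control S E w a C A s t p : 2^-1 < a -> 0 <= C ->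
  superadd S E w -> germ S E w a C A -> S <= s -> t <= E ->
  itv_partition s t p ->
  `|psum A s p - A s t| <= sewC a * cbound w a C s t.
Proof.
move=> a2 C0 sw gA Ss tE pp; have st := itvp_le pp.
have b1 : 1 < a + 2^-1 by lra.
have a0 : 0 <= a by lra.
have b0 : 0 <= a + 2^-1 by lra.
have bN0 : a + 2^-1 != 0 by rewrite gt_eqF //; lra.
have sw' : superadd s t w := superadd_sub Ss tE sw.
have w0 := sw'.1.
have gA' u m v : s <= u -> u <= m -> m <= v -> v <= t ->
    `|A u v - A u m - A m v| <= cbound w a C u v.
  by move=> su um mv vt; apply: gA => //; [exact: le_trans su|exact: le_trans tE].
(* The normalisation divides by t - s and by w(s,t). If one of them is 0, all bounds inside [s,t]
   vanish and the sewing bound with control 0 applies. *)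
have [deg|ndeg] := boolP ((t - s == 0) || (w s t == 0)).
  have z u v : s <= u -> u <= v -> v <= t -> cbound w a C u v = 0.
    move=> su uv vt; rewrite /cbound; case/orP: deg => /eqP deg.
      have -> : v - u = 0 by lra.
      by rewrite powR0 ?mulr0 ?mul0r // gt_eqF //; lra.
    have -> : w u v = 0.
      by apply/le_anti; rewrite w0 // andbT -deg (superadd_le sw').
    by rewrite sqrtr0 mulr0.
  have := @sewing_bound _ s t (fun _ _ => 0) A _ s t p b1 _ (lexx _) (lexx _) _ pp.
  rewrite powR0 // mulr0 z // mulr0; apply.
    by split=> *; rewrite ?addr0.
  by move=> u m v su um mv vt; rewrite -(z u v) ?gA' //; exact: le_trans mv.
move: ndeg; rewrite negb_or => /andP[L0 W0].
have {}L0 : 0 < t - s by rewrite lt_def L0 subr_ge0.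
have {}W0 : 0 < w s t by rewrite lt_def W0 w0.
pose c := cbound w a C s t `^ (a + 2^-1)^-1.
have cE : c `^ (a + 2^-1) = cbound w a C s t.
  by rewrite -powRrM mulVf // powRr1 // cbound_ge0.
pose th u v := c * ((v - u) / (t - s) + w u v / w s t).
have c0 : 0 <= c by exact: powR_ge0.
have sth : superadd s t th.
  split.
    move=> u v su uv vt; rewrite mulr_ge0 // addr_ge0 // divr_ge0 ?subr_ge0 // ?w0 //.
  move=> u m v su um mv vt; rewrite /th -mulrDr ler_wpM2l //.
  rewrite addrACA -!mulrDl lerD //.
    by have -> : m - u + (v - m) = v - u by ring.
  by rewrite ler_wpM2r ?invr_ge0 ?(ltW W0) // sw'.2.
have := @sewing_bound _ s t th A _ s t p b1 sth (lexx _) (lexx _) _ pp.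
have -> : th s t = c * 2 by rewrite /th !divff ?gt_eqF //; ring.
rewrite powRM // cE => H.
suff H2 u m v : s <= u -> u <= m -> m <= v -> v <= t ->
    `|A u v - A u m - A m v| <= th u v `^ (a + 2^-1).
  have -> : sewC a * cbound w a C s t =
      sewK (a + 2^-1) * (cbound w a C s t * 2 `^ (a + 2^-1)).
    by rewrite /sewC; ring.
  exact: H H2.
move=> su um mv vt.
apply: le_trans (gA' _ _ _ su um mv vt) _.
have uv := le_trans um mv.
have x0 : 0 <= (v - u) / (t - s) by rewrite divr_ge0 ?subr_ge0 // ltW // -subr_gt0.
have y0 : 0 <= w u v / w s t by rewrite divr_ge0 ?w0 // ltW.
rewrite powRM ?addr_ge0 // cE.
have -> : cbound w a C u v = cbound w a C s t *
    (((v - u) / (t - s)) `^ a * Num.sqrt (w u v / w s t)).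
  rewrite /cbound powRM ?subr_ge0 ?invr_ge0 // ?subr_ge0 //.
  rewrite sqrtrM ?w0 // sqrtrV ?ltW //.
  have e1 : (t - s)^-1 `^ a = ((t - s) `^ a)^-1.
    by rewrite -(@powR_inv1 _ (t - s)) ?ltW // -powRrM mulN1r powRN.
  have e2 : (t - s) `^ a != 0 by rewrite gt_eqF // powR_gt0.
  have e3 : Num.sqrt (w s t) != 0 by rewrite gt_eqF // sqrtr_gt0.
  by rewrite e1; field; rewrite e2 e3.
rewrite ler_wpM2l ?cbound_ge0 //.
have [xy0|xy0] := eqVneq ((v - u) / (t - s) + w u v / w s t) 0.
  have -> : w u v / w s t = 0 by lra.
  by rewrite sqrtr0 mulr0 powR_ge0.
rewrite powRDp ?lt_def ?xy0 ?addr_ge0 //.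
rewrite ler_pM ?powR_ge0 ?sqrtr_ge0 //.
  by rewrite ge0_ler_powR ?nnegrE ?addr_ge0 // lerDl.
by rewrite powR12_sqrt ?addr_ge0 // ler_wsqrtr // lerDr.
Qed.

(* Young's inequality sacrifices the surplus a - 1/2 > 0 to the mesh. *)
Lemma psum_cbound_mesh S E w a C delta s t p : 2^-1 <= a -> 0 <= C ->
  superadd S E w -> S <= s -> t <= E -> 0 < delta -> itv_partition s t p ->
  path (fun x y => y - x < delta) s p ->
  psum (cbound w a C) s p <= C * delta `^ (a - 2^-1) * (t - s + w s t).
Proof.
move=> a2 C0 sw Ss tE d0 pp pm.
have D0 : 0 <= C * delta `^ (a - 2^-1) by rewrite mulr_ge0 ?powR_ge0.
have sL : superadd S E (fun u v => v - u + w u v).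
  case: sw => w0 wD; split.
    by move=> u v Su uv vE; rewrite addr_ge0 ?subr_ge0 ?w0.
  move=> u m v Su um mv vE; have := wD u m v Su um mv vE; lra.
apply: le_trans (_ : C * delta `^ (a - 2^-1) *
    psum (fun u v => v - u + w u v) s p <= _); last first.
  by rewrite ler_wpM2l // (psum_superadd sL).
rewrite -psumZ; elim: p s Ss pp pm => [//|x p IH] s Ss /itvp_cons[sx xp] /= /andP[dx pm].
have xt := itvp_le xp; have xE := le_trans xt tE.
rewrite lerD //; last by apply: IH => //; exact: le_trans Ss (ltW sx).
rewrite /cbound -!mulrA ler_wpM2l //.
have xs0 : 0 < x - s by rewrite subr_gt0.
have w0 := sw.1 s x Ss (ltW sx) xE.
have -> : (x - s) `^ a = (x - s) `^ (a - 2^-1) * Num.sqrt (x - s).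
  by rewrite -powR12_sqrt ?ltW // -powRDp // subrK.
rewrite -mulrA ler_pM ?powR_ge0 ?mulr_ge0 ?sqrtr_ge0 //.
  by rewrite ge0_ler_powR ?nnegrE ?subr_ge0 // ltW.
have h1 := sqr_sqrtr (ltW xs0); have h2 := sqr_sqrtr w0.
rewrite -{2}h1 -{2}h2.
have := sqr_ge0 (Num.sqrt (x - s) - Num.sqrt (w s x)).
have := sqr_ge0 (Num.sqrt (x - s)); have := sqr_ge0 (Num.sqrt (w s x)).
nra.
Qed.

Lemma mesh_small a C M e : 2^-1 < a -> 0 < e ->
  exists2 delta, 0 < delta & C * delta `^ (a - 2^-1) * M < e.
Proof.
move=> a2 e0; have [CM|CM] := leP (C * M) 0.
  exists 1; first by [].
  by rewrite powR1 mulr1; exact: le_lt_trans CM e0.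
pose c := (e / (C * M) / 2).
have c0 : 0 < c by rewrite !divr_gt0.
exists (c `^ (a - 2^-1)^-1); first by rewrite powR_gt0.
rewrite -powRrM mulVf ?gt_eqF ?subr_gt0 // powRr1 ?ltW // /c.
suff -> : C * (e / (C * M) / 2) * M = e / 2 by lra.
have : C * M != 0 by rewrite gt_eqF.
by rewrite mulf_eq0 negb_or => /andP[C0 M0]; field; rewrite C0 M0.
Qed.

Lemma germ_refine S E w a C A delta s t p q : 2^-1 < a -> 0 <= C ->
  superadd S E w -> germ S E w a C A -> S <= s -> t <= E -> 0 < delta ->
  itv_partition s t p -> itv_partition s t q ->
  path (fun x y => y - x < delta) s p -> path (fun x y => y - x < delta) s q ->
  `|psum A s p - psum A s q| <=
    (sewC a * C) * delta `^ (a - 2^-1) * (2 * (t - s + w s t)).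
Proof.
move=> a2 C0 sw gA Ss tE d0 pp qq pm qm.
have [r [rr pr qr]] := common_refinement pp qq.
have k0 := sewC_ge0 a2.
have bnd u v r' : S <= u -> v <= E -> itv_partition u v r' ->
    `|psum A u r' - A u v| <= cbound w a (sewC a * C) u v.
  move=> Su vE rp; have := sewing_control a2 C0 sw gA Su vE rp.
  by rewrite /cbound !mulrA.
have h z : itv_partition s t z -> path (fun x y => y - x < delta) s z ->
    {subset z <= r} -> `|psum A s r - psum A s z| <=
    (sewC a * C) * delta `^ (a - 2^-1) * (t - s + w s t).
  move=> zz zm zr; apply: le_trans (refinement_bound Ss tE bnd rr zz zr) _.
  by apply: (psum_cbound_mesh (ltW a2) _ sw Ss tE d0 zz zm); rewrite mulr_ge0.
have h1 := h p pp pm pr; have h2 := h q qq qm qr.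
have -> : psum A s p - psum A s q =
   (psum A s r - psum A s q) - (psum A s r - psum A s p) by ring.
apply: le_trans (ler_normB _ _) _; lra.
Qed.

Lemma germ_cvg S E w a C A s t : 2^-1 < a -> 0 <= C ->
  superadd S E w -> germ S E w a C A -> S <= s -> s <= t -> t <= E ->
  cvg (psum A s @ mesh0 s t).
Proof.
move=> a2 C0 sw gA Ss st tE; apply: cauchy_filter_cvg; first exact: mesh0_proper.
move=> e e0; have [delta d0 hd] := mesh_small (sewC a * C) (2 * (t - s + w s t)) a2 e0.
exists [set p | itv_partition s t p /\ mesh s t p < delta]; first by exists delta.
move=> p q [pp]; rewrite mesh_ltP // => pm [qq]; rewrite mesh_ltP // => qm.
exact: le_lt_trans (germ_refine a2 C0 sw gA Ss tE d0 pp qq pm qm) hd.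
Qed.

End Sewing.

(** * Existence and calculus of Riemann-Stieltjes integrals *)

Section RiemannStieltjes.
Context {R : realType}.
Implicit Types (r s t u v x y a C delta e : R) (p q : seq R) (A B w : R -> R -> R).
Implicit Types (f g : R -> R).

Definition lgerm f g u v := f u * (g v - g u).

(** The first product is the defect of the left-point germ at x. The second is the cost of moving
    the tag of the cell [u,v] from u to x. *)
Definition young_pair (S E : R) w a C f g := forall u x v,
  S <= u -> u <= x -> x <= v -> v <= E ->
  `|f x - f u| * `|g v - g x| <= cbound w a C u v /\
  `|f x - f u| * `|g v - g u| <= cbound w a C u v.

Lemma young_germ S E w a C f g : young_pair S E w a C f g ->
  germ S E w a C (lgerm f g).
Proof.
move=> fg u m v Su um mv vE; rewrite /lgerm.
have -> : f u * (g v - g u) - f u * (g m - g u) - f m * (g v - g m) =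
  - ((f m - f u) * (g v - g m)) by ring.
by rewrite normrN normrM; case: (fg u m v Su um mv vE).
Qed.

Lemma RS_sum_left f g s t p : RS_sum f g s t (left_tags s t p) = psum (lgerm f g) s p.
Proof. by rewrite (psumE _ _ t). Qed.

Lemma RS_sum_tags S E w a C f g s t px : young_pair S E w a C f g ->
  S <= s -> t <= E -> itv_partition s t px.1 ->
  (forall l, (l < size px.1)%N ->
        part_point s t px.1 l <= px.2 l <= part_point s t px.1 l.+1) ->
  `|RS_sum f g s t px - psum (lgerm f g) s px.1| <= psum (cbound w a C) s px.1.
Proof.
move=> fg Ss tE pp tags; rewrite !(psumE _ _ t) /RS_sum -sumrB.
apply: le_trans (ler_norm_sum _ _ _) _.
apply: ler_sum_nat => l /andP[_ lp].
have [h1 h2 h3] := part_point_le pp lp; have /andP[k1 k2] := tags l lp.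
rewrite /lgerm -mulrBl normrM.
by case: (fg _ _ _ (le_trans Ss h1) k1 k2 (le_trans h3 tE)).
Qed.

Lemma young_integrable S E w a C f g s t : 2^-1 < a -> 0 <= C ->
  superadd S E w -> young_pair S E w a C f g -> S <= s -> s <= t -> t <= E ->
  RS_integrable f g s t.
Proof.
move=> a2 C0 sw fg Ss st tE; apply: cauchy_filter_cvg.
  exact: tagged_mesh0_proper.
move=> e e0; have [delta d0 hd] :=
  mesh_small (2 * C + 2 * (sewC a * C)) (t - s + w s t) a2 e0.
exists [set px | [/\ itv_partition s t px.1, mesh s t px.1 < delta &
      forall l, (l < size px.1)%N ->
        part_point s t px.1 l <= px.2 l <= part_point s t px.1 l.+1]].
  by exists delta.
move=> p q [pp]; rewrite mesh_ltP // => pm pt [qq]; rewrite mesh_ltP // => qm qt.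
apply: le_lt_trans hd.
have h1 := RS_sum_tags fg Ss tE pp pt.
have h2 := RS_sum_tags fg Ss tE qq qt.
have h3 := germ_refine a2 C0 sw (young_germ fg) Ss tE d0 pp qq pm qm.
have h4 := psum_cbound_mesh (ltW a2) C0 sw Ss tE d0 pp pm.
have h5 := psum_cbound_mesh (ltW a2) C0 sw Ss tE d0 qq qm.
have -> : RS_sum f g s t p - RS_sum f g s t q =
  (RS_sum f g s t p - psum (lgerm f g) s p.1)
  + (psum (lgerm f g) s p.1 - psum (lgerm f g) s q.1)
  - (RS_sum f g s t q - psum (lgerm f g) s q.1) by ring.
apply: le_trans (ler_normB _ _) _.
apply: le_trans (lerD (ler_normD _ _) (lexx _)) _; lra.
Qed.

Lemma RS_psum f g s t e : s <= t -> RS_integrable f g s t -> 0 < e ->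
  exists2 delta, 0 < delta & forall p, itv_partition s t p ->
    path (fun x y => y - x < delta) s p ->
    `|psum (lgerm f g) s p - RS_integral f g s t| < e.
Proof.
move=> st fg e0.
have PF := tagged_mesh0_proper st.
have [delta d0 hd] := cvg_near_lt _ fg e0.
exists delta => // p pp pm; rewrite -(RS_sum_left f g s t p); apply: hd.
by split => //=; [rewrite mesh_ltP|exact: left_tagsP].
Qed.

Lemma RS_valueP f g s t I : s <= t ->
  RS_sum f g s t @ tagged_mesh0 s t --> I ->
  RS_integrable f g s t /\ RS_integral f g s t = I.
Proof.
move=> st h; have PF := tagged_mesh0_proper st.
by split; [apply/cvg_ex; exists I|apply: cvg_lim].
Qed.

Lemma RS_ext f1 f2 g1 g2 s t : s <= t ->
  (forall r, s <= r -> r <= t -> f1 r = f2 r) ->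
  (forall r, s <= r -> r <= t -> g1 r = g2 r) ->
  RS_integrable f1 g1 s t ->
  RS_integrable f2 g2 s t /\ RS_integral f2 g2 s t = RS_integral f1 g1 s t.
Proof.
move=> st f12 g12 h; have PF := tagged_mesh0_proper st.
apply: RS_valueP => //; apply: cvg_trans h.
apply: near_eq_cvg; exists 1 => //= px [pp _ tags].
rewrite /RS_sum; apply: eq_big_nat => l /andP[_ lp].
have [h1 h2 h3] := part_point_le pp lp; have /andP[k1 k2] := tags l lp.
have st1 : s <= part_point s t px.1 l.+1 by exact: le_trans h1 (ltW h2).
have st2 : part_point s t px.1 l <= t by exact: le_trans (ltW h2) h3.
by rewrite f12 ?(le_trans h1) ?(le_trans k2) // !g12.
Qed.

Lemma RS_Dl f1 f2 g s t : s <= t ->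
  RS_integrable f1 g s t -> RS_integrable f2 g s t ->
  RS_integrable (fun r => f1 r + f2 r) g s t /\
  RS_integral (fun r => f1 r + f2 r) g s t =
    RS_integral f1 g s t + RS_integral f2 g s t.
Proof.
move=> st h1 h2; have PF := tagged_mesh0_proper st.
apply: RS_valueP => //; rewrite (_ : RS_sum _ _ _ _ =
  fun px => RS_sum f1 g s t px + RS_sum f2 g s t px).
  exact: cvgD.
apply/funext => px; rewrite /RS_sum -big_split /=.
by apply: eq_bigr => l _; rewrite mulrDl.
Qed.

Lemma RS_Dr f g1 g2 s t : s <= t ->
  RS_integrable f g1 s t -> RS_integrable f g2 s t ->
  RS_integrable f (fun r => g1 r + g2 r) s t /\
  RS_integral f (fun r => g1 r + g2 r) s t =
    RS_integral f g1 s t + RS_integral f g2 s t.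
Proof.
move=> st h1 h2; have PF := tagged_mesh0_proper st.
apply: RS_valueP => //; rewrite (_ : RS_sum _ _ _ _ =
  fun px => RS_sum f g1 s t px + RS_sum f g2 s t px).
  exact: cvgD.
apply/funext => px; rewrite /RS_sum -big_split /=.
by apply: eq_bigr => l _; ring.
Qed.

Lemma RS_Zl c f g s t : s <= t -> RS_integrable f g s t ->
  RS_integrable (fun r => c * f r) g s t /\
  RS_integral (fun r => c * f r) g s t = c * RS_integral f g s t.
Proof.
move=> st h1; have PF := tagged_mesh0_proper st.
apply: RS_valueP => //; rewrite (_ : RS_sum _ _ _ _ =
  fun px => c * RS_sum f g s t px).
  by apply: cvgM => //; exact: cvg_cst.
apply/funext => px; rewrite /RS_sum mulr_sumr.
by apply: eq_bigr => l _; rewrite mulrA.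
Qed.

Lemma RS_cst c g s t : s <= t ->
  RS_integrable (fun=> c) g s t /\
  RS_integral (fun=> c) g s t = c * (g t - g s).
Proof.
move=> st; have PF := tagged_mesh0_proper st.
apply: RS_valueP => //.
have : (fun _ : seq R * (nat -> R) => c * (g t - g s)) @ tagged_mesh0 s t -->
    c * (g t - g s) by exact: cvg_cst.
apply: cvg_trans; apply: near_eq_cvg; exists 1 => //= px [pp _ _].
by rewrite -(psum_tel g pp) (psumE _ _ t) mulr_sumr.
Qed.

Lemma itvp_concat s u t p q : itv_partition s u p -> itv_partition u t q ->
  itv_partition s t (p ++ q).
Proof.
move=> [pp /eqP pl] [qp ql].
by split; [rewrite cat_path pl pp|rewrite last_cat pl].
Qed.

Lemma eq_of_near (x y : R) : (forall e, 0 < e -> `|x - y| <= e) -> x = y.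
Proof.
move=> h; apply/eqP; rewrite -subr_eq0 -normr_eq0 eq_le normr_ge0 andbT.
by apply/ler_addgt0Pr => e e0; rewrite add0r; exact: h.
Qed.

Lemma RS_chasles f g s u t : s <= u -> u <= t ->
  RS_integrable f g s u -> RS_integrable f g u t -> RS_integrable f g s t ->
  RS_integral f g s t = RS_integral f g s u + RS_integral f g u t.
Proof.
move=> su ut h1 h2 h3; apply: eq_of_near => e e0.
have e3 : 0 < e / 3 by rewrite divr_gt0.
have [d1 d10 k1] := RS_psum su h1 e3.
have [d2 d20 k2] := RS_psum ut h2 e3.
have [d3 d30 k3] := RS_psum (le_trans su ut) h3 e3.
pose d := Num.min d1 (Num.min d2 d3).
have d0 : 0 < d by rewrite !lt_min d10 d20.
have [p pp pm] := itvp_mesh su d0; have [q qq qm] := itvp_mesh ut d0.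
have sub (d' : R) z c : d <= d' -> path (fun x y => y - x < d) c z ->
    path (fun x y => y - x < d') c z.
  by move=> dd; apply: sub_path => x y /lt_le_trans; apply.
have l1 := k1 p pp (sub d1 _ _ _ pm).
have l2 := k2 q qq (sub d2 _ _ _ qm).
have l3 := k3 (p ++ q) (itvp_concat pp qq).
have pu : last s p = u by case: pp => _ /eqP.
move: l1 l2 l3; rewrite psum_cat pu.
rewrite /d !ge_min !lexx ?orbT => /(_ isT) l1 /(_ isT) l2.
have -> : path (fun x y => y - x < d3) s (p ++ q).
  by rewrite cat_path pu !(sub d3) //; rewrite /d !ge_min lexx !orbT.
move=> /(_ isT) l3.
set a := psum _ s p in l1 l3; set b := psum _ u q in l2 l3.
have -> : RS_integral f g s t - (RS_integral f g s u + RS_integral f g u t)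
  = (a - RS_integral f g s u) + (b - RS_integral f g u t)
    - (a + b - RS_integral f g s t) by ring.
apply: le_trans (ler_normB _ _) _.
apply: le_trans (lerD (ler_normD _ _) (lexx _)) _; lra.
Qed.

Lemma RS_diff_bound w a C f1 g1 f2 g2 s t : 2^-1 < a -> 0 <= C -> s <= t ->
  superadd s t w ->
  germ s t w a C (fun u v => lgerm f1 g1 u v - lgerm f2 g2 u v) ->
  RS_integrable f1 g1 s t -> RS_integrable f2 g2 s t ->
  `|RS_integral f1 g1 s t - RS_integral f2 g2 s t
    - (lgerm f1 g1 s t - lgerm f2 g2 s t)| <= sewC a * cbound w a C s t.
Proof.
move=> a2 C0 st sw gA h1 h2; apply/ler_addgt0Pr => e e0.
have e2 : 0 < e / 2 by rewrite divr_gt0.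
have [d1 d10 k1] := RS_psum st h1 e2.
have [d2 d20 k2] := RS_psum st h2 e2.
have d0 : 0 < Num.min d1 d2 by rewrite !lt_min d10 d20.
have [p pp pm] := itvp_mesh st d0.
have l1 : path (fun x y => y - x < d1) s p.
  by apply: sub_path pm => x y; rewrite lt_min => /andP[].
have l2 : path (fun x y => y - x < d2) s p.
  by apply: sub_path pm => x y; rewrite lt_min => /andP[].
have := sewing_control a2 C0 sw gA (lexx _) (lexx _) pp.
have {l1}l1 := k1 p pp l1; have {l2}l2 := k2 p pp l2.
rewrite -psumB.
set x := psum _ s p in l1 *; set y := psum _ s p in l2 *.
set z := lgerm _ _ _ _; set z' := lgerm _ _ _ _ => l3.
have -> : RS_integral f1 g1 s t - RS_integral f2 g2 s t - (z - z') =
  (x - y - (z - z')) - (x - RS_integral f1 g1 s t) + (y - RS_integral f2 g2 s t).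
  by ring.
apply: le_trans (ler_normD _ _) _.
apply: le_trans (lerD (ler_normB _ _) (lexx _)) _; lra.
Qed.

Lemma RS_bound w a C f g s t : 2^-1 < a -> 0 <= C -> s <= t ->
  superadd s t w -> young_pair s t w a C f g ->
  `|RS_integral f g s t - f s * (g t - g s)| <= sewC a * cbound w a C s t.
Proof.
move=> a2 C0 st sw fg.
have h1 := young_integrable a2 C0 sw fg (lexx _) st (lexx _).
have [h2 h3] := RS_cst 0 g st.
have := @RS_diff_bound w a C f g (fun=> 0) g s t a2 C0 st sw _ h1 h2.
rewrite h3 /lgerm !mul0r !subr0; apply.
move=> u m v su um mv vt; rewrite /lgerm !mul0r !subr0.
exact: young_germ fg _ _ _ su um mv vt.
Qed.

End RiemannStieltjes.

(** * The Young estimate for a Hoelder path and a Cameron-Martin path *)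

Section YoungCore.
Context {R : realType}.
Implicit Types (r s t u v x y a h C e : R) (A B w : R -> R -> R) (f g : R -> R).

(** At x = 0 the law of exponents may fail, since 0^0 = 1 while all other powers of 0 vanish.
    Nonnegative exponents exclude a + h = 0 with a different from 0. *)
Lemma powR_addr x a h : 0 <= a -> 0 <= h -> x `^ (a + h) = x `^ a * x `^ h.
Proof.
move=> a0 h0; have [->|x0] := eqVneq x 0; last by rewrite powRD // x0 implybT.
have [->|aN0] := eqVneq a 0; first by rewrite add0r powRr0 mul1r.
have ahN0 : a + h != 0 by rewrite gt_eqF // ltr_wpDr // lt_def aN0.
by rewrite (powR0 aN0) (powR0 ahN0) mul0r.
Qed.

(** The exponents add up while the factor w^(1/2) of g is kept. Only products of an oscillation of f
    with an oscillation of g are estimated, so the same bound serves f dg and g df. *)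
Lemma young_core s t a h C D w f g : 0 <= a -> 0 <= h -> 2^-1 < a + h ->
  0 <= C -> 0 <= D -> s <= t -> superadd s t w ->
  (forall r r', s <= r -> r <= r' -> r' <= t -> `|f r' - f r| <= C * (r' - r) `^ a) ->
  (forall r r', s <= r -> r <= r' -> r' <= t -> `|g r' - g r| <= cbound w h D r r') ->
  [/\ RS_integrable f g s t,
     `|RS_integral f g s t - f s * (g t - g s)| <=
       sewC (a + h) * cbound w (a + h) (C * D) s t,
     RS_integrable g f s t &
     `|RS_integral g f s t - g s * (f t - f s)| <=
       sewC (a + h) * cbound w (a + h) (C * D) s t].
Proof.
move=> a0 h0 ah C0 D0 st sw fH gC.
have CD0 : 0 <= C * D by exact: mulr_ge0.
have key u x y v : s <= u -> u <= x -> x <= v -> u <= y -> y <= v ->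
    v <= t -> forall x', u <= x' -> x' <= x -> forall y', u <= y' -> y' <= y ->
    `|f x - f x'| * `|g y - g y'| <= cbound w (a + h) (C * D) u v.
  move=> su ux xv uy yv vt x' ux' xx' y' uy' yy'.
  have fx := fH x' x (le_trans su ux') xx' (le_trans xv vt).
  have gy := gC y' y (le_trans su uy') yy' (le_trans yv vt).
  apply: (le_trans (ler_pM _ _ fx gy)) => //.
  have uv := le_trans ux xv.
  rewrite /cbound powR_addr //.
  have -> : C * D * ((v - u) `^ a * (v - u) `^ h) * Num.sqrt (w u v) =
    C * (v - u) `^ a * (D * (v - u) `^ h * Num.sqrt (w u v)) by ring.
  rewrite ler_pM ?mulr_ge0 ?powR_ge0 ?sqrtr_ge0 //.
    rewrite ler_wpM2l // ge0_ler_powR ?nnegrE ?subr_ge0 //.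
    by rewrite lerB.
  exact: (cbound_le sw).
have fg : young_pair s t w (a + h) (C * D) f g.
  move=> u x v su ux xv vt; have uv := le_trans ux xv; split.
    have := key u x v v su ux xv uv (lexx _) vt u (lexx _) ux x ux xv; exact.
  have := key u x v v su ux xv uv (lexx _) vt u (lexx _) ux u (lexx _) uv; exact.
have gf : young_pair s t w (a + h) (C * D) g f.
  move=> u x v su ux xv vt; have uv := le_trans ux xv; split; rewrite mulrC.
    have := key u v x v su uv (lexx _) ux xv vt x ux xv u (lexx _) ux; exact.
  have := key u v x v su uv (lexx _) ux xv vt u (lexx _) uv u (lexx _) ux; exact.
split.
- exact: young_integrable ah CD0 sw fg (lexx _) st (lexx _).
- exact: RS_bound.
- exact: young_integrable ah CD0 sw gf (lexx _) st (lexx _).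
- exact: RS_bound.
Qed.

End YoungCore.

(** * Regularity classes and Young integrals of the second level *)

Section Classes.
Context {R : realType} (T : R).
Implicit Types (r s t u v x y a h C e : R) (A B w psi : R -> R -> R) (f g : R -> R).

(* Hb: Hoelder regularity of a two-parameter function; Cb: regularity of
   Cameron-Martin type, the control being normalized so that C is the size. *)
Definition Hb a C psi := 0 <= C /\ forall s t, 0 <= s -> s <= t -> t <= T ->
  `|psi s t| <= C * (t - s) `^ a.

Definition Cb h C psi := 0 <= C /\ exists w, [/\ superadd 0 T w, w 0 T <= 1 &
  forall s t, 0 <= s -> s <= t -> t <= T -> `|psi s t| <= cbound w h C s t].

Definition dl f s t := f t - f s.

(* The entry \int_s^t f_{s,r} dg_r of I[f,g]. *)
Definition YI f g s t := RS_integral (fun r => f r - f s) g s t.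

Definition YIok f g := forall s t, 0 <= s -> s <= t -> t <= T ->
  RS_integrable (fun r => f r - f s) g s t.

Lemma dlB f g : dl (f - g) = dl f - dl g.
Proof. by apply/funext => s; apply/funext => t; rewrite /dl !fctE; ring. Qed.

Lemma dlD f g : dl (f + g) = dl f + dl g.
Proof. by apply/funext => s; apply/funext => t; rewrite /dl !fctE; ring. Qed.

Lemma cbound_H w h C s t : superadd 0 T w -> w 0 T <= 1 -> 0 <= C ->
  0 <= s -> s <= t -> t <= T -> cbound w h C s t <= C * (t - s) `^ h.
Proof.
move=> sw w1 C0 s0 st tT; rewrite /cbound ler_piMr ?mulr_ge0 ?powR_ge0 //.
rewrite -[leRHS]sqrtr1 ler_wsqrtr //; apply: le_trans w1.
by apply: (superadd_le sw).
Qed.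

Lemma Cb_Hb h C psi : Cb h C psi -> Hb h C psi.
Proof.
move=> [C0 [w [sw w1 H]]]; split => // s t s0 st tT.
exact: le_trans (H s t s0 st tT) (cbound_H _ sw w1 C0 s0 st tT).
Qed.

Lemma Hb_mono a C D psi : C <= D -> Hb a C psi -> Hb a D psi.
Proof.
move=> CD [C0 H]; split; first exact: le_trans CD.
move=> s t s0 st tT; apply: le_trans (H s t s0 st tT) _.
by rewrite ler_wpM2r ?powR_ge0.
Qed.

Lemma cbound_mono w h C D s t : C <= D -> cbound w h C s t <= cbound w h D s t.
Proof. by move=> CD; rewrite /cbound -!mulrA ler_wpM2r // mulr_ge0 ?powR_ge0 ?sqrtr_ge0. Qed.

Lemma Cb_mono h C D psi : C <= D -> Cb h C psi -> Cb h D psi.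
Proof.
move=> CD [C0 [w [sw w1 H]]]; split; first exact: le_trans CD.
exists w; split => // s t s0 st tT; apply: le_trans (H s t s0 st tT) _.
exact: cbound_mono.
Qed.

Lemma Hb_ext a C psi phi : (forall s t, 0 <= s -> s <= t -> t <= T ->
  psi s t = phi s t) -> Hb a C psi -> Hb a C phi.
Proof. by move=> E [C0 H]; split => // s t *; rewrite -E // H. Qed.

Lemma Cb_ext a C psi phi : (forall s t, 0 <= s -> s <= t -> t <= T ->
  psi s t = phi s t) -> Cb a C psi -> Cb a C phi.
Proof.
move=> E [C0 [w [sw w1 H]]]; split => //; exists w; split => // s t *.
by rewrite -E // H.
Qed.

Lemma HbD a C D psi phi : Hb a C psi -> Hb a D phi -> Hb a (2 * (C + D)) (psi + phi).
Proof.
move=> [C0 H] [D0 K]; split; first by rewrite mulr_ge0 ?addr_ge0.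
move=> s t s0 st tT; rewrite !fctE; apply: le_trans (ler_normD _ _) _.
apply: le_trans (lerD (H s t s0 st tT) (K s t s0 st tT)) _.
by rewrite -mulrDl ler_wpM2r ?powR_ge0 //; lra.
Qed.

(** Controls of total mass at most 1 are averaged rather than added, so that the mass stays at most
    1. Each square root loses at most a factor 2 against the average, which is the origin of the
    factor 2 in [qnorm]. *)
Lemma sqrt_avg x y C D : 0 <= x -> 0 <= y -> 0 <= C -> 0 <= D ->
  C * Num.sqrt x + D * Num.sqrt y <= 2 * (C + D) * Num.sqrt ((x + y) / 2).
Proof.
move=> x0 y0 C0 D0.
have two z : 0 <= z -> z <= x + y -> Num.sqrt z <= 2 * Num.sqrt ((x + y) / 2).
  move=> z0 zxy; rewrite -ler_sqr ?nnegrE ?mulr_ge0 ?sqrtr_ge0 //.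
  rewrite exprMn !sqr_sqrtr ?divr_ge0 ?addr_ge0 //; lra.
have h1 := two x x0 _; have h2 := two y y0 _.
rewrite [2 * (C + D)]mulrC -mulrA mulrDl lerD // ler_wpM2l //.
  by apply: h1; lra.
by apply: h2; lra.
Qed.

Lemma superadd_avg w w' : superadd 0 T w -> superadd 0 T w' ->
  superadd 0 T (fun s t => (w s t + w' s t) / 2).
Proof.
move=> [w0 wD] [w0' wD']; split.
  by move=> u v *; rewrite divr_ge0 ?addr_ge0 ?w0 ?w0'.
move=> u m v u0 um mv vT; have := wD u m v u0 um mv vT.
have := wD' u m v u0 um mv vT; lra.
Qed.

Lemma CbD a C D psi phi : Cb a C psi -> Cb a D phi -> Cb a (2 * (C + D)) (psi + phi).
Proof.
move=> [C0 [w [sw w1 H]]] [D0 [w' [sw' w1' K]]].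
split; first by rewrite mulr_ge0 ?addr_ge0.
exists (fun s t => (w s t + w' s t) / 2); split; [exact: superadd_avg|lra|].
move=> s t s0 st tT; rewrite !fctE; apply: le_trans (ler_normD _ _) _.
apply: le_trans (lerD (H s t s0 st tT) (K s t s0 st tT)) _.
have := sqrt_avg (sw.1 s t s0 st tT) (sw'.1 s t s0 st tT) C0 D0.
move=> /(ler_wpM2r (powR_ge0 (t - s) a)); rewrite /cbound; lra.
Qed.

Lemma HbN a C psi : Hb a C psi -> Hb a C (- psi).
Proof. by move=> [C0 H]; split => // s t *; rewrite !fctE normrN H. Qed.

Lemma Hb_weaken a a' C psi : 0 <= a' -> a' <= a -> 0 <= T ->
  Hb a C psi -> Hb a' (C * T `^ (a - a')) psi.
Proof.
move=> a0 aa T0 [C0 H]; split; first by rewrite mulr_ge0 ?powR_ge0.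
move=> s t s0 st tT; apply: le_trans (H s t s0 st tT) _.
have -> : (t - s) `^ a = (t - s) `^ (a - a') * (t - s) `^ a'.
  by rewrite -powR_addr ?subr_ge0 // subrK.
rewrite -mulrA ler_wpM2l //.
rewrite ler_wpM2r ?powR_ge0 // ge0_ler_powR ?nnegrE ?subr_ge0 //.
by rewrite (le_trans _ tT) // lerBlDr lerDl.
Qed.

(** The length divided by T is a normalised control, and t - s is the square of its square root.
    Hence Lipschitz paths may play the role of the Cameron-Martin path in a Young integral. *)
Lemma Hb1_Cb C psi : 0 < T -> Hb 1 C psi -> Cb 2^-1 (C * Num.sqrt T) psi.
Proof.
move=> T0 [C0 H]; split; first by rewrite mulr_ge0 ?sqrtr_ge0.
exists (fun s t => (t - s) / T); split.
- split; first by move=> u v *; rewrite divr_ge0 ?subr_ge0 // ltW.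
  move=> u m v *; rewrite -mulrDl.
  by have -> : m - u + (v - m) = v - u by ring.
- by rewrite subr0 divff // gt_eqF.
- move=> s t s0 st tT; apply: le_trans (H s t s0 st tT) _.
  have ts0 : 0 <= t - s by rewrite subr_ge0.
  rewrite powRr1 // /cbound powR12_sqrt // sqrtrM // (sqrtrV (ltW T0)).
  have hT : Num.sqrt T != 0 by rewrite gt_eqF // sqrtr_gt0.
  have e : t - s = Num.sqrt (t - s) * Num.sqrt (t - s).
    by rewrite -expr2 sqr_sqrtr.
  have -> : C * Num.sqrt T * Num.sqrt (t - s) * (Num.sqrt (t - s) / Num.sqrt T) =
      C * (Num.sqrt (t - s) * Num.sqrt (t - s)) by field.
  by rewrite -e.
Qed.

Lemma Hb_incr_local a C f s t : Hb a C (dl f) -> 0 <= s -> t <= T ->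
  forall c r r', s <= r -> r <= r' -> r' <= t ->
   `|(f r' - c) - (f r - c)| <= C * (r' - r) `^ a.
Proof.
move=> [C0 H] s0 tT c r r' sr rr rt.
have -> : f r' - c - (f r - c) = dl f r r' by rewrite /dl; ring.
by apply: H => //; [exact: le_trans sr|exact: le_trans tT].
Qed.

Lemma YI_core a h C D f g : 0 <= a -> 0 <= h -> 2^-1 < a + h ->
  Hb a C (dl f) -> Cb h D (dl g) ->
  [/\ YIok f g, YIok g f,
      Cb (a + h) (sewC (a + h) * (C * D)) (YI f g) &
      Cb (a + h) (sewC (a + h) * (C * D)) (YI g f)].
Proof.
move=> a0 h0 ah Hf [D0 [w [sw w1 Hg]]]; have [C0 _] := Hf.
have CD0 := mulr_ge0 C0 D0.
(* Both constants are free: c = f s or c' = g s cancels the first-order term of the corresponding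
   integral, and the other constant is then 0. *)
have key s t c c' : 0 <= s -> s <= t -> t <= T ->
  [/\ RS_integrable (fun r => f r - c) (fun r => g r - c') s t,
     `|RS_integral (fun r => f r - c) (fun r => g r - c') s t - (f s - c) * (g t - c' - (g s - c'))| <=
       sewC (a + h) * cbound w (a + h) (C * D) s t,
     RS_integrable (fun r => g r - c') (fun r => f r - c) s t &
     `|RS_integral (fun r => g r - c') (fun r => f r - c) s t - (g s - c') * (f t - c - (f s - c))| <=
       sewC (a + h) * cbound w (a + h) (C * D) s t].
  move=> s0 st tT; apply: young_core => //.
  - exact: superadd_sub s0 tT sw.
  - exact: Hb_incr_local Hf s0 tT c.
  - move=> r r' sr rr rt.
    have -> : g r' - c' - (g r - c') = dl g r r' by rewrite /dl; ring.
    by apply: Hg => //; [exact: le_trans sr|exact: le_trans tT].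
have cE s t : sewC (a + h) * cbound w (a + h) (C * D) s t =
    cbound w (a + h) (sewC (a + h) * (C * D)) s t by rewrite /cbound; ring.
have k0 : 0 <= sewC (a + h) * (C * D) by rewrite mulr_ge0 // sewC_ge0.
have z (F : R -> R) : (fun r => F r - 0) = F.
  by apply/funext => r; rewrite subr0.
split.
- by move=> s t s0 st tT; have [] := key s t (f s) 0 s0 st tT; rewrite z.
- by move=> s t s0 st tT; have [] := key s t 0 (g s) s0 st tT; rewrite z.
- split => //; exists w; split => // s t s0 st tT.
  have [_ + _ _] := key s t (f s) 0 s0 st tT.
  by rewrite z subrr mul0r subr0 cE.
- split => //; exists w; split => // s t s0 st tT.
  have [_ _ _] := key s t 0 (g s) s0 st tT.
  by rewrite z subrr mul0r subr0 cE.
Qed.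

End Classes.

(** * Convergence of iterated integrals *)

Section Convergence.
Context {R : realType}.

(* N C x stands for |x| <= C; triangle inequalities hold up to a factor 2,
   because controls are renormalized when classes Cb are added. *)
Definition qnorm (X : zmodType) (N : R -> X -> Prop) :=
  [/\ forall C x, N C x -> 0 <= C,
      forall C D x, C <= D -> N C x -> N D x &
      forall C D x y, N C x -> N D y -> N (2 * (C + D)) (x + y)].

Definition qcvg (X : zmodType) (N : R -> X -> Prop) (x_ : nat -> X) (x : X) :=
  (exists C, N C x) /\
  forall e, 0 < e -> exists n0, forall n, (n0 <= n)%N -> N e (x_ n - x).

(** Continuity of bounded bilinear maps. Bilinearity is required only as a transfer of [N3] bounds
    between elements of finite size, because an integral is additive only where it exists. *)
Lemma bil_qcvg (X Y Z : zmodType) (N1 : R -> X -> Prop) (N2 : R -> Y -> Prop)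
    (N3 : R -> Z -> Prop) (Bil : X -> Y -> Z) (K : R) x_ x y_ y :
  qnorm N1 -> qnorm N2 -> qnorm N3 -> 0 <= K ->
  (forall C D x y, N1 C x -> N2 D y -> N3 (K * (C * D)) (Bil x y)) ->
  (forall C C' D E x x' y, N1 C x -> N1 C' x' -> N2 D y ->
     N3 E (Bil (x - x') y) -> N3 E (Bil x y - Bil x' y)) ->
  (forall C D D' E x y y', N1 C x -> N2 D y -> N2 D' y' ->
     N3 E (Bil x (y - y')) -> N3 E (Bil x y - Bil x y')) ->
  qcvg N1 x_ x -> qcvg N2 y_ y -> qcvg N3 (fun n => Bil (x_ n) (y_ n)) (Bil x y).
Proof.
move=> [p1 m1 a1] [p2 m2 a2] [p3 m3 a3] K0 BB Bl Br.
move=> [[C xC] cx] [[D yD] cy]; have C0 := p1 _ _ xC; have D0 := p2 _ _ yD.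
split; first by exists (K * (C * D)); exact: BB.
(* For eta at most 1 the size of y_n is at most 2 (1 + D). The two halves of the difference then
   have sizes K eta 2 (1 + D) and K C eta, and the quasi-triangle inequality doubles their sum. *)
move=> e e0; pose M := 4 * K * (1 + D) + 2 * K * C.
have M0 : 0 <= M by rewrite /M addr_ge0 // !mulr_ge0 // addr_ge0.
pose eta := Num.min 1 (e / (M + 1)).
have eta0 : 0 < eta by rewrite lt_min ltr01 divr_gt0 // ltr_wpDl.
have eta1 : eta <= 1 by rewrite ge_min lexx.
have etaM : eta * M <= e.
  have : eta <= e / (M + 1) by rewrite ge_min lexx orbT.
  rewrite ler_pdivlMr ?ltr_wpDl // => h; nra.
have [n1 h1] := cx eta eta0; have [n2 h2] := cy eta eta0.
exists (maxn n1 n2) => n; rewrite geq_max => /andP[/h1 hx /h2 hy].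
have xn : N1 (2 * (eta + C)) (x_ n) by rewrite -(subrK x (x_ n)); exact: a1.
have yn : N2 (2 * (eta + D)) (y_ n) by rewrite -(subrK y (y_ n)); exact: a2.
have -> : Bil (x_ n) (y_ n) - Bil x y =
    (Bil (x_ n) (y_ n) - Bil x (y_ n)) + (Bil x (y_ n) - Bil x y).
  by rewrite addrA subrK.
apply: m3 (a3 _ _ _ _ (Bl _ _ _ _ _ _ _ xn xC yn (BB _ _ _ _ hx yn))
   (Br _ _ _ _ _ _ _ xC yn yD (BB _ _ _ _ xC hy))).
apply: le_trans etaM; rewrite /M.
have : K * (eta * (2 * (eta + D))) <= K * (eta * (2 * (1 + D))).
  apply: ler_wpM2l => //; apply: ler_wpM2l; first exact: ltW.
  by apply: ler_wpM2l => //; rewrite lerD2r.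
lra.
Qed.

Lemma qcvg_D (X : zmodType) (N : R -> X -> Prop) x_ x y_ y : qnorm N ->
  qcvg N x_ x -> qcvg N y_ y -> qcvg N (fun n => x_ n + y_ n) (x + y).
Proof.
move=> [p m a] [[C xC] cx] [[D yD] cy]; split.
  by exists (2 * (C + D)); exact: a.
move=> e e0; have e4 : 0 < e / 4 by rewrite divr_gt0.
have [n1 h1] := cx _ e4; have [n2 h2] := cy _ e4.
exists (maxn n1 n2) => n; rewrite geq_max => /andP[/h1 hx /h2 hy].
by rewrite opprD addrACA; apply: m (a _ _ _ _ hx hy); lra.
Qed.

Lemma qcvg_imp (X Y : zmodType) (N : R -> X -> Prop) (N' : R -> Y -> Prop)
    (F : X -> Y) (k : R) x_ x : qnorm N' -> 0 <= k ->
  (forall C x, N C x -> N' (k * C) (F x)) ->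
  (forall x y E, N' E (F (x - y)) -> N' E (F x - F y)) ->
  qcvg N x_ x -> qcvg N' (fun n => F (x_ n)) (F x).
Proof.
move=> [p m a] k0 NN FB [[C xC] cx]; split; first by exists (k * C); exact: NN.
move=> e e0; have e1 : 0 < e / (k + 1) by rewrite divr_gt0 // ltr_wpDl.
have [n1 h1] := cx _ e1; exists n1 => n /h1 h.
apply: m (FB _ _ _ (NN _ _ h)).
rewrite mulrCA ler_piMr ?(ltW e0) // ler_pdivrMr ?ltr_wpDl //; lra.
Qed.

End Convergence.

(** * Continuity of integrals whose integrand depends on both end points *)

Section TwoParameter.
Context {R : realType} (T : R).
Hypothesis T0 : 0 < T.
Implicit Types (r s t u v a h C D e : R) (psi x y X : R -> R -> R) (f g : R -> R).
Implicit Types (Phi : R -> R -> R -> R) (xi : R -> R -> R -> R -> R).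

Definition HP a C f := Hb T a C (dl f).
Definition CP a C f := Cb T a C (dl f).

Lemma Hb_qnorm a : qnorm (Hb T a).
Proof.
split; first by move=> C x [].
  by move=> C D x CD; exact: Hb_mono CD.
by move=> C D x y; exact: HbD.
Qed.

Lemma Cb_qnorm a : qnorm (Cb T a).
Proof.
split; first by move=> C x [].
  by move=> C D x CD; exact: Cb_mono CD.
by move=> C D x y; exact: CbD.
Qed.

Lemma HP_qnorm a : qnorm (HP a).
Proof.
split; first by move=> C x [].
  by move=> C D x CD; exact: Hb_mono CD.
by move=> C D x y hx hy; rewrite /HP dlD; exact: HbD.
Qed.

Lemma CP_qnorm a : qnorm (CP a).
Proof.
split; first by move=> C x [].
  by move=> C D x CD; exact: Cb_mono CD.
by move=> C D x y hx hy; rewrite /CP dlD; exact: CbD.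
Qed.

Lemma RS_Bl f1 f2 g s t : s <= t ->
  RS_integrable f1 g s t -> RS_integrable f2 g s t ->
  RS_integrable (fun r => f1 r - f2 r) g s t /\
  RS_integral (fun r => f1 r - f2 r) g s t =
    RS_integral f1 g s t - RS_integral f2 g s t.
Proof.
move=> st h1 h2; have [h3 e3] := RS_Zl (-1) st h2.
have [h4 e4] := RS_Dl st h1 h3.
rewrite -mulN1r -e3 -e4 (_ : (fun r => f1 r - f2 r) = fun r => f1 r + -1 * f2 r) //.
by apply/funext => r; rewrite mulN1r.
Qed.

Lemma RS_Zr c f g s t : s <= t -> RS_integrable f g s t ->
  RS_integrable f (fun r => c * g r) s t /\
  RS_integral f (fun r => c * g r) s t = c * RS_integral f g s t.
Proof.
move=> st h1; have PF := tagged_mesh0_proper st.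
apply: RS_valueP => //; rewrite (_ : RS_sum _ _ _ _ =
  fun px => c * RS_sum f g s t px).
  by apply: cvgM => //; exact: cvg_cst.
apply/funext => px; rewrite /RS_sum mulr_sumr.
by apply: eq_bigr => l _; ring.
Qed.

Lemma RS_Br f g1 g2 s t : s <= t ->
  RS_integrable f g1 s t -> RS_integrable f g2 s t ->
  RS_integrable f (fun r => g1 r - g2 r) s t /\
  RS_integral f (fun r => g1 r - g2 r) s t =
    RS_integral f g1 s t - RS_integral f g2 s t.
Proof.
move=> st h1 h2; have [h3 e3] := RS_Zr (-1) st h2.
have [h4 e4] := RS_Dr st h1 h3.
rewrite -mulN1r -e3 -e4 (_ : (fun r => g1 r - g2 r) = fun r => g1 r + -1 * g2 r) //.
by apply/funext => r; rewrite mulN1r.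
Qed.

Lemma YI_Bl f1 f2 g s t : s <= t ->
  RS_integrable (fun r => f1 r - f1 s) g s t ->
  RS_integrable (fun r => f2 r - f2 s) g s t ->
  YI (f1 - f2) g s t = YI f1 g s t - YI f2 g s t.
Proof.
move=> st h1 h2; have [_ <-] := RS_Bl st h1 h2.
by rewrite /YI; congr RS_integral; apply/funext => r; rewrite !fctE; ring.
Qed.

Lemma YI_Br f g1 g2 s t : s <= t ->
  RS_integrable (fun r => f r - f s) g1 s t ->
  RS_integrable (fun r => f r - f s) g2 s t ->
  YI f (g1 - g2) s t = YI f g1 s t - YI f g2 s t.
Proof. by move=> st h1 h2; have [_ <-] := RS_Br st h1 h2. Qed.

Lemma YI_cvg a h (f_ g_ : nat -> R -> R) f g : 0 <= a -> 0 <= h -> 2^-1 < a + h ->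
  qcvg (HP a) f_ f -> qcvg (CP h) g_ g ->
  qcvg (Cb T (a + h)) (fun n => YI (f_ n) (g_ n)) (YI f g) /\
  qcvg (Cb T (a + h)) (fun n => YI (g_ n) (f_ n)) (YI g f).
Proof.
move=> a0 h0 ah cf cg; have K0 := sewC_ge0 ah; split.
- apply: (bil_qcvg (HP_qnorm a) (CP_qnorm h) (Cb_qnorm (a + h)) K0) cf cg.
  + by move=> C D x y hx hy; have [] := YI_core a0 h0 ah hx hy.
  + move=> C C' D E x x' y hx hx' hy; apply: Cb_ext => s t s0 st tT.
    have [ok1 _ _ _] := YI_core a0 h0 ah hx hy.
    have [ok2 _ _ _] := YI_core a0 h0 ah hx' hy.
    by rewrite YI_Bl //; [exact: ok1|exact: ok2].
  + move=> C D D' E x y y' hx hy hy'; apply: Cb_ext => s t s0 st tT.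
    have [ok1 _ _ _] := YI_core a0 h0 ah hx hy.
    have [ok2 _ _ _] := YI_core a0 h0 ah hx hy'.
    by rewrite YI_Br //; [exact: ok1|exact: ok2].
- pose B (x y : R -> R) := YI y x.
  suff : qcvg (Cb T (a + h)) (fun n => B (f_ n) (g_ n)) (B f g) by [].
  apply: (bil_qcvg (HP_qnorm a) (CP_qnorm h) (Cb_qnorm (a + h)) K0) cf cg; rewrite /B.
  + by move=> C D x y hx hy; have [] := YI_core a0 h0 ah hx hy.
  + move=> C C' D E x x' y hx hx' hy; apply: Cb_ext => s t s0 st tT.
    have [_ ok1 _ _] := YI_core a0 h0 ah hx hy.
    have [_ ok2 _ _] := YI_core a0 h0 ah hx' hy.
    by rewrite YI_Br //; [exact: ok1|exact: ok2].
  + move=> C D D' E x y y' hx hy hy'; apply: Cb_ext => s t s0 st tT.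
    have [_ ok1 _ _] := YI_core a0 h0 ah hx hy.
    have [_ ok2 _ _] := YI_core a0 h0 ah hx hy'.
    by rewrite YI_Bl //; [exact: ok1|exact: ok2].
Qed.

(** Integrands of the third level: on [s,t] they are a-Hoelder in r with a constant of order (t -
    s)^a', and their initial value has the matching order a' + a. The shapes X_{s,r}, X_{r,t} and
    f_{s,r} h_{r,t} all fit, so [J] covers [iint_r], [iint_l] and [iint_m]. *)
Definition Bb a a' C Phi := 0 <= C /\ forall s t, 0 <= s -> s <= t -> t <= T ->
  (forall r r', s <= r -> r <= r' -> r' <= t ->
    `|Phi s t r' - Phi s t r| <= C * (t - s) `^ a' * (r' - r) `^ a) /\
  `|Phi s t s| <= C * (t - s) `^ (a' + a).

Definition CBb h a' C Phi := 0 <= C /\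
  exists w, [/\ superadd 0 T w, w 0 T <= 1 &
  forall s t, 0 <= s -> s <= t -> t <= T ->
  (forall r r', s <= r -> r <= r' -> r' <= t ->
    `|Phi s t r' - Phi s t r| <= cbound w h (C * (t - s) `^ a') r r') /\
  `|Phi s t s| <= C * (t - s) `^ (a' + h)].

Definition J Phi g s t := RS_integral (Phi s t) g s t.

Definition Jok Phi g := forall s t, 0 <= s -> s <= t -> t <= T ->
  RS_integrable (Phi s t) g s t.

Lemma Bb_qnorm a a' : qnorm (Bb a a').
Proof.
split; first by move=> C x [].
  move=> C D x CD [C0 H]; split; first exact: le_trans CD.
  move=> s t s0 st tT; have [h1 h2] := H s t s0 st tT; split.
    move=> r r' sr rr rt; apply: le_trans (h1 r r' sr rr rt) _.
    by rewrite -!mulrA ler_wpM2r // mulr_ge0 ?powR_ge0.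
  by apply: le_trans h2 _; rewrite ler_wpM2r ?powR_ge0.
move=> C D x y [C0 H] [D0 K]; split; first by rewrite mulr_ge0 ?addr_ge0.
move=> s t s0 st tT; have [h1 h2] := H s t s0 st tT; have [k1 k2] := K s t s0 st tT.
split.
  move=> r r' sr rr rt; rewrite !fctE.
  have -> : x s t r' + y s t r' - (x s t r + y s t r) =
    (x s t r' - x s t r) + (y s t r' - y s t r) by ring.
  apply: le_trans (ler_normD _ _) _.
  apply: le_trans (lerD (h1 r r' sr rr rt) (k1 r r' sr rr rt)) _.
  have := mulr_ge0 (addr_ge0 C0 D0) (mulr_ge0 (powR_ge0 (t - s) a') (powR_ge0 (r' - r) a)).
  lra.
rewrite !fctE; apply: le_trans (ler_normD _ _) _; apply: le_trans (lerD h2 k2) _.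
rewrite -mulrDl ler_wpM2r ?powR_ge0 //; lra.
Qed.

Lemma CBb_qnorm a a' : qnorm (CBb a a').
Proof.
split; first by move=> C x [].
  move=> C D x CD [C0 [w [sw w1 H]]]; split; first exact: le_trans CD.
  exists w; split => // s t s0 st tT; have [h1 h2] := H s t s0 st tT; split.
    move=> r r' sr rr rt; apply: le_trans (h1 r r' sr rr rt) _.
    by apply: cbound_mono; rewrite ler_wpM2r ?powR_ge0.
  by apply: le_trans h2 _; rewrite ler_wpM2r ?powR_ge0.
move=> C D x y [C0 [w [sw w1 H]]] [D0 [w' [sw' w1' K]]].
split; first by rewrite mulr_ge0 ?addr_ge0.
exists (fun s t => (w s t + w' s t) / 2); split; [exact: superadd_avg|lra|].
move=> s t s0 st tT; have [h1 h2] := H s t s0 st tT; have [k1 k2] := K s t s0 st tT.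
split.
  move=> r r' sr rr rt; rewrite !fctE.
  have -> : x s t r' + y s t r' - (x s t r + y s t r) =
    (x s t r' - x s t r) + (y s t r' - y s t r) by ring.
  apply: le_trans (ler_normD _ _) _.
  apply: le_trans (lerD (h1 r r' sr rr rt) (k1 r r' sr rr rt)) _.
  have s0r := le_trans s0 sr; have rT := le_trans rt tT.
  have := sqrt_avg (sw.1 r r' s0r rr rT) (sw'.1 r r' s0r rr rT) C0 D0.
  move=> /(ler_wpM2r (mulr_ge0 (powR_ge0 (t - s) a') (powR_ge0 (r' - r) a))).
  rewrite /cbound; lra.
rewrite !fctE; apply: le_trans (ler_normD _ _) _; apply: le_trans (lerD h2 k2) _.
rewrite -mulrDl ler_wpM2r ?powR_ge0 //; lra.
Qed.

Lemma J_core a a' h C D Phi g : 0 <= a -> 0 <= a' -> 0 <= h -> 2^-1 < a + h ->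
  Bb a a' C Phi -> CP h D g ->
  Jok Phi g /\ Hb T (a' + a + h) ((sewC (a + h) + 1) * (C * D)) (J Phi g).
Proof.
move=> a0 a'0 h0 ah [C0 HF] Cg; have [D0 HD] := Cb_Hb Cg.
have [_ [w [sw w1 Hg]]] := Cg.
have key s t : 0 <= s -> s <= t -> t <= T ->
  RS_integrable (Phi s t) g s t /\ `|RS_integral (Phi s t) g s t
    - Phi s t s * (g t - g s)| <=
       sewC (a + h) * cbound w (a + h) (C * (t - s) `^ a' * D) s t.
  move=> s0 st tT; have [h1 h2] := HF s t s0 st tT.
  have C1 : 0 <= C * (t - s) `^ a' by rewrite mulr_ge0 ?powR_ge0.
  have gC r r' : s <= r -> r <= r' -> r' <= t -> `|g r' - g r| <= cbound w h D r r'.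
    by move=> sr rr rt; apply: Hg => //; [exact: le_trans sr|exact: le_trans tT].
  by have [] := young_core a0 h0 ah C1 D0 st (superadd_sub s0 tT sw) h1 gC.
split; first by move=> s t s0 st tT; have [] := key s t s0 st tT.
have K0 := sewC_ge0 ah.
split; first by rewrite mulr_ge0 ?addr_ge0 // mulr_ge0.
move=> s t s0 st tT; have [_ h1] := key s t s0 st tT.
have [_ h2] := HF s t s0 st tT; have h3 := HD s t s0 st tT.
have h4 := ler_pM (normr_ge0 _) (normr_ge0 _) h2 h3; rewrite -normrM in h4.
have C1 : 0 <= C * (t - s) `^ a' * D by rewrite !mulr_ge0 ?powR_ge0.
have h5 := cbound_H (a + h) sw w1 C1 s0 st tT.
rewrite -(subrK (Phi s t s * (g t - g s)) (J Phi g s t)).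
apply: le_trans (ler_normD _ _) _; apply: le_trans (lerD h1 h4) _.
rewrite mulrDl mul1r mulrDl lerD //.
  apply: le_trans (ler_wpM2l K0 h5) _.
  by rewrite -addrA (powR_addr _ a'0) ?addr_ge0 // le_eqVlt; apply/orP; left; apply/eqP; ring.
by rewrite (powR_addr _ (addr_ge0 a'0 a0) h0) le_eqVlt; apply/orP; left; apply/eqP; ring.
Qed.

(** The roles are exchanged: the integrand carries the control and the integrator is only Hoelder.
    This serves the one term of [transl3] integrated against b, namely that of U^2. *)
Lemma J_core' a a' h C D Phi g : 0 <= a -> 0 <= a' -> 0 <= h -> 2^-1 < a + h ->
  CBb h a' C Phi -> HP a D g ->
  Jok Phi g /\ Hb T (a' + h + a) ((sewC (a + h) + 1) * (C * D)) (J Phi g).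
Proof.
move=> a0 a'0 h0 ah [C0 [w [sw w1 HF]]] Hg; have [D0 HD] := Hg.
have key s t : 0 <= s -> s <= t -> t <= T ->
  RS_integrable (Phi s t) g s t /\ `|RS_integral (Phi s t) g s t
    - Phi s t s * (g t - g s)| <=
       sewC (a + h) * cbound w (a + h) (D * (C * (t - s) `^ a')) s t.
  move=> s0 st tT; have [h1 h2] := HF s t s0 st tT.
  have C1 : 0 <= C * (t - s) `^ a' by rewrite mulr_ge0 ?powR_ge0.
  have gC r r' : s <= r -> r <= r' -> r' <= t -> `|g r' - g r| <= D * (r' - r) `^ a.
    by move=> sr rr rt; apply: HD => //; [exact: le_trans sr|exact: le_trans tT].
  by have [] := young_core a0 h0 ah D0 C1 st (superadd_sub s0 tT sw) gC h1.
split; first by move=> s t s0 st tT; have [] := key s t s0 st tT.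
have K0 := sewC_ge0 ah.
split; first by rewrite mulr_ge0 ?addr_ge0 // mulr_ge0.
move=> s t s0 st tT; have [_ h1] := key s t s0 st tT.
have [_ h2] := HF s t s0 st tT; have h3 := HD s t s0 st tT.
have h4 := ler_pM (normr_ge0 _) (normr_ge0 _) h2 h3; rewrite -normrM in h4.
have C1 : 0 <= D * (C * (t - s) `^ a') by rewrite !mulr_ge0 ?powR_ge0.
have h5 := cbound_H (a + h) sw w1 C1 s0 st tT.
rewrite -(subrK (Phi s t s * (g t - g s)) (J Phi g s t)).
apply: le_trans (ler_normD _ _) _; apply: le_trans (lerD h1 h4) _.
rewrite mulrDl mul1r mulrDl lerD //.
  apply: le_trans (ler_wpM2l K0 h5) _.
  rewrite -addrA [h + a]addrC (powR_addr _ a'0) ?addr_ge0 //.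
  by rewrite le_eqVlt; apply/orP; left; apply/eqP; ring.
by rewrite (powR_addr _ (addr_ge0 a'0 h0) a0) le_eqVlt; apply/orP; left; apply/eqP; ring.
Qed.

Lemma J_cvg a a' h (Phi_ : nat -> R -> R -> R -> R) Phi (g_ : nat -> R -> R) g : 0 <= a -> 0 <= a' -> 0 <= h -> 2^-1 < a + h ->
  qcvg (Bb a a') Phi_ Phi -> qcvg (CP h) g_ g ->
  qcvg (Hb T (a' + a + h)) (fun n => J (Phi_ n) (g_ n)) (J Phi g).
Proof.
move=> a0 a'0 h0 ah; have K0 : 0 <= sewC (a + h) + 1 by rewrite addr_ge0 // sewC_ge0.
apply: (bil_qcvg (Bb_qnorm a a') (CP_qnorm h) (Hb_qnorm _) K0).
- by move=> C D x y hx hy; have [] := J_core a0 a'0 h0 ah hx hy.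
- move=> C C' D E x x' y hx hx' hy; apply: Hb_ext => s t s0 st tT.
  have [ok1 _] := J_core a0 a'0 h0 ah hx hy.
  have [ok2 _] := J_core a0 a'0 h0 ah hx' hy.
  by have [_ e] := RS_Bl st (ok1 s t s0 st tT) (ok2 s t s0 st tT); exact: e.
- move=> C D D' E x y y' hx hy hy'; apply: Hb_ext => s t s0 st tT.
  have [ok1 _] := J_core a0 a'0 h0 ah hx hy.
  have [ok2 _] := J_core a0 a'0 h0 ah hx hy'.
  by have [_ e] := RS_Br st (ok1 s t s0 st tT) (ok2 s t s0 st tT); exact: e.
Qed.

Lemma J_cvg' a a' h (Phi_ : nat -> R -> R -> R -> R) Phi (g_ : nat -> R -> R) g : 0 <= a -> 0 <= a' -> 0 <= h -> 2^-1 < a + h ->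
  qcvg (CBb h a') Phi_ Phi -> qcvg (HP a) g_ g ->
  qcvg (Hb T (a' + h + a)) (fun n => J (Phi_ n) (g_ n)) (J Phi g).
Proof.
move=> a0 a'0 h0 ah; have K0 : 0 <= sewC (a + h) + 1 by rewrite addr_ge0 // sewC_ge0.
apply: (bil_qcvg (CBb_qnorm h a') (HP_qnorm a) (Hb_qnorm _) K0).
- by move=> C D x y hx hy; have [] := J_core' a0 a'0 h0 ah hx hy.
- move=> C C' D E x x' y hx hx' hy; apply: Hb_ext => s t s0 st tT.
  have [ok1 _] := J_core' a0 a'0 h0 ah hx hy.
  have [ok2 _] := J_core' a0 a'0 h0 ah hx' hy.
  by have [_ e] := RS_Bl st (ok1 s t s0 st tT) (ok2 s t s0 st tT); exact: e.
- move=> C D D' E x y y' hx hy hy'; apply: Hb_ext => s t s0 st tT.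
  have [ok1 _] := J_core' a0 a'0 h0 ah hx hy.
  have [ok2 _] := J_core' a0 a'0 h0 ah hx hy'.
  by have [_ e] := RS_Br st (ok1 s t s0 st tT) (ok2 s t s0 st tT); exact: e.
Qed.

End TwoParameter.

(** * Chen's relations and the regularity that they imply *)

Section Chen.
Context {R : realType} (T : R).
Hypothesis T0 : 0 < T.
Implicit Types (r s t u v a h C D e : R) (psi x y X : R -> R -> R) (f g : R -> R).
Implicit Types (Phi : R -> R -> R -> R) (xi : R -> R -> R -> R -> R).

Definition chen_rel (S E : R) (X : R -> R -> R) (rem : R -> R -> R -> R) :=
  forall s u t, S <= s -> s <= u -> u <= t -> t <= E ->
    X s t = X s u + X u t + rem s u t.

(** The uniqueness half of sewing. An additive function equals its sum over every partition, and an
    exponent above 1 makes this sum vanish with the mesh. The plain power (t - s)^a is a [cbound]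
    with the length as control and exponent a - 1/2. *)
Lemma additive_small_eq0 (S E a C : R) psi : 1 < a -> 0 <= C ->
  chen_rel S E psi (fun _ _ _ => 0) ->
  (forall s t, S <= s -> s <= t -> t <= E -> `|psi s t| <= C * (t - s) `^ a) ->
  forall s t, S <= s -> s <= t -> t <= E -> psi s t = 0.
Proof.
move=> a1 C0 add bnd s t Ss st tE; apply: eq_of_near => e e0; rewrite subr0.
have a2 : 2^-1 < a - 2^-1 by lra.
pose w (x y : R) := y - x.
have sw : superadd S E w.
  split; first by move=> x y _ xy _; rewrite subr_ge0.
  by move=> x m y *; rewrite /w; lra.
have [delta d0 hd] := mesh_small C (t - s + w s t) a2 e0.
have [p pp pm] := itvp_mesh st d0.
have -> : psi s t = psum psi s p.
  elim: p s Ss {st hd pm} pp => [|x p IH] s Ss /=.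
    move=> /itv_partition_nil st; have sE : s <= E by rewrite st.
    by have := add s s s Ss (lexx _) (lexx _) sE; rewrite -st; lra.
  move=> /itvp_cons[sx xp]; have xt := itvp_le xp.
  rewrite (add s x t Ss (ltW sx) xt tE) addr0 (IH x) //.
  exact: le_trans Ss (ltW sx).
apply: le_trans (ler_norm_psum _ _ _) _; apply: le_trans (ltW hd).
apply: le_trans (psum_cbound_mesh (ltW a2) C0 sw Ss tE d0 pp pm).
apply: psum_le Ss tE pp _ => u v Su uv vE; apply: le_trans (bnd u v Su (ltW uv) vE) _.
rewrite /cbound /w -mulrA -powR12_sqrt ?subr_ge0 ?(ltW uv) //.
by rewrite -powRDp ?subr_gt0 // subrK.
Qed.

Lemma YI_chen f g : YIok T f g -> chen_rel 0 T (YI f g) (fun s u t => dl f s u * dl g u t).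
Proof.
move=> ok s u t s0 su ut tT.
have h1 := ok s u s0 su (le_trans ut tT).
have h2 := ok u t (le_trans s0 su) ut tT.
have h3 := ok s t s0 (le_trans su ut) tT.
have [h4 e4] := RS_cst (f u - f s) g ut.
have [h5 e5] := RS_Dl ut h2 h4.
have E : (fun r => f r - f u + (f u - f s)) = (fun r => f r - f s).
  by apply/funext => r; ring.
rewrite E in h5 e5.
by rewrite /YI (RS_chasles su ut h1 h5 h3) e5 e4 /dl addrA.
Qed.

Definition T3 f1 f2 f3 s t := RS_integral (fun r => YI f1 f2 s r) f3 s t.

Lemma J1_chen X x f g :
  chen_rel 0 T X (fun s u t => x s u * dl f u t) ->
  Jok T (fun s _ r => X s r) g -> YIok T f g ->
  chen_rel 0 T (J (fun s _ r => X s r) g)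
    (fun s u t => x s u * YI f g u t + X s u * dl g u t).
Proof.
move=> cX ok okf s u t s0 su ut tT; have u0 := le_trans s0 su.
have h1 := ok s u s0 su (le_trans ut tT).
have h2 := ok u t u0 ut tT.
have h3 := ok s t s0 (le_trans su ut) tT.
have [h4 e4] := RS_cst (X s u) g ut.
have [h5 e5] := RS_Zl (x s u) ut (okf u t u0 ut tT).
have [h6 e6] := RS_Dl ut h2 h4.
have [h7 e7] := RS_Dl ut h6 h5.
have E r : u <= r -> r <= t -> X u r + X s u + x s u * (f r - f u) = X s r.
  by move=> ur rt; rewrite (cX s u r) // ?(le_trans rt) // /dl; ring.
have [h8 e8] := RS_ext ut E (fun _ _ _ => erefl) h7.
by rewrite /J (RS_chasles su ut h1 h8 h3) e8 e7 e6 e5 e4 /YI /dl; ring.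
Qed.

(** The increment is taken up to the right end point: this is what remains when an integrand of the
    form h_{r,t} or X_{r,t} is split at an intermediate time. *)
Definition KI f g s t := RS_integral (fun r => f t - f r) g s t.

Definition KIok f g := forall s t, 0 <= s -> s <= t -> t <= T ->
  RS_integrable (fun r => f t - f r) g s t.

Lemma KI_chen f g : KIok f g -> chen_rel 0 T (KI f g) (fun s u t => dl g s u * dl f u t).
Proof.
move=> ok s u t s0 su ut tT.
have h1 := ok s u s0 su (le_trans ut tT).
have h2 := ok u t (le_trans s0 su) ut tT.
have h3 := ok s t s0 (le_trans su ut) tT.
have [h4 e4] := RS_cst (f t - f u) g su.
have [h5 e5] := RS_Dl su h1 h4.
have E : (fun r => f u - f r + (f t - f u)) = (fun r => f t - f r).
  by apply/funext => r; ring.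
rewrite E in h5 e5.
by rewrite /KI (RS_chasles su ut h5 h2 h3) e5 e4 /dl; ring.
Qed.

Lemma JM_chen (f g h : R -> R) :
  Jok T (fun s t r => dl f s r * dl h r t) g -> YIok T f g -> KIok h g ->
  chen_rel 0 T (J (fun s t r => dl f s r * dl h r t) g)
    (fun s u t => dl f s u * KI h g u t + YI f g s u * dl h u t).
Proof.
move=> ok okf okh s u t s0 su ut tT; have u0 := le_trans s0 su.
have uT := le_trans ut tT.
have h1 := ok s u s0 su uT.
have h2 := ok u t u0 ut tT.
have h3 := ok s t s0 (le_trans su ut) tT.
have [h4 e4] := RS_Zl (h t - h u) su (okf s u s0 su uT).
have [h5 e5] := RS_Zl (f u - f s) ut (okh u t u0 ut tT).
have [h6 e6] := RS_Dl su h1 h4.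
have [h7 e7] := RS_Dl ut h2 h5.
have E1 r : s <= r -> r <= u -> dl f s r * dl h r u + (h t - h u) * (f r - f s) =
  dl f s r * dl h r t by move=> _ _; rewrite /dl; ring.
have E2 r : u <= r -> r <= t -> dl f u r * dl h r t + (f u - f s) * (h t - h r) =
  dl f s r * dl h r t by move=> _ _; rewrite /dl; ring.
have [h8 e8] := RS_ext su E1 (fun _ _ _ => erefl) h6.
have [h9 e9] := RS_ext ut E2 (fun _ _ _ => erefl) h7.
by rewrite /J (RS_chasles su ut h8 h9 h3) e8 e9 e7 e6 e5 e4 /YI /KI /dl; ring.
Qed.

Lemma JL_chen X (f h g : R -> R) :
  chen_rel 0 T X (fun s u t => dl f s u * dl h u t) ->
  Jok T (fun _ t r => X r t) g -> KIok f g ->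
  chen_rel 0 T (J (fun _ t r => X r t) g)
    (fun s u t => dl g s u * X u t + KI f g s u * dl h u t).
Proof.
move=> cX ok okf s u t s0 su ut tT; have u0 := le_trans s0 su.
have uT := le_trans ut tT.
have h1 := ok s u s0 su uT.
have h2 := ok u t u0 ut tT.
have h3 := ok s t s0 (le_trans su ut) tT.
have [h4 e4] := RS_cst (X u t) g su.
have [h5 e5] := RS_Zl (h t - h u) su (okf s u s0 su uT).
have [h6 e6] := RS_Dl su h1 h4.
have [h7 e7] := RS_Dl su h6 h5.
have E r : s <= r -> r <= u -> X r u + X u t + (h t - h u) * (f u - f r) = X r t.
  by move=> sr ru; rewrite (cX r u t) // ?(le_trans s0) // /dl; ring.
have [h8 e8] := RS_ext su E (fun _ _ _ => erefl) h7.
by rewrite /J (RS_chasles su ut h8 h2 h3) e8 e7 e6 e5 e4 /KI /dl; ring.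
Qed.

(* Classes of products x_{p,q} y_{p',q'}, with p, q, p', q' unrelated. *)
Definition N4 a a' C xi := 0 <= C /\ forall p q p' q', 0 <= p -> p <= q -> q <= T ->
  0 <= p' -> p' <= q' -> q' <= T ->
  `|xi p q p' q'| <= C * (q - p) `^ a * (q' - p') `^ a'.

Definition CN4 a C xi := 0 <= C /\ exists w, [/\ superadd 0 T w, w 0 T <= 1 &
  forall p q p' q', 0 <= p -> p <= q -> q <= T ->
  0 <= p' -> p' <= q' -> q' <= T ->
  `|xi p q p' q'| <= cbound w a (C * (q - p) `^ a) p' q'].

Definition tens (x y : R -> R -> R) p q p' q' := x p q * y p' q'.

Lemma N4_qnorm a a' : qnorm (N4 a a').
Proof.
split; first by move=> C x [].
  move=> C D x CD [C0 H]; split; first exact: le_trans CD.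
  move=> p q p' q' h1 h2 h3 h4 h5 h6; apply: le_trans (H _ _ _ _ h1 h2 h3 h4 h5 h6) _.
  by rewrite -!mulrA ler_wpM2r // mulr_ge0 ?powR_ge0.
move=> C D x y [C0 H] [D0 K]; split; first by rewrite mulr_ge0 ?addr_ge0.
move=> p q p' q' h1 h2 h3 h4 h5 h6; rewrite !fctE; apply: le_trans (ler_normD _ _) _.
have := lerD (H _ _ _ _ h1 h2 h3 h4 h5 h6) (K _ _ _ _ h1 h2 h3 h4 h5 h6).
have := mulr_ge0 (addr_ge0 C0 D0) (mulr_ge0 (powR_ge0 (q - p) a) (powR_ge0 (q' - p') a')).
lra.
Qed.

Lemma CN4_qnorm a : qnorm (CN4 a).
Proof.
split; first by move=> C x [].
  move=> C D x CD [C0 [w [sw w1 H]]]; split; first exact: le_trans CD.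
  exists w; split => // p q p' q' h1 h2 h3 h4 h5 h6.
  apply: le_trans (H _ _ _ _ h1 h2 h3 h4 h5 h6) _.
  by apply: cbound_mono; rewrite ler_wpM2r ?powR_ge0.
move=> C D x y [C0 [w [sw w1 H]]] [D0 [w' [sw' w1' K]]].
split; first by rewrite mulr_ge0 ?addr_ge0.
exists (fun s t => (w s t + w' s t) / 2); split; [exact: superadd_avg|lra|].
move=> p q p' q' h1 h2 h3 h4 h5 h6; rewrite !fctE; apply: le_trans (ler_normD _ _) _.
apply: le_trans (lerD (H _ _ _ _ h1 h2 h3 h4 h5 h6) (K _ _ _ _ h1 h2 h3 h4 h5 h6)) _.
have := sqrt_avg (sw.1 p' q' h4 h5 h6) (sw'.1 p' q' h4 h5 h6) C0 D0.
move=> /(ler_wpM2r (mulr_ge0 (powR_ge0 (q - p) a) (powR_ge0 (q' - p') a))).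
rewrite /cbound; lra.
Qed.

Lemma tens_N4 a a' C D x y : Hb T a C x -> Hb T a' D y -> N4 a a' (1 * (C * D)) (tens x y).
Proof.
move=> [C0 H] [D0 K]; split; first by rewrite mul1r mulr_ge0.
move=> p q p' q' h1 h2 h3 h4 h5 h6; rewrite /tens normrM.
have := ler_pM (normr_ge0 _) (normr_ge0 _) (H p q h1 h2 h3) (K p' q' h4 h5 h6).
by move=> h; apply: le_trans h _; rewrite le_eqVlt; apply/orP; left; apply/eqP; ring.
Qed.

Lemma tens_CN4 a C D x y : Hb T a C x -> Cb T a D y -> CN4 a (1 * (C * D)) (tens x y).
Proof.
move=> [C0 H] [D0 [w [sw w1 K]]]; split; first by rewrite mul1r mulr_ge0.
exists w; split => // p q p' q' h1 h2 h3 h4 h5 h6; rewrite /tens normrM.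
have := ler_pM (normr_ge0 _) (normr_ge0 _) (H p q h1 h2 h3) (K p' q' h4 h5 h6).
move=> h; apply: le_trans h _; rewrite /cbound.
by rewrite le_eqVlt; apply/orP; left; apply/eqP; ring.
Qed.

Lemma tens_Bl x x' y : tens (x - x') y = tens x y - tens x' y.
Proof. by do 4 apply/funext => ?; rewrite /tens !fctE; ring. Qed.

Lemma tens_Br x y y' : tens x (y - y') = tens x y - tens x y'.
Proof. by do 4 apply/funext => ?; rewrite /tens !fctE; ring. Qed.

Lemma tens_cvg a a' (x_ y_ : nat -> R -> R -> R) x y :
  qcvg (Hb T a) x_ x -> qcvg (Hb T a') y_ y ->
  qcvg (N4 a a') (fun n => tens (x_ n) (y_ n)) (tens x y).
Proof.
apply: (bil_qcvg (Hb_qnorm T a) (Hb_qnorm T a') (N4_qnorm a a') ler01).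
- by move=> C D x0 y0; exact: tens_N4.
- by move=> *; rewrite -tens_Bl.
- by move=> *; rewrite -tens_Br.
Qed.

Lemma tens_cvg' a (x_ y_ : nat -> R -> R -> R) x y :
  qcvg (Hb T a) x_ x -> qcvg (Cb T a) y_ y ->
  qcvg (CN4 a) (fun n => tens (x_ n) (y_ n)) (tens x y).
Proof.
apply: (bil_qcvg (Hb_qnorm T a) (Cb_qnorm T a) (CN4_qnorm a) ler01).
- by move=> C D x0 y0; exact: tens_CN4.
- by move=> *; rewrite -tens_Bl.
- by move=> *; rewrite -tens_Br.
Qed.

Definition chen_tens X xi := chen_rel 0 T X (fun s u t => xi s u u t).

Lemma chen_tensB X X' xi xi' : chen_tens X xi -> chen_tens X' xi' ->
  chen_tens (X - X') (xi - xi').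
Proof.
by move=> h h' s u t *; rewrite !fctE (h s u t) // (h' s u t) //; ring.
Qed.

(** By Chen's relation the increment of X_{s,r} in r is X_{r,r'} plus a product containing one
    increment over [r,r']. Both are (r' - r)^a times a quantity of order (t - s)^a. *)
Lemma base1 a C D X xi : 0 <= a -> chen_tens X xi -> Hb T (a + a) C X -> N4 a a D xi ->
  Bb T a a (2 * (C + D)) (fun s _ r => X s r).
Proof.
move=> a0 ch [C0 HX] [D0 Hxi]; have CD := addr_ge0 C0 D0.
split; first by rewrite mulr_ge0.
move=> s t s0 st tT; split.
  move=> r r' sr rr rt; have rT := le_trans rt tT; have r0 := le_trans s0 sr.
  have -> : X s r' - X s r = X r r' + xi s r r r' by rewrite (ch s r r') //; ring.
  apply: le_trans (ler_normD _ _) _.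
  have h1 := HX r r' r0 rr rT.
  have h2 := Hxi s r r r' s0 sr (le_trans rr rT) r0 rr rT.
  have p1 : (r' - r) `^ a <= (t - s) `^ a.
    by rewrite ge0_ler_powR ?nnegrE ?subr_ge0 // lerB.
  have p2 : (r - s) `^ a <= (t - s) `^ a.
    by rewrite ge0_ler_powR ?nnegrE ?subr_ge0 ?lerB // (le_trans rr).
  rewrite powR_addr // in h1.
  have p0 := powR_ge0 (r' - r) a.
  have := ler_wpM2l C0 (ler_wpM2r p0 p1).
  have := ler_wpM2l D0 (ler_wpM2r p0 p2).
  have := mulr_ge0 CD (mulr_ge0 (powR_ge0 (t - s) a) p0).
  lra.
have h1 := HX s s s0 (lexx _) (le_trans st tT).
apply: le_trans h1 _; rewrite subrr.
apply: ler_pM => //; first lra.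
by rewrite ge0_ler_powR ?nnegrE ?subr_ge0 ?addr_ge0.
Qed.

Lemma base3 a C D X xi : 0 <= a -> chen_tens X xi -> Hb T (a + a) C X -> N4 a a D xi ->
  Bb T a a (2 * (C + D)) (fun _ t r => X r t).
Proof.
move=> a0 ch [C0 HX] [D0 Hxi]; have CD := addr_ge0 C0 D0.
split; first by rewrite mulr_ge0.
move=> s t s0 st tT; split.
  move=> r r' sr rr rt; have rT := le_trans rt tT; have r0 := le_trans s0 sr.
  have r'0 := le_trans r0 rr.
  have -> : X r' t - X r t = - (X r r' + xi r r' r' t).
    by rewrite (ch r r' t) //; ring.
  rewrite normrN; apply: le_trans (ler_normD _ _) _.
  have h1 := HX r r' r0 rr rT.
  have h2 := Hxi r r' r' t r0 rr rT r'0 rt tT.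
  have p1 : (r' - r) `^ a <= (t - s) `^ a.
    by rewrite ge0_ler_powR ?nnegrE ?subr_ge0 // lerB.
  have p2 : (t - r') `^ a <= (t - s) `^ a.
    by rewrite ge0_ler_powR ?nnegrE ?subr_ge0 ?lerB // (le_trans sr).
  rewrite powR_addr // in h1.
  have p0 := powR_ge0 (r' - r) a.
  have := ler_wpM2l C0 (ler_wpM2r p0 p1).
  have := ler_wpM2l D0 (ler_wpM2r p0 p2).
  have := mulr_ge0 CD (mulr_ge0 (powR_ge0 (t - s) a) p0).
  lra.
apply: le_trans (HX s t s0 st tT) _; rewrite ler_wpM2r ?powR_ge0 //; lra.
Qed.

(* Moving the middle point of xi_{s,r,r,t} produces terms containing an increment
   over [r, r']. *)
Definition mid_rel xi := forall s r r' t, 0 <= s -> s <= r -> r <= r' -> r' <= t ->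
  t <= T -> xi s r' r' t - xi s r r t = xi r r' r' t - xi s r r r'.

Lemma mid_relB xi xi' : mid_rel xi -> mid_rel xi' -> mid_rel (xi - xi').
Proof.
move=> h h' s r r' t h1 h2 h3 h4 h5; rewrite !fctE.
have := h s r r' t h1 h2 h3 h4 h5; have := h' s r r' t h1 h2 h3 h4 h5; lra.
Qed.

Lemma mid_rel_tens f g : mid_rel (tens (dl f) (dl g)).
Proof. by move=> *; rewrite /tens /dl; ring. Qed.

Lemma base2 a C xi : 0 <= a -> mid_rel xi -> N4 a a C xi ->
  Bb T a a (2 * C) (fun s t r => xi s r r t).
Proof.
move=> a0 mid [C0 Hxi]; split; first by rewrite mulr_ge0.
move=> s t s0 st tT; split.
  move=> r r' sr rr rt; have rT := le_trans rt tT; have r0 := le_trans s0 sr.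
  rewrite (mid s r r' t) //; apply: le_trans (ler_normB _ _) _.
  have r'0 := le_trans r0 rr.
  have h1 := Hxi r r' r' t r0 rr rT r'0 rt tT.
  have h2 := Hxi s r r r' s0 sr (le_trans rr rT) r0 rr rT.
  have p1 : (t - r') `^ a <= (t - s) `^ a.
    by rewrite ge0_ler_powR ?nnegrE ?subr_ge0 ?lerB // (le_trans sr).
  have p2 : (r - s) `^ a <= (t - s) `^ a.
    by rewrite ge0_ler_powR ?nnegrE ?subr_ge0 ?lerB // (le_trans rr).
  have p0 := powR_ge0 (r' - r) a.
  have := ler_wpM2l C0 (ler_wpM2r p0 p1).
  have := ler_wpM2l C0 (ler_wpM2r p0 p2).
  lra.
have h1 := Hxi s s s t s0 (lexx _) (le_trans st tT) s0 st tT.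
have p2 : (s - s) `^ a <= (t - s) `^ a.
  by rewrite ge0_ler_powR ?nnegrE ?subr_ge0 ?lerB.
have p0 := powR_ge0 (t - s) a.
rewrite powR_addr //.
have := ler_wpM2l C0 (ler_wpM2r p0 p2).
have := mulr_ge0 C0 (mulr_ge0 p0 p0); lra.
Qed.

Lemma base1' a C D X xi : 0 <= a -> chen_tens X xi -> Cb T (a + a) C X -> CN4 a D xi ->
  CBb T a a (2 * (C + D)) (fun s _ r => X s r).
Proof.
move=> a0 ch cX [D0 [w [sw w1 Hxi]]]; have [_ HX'] := Cb_Hb cX.
have [C0 [w' [sw' w1' HX]]] := cX; have CD := addr_ge0 C0 D0.
split; first by rewrite mulr_ge0.
exists (fun s t => (w' s t + w s t) / 2); split; [exact: superadd_avg|lra|].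
move=> s t s0 st tT; split.
  move=> r r' sr rr rt; have rT := le_trans rt tT; have r0 := le_trans s0 sr.
  have -> : X s r' - X s r = X r r' + xi s r r r' by rewrite (ch s r r') //; ring.
  apply: le_trans (ler_normD _ _) _.
  have h1 := HX r r' r0 rr rT.
  have h2 := Hxi s r r r' s0 sr (le_trans rr rT) r0 rr rT.
  have p1 : (r' - r) `^ a <= (t - s) `^ a.
    by rewrite ge0_ler_powR ?nnegrE ?subr_ge0 // lerB.
  have p2 : (r - s) `^ a <= (t - s) `^ a.
    by rewrite ge0_ler_powR ?nnegrE ?subr_ge0 ?lerB // (le_trans rr).
  rewrite /cbound powR_addr // in h1; rewrite /cbound in h2.
  have p0 := mulr_ge0 (powR_ge0 (r' - r) a) (sqrtr_ge0 (w' r r')).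
  have p0' := mulr_ge0 (powR_ge0 (r' - r) a) (sqrtr_ge0 (w r r')).
  have := ler_wpM2l C0 (ler_wpM2r p0 p1).
  have := ler_wpM2l D0 (ler_wpM2r p0' p2).
  have := sqrt_avg (sw'.1 r r' r0 rr rT) (sw.1 r r' r0 rr rT) C0 D0.
  move=> /(ler_wpM2r (mulr_ge0 (powR_ge0 (t - s) a) (powR_ge0 (r' - r) a))).
  rewrite /cbound; lra.
have h1 := HX' s s s0 (lexx _) (le_trans st tT).
apply: le_trans h1 _; rewrite subrr.
apply: ler_pM => //; first lra.
by rewrite ge0_ler_powR ?nnegrE ?subr_ge0 ?addr_ge0.
Qed.

(** The bound on F x needs a companion y, here the remainder of Chen's relation. As this relation is
    linear in the pair (x, y), the differences satisfy it too, and boundedness gives continuity. *)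
Lemma lin2_qcvg (X Y Z : zmodType) (N1 : R -> X -> Prop) (N2 : R -> Y -> Prop)
    (N3 : R -> Z -> Prop) (Rel : X -> Y -> Prop) (F : X -> Z)
    (x_ : nat -> X) (x : X) (y_ : nat -> Y) (y : Y) :
  qnorm N3 ->
  (forall C D (x : X) (y : Y), Rel x y -> N1 C x -> N2 D y -> N3 (2 * (C + D)) (F x)) ->
  (forall (x x' : X) (y y' : Y), Rel x y -> Rel x' y' -> Rel (x - x') (y - y')) ->
  (forall x x' : X, F (x - x') = F x - F x') ->
  (forall n, Rel (x_ n) (y_ n)) -> Rel x y ->
  qcvg N1 x_ x -> qcvg N2 y_ y -> qcvg N3 (fun n => F (x_ n)) (F x).
Proof.
move=> [p m _] NF RB FB Rn Rxy [[C xC] cx] [[D yD] cy].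
split; first by exists (2 * (C + D)); exact: NF xC yD.
move=> e e0; have e4 : 0 < e / 4 by rewrite divr_gt0.
have [n1 h1] := cx _ e4; have [n2 h2] := cy _ e4.
exists (maxn n1 n2) => n; rewrite geq_max => /andP[/h1 hx /h2 hy].
by rewrite -FB; apply: m (NF _ _ _ _ (RB _ _ _ _ (Rn n) Rxy) hx hy); lra.
Qed.

Lemma base1_cvg a (X_ : nat -> R -> R -> R) X
    (xi_ : nat -> R -> R -> R -> R -> R) xi : 0 <= a ->
  (forall n, chen_tens (X_ n) (xi_ n)) -> chen_tens X xi ->
  qcvg (Hb T (a + a)) X_ X -> qcvg (N4 a a) xi_ xi ->
  qcvg (Bb T a a) (fun n s _ r => X_ n s r) (fun s _ r => X s r) /\
  qcvg (Bb T a a) (fun n _ t r => X_ n r t) (fun _ t r => X r t).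
Proof.
move=> a0 cn c cX cxi; split.
  pose F (Y : R -> R -> R) (s _ r : R) := Y s r.
  apply: (@lin2_qcvg _ _ _ _ _ _ chen_tens F _ _ _ _ (Bb_qnorm T a a) _ _ _ cn c cX cxi) => //.
    by move=> C D x y; exact: base1.
  by move=> *; exact: chen_tensB.
pose F (Y : R -> R -> R) (_ t r : R) := Y r t.
apply: (@lin2_qcvg _ _ _ _ _ _ chen_tens F _ _ _ _ (Bb_qnorm T a a) _ _ _ cn c cX cxi) => //.
  by move=> C D x y; exact: base3.
by move=> *; exact: chen_tensB.
Qed.

Lemma base1_cvg' a (X_ : nat -> R -> R -> R) X
    (xi_ : nat -> R -> R -> R -> R -> R) xi : 0 <= a ->
  (forall n, chen_tens (X_ n) (xi_ n)) -> chen_tens X xi ->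
  qcvg (Cb T (a + a)) X_ X -> qcvg (CN4 a) xi_ xi ->
  qcvg (CBb T a a) (fun n s _ r => X_ n s r) (fun s _ r => X s r).
Proof.
move=> a0 cn c cX cxi.
pose F (Y : R -> R -> R) (s _ r : R) := Y s r.
apply: (@lin2_qcvg _ _ _ _ _ _ chen_tens F _ _ _ _ (CBb_qnorm T a a) _ _ _ cn c cX cxi) => //.
  by move=> C D x y; exact: base1'.
by move=> *; exact: chen_tensB.
Qed.

Lemma base2_cvg a (xi_ : nat -> R -> R -> R -> R -> R) xi : 0 <= a ->
  (forall n, mid_rel (xi_ n)) -> mid_rel xi -> qcvg (N4 a a) xi_ xi ->
  qcvg (Bb T a a) (fun n s t r => xi_ n s r r t) (fun s t r => xi s r r t).
Proof.
move=> a0 cn c cxi.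
pose F (y : R -> R -> R -> R -> R) (s t r : R) := y s r r t.
suff : qcvg (Bb T a a) (fun n => F (xi_ n)) (F xi) by [].
pose Rel (x _ : R -> R -> R -> R -> R) := mid_rel x.
apply: (@lin2_qcvg _ _ _ _ _ _ Rel F _ _ _ _ (Bb_qnorm T a a) _ _ _ cn c cxi cxi) => //.
  move=> C D x y mx hx [D0 _]; have [p m _] := Bb_qnorm T a a.
  by apply: m (base2 a0 mx hx); lra.
by move=> *; exact: mid_relB.
Qed.

End Chen.

(** * Identities between iterated integrals of Lipschitz paths *)

Section Lipschitz.
Context {R : realType} (T : R).
Hypothesis T0 : 0 < T.
Implicit Types (r s t u v a C D e : R) (f g h : R -> R) (psi x y X : R -> R -> R).

Definition lip f := exists L, HP T 1 L f.

Lemma lip_HP f a : 0 <= a -> a <= 1 -> lip f -> exists C, HP T a C f.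
Proof.
by move=> a0 a1 [L hL]; eexists; exact: (Hb_weaken a0 a1 (ltW T0) hL).
Qed.

Lemma lip_CP f : lip f -> exists C, CP T 2^-1 C f.
Proof. by move=> [L hL]; eexists; exact: Hb1_Cb T0 hL. Qed.

Lemma lipD f g : lip f -> lip g -> lip (f + g).
Proof. by move=> [L hL] [M hM]; exists (2 * (L + M)); rewrite /HP dlD; exact: HbD. Qed.

(** A Lipschitz integrand and an integrator of class [Cb] with exponent 1/2 give 3/2 in total. It is
    written 3/4 + 3/4 because [base1] expects two equal exponents. *)
Lemma lip_YI f g : lip f -> lip g ->
  YIok T f g /\ exists C, Hb T (3/4 + 3/4) C (YI f g).
Proof.
move=> [L hL] /lip_CP[C hC].
have [] := YI_core ler01 _ _ hL hC; [lra|lra|move=> ok _ hY _; split => //].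
have -> : (3 / 4 + 3 / 4 : R) = 1 + 2^-1 by field.
by eexists; exact: Cb_Hb hY.
Qed.

Lemma lip_Bb1 f g : lip f -> lip g ->
  exists C, Bb T (3/4) (3/4) C (fun s _ r => YI f g s r).
Proof.
move=> lf lg; have [ok [C hC]] := lip_YI lf lg.
have [D hD] : exists C, HP T (3/4) C f by apply: lip_HP => //; lra.
have [E hE] : exists C, HP T (3/4) C g by apply: lip_HP => //; lra.
eexists; apply: (@base1 _ _ _ _ _ _ (tens (dl f) (dl g)) _ _ hC (tens_N4 hD hE)).
  lra.
exact: YI_chen.
Qed.

Lemma lip_Bb3 f g : lip f -> lip g ->
  exists C, Bb T (3/4) (3/4) C (fun _ t r => YI f g r t).
Proof.
move=> lf lg; have [ok [C hC]] := lip_YI lf lg.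
have [D hD] : exists C, HP T (3/4) C f by apply: lip_HP => //; lra.
have [E hE] : exists C, HP T (3/4) C g by apply: lip_HP => //; lra.
eexists; apply: (@base3 _ _ _ _ _ _ (tens (dl f) (dl g)) _ _ hC (tens_N4 hD hE)).
  lra.
exact: YI_chen.
Qed.

Lemma lip_Bb2 f g : lip f -> lip g ->
  exists C, Bb T (3/4) (3/4) C (fun s t r => dl f s r * dl g r t).
Proof.
move=> lf lg.
have [D hD] : exists C, HP T (3/4) C f by apply: lip_HP => //; lra.
have [E hE] : exists C, HP T (3/4) C g by apply: lip_HP => //; lra.
eexists; apply: (@base2 _ _ _ _ (tens (dl f) (dl g)) _ _ (tens_N4 hD hE)).
  lra.
exact: mid_rel_tens.
Qed.

Lemma lip_J Phi g : (exists C, Bb T (3/4) (3/4) C Phi) -> lip g ->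
  Jok T Phi g /\ exists C, Hb T (3/4 + 3/4 + 2^-1) C (J Phi g).
Proof.
move=> [C hC] /lip_CP[D hD].
have [] := J_core _ _ _ _ hC hD; [lra|lra|lra|lra|move=> ok hJ; split => //].
by eexists; exact: hJ.
Qed.

Lemma lip_KI f g : lip f -> lip g -> KIok T f g /\ exists C, Hb T (3/4 + 2^-1) C (KI f g).
Proof.
move=> lf /lip_CP[D hD].
have [C [C0 hC]] : exists C, HP T (3/4) C f by apply: lip_HP => //; lra.
have B : Bb T (3/4) 0 C (fun _ t r => f t - f r).
  split => // s t s0 st tT; split.
    move=> r r' sr rr rt; rewrite powRr0 mulr1.
    have -> : f t - f r' - (f t - f r) = - dl f r r' by rewrite /dl; ring.
    by rewrite normrN hC // ?(le_trans s0) // (le_trans rt).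
  by rewrite add0r; exact: hC.
have [] := J_core _ _ _ _ B hD; [lra|lra|lra|lra|move=> ok]; rewrite add0r => hJ.
by split => //; eexists; exact: hJ.
Qed.

(** The difference is additive and of exponent above 1. Integration by parts and the exchange of the
    order of integration are derived from this principle, without Fubini's theorem. *)
Lemma chen_unique A B rem a : 1 < a -> chen_rel 0 T A rem -> chen_rel 0 T B rem ->
  (exists C, Hb T a C A) -> (exists C, Hb T a C B) ->
  forall s t, 0 <= s -> s <= t -> t <= T -> A s t = B s t.
Proof.
move=> a1 cA cB [C hC] [D hD] s t s0 st tT; apply/eqP; rewrite -subr_eq0; apply/eqP.
have [E0 HE] := HbD hC (HbN hD).
apply: (additive_small_eq0 (S := 0) (E := T) (psi := A - B) a1 E0 _ HE s0 st tT).
by move=> x y z *; rewrite !fctE (cA x y z) // (cB x y z) //; ring.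
Qed.

Lemma KI_YI f g : lip f -> lip g ->
  forall s t, 0 <= s -> s <= t -> t <= T -> KI f g s t = YI g f s t.
Proof.
move=> lf lg; have [okK [C hK]] := lip_KI lf lg; have [okY [D hY]] := lip_YI lg lf.
apply: (@chen_unique _ _ (fun s u t => dl g s u * dl f u t) (3/4 + 2^-1)).
- lra.
- exact: KI_chen.
- exact: YI_chen.
- by exists C.
- eexists; apply: (Hb_weaken _ _ (ltW T0) hY); lra.
Qed.

Lemma YI_by_parts f g : lip f -> lip g ->
  forall s t, 0 <= s -> s <= t -> t <= T ->
    YI g f s t = dl f s t * dl g s t - YI f g s t.
Proof.
move=> lf lg; have [ok [C hC]] := lip_YI lf lg; have [ok' [D hD]] := lip_YI lg lf.
apply: (@chen_unique _ _ (fun s u t => dl g s u * dl f u t) (3/4 + 3/4)).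
- lra.
- exact: YI_chen.
- by move=> s u t *; rewrite (YI_chen ok (s := s) (u := u)) // /dl; ring.
- by exists D.
- have [A [A0 hA]] : exists C, HP T (3/4) C f by apply: lip_HP => //; lra.
  have [B [B0 hB]] : exists C, HP T (3/4) C g by apply: lip_HP => //; lra.
  have H : Hb T (3/4 + 3/4) (A * B) (fun s t => dl f s t * dl g s t).
    split; first exact: mulr_ge0.
    move=> s t s0 st tT; rewrite normrM powR_addr; [|lra|lra].
    apply: le_trans (ler_pM _ _ (hA s t s0 st tT) (hB s t s0 st tT)) _ => //.
    by rewrite mulrACA.
  by eexists; exact: HbD H (HbN hC).
Qed.

Lemma JM_T3 f g h : lip f -> lip g -> lip h ->
  forall s t, 0 <= s -> s <= t -> t <= T ->
    J (fun s t r => dl f s r * dl h r t) g s t = T3 f g h s t.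
Proof.
move=> lf lg lh; have [ok1 h1] := lip_J (lip_Bb2 lf lh) lg.
have [ok2 h2] := lip_J (lip_Bb1 lf lg) lh.
have [okfg _] := lip_YI lf lg; have [okgh _] := lip_YI lg lh.
have [okK _] := lip_KI lh lg.
apply: (@chen_unique _ _ (fun s u t => dl f s u * YI g h u t + YI f g s u * dl h u t) (3/4 + 3/4 + 2^-1)) => //.
- lra.
- move=> s u t s0 su ut tT; rewrite (JM_chen ok1 okfg okK s0 su ut tT).
  by rewrite (KI_YI lh lg (le_trans s0 su) ut tT).
- exact: J1_chen (YI_chen okfg) ok2 okgh.
Qed.

Lemma JL_T3 f g h : lip f -> lip g -> lip h ->
  forall s t, 0 <= s -> s <= t -> t <= T ->
    J (fun _ t r => YI f h r t) g s t = T3 g f h s t.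
Proof.
move=> lf lg lh; have [ok1 h1] := lip_J (lip_Bb3 lf lh) lg.
have [ok2 h2] := lip_J (lip_Bb1 lg lf) lh.
have [okgf _] := lip_YI lg lf; have [okfh _] := lip_YI lf lh.
have [okK _] := lip_KI lf lg.
apply: (@chen_unique _ _ (fun s u t => dl g s u * YI f h u t + YI g f s u * dl h u t) (3/4 + 3/4 + 2^-1)) => //.
- lra.
- move=> s u t s0 su ut tT; rewrite (JL_chen (YI_chen okfh) ok1 okK s0 su ut tT).
  by rewrite (KI_YI lf lg s0 su (le_trans ut tT)).
- exact: J1_chen (YI_chen okgf) ok2 okfh.
Qed.

Lemma YI_Dl f f' g : lip f -> lip f' -> lip g ->
  forall s t, 0 <= s -> s <= t -> t <= T ->
  YI (f + f') g s t = YI f g s t + YI f' g s t.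
Proof.
move=> lf lf' lg s t s0 st tT; have [ok1 _] := lip_YI lf lg.
have [ok2 _] := lip_YI lf' lg.
have [_ <-] := RS_Dl st (ok1 s t s0 st tT) (ok2 s t s0 st tT).
by rewrite /YI; congr RS_integral; apply/funext => r; rewrite !fctE; ring.
Qed.

Lemma YI_Dr f g g' : lip f -> lip g -> lip g' ->
  forall s t, 0 <= s -> s <= t -> t <= T ->
  YI f (g + g') s t = YI f g s t + YI f g' s t.
Proof.
move=> lf lg lg' s t s0 st tT; have [ok1 _] := lip_YI lf lg.
have [ok2 _] := lip_YI lf lg'.
by have [_ <-] := RS_Dr st (ok1 s t s0 st tT) (ok2 s t s0 st tT).
Qed.

Lemma T3_ok f g h : lip f -> lip g -> lip h -> Jok T (fun s _ r => YI f g s r) h.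
Proof. by move=> lf lg lh; have [] := lip_J (lip_Bb1 lf lg) lh. Qed.

Lemma T3_D1 f f' g h : lip f -> lip f' -> lip g -> lip h ->
  forall s t, 0 <= s -> s <= t -> t <= T ->
  T3 (f + f') g h s t = T3 f g h s t + T3 f' g h s t.
Proof.
move=> lf lf' lg lh s t s0 st tT.
have ok1 := T3_ok lf lg lh s0 st tT; have ok2 := T3_ok lf' lg lh s0 st tT.
have [ok3 <-] := RS_Dl st ok1 ok2.
have E r : s <= r -> r <= t -> YI f g s r + YI f' g s r = YI (f + f') g s r.
  by move=> sr rt; rewrite YI_Dl // (le_trans rt).
by have [_ e] := RS_ext st E (fun _ _ _ => erefl) ok3; exact: e.
Qed.

Lemma T3_D2 f g g' h : lip f -> lip g -> lip g' -> lip h ->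
  forall s t, 0 <= s -> s <= t -> t <= T ->
  T3 f (g + g') h s t = T3 f g h s t + T3 f g' h s t.
Proof.
move=> lf lg lg' lh s t s0 st tT.
have ok1 := T3_ok lf lg lh s0 st tT; have ok2 := T3_ok lf lg' lh s0 st tT.
have [ok3 <-] := RS_Dl st ok1 ok2.
have E r : s <= r -> r <= t -> YI f g s r + YI f g' s r = YI f (g + g') s r.
  by move=> sr rt; rewrite YI_Dr // (le_trans rt).
by have [_ e] := RS_ext st E (fun _ _ _ => erefl) ok3; exact: e.
Qed.

Lemma T3_D3 f g h h' : lip f -> lip g -> lip h -> lip h' ->
  forall s t, 0 <= s -> s <= t -> t <= T ->
  T3 f g (h + h') s t = T3 f g h s t + T3 f g h' s t.
Proof.
move=> lf lg lh lh' s t s0 st tT.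
have ok1 := T3_ok lf lg lh s0 st tT; have ok2 := T3_ok lf lg lh' s0 st tT.
by have [ok3 <-] := RS_Dr st ok1 ok2.
Qed.

(** Two of the eight multilinear terms, with one factor g in the middle or in front, are rewritten
    as integrals against that factor. In this form they match [transl3] and survive when the f
    become rough, since the integrator is then the Cameron-Martin path. *)
Lemma T3_expand f1 g1 f2 g2 f3 g3 : lip f1 -> lip g1 -> lip f2 -> lip g2 ->
  lip f3 -> lip g3 -> forall s t, 0 <= s -> s <= t -> t <= T ->
  T3 (f1 + g1) (f2 + g2) (f3 + g3) s t =
    T3 f1 f2 f3 s t + T3 g1 g2 g3 s t + T3 g1 g2 f3 s t + T3 g1 f2 g3 s t
    + T3 f1 g2 g3 s t + J (fun s t r => dl f1 s r * dl f3 r t) g2 s t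
    + T3 f1 f2 g3 s t + J (fun _ t r => YI f2 f3 r t) g1 s t.
Proof.
move=> l1 m1 l2 m2 l3 m3 s t s0 st tT.
rewrite T3_D1 ?T3_D2 ?T3_D3 //; try exact: lipD.
rewrite JM_T3 // JL_T3 //; ring.
Qed.

Lemma YI_linear f g S E : 0 <= S -> E <= T -> lip f -> lip g ->
  (exists c, forall s t, S <= s -> s <= t -> t <= E -> dl f s t = c * (t - s)) ->
  (exists c, forall s t, S <= s -> s <= t -> t <= E -> dl g s t = c * (t - s)) ->
  forall s t, S <= s -> s <= t -> t <= E -> YI f g s t = dl f s t * dl g s t / 2.
Proof.
move=> S0 ET lf lg [c Hc] [c' Hc'].
have [ok [C [C0 hC]]] := lip_YI lf lg.
have [A [A0 hA]] : exists C, HP T (3/4) C f by apply: lip_HP => //; lra.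
have [B [B0 hB]] : exists C, HP T (3/4) C g by apply: lip_HP => //; lra.
move=> s t Ss st tE; apply/eqP; rewrite -subr_eq0; apply/eqP.
have a1 : 1 < 3 / 4 + 3 / 4 :> R by lra.
have D0 : 0 <= C + A * B by rewrite addr_ge0 // mulr_ge0.
apply: (additive_small_eq0 (S := S) (E := E) (psi := fun s t => YI f g s t - dl f s t * dl g s t / 2) a1 D0 _ _ Ss st tE).
- move=> x y z Sx xy yz zE; rewrite (YI_chen ok (s := x) (u := y)) ?(le_trans S0) ?(le_trans zE) //.
  have xE := le_trans xy (le_trans yz zE); have yE := le_trans yz zE; have Sy := le_trans Sx xy.
  rewrite (Hc x y) // (Hc y z) // (Hc x z) ?(le_trans xy) //.
  rewrite (Hc' x y) // (Hc' y z) // (Hc' x z) ?(le_trans xy) //.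
  by field.
- move=> x y Sx xy yE; have x0 := le_trans S0 Sx; have yT := le_trans yE ET.
  have h1 := hC x y x0 xy yT.
  have h2 := ler_pM (normr_ge0 _) (normr_ge0 _) (hA x y x0 xy yT) (hB x y x0 xy yT).
  rewrite -normrM in h2.
  apply: le_trans (ler_normB _ _) _.
  have -> : `|dl f x y * dl g x y / 2| = `|dl f x y * dl g x y| / 2.
    by rewrite normrM (ger0_norm (x := 2^-1)) // invr_ge0.
  have := normr_ge0 (dl f x y * dl g x y).
  move: h1; rewrite powR_addr; [|lra|lra].
  lra.
Qed.

End Lipschitz.

(** * Passage to the limit in the second and third levels *)

Section Limits.
Context {R : realType} (T : R).
Hypothesis T0 : 0 < T.
Implicit Types (r s t u v a C D e : R) (f g h : R -> R) (psi x y X : R -> R -> R).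

Lemma HP_qcvg a (f_ : nat -> R -> R) f :
  qcvg (HP T a) f_ f -> qcvg (Hb T a) (fun n => dl (f_ n)) (dl f).
Proof. by move=> [b h]; split => // e /h[n0 k]; exists n0 => n /k; rewrite /HP dlB. Qed.

Lemma CP_qcvg a (f_ : nat -> R -> R) f :
  qcvg (CP T a) f_ f -> qcvg (Cb T a) (fun n => dl (f_ n)) (dl f).
Proof. by move=> [b h]; split => // e /h[n0 k]; exists n0 => n /k; rewrite /CP dlB. Qed.

Lemma CP_HP a (f_ : nat -> R -> R) f : qcvg (CP T a) f_ f -> qcvg (HP T a) f_ f.
Proof.
move=> [[C h] k]; split; first by exists C; exact: Cb_Hb.
by move=> e /k[n0 l]; exists n0 => n /l; exact: Cb_Hb.
Qed.

Lemma Cb_Hb_qcvg a (X_ : nat -> R -> R -> R) X : qcvg (Cb T a) X_ X -> qcvg (Hb T a) X_ X.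
Proof.
move=> [[C h] k]; split; first by exists C; exact: Cb_Hb.
by move=> e /k[n0 l]; exists n0 => n /l; exact: Cb_Hb.
Qed.

Lemma Hb_qcvg_ext a (X_ Y_ : nat -> R -> R -> R) X Y :
  (forall n s t, 0 <= s -> s <= t -> t <= T -> X_ n s t = Y_ n s t) ->
  (forall s t, 0 <= s -> s <= t -> t <= T -> X s t = Y s t) ->
  qcvg (Hb T a) X_ X -> qcvg (Hb T a) Y_ Y.
Proof.
move=> E E' [[C h] k]; split; first by exists C; exact: Hb_ext h.
move=> e /k[n0 l]; exists n0 => n /l; apply: Hb_ext => s t *.
by rewrite !fctE E // E'.
Qed.

Lemma Hb_qcvg_weaken a a' (X_ : nat -> R -> R -> R) X : 0 <= a' -> a' <= a ->
  qcvg (Hb T a) X_ X -> qcvg (Hb T a') X_ X.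
Proof.
move=> a0 aa; apply: (@qcvg_imp _ _ _ (Hb T a) (Hb T a') id (T `^ (a - a'))) => //.
- exact: Hb_qnorm.
- exact: powR_ge0.
- by move=> C x hx; rewrite mulrC; exact: Hb_weaken (ltW T0) hx.
Qed.

Lemma qcvg_pt a (X_ : nat -> R -> R -> R) X : qcvg (Hb T a) X_ X ->
  forall s t, 0 <= s -> s <= t -> t <= T -> (X_ n s t) @[n --> \oo] --> X s t.
Proof.
move=> [_ h] s t s0 st tT; apply/cvgrPdist_le => e e0.
have d0 : 0 < e / ((t - s) `^ a + 1) by rewrite divr_gt0 // ltr_wpDl // powR_ge0.
have [n0 k] := h _ d0; exists n0 => // n /= /k[_ /(_ s t s0 st tT)].
rewrite !fctE distrC => l; apply: le_trans l _.
rewrite mulrAC ler_pdivrMr ?ltr_wpDl ?powR_ge0 // ler_wpM2l ?(ltW e0) //.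
by rewrite lerDl.
Qed.

Lemma chen_lim a b c (X_ : nat -> R -> R -> R) X (f_ g_ : nat -> R -> R) f g :
  (forall n, chen_tens T (X_ n) (tens (dl (f_ n)) (dl (g_ n)))) ->
  qcvg (Hb T a) X_ X -> qcvg (HP T b) f_ f -> qcvg (HP T c) g_ g ->
  chen_tens T X (tens (dl f) (dl g)).
Proof.
move=> ch /qcvg_pt cX /HP_qcvg/qcvg_pt cf /HP_qcvg/qcvg_pt cg s u t s0 su ut tT.
have u0 := le_trans s0 su; have uT := le_trans ut tT; have st := le_trans su ut.
have h1 := cX s t s0 st tT; apply: cvg_unique h1 _ => //.
rewrite (_ : (fun n => X_ n s t) =
  (fun n => X_ n s u + X_ n u t + dl (f_ n) s u * dl (g_ n) u t)); last first.
  by apply/funext => n; rewrite (ch n s u t).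
apply: cvgD; first by apply: cvgD; [exact: cX|exact: cX].
by apply: cvgM; [exact: cf|exact: cg].
Qed.

Lemma second_base a (X_ : nat -> R -> R -> R) X (f_ g_ : nat -> R -> R) f g : 0 <= a ->
  (forall n, chen_tens T (X_ n) (tens (dl (f_ n)) (dl (g_ n)))) ->
  qcvg (Hb T (a + a)) X_ X -> qcvg (HP T a) f_ f -> qcvg (HP T a) g_ g ->
  qcvg (Bb T a a) (fun n s _ r => X_ n s r) (fun s _ r => X s r) /\
  qcvg (Bb T a a) (fun n _ t r => X_ n r t) (fun _ t r => X r t).
Proof.
move=> a0 ch cX cf cg; have ch' := chen_lim ch cX cf cg.
exact: base1_cvg a0 ch ch' cX (tens_cvg (HP_qcvg cf) (HP_qcvg cg)).
Qed.

Lemma lip_chen f g : lip T f -> lip T g -> chen_tens T (YI f g) (tens (dl f) (dl g)).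
Proof. by move=> lf lg; apply: YI_chen; have [] := lip_YI T0 lf lg. Qed.

Lemma Jok_lim a Phi_ Phi (g_ : nat -> R -> R) g : 0 <= a -> 2^-1 < a + a ->
  qcvg (Bb T a a) Phi_ Phi -> qcvg (CP T a) g_ g -> Jok T Phi g.
Proof. by move=> a0 aa [[C hC] _] [[D hD] _]; have [] := J_core a0 a0 a0 aa hC hD. Qed.

(** Besides the given limit B3 there are seven terms, each continuous in its integrand and its
    integrator; the integrands converge by the second-level results and Chen's relation. Six
    integrators are Cameron-Martin paths. In the remaining term the integrator is b and the control
    comes from the integrand U^2, hence the class [CBb]. *)
Lemma third_cvg a (b1 b2 b3 u1 u2 u3 : nat -> R -> R)
    (c1 c2 c3 v1 v2 v3 : R -> R)
    (B12 B23 B3 : R -> R -> R) : 4^-1 < a ->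
  (forall n, lip T (b1 n) /\ lip T (u1 n)) ->
  (forall n, lip T (b2 n) /\ lip T (u2 n)) ->
  (forall n, lip T (b3 n) /\ lip T (u3 n)) ->
  qcvg (HP T a) b1 c1 -> qcvg (HP T a) b2 c2 -> qcvg (HP T a) b3 c3 ->
  qcvg (CP T a) u1 v1 -> qcvg (CP T a) u2 v2 -> qcvg (CP T a) u3 v3 ->
  qcvg (Hb T (a + a)) (fun n => YI (b1 n) (b2 n)) B12 ->
  qcvg (Hb T (a + a)) (fun n => YI (b2 n) (b3 n)) B23 ->
  qcvg (Hb T (a + a + a)) (fun n => T3 (b1 n) (b2 n) (b3 n)) B3 ->
  [/\ Jok T (fun s _ r => YI v1 v2 s r) v3, Jok T (fun s _ r => YI v1 v2 s r) c3,
      Jok T (fun s _ r => YI v1 c2 s r) v3, Jok T (fun s _ r => YI c1 v2 s r) v3 &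
      [/\ Jok T (fun s t r => dl c1 s r * dl c3 r t) v2,
      Jok T (fun s _ r => B12 s r) v3, Jok T (fun _ t r => B23 r t) v1 &
  qcvg (Hb T (a + a + a))
    (fun n => T3 (b1 n + u1 n) (b2 n + u2 n) (b3 n + u3 n))
    (fun s t => B3 s t + T3 v1 v2 v3 s t + T3 v1 v2 c3 s t + T3 v1 c2 v3 s t
      + T3 c1 v2 v3 s t + J (fun s t r => dl c1 s r * dl c3 r t) v2 s t
      + J (fun s _ r => B12 s r) v3 s t + J (fun _ t r => B23 r t) v1 s t)]].
Proof.
move=> a4 l1 l2 l3 cb1 cb2 cb3 cu1 cu2 cu3 cB12 cB23 cB3.
have a0 : 0 <= a by lra.
have aa : 2^-1 < a + a by lra.
have hu1 := CP_HP cu1; have hu2 := CP_HP cu2; have hu3 := CP_HP cu3.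
have [Yuu _] := YI_cvg a0 a0 aa hu1 cu2.
have [Ybu _] := YI_cvg a0 a0 aa cb1 cu2.
have [_ Yub] := YI_cvg a0 a0 aa cb2 cu1.
have chuu n := lip_chen (l1 n).2 (l2 n).2.
have chub n := lip_chen (l1 n).2 (l2 n).1.
have chbu n := lip_chen (l1 n).1 (l2 n).2.
have [Suu _] := second_base a0 chuu (Cb_Hb_qcvg Yuu) hu1 hu2.
have [Sub _] := second_base a0 chub (Cb_Hb_qcvg Yub) hu1 cb2.
have [Sbu _] := second_base a0 chbu (Cb_Hb_qcvg Ybu) cb1 hu2.
have [S12 _] := second_base a0 (fun n => lip_chen (l1 n).1 (l2 n).1) cB12 cb1 cb2.
have [_ S23] := second_base a0 (fun n => lip_chen (l2 n).1 (l3 n).1) cB23 cb2 cb3.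
have Suu' : qcvg (CBb T a a) (fun n s _ r => YI (u1 n) (u2 n) s r) (fun s _ r => YI v1 v2 s r).
  apply: (base1_cvg' a0 chuu _ Yuu (tens_cvg' (HP_qcvg hu1) (CP_qcvg cu2))).
  exact: chen_lim chuu (Cb_Hb_qcvg Yuu) hu1 hu2.
have Sm : qcvg (Bb T a a) (fun n s t r => dl (b1 n) s r * dl (b3 n) r t)
    (fun s t r => dl c1 s r * dl c3 r t).
  exact: (base2_cvg a0 (fun n => @mid_rel_tens _ T (b1 n) (b3 n)) (@mid_rel_tens _ T c1 c3)
    (tens_cvg (HP_qcvg cb1) (HP_qcvg cb3))).
have okuuc : Jok T (fun s _ r => YI v1 v2 s r) c3.
  have [[C hC] _] := Suu'; have [[D hD] _] := cb3.
  by have [] := J_core' a0 a0 a0 aa hC hD.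
split; [exact: Jok_lim Suu cu3|exact: okuuc|exact: Jok_lim Sub cu3|exact: Jok_lim Sbu cu3|].
split; [exact: Jok_lim Sm cu2|exact: Jok_lim S12 cu3|exact: Jok_lim S23 cu1|].
have c_uuu := J_cvg a0 a0 a0 aa Suu cu3.
have c_uub := J_cvg' a0 a0 a0 aa Suu' cb3.
have c_ubu := J_cvg a0 a0 a0 aa Sub cu3.
have c_buu := J_cvg a0 a0 a0 aa Sbu cu3.
have c_bub := J_cvg a0 a0 a0 aa Sm cu2.
have c_bbu := J_cvg a0 a0 a0 aa S12 cu3.
have c_ubb := J_cvg a0 a0 a0 aa S23 cu1.
have qn := Hb_qnorm T (a + a + a).
have := qcvg_D qn (qcvg_D qn (qcvg_D qn (qcvg_D qn (qcvg_D qn (qcvg_D qn (qcvg_D qn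
  cB3 c_uuu) c_uub) c_ubu) c_buu) c_bub) c_bbu) c_ubb.
apply: Hb_qcvg_ext => [n s t s0 st tT|//].
have [lb1 lu1] := l1 n; have [lb2 lu2] := l2 n; have [lb3 lu3] := l3 n.
by rewrite (T3_expand T0 lb1 lu1 lb2 lu2 lb3 lu3 s0 st tT).
Qed.

Lemma second_cvg_aux (a h : R) (f_ g_ : nat -> R -> R) f g : 0 <= a -> 0 <= h ->
  2^-1 < a + h -> qcvg (HP T a) f_ f -> qcvg (CP T h) g_ g ->
  [/\ YIok T f g, YIok T g f,
    qcvg (Hb T (a + h)) (fun n => YI (f_ n) (g_ n)) (YI f g) &
    qcvg (Hb T (a + h)) (fun n => YI (g_ n) (f_ n)) (YI g f)].
Proof.
move=> a0 h0 ah cf cg; have [h1 h2] := YI_cvg a0 h0 ah cf cg.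
have [[C hC] _] := cf; have [[D hD] _] := cg.
have [ok1 ok2 _ _] := YI_core a0 h0 ah hC hD.
by split => //; exact: Cb_Hb_qcvg.
Qed.

Lemma second_cvg (a h : R) (b1 u1 b2 u2 : nat -> R -> R) (c1 v1 c2 v2 : R -> R) (X : R -> R -> R) :
  0 <= a -> 0 <= h -> 2^-1 < a + h ->
  (forall n, lip T (b1 n) /\ lip T (u1 n)) ->
  (forall n, lip T (b2 n) /\ lip T (u2 n)) ->
  qcvg (HP T a) b1 c1 -> qcvg (CP T a) u1 v1 ->
  qcvg (HP T h) b2 c2 -> qcvg (CP T h) u2 v2 ->
  qcvg (Hb T (a + h)) (fun n => YI (b1 n) (b2 n)) X ->
  [/\ YIok T c1 v2, YIok T v1 c2, YIok T v1 v2 &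
  qcvg (Hb T (a + h)) (fun n => YI (b1 n + u1 n) (b2 n + u2 n))
    (fun s t => X s t + YI c1 v2 s t + YI v1 c2 s t + YI v1 v2 s t)].
Proof.
move=> a0 h0 ah l1 l2 cb1 cu1 cb2 cu2 cX.
have [ok1 _ k1 _] := second_cvg_aux a0 h0 ah cb1 cu2.
have ha : 2^-1 < h + a by lra.
have [_ ok2 _ k2] := second_cvg_aux h0 a0 ha cb2 cu1.
have [ok3 _ k3 _] := second_cvg_aux a0 h0 ah (CP_HP cu1) cu2.
split => //; rewrite [h + a]addrC in k2.
have qn := Hb_qnorm T (a + h).
have := qcvg_D qn (qcvg_D qn (qcvg_D qn cX k1) k2) k3.
apply: Hb_qcvg_ext => [n s t s0 st tT|//].
have [lb1 lu1] := l1 n; have [lb2 lu2] := l2 n.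
rewrite (YI_Dl T0 lb1 lu1 (lipD lb2 lu2) s0 st tT) (YI_Dr T0 lb1 lb2 lu2 s0 st tT).
rewrite (YI_Dr T0 lu1 lb2 lu2 s0 st tT).
by rewrite !fctE; ring.
Qed.

End Limits.

(** * From Lipschitz to smooth paths *)

Section Smoothing.
Context {R : realType}.
Implicit Types (r s t u v a C D e : R) (f g : R -> R).

Lemma lipschitz_continuous f L : (forall s t, `|f t - f s| <= L * `|t - s|) ->
  continuous f.
Proof.
move=> fL t; apply/cvgrPdist_le => e e0.
have L0 : 0 <= `|L| by [].
have d0 : 0 < e / (`|L| + 1) by rewrite divr_gt0 // ltr_wpDl.
near=> s; apply: le_trans (fL _ _) _.
have : `|t - s| <= e / (`|L| + 1).
  by near: s; apply: cvgr_dist_le.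
rewrite ler_pdivlMr ?ltr_wpDl // => h.
have := ler_norm L; have := normr_ge0 (t - s); nra.
Unshelve. all: by end_near. Qed.

Lemma antiderivative f : continuous f -> (forall t, t <= 0 -> f t = 0) ->
  exists F, forall t, is_derive t (1 : R) F (f t).
Proof.
move=> cf f0.
(* Any negative base point would do: f vanishes on the negative half-line, so F is 0 near every t <
   0, and for t >= 0 the base point lies strictly to the left of t. *)
pose F t := (\int[lebesgue_measure]_(x in `[(-1)%R, t]) (f x))%R.
have F0 t : t <= 0 -> F t = 0.
  move=> t0; rewrite /F (@eq_Rintegral _ _ _ _ _ (cst 0)) ?Rintegral_cst //= ?mul0r //.
  by move=> x; rewrite inE /= in_itv /= => /andP[_ xt]; rewrite f0 // (le_trans xt).
exists F => t; have [t1|t1] := ltP t 0.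
  have d0 : is_derive t (1 : R) (cst 0 : R -> R) 0 by exact: is_derive_cst.
  have e : \forall x \near t, (cst 0 : R -> R) x = F x.
    by near=> x; rewrite F0 //; apply: ltW; near: x; exact: lt_nbhsl.
  rewrite f0 ?(ltW t1) //.
  exact: near_eq_is_derive e d0.
have [||||d e] := @continuous_FTC1_closed R f (-1) t (t + 1).
- by rewrite ltrDl.
- apply: continuous_compact_integrable; first exact: segment_compact.
  exact: continuous_subspaceT.
- by rewrite (lt_le_trans _ t1) // ltrN10.
- exact: cf.
by rewrite -e derive1E; apply: DeriveDef.
Unshelve. all: by end_near. Qed.

Lemma MVT_line g dg a b : (forall t, is_derive t (1 : R) g (dg t)) -> a < b ->
  exists2 c, a <= c <= b & g b - g a = dg c * (b - a).
Proof.
move=> gd ab.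
have h1 x : x \in `]a, b[%R -> is_derive x (1 : R) g (dg x) by move=> _; exact: gd.
have h2 : {within `[a, b], continuous g}.
  by apply: derivable_within_continuous => x _; exact: ex_derive.
have [c cab e] := MVT ab h1 h2.
by exists c => //; move: cab; rewrite in_itv /= => /andP[/ltW -> /ltW ->].
Qed.

(** A minimum is at most the geometric mean of x and y^4 with weights 3/4 and 1/4. *)
Lemma min_interp (x y : R) : 0 <= x -> 0 <= y ->
  Num.min x (y ^+ 4) <= x `^ (3 / 4) * y.
Proof.
move=> x0 y0.
have key (z : R) : 0 <= z -> (z ^+ 4) `^ (3 / 4) = z ^+ 3.
  move=> z0; rewrite -powR_mulrn // -powRrM -powR_mulrn //; congr (_ `^ _); by field.
have [z z0 xz] : exists2 z : R, 0 <= z & x = z ^+ 4.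
  exists (x `^ 4^-1); first exact: powR_ge0.
  by rewrite -powR_mulrn ?powR_ge0 // -powRrM mulVf ?powRr1 // pnatr_eq0.
rewrite xz key //; have [zy|yz] := leP z y.
  rewrite ge_min; apply/orP; left; rewrite exprSr ler_wpM2l // exprn_ge0 //.
rewrite ge_min; apply/orP; right; rewrite exprSr ler_wpM2r // lerXn2r ?nnegrE //.
exact: ltW.
Qed.

Variable T : R.
Hypothesis T0 : 0 < T.

Lemma Hb_Cb h C psi : 0 <= h -> Hb T (h + 2^-1) C psi -> Cb T h (C * Num.sqrt T) psi.
Proof.
move=> h0 [C0 H]; split; first by rewrite mulr_ge0 ?sqrtr_ge0.
exists (fun s t => (t - s) / T); split.
- split; first by move=> u v *; rewrite divr_ge0 ?subr_ge0 // ltW.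
  move=> u m v *; rewrite -mulrDl.
  by have -> : m - u + (v - m) = v - u by ring.
- by rewrite subr0 divff // gt_eqF.
- move=> s t s0 st tT; apply: le_trans (H s t s0 st tT) _.
  have ts0 : 0 <= t - s by rewrite subr_ge0.
  rewrite powR_addr // /cbound powR12_sqrt // sqrtrM // (sqrtrV (ltW T0)).
  have hT : Num.sqrt T != 0 by rewrite gt_eqF // sqrtr_gt0.
  rewrite le_eqVlt; apply/orP; left; apply/eqP; by field.
Qed.

Definition smooth0 f :=
  [/\ f 0 = 0, forall t, derivable f t 1 & continuous (derive1 f)].

(** Moving averages of a Lipschitz path are C^1. The increments of the error are at most 2 L (t - s)
    and at most 2 L times the window length; interpolating these bounds gives a small 3/4-Hoelder
    norm. As 3/4 = 1/4 + 1/2, the surplus 1/2 becomes the length control of the class [CP] with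
    exponent 1/4. *)
Lemma smooth_approx f : lip T f -> exists f_ : nat -> R -> R,
  [/\ forall n, smooth0 (f_ n), forall n, lip T (f_ n),
      qcvg (HP T (3/4)) f_ f & qcvg (CP T 4^-1) f_ f].
Proof.
move=> [L [L0 fL]].
(* Clamping extends the path to the whole line with the same Lipschitz constant, and [g] then
   vanishes on the negative half-line as [antiderivative] requires. *)
pose c (t : R) := Num.max 0 (Num.min t T).
have c0 t : 0 <= c t by rewrite le_max lexx.
have cT t : c t <= T by rewrite ge_max ge_min lexx orbT (ltW T0).
have cE t : 0 <= t -> t <= T -> c t = t.
  by move=> t0 tT; rewrite /c min_l // max_r.
have cL s t : s <= t -> 0 <= c t - c s <= t - s.
  by move=> st; rewrite /c /Num.max /Num.min; do !case: ifP; lra.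
pose g t := f (c t) - f 0.
have gL' s t : s <= t -> `|g t - g s| <= L * (t - s).
  move=> st; have /andP[h1 h2] := cL s t st.
  have -> : g t - g s = dl f (c s) (c t) by rewrite /g /dl; ring.
  apply: le_trans (fL _ _ (c0 s) _ (cT t)) _; first by rewrite -subr_ge0.
  by rewrite powRr1 // ler_wpM2l.
have gL s t : `|g t - g s| <= L * `|t - s|.
  have [st|ts] := leP s t; first by rewrite (@ger0_norm _ (t - s)) ?subr_ge0 // gL'.
  by rewrite distrC (distrC t) (@ger0_norm _ (s - t)) ?subr_ge0 ?gL' // ltW.
have gc := lipschitz_continuous gL.
have g0 t : t <= 0 -> g t = 0.
  move=> t0; rewrite /g /c max_l ?subrr // ge_min t0 //.
have [F dF] := antiderivative gc g0.
pose y n : R := n.+1%:R^-1.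
have y0 n : 0 < y n by rewrite invr_gt0 ltr0n.
(* A fourth power, so that [min_interp] leaves exactly one factor [y n]. *)
pose eta n := y n ^+ 4.
have eta0 n : 0 < eta n by rewrite exprn_gt0.
pose f_ n t := (F (t + eta n) - F t) / eta n - (F (eta n) - F 0) / eta n.
pose df n t := (g (t + eta n) - g t) / eta n.
have fd n t : is_derive t (1 : R) (f_ n) (df n t).
  have d1 : is_derive t (1 : R) (fun x => F (x + eta n)) (g (t + eta n)).
    have := @is_derive1_comp _ F (fun x => x + eta n) t _ 1 (dF (t + eta n)).
    by rewrite mulr1; apply; apply: is_derive_eq; rewrite ?addr0.
  have d2 : is_derive t (1 : R) (fun x => F (x + eta n) - F x) (g (t + eta n) - g t).
    exact: is_deriveB.
  have d3 := is_deriveZ (eta n)^-1 d2.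
  have -> : f_ n = (fun x => (eta n)^-1 *: (F (x + eta n) - F x)) -
      cst ((F (eta n) - F 0) / eta n).
    by apply/funext => x; rewrite /f_ !fctE /GRing.scale /= mulrC.
  have d4 : is_derive t (1 : R) (cst ((F (eta n) - F 0) / eta n) : R -> R) 0.
    exact: is_derive_cst.
  apply: is_derive_eq (is_deriveB d3 d4) _.
  by rewrite subr0 /GRing.scale /= mulrC.
have dfL n t : `|df n t| <= L.
  rewrite /df normrM normfV (gtr0_norm (eta0 n)) ler_pdivrMr //.
  have -> : L * eta n = L * (t + eta n - t) by ring.
  by apply: gL'; rewrite lerDl ltW.
have fl n s t : s <= t -> `|f_ n t - f_ n s| <= L * (t - s).
  rewrite le_eqVlt => /predU1P[->|st]; first by rewrite !subrr normr0 mulr0.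
  have [x _ ->] := MVT_line (fd n) st.
  rewrite normrM (@gtr0_norm _ (t - s)) ?subr_gt0 // ler_wpM2r //.
  by rewrite subr_ge0 ltW.
(* The averages are shifted to start at 0 and f need not start at 0. This constant undoes both
   shifts and disappears in increments. *)
pose k n := f 0 + (F (eta n) - F 0) / eta n.
have close n t : 0 <= t -> t <= T -> `|f_ n t - f t + k n| <= L * eta n.
  move=> t0 tT; have [|x /andP[x1 x2] e] := @MVT_line F g t (t + eta n) dF.
    by rewrite ltrDl.
  have -> : f_ n t - f t + k n = g x - g t.
    have -> : g t = f t - f 0 by rewrite /g (cE t t0 tT).
    by rewrite /f_ e /k; field; exact: lt0r_neq0.
  apply: le_trans (gL' _ _ x1) _; rewrite ler_wpM2l // lerBlDr addrC //.
have bnd n : Hb T (3/4) (2 * L * y n) (dl (f_ n - f)).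
  split; first by rewrite !mulr_ge0 // ltW.
  move=> s t s0 st tT.
  have h1 : `|dl (f_ n - f) s t| <= 2 * L * (t - s).
    rewrite dlB !fctE; apply: le_trans (ler_normB _ _) _.
    have := fl n s t st; have := fL s t s0 st tT; rewrite powRr1 ?subr_ge0 //.
    rewrite /dl; lra.
  have h2 : `|dl (f_ n - f) s t| <= 2 * L * eta n.
    have -> : dl (f_ n - f) s t = (f_ n t - f t + k n) - (f_ n s - f s + k n).
      by rewrite /dl !fctE; ring.
    apply: le_trans (ler_normB _ _) _.
    have := close n t (le_trans s0 st) tT; have := close n s s0 (le_trans st tT); lra.
  apply: (@le_trans _ _ (2 * L * Num.min (t - s) (eta n))).
    by rewrite minr_pMr ?le_min ?h1 ?h2 // mulr_ge0.
  have ts0 : 0 <= t - s by rewrite subr_ge0.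
  have m := min_interp ts0 (ltW (y0 n)); have l2 : 0 <= 2 * L by rewrite mulr_ge0.
  apply: le_trans (ler_wpM2l l2 m) _.
  by have -> : 2 * L * ((t - s) `^ (3 / 4) * y n) = 2 * L * y n * (t - s) `^ (3 / 4) by ring.
have yto e : 0 < e -> exists n0, forall n, (n0 <= n)%N -> y n <= e.
  move=> e0; exists (Num.bound e^-1) => n hn.
  rewrite /y -[leRHS]invrK lef_pV2 ?posrE ?invr_gt0 ?ltr0n //.
  have := archi_boundP (ltW (_ : 0 < e^-1)); rewrite invr_gt0 => /(_ e0) /ltW h.
  by apply: le_trans h _; rewrite ler_nat ltnW.
exists f_; split.
- move=> n; split; first by rewrite /f_ add0r subrr.
    by move=> t; exact: ex_derive.
  have -> : derive1 (f_ n) = df n.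
    by apply/funext => t; rewrite derive1E; exact: derive_val.
  have dfc : forall s t, `|df n t - df n s| <= (2 * L / eta n) * `|t - s|.
    move=> s t.
    have -> : df n t - df n s = ((g (t + eta n) - g (s + eta n)) - (g t - g s)) / eta n.
      by rewrite /df; ring.
    rewrite normrM normfV (gtr0_norm (eta0 n)) mulrAC ler_wpM2r ?invr_ge0 ?(ltW (eta0 n)) //.
    apply: le_trans (ler_normB _ _) _.
    have := gL (s + eta n) (t + eta n); have := gL s t.
    have -> : t + eta n - (s + eta n) = t - s by ring.
    lra.
  exact: lipschitz_continuous dfc.
- move=> n; exists L; split => // s t s0 st tT; rewrite powRr1 ?subr_ge0 //.
  exact: fl.
- split; first by have := @lip_HP R T T0 f (3/4); apply; [lra|lra|exists L; split].
  move=> e e0; have e1 : 0 < e / (2 * L + 1) by rewrite divr_gt0 // ltr_wpDl // mulr_ge0.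
  have [n0 h] := yto _ e1; exists n0 => n /h hn; apply: Hb_mono (bnd n).
  move: hn; rewrite ler_pdivlMr ?ltr_wpDl ?mulr_ge0 // => hn.
  have := ltW (y0 n); nra.
- split.
    have [C hC] : exists C, HP T (4^-1 + 2^-1) C f.
      by apply: (lip_HP T0); [lra|lra|exists L; split].
    by eexists; apply: Hb_Cb hC.
  move=> e e0; have e1 : 0 < e / ((2 * L + 1) * (Num.sqrt T + 1)).
    by rewrite divr_gt0 // mulr_gt0 // ltr_wpDl ?mulr_ge0 ?sqrtr_ge0.
  have [n0 h] := yto _ e1; exists n0 => n /h hn.
  have := bnd n; have -> : (3 / 4 : R) = 4^-1 + 2^-1 by field.
  move=> /Hb_Cb; have q0 : 0 <= 4^-1 :> R by rewrite invr_ge0.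
  move=> /(_ q0); apply: Cb_mono.
  move: hn; rewrite ler_pdivlMr; last by rewrite mulr_gt0 // ltr_wpDl ?mulr_ge0 ?sqrtr_ge0.
  apply: le_trans; have ys := ltW (y0 n); have ss := sqrtr_ge0 T.
  rewrite [2 * L * _]mulrC -mulrA ler_wpM2l //.
  by have := mulr_ge0 L0 ss; nra.
Qed.

End Smoothing.

(** * The Hoelder norm compared with its coordinates *)

Section HolderNorm.
Context {R : realType} (T : R).
Implicit Types (s t eta C e : R).

Lemma tnorm_le (I : finType) (a : I -> R) : tnorm a <= \sum_i `|a i|.
Proof.
have S0 : 0 <= \sum_i `|a i| by exact: sumr_ge0.
rewrite /tnorm -(ger0_norm S0) -sqrtr_sqr ler_wsqrtr // expr2 mulr_suml.
apply: ler_sum => i _; rewrite -real_normK ?num_real // expr2 ler_wpM2l //.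
by rewrite (bigD1 i) //= lerDl sumr_ge0.
Qed.

Lemma tnorm_ge (I : finType) (a : I -> R) i : `|a i| <= tnorm a.
Proof.
rewrite -sqrtr_sqr ler_wsqrtr // (bigD1 i) //= lerDl.
by apply: sumr_ge0 => j _; exact: sqr_ge0.
Qed.

Lemma hnorm_le (I : finType) eta C (psi : two_param R I) : 0 <= C ->
  (forall i, Hb T eta C (fun s t => psi s t i)) ->
  (hnorm T eta psi <= (#|I|%:R * C)%:E)%E.
Proof.
move=> C0 H; apply: ge_ereal_sup => _ [[s t] /= [s0 st tT] <-]; rewrite lee_fin.
have p0 : 0 < (t - s) `^ eta by rewrite powR_gt0 // subr_gt0.
rewrite ler_pdivrMr //; apply: le_trans (tnorm_le _) _.
apply: (@le_trans _ _ (\sum_(i : I) C * (t - s) `^ eta)).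
  by apply: ler_sum => i _; have [_] := H i; apply => //; exact: ltW.
by rewrite sumr_const mulr_natl -mulrnAl.
Qed.

Lemma hnorm_lt (I : finType) eta C (psi : two_param R I) :
  (hnorm T eta psi < C%:E)%E ->
  forall i s t, 0 <= s -> s < t -> t <= T -> `|psi s t i| <= C * (t - s) `^ eta.
Proof.
move=> H i s t s0 st tT; have p0 : 0 < (t - s) `^ eta by rewrite powR_gt0 // subr_gt0.
apply: le_trans (tnorm_ge _ i) _; rewrite -ler_pdivrMr // -lee_fin.
apply: le_trans (ltW H); apply: ereal_sup_ubound; by exists (s, t).
Qed.

End HolderNorm.

(** * The third level of the extension *)

Section Extension.
Context {R : realType} (T : R).
Hypothesis T0 : 0 < T.
Implicit Types (r s t u v a b c C D e : R) (f g h : R -> R) (p : seq R).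
Implicit Types (x y z A B psi : R -> R -> R).

(** The summand of [ext_sum] with s frozen. Its defect at m involves only the increments over [u,m]
    and [m,v] and no longer s, which is what makes it fit for sewing. *)
Definition ext_germ x A B z s u v := x s u * A u v + B s u * z u v.

Definition ext_lim x A B z s t := lim (psum (ext_germ x A B z s) s @ mesh0 s t).

Lemma ext_germ_defect x y z A B s u m v :
  chen_rel 0 T x (fun _ _ _ => 0) -> chen_rel 0 T z (fun _ _ _ => 0) ->
  chen_tens T A (tens y z) -> chen_tens T B (tens x y) ->
  0 <= s -> s <= u -> u <= m -> m <= v -> v <= T ->
  ext_germ x A B z s u v - ext_germ x A B z s u m - ext_germ x A B z s m v =
    - (x u m * A m v + B u m * z m v).
Proof.
move=> cx cz cA cB s0 su um mv vT; have u0 := le_trans s0 su.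
have mT := le_trans mv vT.
rewrite /ext_germ (cA u m v) // (cB s u m) // (cx s u m) // (cz u m v) // /tens; ring.
Qed.

Lemma superadd_length : superadd 0 T (fun s t : R => t - s).
Proof. by split=> *; [rewrite subr_ge0|lra]. Qed.

(** Ordinary Hoelder defects enter the sewing results with the length as control: half a power of t
    - s moves under the square root. *)
Lemma cbound_length a C s t : 2^-1 <= a -> s <= t ->
  cbound (fun s t : R => t - s) (a - 2^-1) C s t = C * (t - s) `^ a.
Proof.
move=> a2 st; rewrite /cbound -mulrA -powR12_sqrt ?subr_ge0 //.
by rewrite -powR_addr ?subr_ge0 ?invr_ge0 // subrK.
Qed.

(** Stated for a difference so that it serves twice: with a zero germ it gives the existence of the
    extension, with two germs its continuity in the two lower levels. *)
Lemma germ_diff_defect a b c C x y z A B x' y' z' A' B' s :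
  chen_rel 0 T x (fun _ _ _ => 0) -> chen_rel 0 T z (fun _ _ _ => 0) ->
  chen_tens T A (tens y z) -> chen_tens T B (tens x y) ->
  chen_rel 0 T x' (fun _ _ _ => 0) -> chen_rel 0 T z' (fun _ _ _ => 0) ->
  chen_tens T A' (tens y' z') -> chen_tens T B' (tens x' y') ->
  0 <= a -> 0 <= b -> 0 <= c -> 1 < a + b + c ->
  N4 T a (b + c) C (tens x' A' - tens x A) ->
  N4 T (a + b) c C (tens B' z' - tens B z) -> 0 <= s ->
  germ s T (fun s t => t - s) (a + b + c - 2^-1) (2 * C)
   (fun u v => ext_germ x' A' B' z' s u v - ext_germ x A B z s u v).
Proof.
move=> cx cz cA cB cx' cz' cA' cB' a0 b0 c0 abc [C0 h1] [_ h2] s0 u m v su um mv vT.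
have u0 := le_trans s0 su; have m0 := le_trans u0 um; have mT := le_trans mv vT.
rewrite cbound_length; [|lra|exact: le_trans mv].
have -> : ext_germ x' A' B' z' s u v - ext_germ x A B z s u v -
   (ext_germ x' A' B' z' s u m - ext_germ x A B z s u m) -
   (ext_germ x' A' B' z' s m v - ext_germ x A B z s m v) =
   - ((tens x' A' - tens x A) u m m v + (tens B' z' - tens B z) u m m v).
  have e1 := ext_germ_defect cx cz cA cB s0 su um mv vT.
  have e2 := ext_germ_defect cx' cz' cA' cB' s0 su um mv vT.
  rewrite !fctE /tens; move: e1 e2.
  by set A1 := ext_germ _ _ _ _ _ _ _; lra.
rewrite normrN; apply: le_trans (ler_normD _ _) _.
have k1 := h1 u m m v u0 um mT m0 mv vT; have k2 := h2 u m m v u0 um mT m0 mv vT.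
have p (q : R) : 0 <= q -> (m - u) `^ q <= (v - u) `^ q /\ (v - m) `^ q <= (v - u) `^ q.
  by move=> q0; rewrite !ge0_ler_powR ?nnegrE ?subr_ge0 ?lerB // (le_trans um).
have bc0 := addr_ge0 b0 c0; have ab0 := addr_ge0 a0 b0.
have l1 : (m - u) `^ a * (v - m) `^ (b + c) <= (v - u) `^ (a + b + c).
  rewrite -addrA (powR_addr _ a0 bc0) ler_pM ?powR_ge0 //; first by case: (p a a0).
  by case: (p _ bc0).
have l2 : (m - u) `^ (a + b) * (v - m) `^ c <= (v - u) `^ (a + b + c).
  rewrite (powR_addr _ ab0 c0) ler_pM ?powR_ge0 //; first by case: (p _ ab0).
  by case: (p c c0).
have := ler_wpM2l C0 l1; have := ler_wpM2l C0 l2; lra.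
Qed.

Lemma ext_germ_diag a C x A B z s t : 0 < a -> Hb T a C x -> (exists2 b, 0 < b & exists D, Hb T b D B) ->
  0 <= s -> s <= T -> ext_germ x A B z s s t = 0.
Proof.
move=> a0 [_ hx] [b b0 [D [_ hB]]] s0 sT.
have := hx s s s0 (lexx _) sT; have := hB s s s0 (lexx _) sT.
rewrite subrr !powR0 ?gt_eqF // !mulr0 !normr_le0 => /eqP eB /eqP ex.
by rewrite /ext_germ ex eB !mul0r addr0.
Qed.

Lemma ext_cvg a b c C C1 D1 x y z A B : 0 < a -> 0 < b -> 0 < c -> 1 < a + b + c ->
  chen_rel 0 T x (fun _ _ _ => 0) -> chen_rel 0 T z (fun _ _ _ => 0) ->
  chen_tens T A (tens y z) -> chen_tens T B (tens x y) ->
  Hb T a C1 x -> Hb T (a + b) D1 B ->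
  N4 T a (b + c) C (tens x A) -> N4 T (a + b) c C (tens B z) ->
  (forall s t, 0 <= s -> s <= t -> t <= T ->
    psum (ext_germ x A B z s) s @ mesh0 s t --> ext_lim x A B z s t) /\
  exists K, Hb T (a + b + c) K (ext_lim x A B z).
Proof.
move=> a0 b0 c0 abc cx cz cA cB hx hB h1 h2; have [C0 _] := h1.
have gm s : 0 <= s -> germ s T (fun s t => t - s) (a + b + c - 2^-1) (2 * C)
   (ext_germ x A B z s).
  move=> s0.
  have zr : chen_rel 0 T (fun _ _ => 0) (fun _ _ _ => 0) by move=> ? ? ? *; rewrite !addr0.
  have zt : chen_tens T (fun _ _ => 0) (tens (fun _ _ => 0) (fun _ _ => 0)).
    by move=> ? ? ? *; rewrite /tens mul0r !addr0.
  have k1 : N4 T a (b + c) C (tens x A - tens (fun _ _ => 0) (fun _ _ => 0)).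
    by move: h1; congr N4; do 4 apply/funext => ?; rewrite !fctE /tens mul0r subr0.
  have k2 : N4 T (a + b) c C (tens B z - tens (fun _ _ => 0) (fun _ _ => 0)).
    by move: h2; congr N4; do 4 apply/funext => ?; rewrite !fctE /tens mul0r subr0.
  have := germ_diff_defect zr zr zt zt cx cz cA cB (ltW a0) (ltW b0) (ltW c0) abc k1 k2 s0.
  move=> k u m v su um mv vT; have := k u m v su um mv vT.
  by rewrite /ext_germ !mul0r !addr0 !subr0.
have a2 : 2^-1 < a + b + c - 2^-1 by lra.
have C20 : 0 <= 2 * C by rewrite mulr_ge0.
have sw s : 0 <= s -> superadd s T (fun s t : R => t - s).
  by move=> s0; exact: superadd_sub s0 (lexx _) superadd_length.
have cv s t : 0 <= s -> s <= t -> t <= T ->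
    psum (ext_germ x A B z s) s @ mesh0 s t --> ext_lim x A B z s t.
  move=> s0 st tT; exact: germ_cvg a2 C20 (sw s s0) (gm s s0) (lexx _) st tT.
split => //; exists (sewC (a + b + c - 2^-1) * (2 * C)); split.
  by rewrite mulr_ge0 // sewC_ge0.
move=> s t s0 st tT; rewrite -(subr0 (ext_lim _ _ _ _ _ _)).
apply: (lim_norm_le (mesh0_proper st) (cv s t s0 st tT)).
exists 1 => //= p [pp _]; rewrite /= subr0.
have := sewing_control a2 C20 (sw s s0) (gm s s0) (lexx _) tT pp.
have ab0 : 0 < a + b by rewrite addr_gt0.
rewrite (ext_germ_diag _ _ _ a0 hx) ?subr0 //; last exact: le_trans tT.
  by rewrite cbound_length ?mulrA //; lra.
by exists (a + b) => //; exists D1.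
Qed.

(** Chen's relation iterated along p. A third level thus differs from the extension sum only by the
    sum of its own values over the cells, which is negligible for an exponent above 1. *)
Lemma psum_third X3 x A B z s r t p :
  chen_rel 0 T X3 (fun s u t => x s u * A u t + B s u * z u t) ->
  0 <= s -> s <= r -> t <= T -> itv_partition r t p -> X3 s s = 0 ->
  X3 s t = X3 s r + psum X3 r p + psum (ext_germ x A B z s) r p.
Proof.
move=> c3 s0 + tT; elim: p r => [|q p IH] r sr /=.
  by move=> /itv_partition_nil -> _; rewrite !addr0.
move=> /itvp_cons[rq qp] X0; have qt := itvp_le qp.
rewrite (IH q _ qp X0) ?(le_trans sr (ltW rq)) //.
by rewrite (c3 s r q) ?(ltW rq) ?(le_trans qt) // /ext_germ; ring.
Qed.

(* A third level with the right Chen relation and more than Lipschitz decay is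
   the extension of its two lower levels. *)
Lemma ext_dist a b c C C1 D1 C1' D1' E q x y z A B x' y' z' A' B' X3 :
  0 < a -> 0 < b -> 0 < c -> 1 < a + b + c ->
  chen_rel 0 T x (fun _ _ _ => 0) -> chen_rel 0 T z (fun _ _ _ => 0) ->
  chen_tens T A (tens y z) -> chen_tens T B (tens x y) ->
  chen_rel 0 T x' (fun _ _ _ => 0) -> chen_rel 0 T z' (fun _ _ _ => 0) ->
  chen_tens T A' (tens y' z') -> chen_tens T B' (tens x' y') ->
  Hb T a C1 x -> Hb T (a + b) D1 B -> Hb T a C1' x' -> Hb T (a + b) D1' B' ->
  (forall s t, 0 <= s -> s <= t -> t <= T ->
    psum (ext_germ x A B z s) s @ mesh0 s t --> ext_lim x A B z s t) ->
  N4 T a (b + c) C (tens x' A' - tens x A) ->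
  N4 T (a + b) c C (tens B' z' - tens B z) ->
  1 < q -> Hb T q E X3 ->
  chen_rel 0 T X3 (fun s u t => x' s u * A' u t + B' s u * z' u t) ->
  Hb T (a + b + c) (sewC (a + b + c - 2^-1) * (2 * C)) (X3 - ext_lim x A B z).
Proof.
move=> a0 b0 c0 abc cx cz cA cB cx' cz' cA' cB' hx hB hx' hB' cv h1 h2 q1 h3 c3.
have [C0 _] := h1; have [E0 hE] := h3.
have a2 : 2^-1 < a + b + c - 2^-1 by lra.
have C20 : 0 <= 2 * C by rewrite mulr_ge0.
split; first by rewrite mulr_ge0 // sewC_ge0.
move=> s t s0 st tT; rewrite !fctE; apply/ler_addgt0Pr => e e0.
have e2 : 0 < e / 2 by rewrite divr_gt0.
have q2 : 2^-1 < q - 2^-1 by lra.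
have sT := le_trans st tT.
have [d1 d10 k1] := mesh_small E (t - s + (t - s)) q2 e2.
have [d2 d20 k2] := cvg_near_lt (@filter_filter _ _ (mesh0_proper st)) (cv s t s0 st tT) e2.
have d0 : 0 < Num.min d1 d2 by rewrite lt_min d10 d20.
have [p pp pm] := itvp_mesh st d0.
have pm1 : path (fun u v => v - u < d1) s p.
  by apply: sub_path pm => ? ?; rewrite lt_min => /andP[].
have pm2 : path (fun u v => v - u < d2) s p.
  by apply: sub_path pm => ? ?; rewrite lt_min => /andP[].
have {k2}l2 : `|psum (ext_germ x A B z s) s p - ext_lim x A B z s t| < e / 2.
  by apply: k2; split => //; rewrite mesh_ltP.
have X0 : X3 s s = 0.
  have := hE s s s0 (lexx _) sT; rewrite subrr powR0 ?mulr0 ?normr_le0; last by lra.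
  by move/eqP.
have l1 : `|psum X3 s p| <= e / 2.
  apply: le_trans (ler_norm_psum _ _ _) _; apply: le_trans (ltW k1).
  apply: le_trans (psum_cbound_mesh (ltW q2) E0 superadd_length s0 tT d10 pp pm1).
  apply: psum_le s0 tT pp _ => u v u0 uv vT.
  rewrite cbound_length ?(ltW uv) //; last by lra.
  exact: hE u0 (ltW uv) vT.
have gm := germ_diff_defect cx cz cA cB cx' cz' cA' cB' (ltW a0) (ltW b0) (ltW c0) abc h1 h2 s0.
have := sewing_control a2 C20 (superadd_sub s0 (lexx _) superadd_length) gm (lexx _) tT pp.
have ab0 : 0 < a + b by rewrite addr_gt0.
rewrite (ext_germ_diag _ _ _ a0 hx) //; last by exists (a + b) => //; exists D1.
rewrite (ext_germ_diag _ _ _ a0 hx') //; last by exists (a + b) => //; exists D1'.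
rewrite -psumB !subr0 cbound_length ?mulrA //; last by lra.
rewrite (psum_third c3 s0 (lexx _) tT pp X0) X0 add0r.
move=> l3.
have -> : psum X3 s p + psum (ext_germ x' A' B' z' s) s p - ext_lim x A B z s t =
  psum X3 s p + (psum (ext_germ x' A' B' z' s) s p - psum (ext_germ x A B z s) s p)
  + (psum (ext_germ x A B z s) s p - ext_lim x A B z s t) by ring.
apply: le_trans (ler_normD _ _) _.
apply: le_trans (lerD (ler_normD _ _) (lexx _)) _; lra.
Qed.

Lemma dl_chen f : chen_rel 0 T (dl f) (fun _ _ _ => 0).
Proof. by move=> *; rewrite /dl; ring. Qed.

Lemma lip_T3_chen f g h : lip T f -> lip T g -> lip T h ->
  chen_rel 0 T (T3 f g h) (fun s u t => dl f s u * YI g h u t + YI f g s u * dl h u t).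
Proof.
move=> lf lg lh; have ok := T3_ok T0 lf lg lh.
have [okfg _] := lip_YI T0 lf lg; have [okgh _] := lip_YI T0 lg lh.
exact: J1_chen (YI_chen okfg) ok okgh.
Qed.

(** The third iterated integral of Lipschitz paths has exponent 3/4 + 3/4 + 1/2 = 2, so [ext_dist]
    applies to it and measures its distance to the extension of the limits by the distances of the
    lower levels alone. No convergence of a third level is assumed. *)
Lemma ext_qcvg a b c (f_ g_ h_ : nat -> R -> R) f g h (A B : R -> R -> R) :
  0 < a -> 0 < b -> 0 < c -> a <= 3 / 4 -> b <= 3 / 4 -> 1 < a + b + c ->
  (forall n, [/\ lip T (f_ n), lip T (g_ n) & lip T (h_ n)]) ->
  qcvg (HP T a) f_ f -> qcvg (HP T b) g_ g -> qcvg (HP T c) h_ h ->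
  qcvg (Hb T (b + c)) (fun n => YI (g_ n) (h_ n)) A ->
  qcvg (Hb T (a + b)) (fun n => YI (f_ n) (g_ n)) B ->
  (forall s t, 0 <= s -> s <= t -> t <= T ->
    psum (ext_germ (dl f) A B (dl h) s) s @ mesh0 s t -->
      ext_lim (dl f) A B (dl h) s t) /\
  qcvg (Hb T (a + b + c)) (fun n => T3 (f_ n) (g_ n) (h_ n)) (ext_lim (dl f) A B (dl h)).
Proof.
move=> a0 b0 c0 a34 b34 abc l cf cg ch cA cB.
have chA : chen_tens T A (tens (dl g) (dl h)).
  by apply: (chen_lim (X_ := fun n => YI (g_ n) (h_ n)) _ cA cg ch) => n; have [] := l n => *; exact: lip_chen.
have chB : chen_tens T B (tens (dl f) (dl g)).
  by apply: (chen_lim (X_ := fun n => YI (f_ n) (g_ n)) _ cB cf cg) => n; have [] := l n => *; exact: lip_chen.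
have tA := tens_cvg (HP_qcvg cf) cA; have tB := tens_cvg cB (HP_qcvg ch).
have [[D1 hB] _] := cB; have [[C1 hf] _] := cf.
have [[M1 hM1] tA'] := tA; have [[M2 hM2] tB'] := tB.
have [m1 _] := hM1; have [m2 _] := hM2.
have M1' : N4 T a (b + c) (M1 + M2) (tens (dl f) A).
  by have [_ m _] := N4_qnorm T a (b + c); apply: m hM1; lra.
have M2' : N4 T (a + b) c (M1 + M2) (tens B (dl h)).
  by have [_ m _] := N4_qnorm T (a + b) c; apply: m hM2; lra.
have [cv bd] := ext_cvg a0 b0 c0 abc (@dl_chen f) (@dl_chen h) chA chB hf hB M1' M2'.
split => //; split => // e e0.
set K := sewC (a + b + c - 2^-1); have K0 : 0 <= K by rewrite sewC_ge0 //; lra.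
have e1 : 0 < e / (2 * (K + 1)) by rewrite divr_gt0 // mulr_gt0 // ltr_wpDl.
have [n1 k1] := tA' _ e1; have [n2 k2] := tB' _ e1.
exists (maxn n1 n2) => n; rewrite geq_max => /andP[/k1 l1 /k2 l2].
have [lf lg lh] := l n.
have [C2 hf2] : exists C, HP T a C (f_ n) by apply: (lip_HP T0 _ _ lf); lra.
have [C3 hB2] : exists C, Hb T (a + b) C (YI (f_ n) (g_ n)).
  by have [_ [C3 h3]] := lip_YI T0 lf lg; eexists; apply: (Hb_weaken _ _ (ltW T0) h3); lra.
have [_ [C4 h4]] := lip_J T0 (lip_Bb1 T0 lf lg) lh.
have q1 : 1 < 3 / 4 + 3 / 4 + 2^-1 :> R by lra.
have := ext_dist a0 b0 c0 abc (@dl_chen f) (@dl_chen h) chA chB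
  (@dl_chen (f_ n)) (@dl_chen (h_ n)) (lip_chen T0 lg lh) (lip_chen T0 lf lg)
  hf hB hf2 hB2 cv l1 l2 q1 h4 (lip_T3_chen lf lg lh).
apply: Hb_mono; rewrite -/K.
have -> : K * (2 * (e / (2 * (K + 1)))) = e * (K / (K + 1)).
  by field; rewrite gt_eqF // ltr_wpDl.
rewrite ler_piMr ?(ltW e0) // ler_pdivrMr ?ltr_wpDl //; lra.
Qed.

End Extension.

(** * Limits of Lipschitz lifts are geometric rough paths *)

Section FiniteFamilies.
Context {R : realType} (T : R).
Hypothesis T0 : 0 < T.
Implicit Types (s t u v a C D e eta kappa : R) (psi x A : R -> R -> R).

Lemma eventually_all (I : finType) (P : I -> nat -> Prop) :
  (forall i, exists n0, forall n, (n0 <= n)%N -> P i n) ->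
  exists n0, forall n, (n0 <= n)%N -> forall i, P i n.
Proof.
move=> /choice[N hN]; exists (\max_i N i)%N => n hn i; apply: hN.
exact: leq_trans (leq_bigmax i) hn.
Qed.

Lemma Hb_family (I : finType) eta (psi : two_param R I) :
  (forall i, exists C, Hb T eta C (fun s t => psi s t i)) ->
  exists2 C, 0 <= C & forall i, Hb T eta C (fun s t => psi s t i).
Proof.
move=> /choice[C hC]; exists (\sum_i C i).
  by apply: sumr_ge0 => i _; have [] := hC i.
move=> i; apply: Hb_mono (hC i); rewrite (bigD1 i) //= lerDl.
by apply: sumr_ge0 => j _; have [] := hC j.
Qed.

Lemma hnorm_fin (I : finType) eta (psi : two_param R I) :
  (forall i, exists C, Hb T eta C (fun s t => psi s t i)) ->
  (hnorm T eta psi < +oo)%E.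
Proof.
move=> /Hb_family[C C0 hC]; apply: le_lt_trans (hnorm_le C0 hC) _; exact: ltry.
Qed.

Lemma hnorm_approx (I : finType) eta (psi_ : nat -> two_param R I)
    (psi : two_param R I) (phi_ : nat -> nat -> two_param R I) e : 0 < e ->
  (forall i, qcvg (Hb T eta) (fun n s t => psi_ n s t i) (fun s t => psi s t i)) ->
  (forall n i, qcvg (Hb T eta) (fun m s t => phi_ n m s t i) (fun s t => psi_ n s t i)) ->
  exists n0, forall n, (n0 <= n)%N -> exists m0, forall m, (m0 <= m)%N ->
    (hnorm T eta (phi_ n m - psi)%R <= e%:E)%E.
Proof.
move=> e0 h1 h2; pose e1 := e / (4 * (#|I|%:R + 1)).
have c1 : 0 < #|I|%:R + 1 :> R by rewrite ltr_wpDl.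
have e10 : 0 < e1 by rewrite divr_gt0 // mulr_gt0.
have [|n0 hn] := @eventually_all I (fun i n =>
    Hb T eta e1 (fun s t => psi_ n s t i - psi s t i)).
  by move=> i; have [_ /(_ _ e10)[n0 k]] := h1 i; exists n0.
exists n0 => n /hn H.
have [|m0 hm] := @eventually_all I (fun i m =>
    Hb T eta e1 (fun s t => phi_ n m s t i - psi_ n s t i)).
  by move=> i; have [_ /(_ _ e10)[m0 k]] := h2 n i; exists m0.
exists m0 => m /hm H'.
have e40 : 0 <= 2 * (e1 + e1) by rewrite mulr_ge0 // addr_ge0 // ltW.
apply: (@le_trans _ _ (#|I|%:R * (2 * (e1 + e1)))%:E).
  apply: (hnorm_le e40) => i; have := HbD (H' i) (H i).
  by apply: Hb_ext => s t _ _ _; rewrite !fctE; ring.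
rewrite lee_fin /e1.
have -> : #|I|%:R * (2 * (e / (4 * (#|I|%:R + 1)) + e / (4 * (#|I|%:R + 1)))) =
   e * (#|I|%:R / (#|I|%:R + 1)) by field; rewrite gt_eqF.
rewrite ler_piMr ?(ltW e0) // ler_pdivrMr //; lra.
Qed.

(** Chen's relation makes psi Hoelder in each variable, uniformly in the other. Two points of the
    simplex are joined through (s',t) or (s,t'), whichever is known to lie in the simplex. *)
Lemma continuous_two_chen kappa b C D psi (rem : R -> R -> R -> R) :
  0 < kappa -> kappa <= b -> chen_rel 0 T psi rem -> Hb T b C psi -> 0 <= D ->
  (forall s u t, 0 <= s -> s <= u -> u <= t -> t <= T ->
    `|rem s u t| <= D * (u - s) `^ kappa * (t - u) `^ kappa) ->
  {within [set st : R * R | [/\ 0 <= st.1, st.1 <= st.2 & st.2 <= T]],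
    continuous (fun st : R * R => psi st.1 st.2)}.
Proof.
move=> k0 kb ch hC D0 hD.
have [C0 hC'] := Hb_weaken (ltW k0) kb (ltW T0) hC.
pose M := C * T `^ (b - kappa) + D * T `^ kappa.
have M0 : 0 <= M by rewrite addr_ge0 // mulr_ge0 ?powR_ge0.
have pT (p q : R) : 0 <= p -> p <= q -> q <= T -> (q - p) `^ kappa <= T `^ kappa.
  move=> p0 pq qT; rewrite ge0_ler_powR ?nnegrE ?(ltW k0) ?subr_ge0 ?(ltW T0) //.
  by rewrite (le_trans _ qT) // lerBlDr lerDl.
have right_ s u t : 0 <= s -> s <= u -> u <= t -> t <= T ->
    `|psi s t - psi s u| <= M * (t - u) `^ kappa.
  move=> s0 su ut tT; have -> : psi s t - psi s u = psi u t + rem s u t.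
    by rewrite (ch s u t) //; ring.
  have h1 := hC' u t (le_trans s0 su) ut tT; have h2 := hD s u t s0 su ut tT.
  apply: le_trans (ler_normD _ _) _; rewrite /M.
  have := ler_wpM2r (powR_ge0 (t - u) kappa) (ler_wpM2l D0 (pT s u s0 su (le_trans ut tT))).
  lra.
have left_ s u t : 0 <= s -> s <= u -> u <= t -> t <= T ->
    `|psi s t - psi u t| <= M * (u - s) `^ kappa.
  move=> s0 su ut tT; have -> : psi s t - psi u t = psi s u + rem s u t.
    by rewrite (ch s u t) //; ring.
  have h1 := hC' s u s0 su (le_trans ut tT); have h2 := hD s u t s0 su ut tT.
  apply: le_trans (ler_normD _ _) _; rewrite /M.
  have := ler_wpM2l (powR_ge0 (u - s) kappa) (ler_wpM2l D0 (pT u t (le_trans s0 su) ut tT)).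
  lra.
have right_' s t t' : 0 <= s -> s <= t -> s <= t' -> t <= T -> t' <= T ->
    `|psi s t - psi s t'| <= M * `|t - t'| `^ kappa.
  move=> s0 st st' tT tT'; have [tt|tt] := leP t t'.
    rewrite distrC (distrC t) (@ger0_norm _ (t' - t)) ?subr_ge0 //.
    exact: right_.
  by rewrite (@ger0_norm _ (t - t')) ?subr_ge0 ?(ltW tt) //; apply: right_ => //; exact: ltW.
have left_' s s' t : 0 <= s -> 0 <= s' -> s <= t -> s' <= t -> t <= T ->
    `|psi s t - psi s' t| <= M * `|s - s'| `^ kappa.
  move=> s0 s0' st st' tT; have [ss|ss] := leP s s'.
    by rewrite (distrC s) (@ger0_norm _ (s' - s)) ?subr_ge0 //; exact: left_.
  rewrite distrC (@ger0_norm _ (s - s')) ?subr_ge0 ?(ltW ss) //.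
  by apply: left_ => //; exact: ltW.
apply/subspace_continuousP => -[s t] /= [s0 st tT].
apply/cvgrPdist_le => e e0; rewrite /= near_withinE.
pose d := (e / (2 * (M + 1))) `^ kappa^-1.
have M1 : 0 < 2 * (M + 1) by rewrite mulr_gt0 // ltr_wpDl.
have d0 : 0 < d by rewrite powR_gt0 // divr_gt0.
have dk : d `^ kappa = e / (2 * (M + 1)).
  by rewrite -powRrM mulVf ?gt_eqF // powRr1 // divr_ge0 ?(ltW e0) ?(ltW M1).
have small (q : R) : `|q| < d -> M * `|q| `^ kappa <= e / 2.
  move=> xd; have : `|q| `^ kappa <= e / (2 * (M + 1)).
    by rewrite -dk ge0_ler_powR ?nnegrE ?(ltW k0) ?(ltW xd) ?(ltW d0).
  move=> /(ler_wpM2l M0) h; apply: le_trans h _.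
  have -> : M * (e / (2 * (M + 1))) = e / 2 * (M / (M + 1)).
    by field; rewrite gt_eqF // ltr_wpDl.
  rewrite ler_piMr ?divr_ge0 ?(ltW e0) // ler_pdivrMr ?ltr_wpDl //; lra.
apply/nbhs_ballP; exists d => // -[s' t'] [/= bs bt] [/= s0' st' tT'].
rewrite -ball_normE /= in bs; rewrite -ball_normE /= in bt.
have ks := small _ bs; have kt := small _ bt.
have [s't|ts'] := leP s' t.
  have h1 := left_' s s' t s0 s0' st s't tT.
  have h2 := right_' s' t t' s0' s't st' tT tT'.
  have -> : psi s t - psi s' t' = (psi s t - psi s' t) + (psi s' t - psi s' t') by ring.
  apply: le_trans (ler_normD _ _) _; lra.
have st2 := le_trans st (le_trans (ltW ts') st').
have h1 := right_' s t t' s0 st st2 tT tT'.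
have h2 := left_' s s' t' s0 s0' st2 st' tT'.
have -> : psi s t - psi s' t' = (psi s t - psi s t') + (psi s t' - psi s' t') by ring.
apply: le_trans (ler_normD _ _) _; lra.
Qed.

Lemma chen_rel_lim a (X_ : nat -> R -> R -> R) X (rem_ : nat -> R -> R -> R -> R) rem :
  (forall n, chen_rel 0 T (X_ n) (rem_ n)) -> qcvg (Hb T a) X_ X ->
  (forall s u t, 0 <= s -> s <= u -> u <= t -> t <= T ->
    rem_ n s u t @[n --> \oo] --> rem s u t) ->
  chen_rel 0 T X rem.
Proof.
move=> ch /qcvg_pt cX cr s u t s0 su ut tT.
have u0 := le_trans s0 su; have uT := le_trans ut tT; have st := le_trans su ut.
have h1 := cX s t s0 st tT; apply: cvg_unique h1 _ => //.
rewrite (_ : (fun n => X_ n s t) =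
  (fun n => X_ n s u + X_ n u t + rem_ n s u t)); last first.
  by apply/funext => n; rewrite (ch n s u t).
by apply: cvgD; [apply: cvgD; exact: cX|exact: cr].
Qed.

(** Exponent 3/4 at the first level and 1 at the others is enough, as the exponents of the distances
    used below are at most 1/2 and 1 respectively. *)
Lemma smooth_seq (K : finType) (z : path_in R K) : (forall i, lip T (z^~ i)) ->
  exists x_ : nat -> path_in R K,
  [/\ forall m, is_C1_0 (x_ m),
      forall i, qcvg (Hb T (3/4)) (fun m => dl ((x_ m)^~ i)) (dl (z^~ i)),
      forall i j, qcvg (Hb T 1) (fun m => YI ((x_ m)^~ i) ((x_ m)^~ j))
         (YI (z^~ i) (z^~ j)) &
      forall i j k, qcvg (Hb T 1) (fun m => T3 ((x_ m)^~ i) ((x_ m)^~ j) ((x_ m)^~ k))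
         (T3 (z^~ i) (z^~ j) (z^~ k))].
Proof.
move=> lz; have /choice[f_ hf] := fun i => smooth_approx T0 (lz i).
exists (fun m t i => f_ i m t).
have hH i : qcvg (HP T (3/4)) (f_ i) (z^~ i) by have [] := hf i.
have hC i : qcvg (CP T 4^-1) (f_ i) (z^~ i) by have [] := hf i.
have hl i n : lip T (f_ i n) by have [] := hf i.
have Y1 i j : qcvg (Hb T 1) (fun m => YI (f_ i m) (f_ j m)) (YI (z^~ i) (z^~ j)).
  have [|||_ _ h _] := second_cvg_aux _ _ _ (hH i) (hC j); [lra|lra|lra|].
  by have -> : 1 = 3 / 4 + 4^-1 :> R by field.
split.
- by move=> m i; have [h _ _ _] := hf i; exact: h.
- by move=> i; exact: HP_qcvg.
- exact: Y1.
- move=> i j k.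
  have h2 l : qcvg (HP T 2^-1) (f_ l) (z^~ l).
    apply: (@qcvg_imp _ _ _ (HP T (3/4)) (HP T 2^-1) id (T `^ (3/4 - 2^-1)) _ _ _ _ _ _ (hH l)) => //.
    - exact: HP_qnorm.
    - exact: powR_ge0.
    - by move=> C x hx; rewrite mulrC; apply: Hb_weaken (ltW T0) hx; lra.
  have e1 : 1 = 2^-1 + 2^-1 :> R by field.
  have Y2 := Y1 i j; rewrite [X in Hb T X]e1 in Y2.
  have p0 : 0 <= 2^-1 :> R by lra.
  have [B _] := second_base p0 (fun n => lip_chen T0 (hl i n) (hl j n)) Y2 (h2 i) (h2 j).
  have q0 : 0 <= 4^-1 :> R by lra.
  have q1 : 2^-1 < 2^-1 + 4^-1 :> R by lra.
  by apply: (Hb_qcvg_weaken T0 _ _ (J_cvg p0 p0 q0 q1 B (hC k))); lra.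
Qed.

Lemma prod_bound kappa a b x A : 0 <= kappa -> kappa <= a -> kappa <= b ->
  (exists C, Hb T a C x) -> (exists C, Hb T b C A) ->
  exists2 D, 0 <= D & forall s u t, 0 <= s -> s <= u -> u <= t -> t <= T ->
    `|x s u * A u t| <= D * (u - s) `^ kappa * (t - u) `^ kappa.
Proof.
move=> k0 ka kb [C /(Hb_weaken k0 ka (ltW T0))[C0 hC]] [D /(Hb_weaken k0 kb (ltW T0))[D0 hD]].
exists (C * T `^ (a - kappa) * (D * T `^ (b - kappa))); first exact: mulr_ge0.
move=> s u t s0 su ut tT; rewrite normrM.
apply: le_trans (ler_pM _ _ (hC s u s0 su (le_trans ut tT)) (hD u t (le_trans s0 su) ut tT)) _ => //.
by rewrite le_eqVlt; apply/orP; left; apply/eqP; ring.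
Qed.

Lemma prod_pt a b (x_ A_ : nat -> R -> R -> R) x A :
  qcvg (Hb T a) x_ x -> qcvg (Hb T b) A_ A ->
  forall s u t, 0 <= s -> s <= u -> u <= t -> t <= T ->
    (x_ n s u * A_ n u t) @[n --> \oo] --> x s u * A u t.
Proof.
move=> cx cA s u t s0 su ut tT.
apply: cvgM; first exact: (qcvg_pt cx s0 su (le_trans ut tT)).
exact: (qcvg_pt cA (le_trans s0 su) ut tT).
Qed.

Definition cont_simplex psi :=
  {within [set st : R * R | [/\ 0 <= st.1, st.1 <= st.2 & st.2 <= T]],
    continuous (fun st : R * R => psi st.1 st.2)}.

Lemma lev1_ok kappa a (f_ : nat -> R -> R) x : 0 < kappa -> kappa <= a ->
  qcvg (Hb T a) (fun n => dl (f_ n)) x ->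
  chen_rel 0 T x (fun _ _ _ => 0) /\ cont_simplex x.
Proof.
move=> k0 ka cx; have ch : chen_rel 0 T x (fun _ _ _ => 0).
  apply: (chen_rel_lim _ cx) => [n|s u t *]; [exact: dl_chen|exact: cvg_cst].
split => //; have [[C hC] _] := cx.
apply: (continuous_two_chen k0 ka ch hC (lexx 0)) => *.
by rewrite normr0 !mul0r.
Qed.

Lemma lev2_ok kappa a b (f_ g_ : nat -> R -> R) x y A : 0 < kappa ->
  kappa <= a -> kappa <= b -> (forall n, lip T (f_ n) /\ lip T (g_ n)) ->
  qcvg (Hb T a) (fun n => dl (f_ n)) x -> qcvg (Hb T b) (fun n => dl (g_ n)) y ->
  qcvg (Hb T (a + b)) (fun n => YI (f_ n) (g_ n)) A ->
  chen_tens T A (tens x y) /\ cont_simplex A.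
Proof.
move=> k0 ka kb l cx cy cA; have ch : chen_tens T A (tens x y).
  apply: (chen_rel_lim _ cA); last exact: prod_pt cx cy.
  by move=> n; have [lf lg] := l n; exact: lip_chen.
split => //; have [[C hC] _] := cA; have [xC _] := cx; have [yC _] := cy.
have [D D0 hD] := prod_bound (ltW k0) ka kb xC yC.
by apply: (continuous_two_chen k0 _ ch hC D0 hD); rewrite ler_wpDr // (le_trans (ltW k0)).
Qed.

Lemma lev3_ok kappa a b c (f_ g_ h_ : nat -> R -> R) x z A B Z : 0 < kappa ->
  kappa <= a -> kappa <= b -> kappa <= c ->
  (forall n, [/\ lip T (f_ n), lip T (g_ n) & lip T (h_ n)]) ->
  qcvg (Hb T a) (fun n => dl (f_ n)) x -> qcvg (Hb T c) (fun n => dl (h_ n)) z ->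
  qcvg (Hb T (b + c)) (fun n => YI (g_ n) (h_ n)) A ->
  qcvg (Hb T (a + b)) (fun n => YI (f_ n) (g_ n)) B ->
  qcvg (Hb T (a + b + c)) (fun n => T3 (f_ n) (g_ n) (h_ n)) Z ->
  chen_rel 0 T Z (fun s u t => x s u * A u t + B s u * z u t) /\ cont_simplex Z.
Proof.
move=> k0 ka kb kc l cx cz cA cB cZ.
have ch : chen_rel 0 T Z (fun s u t => x s u * A u t + B s u * z u t).
  apply: (chen_rel_lim _ cZ); first by move=> n; have [lf lg lh] := l n; exact: lip_T3_chen.
  move=> s u t s0 su ut tT; apply: cvgD; first exact: (prod_pt cx cA).
  exact: (prod_pt cB cz).
split => //; have [[C hC] _] := cZ; have [xC _] := cx; have [zC _] := cz.
have [AC _] := cA; have [BC _] := cB.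
have kbc : kappa <= b + c by rewrite ler_wpDr // (le_trans (ltW k0)).
have kab : kappa <= a + b by rewrite ler_wpDr // (le_trans (ltW k0)).
have [D D0 hD] := prod_bound (ltW k0) ka kbc xC AC.
have [E E0 hE] := prod_bound (ltW k0) kab kc BC zC.
apply: (@continuous_two_chen _ _ _ (D + E) _ _ k0 _ ch hC); last 2 first.
- exact: addr_ge0.
- move=> s u t s0 su ut tT; apply: le_trans (ler_normD _ _) _.
  apply: le_trans (lerD (hD s u t s0 su ut tT) (hE s u t s0 su ut tT)) _.
  by rewrite !mulrDl.
- by rewrite ler_wpDr // (le_trans (ltW k0)).
Qed.

Lemma geometric_of_cvg (I : finType) a (z : nat -> path_in R I) (X : rough3 R I) :
  0 < a -> a + a + a <= 1 -> (forall n i, lip T ((z n)^~ i)) ->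
  (forall i, qcvg (Hb T a) (fun n => dl ((z n)^~ i)) (fun s t => lev1 X s t i)) ->
  (forall i j, qcvg (Hb T (a + a)) (fun n => YI ((z n)^~ i) ((z n)^~ j))
     (fun s t => lev2 X s t (i, j))) ->
  (forall i j k, qcvg (Hb T (a + a + a))
     (fun n => T3 ((z n)^~ i) ((z n)^~ j) ((z n)^~ k))
     (fun s t => lev3 X s t (i, j, k))) ->
  geometric_rough_path T a X.
Proof.
move=> a0 a1 lz c1 c2 c3.
have e2 : 2 * a = a + a by ring.
have e3 : 3 * a = a + a + a by ring.
have l1 i := lev1_ok a0 (lexx a) (c1 i).
have l2 i j := lev2_ok a0 (lexx a) (lexx a) (fun n => conj (lz n i) (lz n j)) (c1 i) (c1 j) (c2 i j).
have l3 i j k := lev3_ok a0 (lexx a) (lexx a) (lexx a)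
  (fun n => And3 (lz n i) (lz n j) (lz n k)) (c1 i) (c1 k) (c2 j k) (c2 i j) (c3 i j k).
split.
  split; split.
  - by move=> i; exact: (l1 i).2.
  - by move=> [i j]; exact: (l2 i j).2.
  - by move=> [[i j] k]; exact: (l3 i j k).2.
  - by apply: hnorm_fin => i; exact: (c1 i).1.
  - by rewrite e2; apply: hnorm_fin => -[i j]; exact: (c2 i j).1.
  - by rewrite e3; apply: hnorm_fin => -[[i j] k]; exact: (c3 i j k).1.
  - by move=> s u t i s0 su ut tT; rewrite ((l1 i).1 s u t) // addr0.
  - by move=> s u t i j s0 su ut tT; rewrite ((l2 i j).1 s u t).
  - by move=> s u t i j k s0 su ut tT; rewrite ((l3 i j k).1 s u t) // addrA.
move=> e e0; have e4 : 0 < e / 4 by rewrite divr_gt0.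
have /choice[x_ hx] := fun n => smooth_seq (lz n).
have d1 : forall n i, qcvg (Hb T a) (fun m s t => incr (x_ n m) s t i)
    (fun s t => incr (z n) s t i).
  move=> n i; have [_ h _ _] := hx n; apply: (Hb_qcvg_weaken T0 _ _ (h i)); lra.
have d2 : forall n ij, qcvg (Hb T (a + a)) (fun m s t => lev2 (S3 (x_ n m)) s t ij)
    (fun s t => lev2 (S3 (z n)) s t ij).
  move=> n [i j]; have [_ _ h _] := hx n; apply: (Hb_qcvg_weaken T0 _ _ (h i j)); lra.
have d3 : forall n ijk, qcvg (Hb T (a + a + a)) (fun m s t => lev3 (S3 (x_ n m)) s t ijk)
    (fun s t => lev3 (S3 (z n)) s t ijk).
  move=> n [[i j] k]; have [_ _ _ h] := hx n; apply: (Hb_qcvg_weaken T0 _ _ (h i j k)); lra.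
have c2' : forall ij, qcvg (Hb T (a + a)) (fun n s t => lev2 (S3 (z n)) s t ij)
    (fun s t => lev2 X s t ij) by move=> [i j]; exact (c2 i j).
have c3' : forall ijk, qcvg (Hb T (a + a + a)) (fun n s t => lev3 (S3 (z n)) s t ijk)
    (fun s t => lev3 X s t ijk) by move=> [[i j] k]; exact (c3 i j k).
have [n1 h1] := hnorm_approx e4 c1 d1.
have [n2 h2] := hnorm_approx e4 c2' d2.
have [n3 h3] := hnorm_approx e4 c3' d3.
pose n := maxn n1 (maxn n2 n3).
have [|m1 k1] := h1 n _; first by rewrite leq_max leqnn.
have [|m2 k2] := h2 n _; first by rewrite !leq_max leqnn orbT.
have [|m3 k3] := h3 n _; first by rewrite !leq_max leqnn !orbT.
pose m := maxn m1 (maxn m2 m3).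
exists (x_ n m); first by have [h _ _ _] := hx n; exact: h.
have j1 := k1 m _; have j2 := k2 m _; have j3 := k3 m _.
apply: (@le_lt_trans _ _ ((e / 4)%:E + (e / 4)%:E + (e / 4)%:E)%E).
  rewrite /rho e2 e3; apply: leeD; first apply: leeD.
  - by apply: j1; rewrite leq_max leqnn.
  - by apply: j2; rewrite !leq_max leqnn orbT.
  - by apply: j3; rewrite !leq_max leqnn !orbT.
by rewrite -!EFinD lte_fin; lra.
Qed.

End FiniteFamilies.

(** * Translation of geometric rough paths *)

Section Deterministic.
Context {R : realType} (T : R).
Hypothesis T0 : 0 < T.
Implicit Types (s t u v : R).

Definition roughness {I J : Type} (alpha gamma : R) (k : I + J) : R :=
  if k is inl _ then alpha else gamma.

Lemma geometric_aniso_of_cvg (I J : finType) alpha gamma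
    (z : nat -> path_in R (I + J)) (X : aniso R I J) :
  0 < alpha -> alpha <= gamma -> gamma <= 2^-1 -> alpha + alpha + alpha <= 1 ->
  (forall n i, lip T ((z n)^~ i)) ->
  (forall k, qcvg (Hb T (roughness alpha gamma k)) (fun n => dl ((z n)^~ k))
     (fun s t => Xi1 X s t k)) ->
  (forall k l, qcvg (Hb T (roughness alpha gamma k + roughness alpha gamma l))
     (fun n => YI ((z n)^~ k) ((z n)^~ l)) (fun s t => Xi2 X s t (k, l))) ->
  (forall i j k, qcvg (Hb T (alpha + alpha + alpha))
     (fun n => T3 ((z n)^~ (inl i)) ((z n)^~ (inl j)) ((z n)^~ (inl k)))
     (fun s t => Xi3 X s t (i, j, k))) ->
  geometric_aniso T alpha gamma X.
Proof.
move=> a0 ag g2 a3 lz c1 c2 c3.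
have ka (k : I + J) : alpha <= roughness alpha gamma k by case: k.
have kg (k : I + J) : roughness alpha gamma k <= 2^-1.
  by case: k => //= _; exact: le_trans g2.
have k0 (k : I + J) : 0 <= roughness alpha gamma k by exact: le_trans (ltW a0) (ka k).
have e2 : 2 * alpha = alpha + alpha by ring.
have e2' : 2 * gamma = gamma + gamma by ring.
have e3 : 3 * alpha = alpha + alpha + alpha by ring.
have l1 i := lev1_ok T0 a0 (ka i) (c1 i).
have l2 i j := lev2_ok T0 a0 (ka i) (ka j) (fun n => conj (lz n i) (lz n j)) (c1 i) (c1 j) (c2 i j).
have l3 i j k := lev3_ok T0 a0 (lexx alpha) (lexx alpha) (lexx alpha)
  (fun n => And3 (lz n (inl i)) (lz n (inl j)) (lz n (inl k)))
  (c1 (inl i)) (c1 (inl k)) (c2 (inl j) (inl k)) (c2 (inl i) (inl j)) (c3 i j k).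
split.
  split; split.
  - by move=> i; exact: (l1 i).2.
  - by move=> [i j]; exact: (l2 i j).2.
  - by move=> [[i j] k]; exact: (l3 i j k).2.
  - by apply: hnorm_fin => i; exact: (c1 (inl i)).1.
  - by rewrite e2; apply: hnorm_fin => -[i j]; exact: (c2 (inl i) (inl j)).1.
  - by rewrite e3; apply: hnorm_fin => -[[i j] k]; exact: (c3 i j k).1.
  - by apply: hnorm_fin => i; exact: (c1 (inr i)).1.
  - by rewrite e2'; apply: hnorm_fin => -[i j]; exact: (c2 (inr i) (inr j)).1.
  - by apply: hnorm_fin => -[i j]; exact: (c2 (inl i) (inr j)).1.
  - by apply: hnorm_fin => -[i j]; rewrite addrC; exact: (c2 (inr i) (inl j)).1.
  - by move=> s u t i s0 su ut tT; rewrite ((l1 i).1 s u t) // addr0.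
  - by move=> s u t i j s0 su ut tT; rewrite ((l2 i j).1 s u t).
  - by move=> s u t i j k s0 su ut tT; rewrite ((l3 i j k).1 s u t) // addrA.
move=> e e0; have e8 : 0 < e / 8 by rewrite divr_gt0.
have /choice[x_ hx] := fun n => smooth_seq T0 (lz n).
have d1 k : forall n, qcvg (Hb T (roughness alpha gamma k))
    (fun m s t => incr (x_ n m) s t k) (fun s t => incr (z n) s t k).
  move=> n; have [_ h _ _] := hx n; apply: (Hb_qcvg_weaken T0 _ _ (h k)) => //.
  by apply: le_trans (kg k) _; lra.
have d2 k l : forall n, qcvg (Hb T (roughness alpha gamma k + roughness alpha gamma l))
    (fun m s t => iint (x_ n m) (x_ n m) s t (k, l)) (fun s t => iint (z n) (z n) s t (k, l)).
  move=> n; have [_ _ h _] := hx n; apply: (Hb_qcvg_weaken T0 _ _ (h k l)).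
    by rewrite addr_ge0.
  by have := kg k; have := kg l; lra.
have d3 i j k : forall n, qcvg (Hb T (alpha + alpha + alpha))
    (fun m s t => Xi3 (aniso_lift (x_ n m)) s t (i, j, k))
    (fun s t => Xi3 (aniso_lift (z n)) s t (i, j, k)).
  move=> n; have [_ _ _ h] := hx n.
  by apply: (Hb_qcvg_weaken T0 _ _ (h (inl i) (inl j) (inl k))) => //; lra.
pose L n := aniso_lift (z n); pose M n m := aniso_lift (x_ n m).
have [n1 h1] := @hnorm_approx _ _ _ alpha (fun n => block1 (Xi1 (L n))) (block1 (Xi1 X))
  (fun n m => block1 (Xi1 (M n m))) _ e8 (fun i => c1 (inl i)) (fun n i => d1 (inl i) n).
have b11 : forall ij, qcvg (Hb T (alpha + alpha)) (fun n s t => block11 (Xi2 (L n)) s t ij)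
   (fun s t => block11 (Xi2 X) s t ij) by move=> [i j]; exact (c2 (inl i) (inl j)).
have b11' : forall n ij, qcvg (Hb T (alpha + alpha)) (fun m s t => block11 (Xi2 (M n m)) s t ij)
   (fun s t => block11 (Xi2 (L n)) s t ij) by move=> n [i j]; exact (d2 (inl i) (inl j) n).
have [n2 h2] := hnorm_approx e8 b11 b11'.
have b3 : forall ijk, qcvg (Hb T (alpha + alpha + alpha)) (fun n s t => Xi3 (L n) s t ijk)
   (fun s t => Xi3 X s t ijk) by move=> [[i j] k]; exact (c3 i j k).
have b3' : forall n ijk, qcvg (Hb T (alpha + alpha + alpha)) (fun m s t => Xi3 (M n m) s t ijk)
   (fun s t => Xi3 (L n) s t ijk) by move=> n [[i j] k]; exact (d3 i j k n).
have [n3 h3] := hnorm_approx e8 b3 b3'.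
have [n4 h4] := @hnorm_approx _ _ _ gamma (fun n => block2 (Xi1 (L n))) (block2 (Xi1 X))
  (fun n m => block2 (Xi1 (M n m))) _ e8 (fun i => c1 (inr i)) (fun n i => d1 (inr i) n).
have b22 : forall ij, qcvg (Hb T (gamma + gamma)) (fun n s t => block22 (Xi2 (L n)) s t ij)
   (fun s t => block22 (Xi2 X) s t ij) by move=> [i j]; exact (c2 (inr i) (inr j)).
have b22' : forall n ij, qcvg (Hb T (gamma + gamma)) (fun m s t => block22 (Xi2 (M n m)) s t ij)
   (fun s t => block22 (Xi2 (L n)) s t ij) by move=> n [i j]; exact (d2 (inr i) (inr j) n).
have [n5 h5] := hnorm_approx e8 b22 b22'.
have b12 : forall ij, qcvg (Hb T (alpha + gamma)) (fun n s t => block12 (Xi2 (L n)) s t ij)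
   (fun s t => block12 (Xi2 X) s t ij) by move=> [i j]; exact (c2 (inl i) (inr j)).
have b12' : forall n ij, qcvg (Hb T (alpha + gamma)) (fun m s t => block12 (Xi2 (M n m)) s t ij)
   (fun s t => block12 (Xi2 (L n)) s t ij) by move=> n [i j]; exact (d2 (inl i) (inr j) n).
have [n6 h6] := hnorm_approx e8 b12 b12'.
have b21 : forall ij, qcvg (Hb T (alpha + gamma)) (fun n s t => block21 (Xi2 (L n)) s t ij)
   (fun s t => block21 (Xi2 X) s t ij).
  by rewrite addrC => -[i j]; exact (c2 (inr i) (inl j)).
have b21' : forall n ij, qcvg (Hb T (alpha + gamma)) (fun m s t => block21 (Xi2 (M n m)) s t ij)
   (fun s t => block21 (Xi2 (L n)) s t ij).
  by rewrite addrC => n [i j]; exact (d2 (inr i) (inl j) n).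
have [n7 h7] := hnorm_approx e8 b21 b21'.
pose n := (n1 + n2 + n3 + n4 + n5 + n6 + n7)%N.
have [|m1 k1] := h1 n _; first by rewrite /n; clear; lia.
have [|m2 k2] := h2 n _; first by rewrite /n; clear; lia.
have [|m3 k3] := h3 n _; first by rewrite /n; clear; lia.
have [|m4 k4] := h4 n _; first by rewrite /n; clear; lia.
have [|m5 k5] := h5 n _; first by rewrite /n; clear; lia.
have [|m6 k6] := h6 n _; first by rewrite /n; clear; lia.
have [|m7 k7] := h7 n _; first by rewrite /n; clear; lia.
pose m := (m1 + m2 + m3 + m4 + m5 + m6 + m7)%N.
exists (x_ n m); first by have [h _ _ _] := hx n; exact: h.
pose E := (e / 8)%:E.
apply: (@le_lt_trans _ _ (E + E + E + E + E + E + E)%E).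
  rewrite /aniso_dist e2 e2' e3; do 6 try apply: leeD.
  - by apply: k1; rewrite /m; clear; lia.
  - by apply: k2; rewrite /m; clear; lia.
  - by apply: k3; rewrite /m; clear; lia.
  - by apply: k4; rewrite /m; clear; lia.
  - by apply: k5; rewrite /m; clear; lia.
  - by apply: k6; rewrite /m; clear; lia.
  - by apply: k7; rewrite /m; clear; lia.
by rewrite -!EFinD lte_fin; lra.
Qed.

Lemma tens_diag_cvg a a' (x_ y_ : nat -> R -> R -> R) x y : 0 <= a -> 0 <= a' ->
  qcvg (Hb T a) x_ x -> qcvg (Hb T a') y_ y ->
  qcvg (Hb T (a + a')) (fun n s t => x_ n s t * y_ n s t) (fun s t => x s t * y s t).
Proof.
move=> a0 a0' cx cy; have := tens_cvg cx cy.
pose F (xi : R -> R -> R -> R -> R) s t := xi s t s t.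
apply: (@qcvg_imp _ _ _ (N4 T a a') (Hb T (a + a')) F 1) => //.
- exact: Hb_qnorm.
- move=> C xi [C0 h]; split; first by rewrite mul1r.
  by move=> s t s0 st tT; rewrite mul1r powR_addr // mulrA /F; exact: h.
Qed.

Section Translation.
Variables (I J : finType) (alpha gamma : R).
Hypothesis a4 : 1 / 4 < alpha.
Hypothesis a3 : alpha < 1 / 3.
Hypothesis g3 : 1 / 3 < gamma.
Hypothesis g2 : gamma < 1 / 2.
Hypothesis ag1 : 1 < 2 * alpha + gamma.
Variables (b u : path_in R I) (w v : path_in R J).
Variables (B : rough3 R I) (Ibw : two_param R (I * J)) (W2 : two_param R (J * J)).
Variables (b_ u_ : nat -> path_in R I) (w_ v_ : nat -> path_in R J).
Hypothesis lI : forall n i, lip T ((b_ n)^~ i) /\ lip T ((u_ n)^~ i).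
Hypothesis lJ : forall n j, lip T ((w_ n)^~ j) /\ lip T ((v_ n)^~ j).
Hypothesis cb : forall i, qcvg (HP T alpha) (fun n => (b_ n)^~ i) (b^~ i).
Hypothesis cu : forall i, qcvg (CP T alpha) (fun n => (u_ n)^~ i) (u^~ i).
Hypothesis cw : forall j, qcvg (HP T gamma) (fun n => (w_ n)^~ j) (w^~ j).
Hypothesis cv : forall j, qcvg (CP T gamma) (fun n => (v_ n)^~ j) (v^~ j).
Hypothesis cB2 : forall i j, qcvg (Hb T (alpha + alpha))
  (fun n => YI ((b_ n)^~ i) ((b_ n)^~ j)) (fun s t => lev2 B s t (i, j)).
Hypothesis cB3 : forall i j k, qcvg (Hb T (alpha + alpha + alpha))
  (fun n => T3 ((b_ n)^~ i) ((b_ n)^~ j) ((b_ n)^~ k)) (fun s t => lev3 B s t (i, j, k)).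
Hypothesis cI : forall i j, qcvg (Hb T (alpha + gamma))
  (fun n => YI ((b_ n)^~ i) ((w_ n)^~ j)) (fun s t => Ibw s t (i, j)).
Hypothesis cW : forall i j, qcvg (Hb T (gamma + gamma))
  (fun n => YI ((w_ n)^~ i) ((w_ n)^~ j)) (fun s t => W2 s t (i, j)).

Let a0 : 0 <= alpha. Proof. by move: a4; lra. Qed.
Let g0 : 0 <= gamma. Proof. by move: g3; lra. Qed.
Let aa2 : 2^-1 < alpha + alpha. Proof. by move: a4; lra. Qed.
Let ag2 : 2^-1 < alpha + gamma. Proof. by move: a4 g3; lra. Qed.
Let ga2 : 2^-1 < gamma + alpha. Proof. by move: a4 g3; lra. Qed.
Let gg2 : 2^-1 < gamma + gamma. Proof. by move: g3; lra. Qed.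
Let a4' : 4^-1 < alpha. Proof. by move: a4; lra. Qed.

Let TS1 := transl1 b u w v.
Let TS2 := transl2 b u w v B Ibw W2.
Let BU3 := transl3 b u B.
Let z n := pair_path (b_ n + u_ n) (w_ n + v_ n).
Let zl := pair_path (b + u) (w + v).
Let rg := @roughness I J alpha gamma.

(** Integration by parts is exact for the Lipschitz interpolations and passes to the limit. The
    entry I[w,b] is therefore obtained from I[b,w] without a further probabilistic argument. *)
Let cflip j i : qcvg (Hb T (gamma + alpha))
  (fun n => YI ((w_ n)^~ j) ((b_ n)^~ i)) (fun s t => ito_flip b w Ibw s t (j, i)).
Proof.
have p := tens_diag_cvg g0 a0 (HP_qcvg (cw j)) (HP_qcvg (cb i)).
have q := cI i j; rewrite addrC in q.
have q' : qcvg (Hb T (gamma + alpha)) (fun n => - YI ((b_ n)^~ i) ((w_ n)^~ j))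
    (- (fun s t => Ibw s t (i, j))).
  pose F (psi : R -> R -> R) := - psi.
  apply: (@qcvg_imp _ _ _ (Hb T (gamma + alpha)) (Hb T (gamma + alpha)) F 1 _ _ _ _ _ _ q) => //.
  - exact: Hb_qnorm.
  - by move=> C x hx; rewrite mul1r; exact: HbN.
  - by move=> x y E; rewrite /F opprD.
have := qcvg_D (Hb_qnorm T (gamma + alpha)) p q'.
apply: Hb_qcvg_ext => // n s t s0 st tT.
rewrite (YI_by_parts T0 (lI n i).1 (lJ n j).1 s0 st tT) !fctE.
by rewrite [dl _ s t * _]mulrC.
Qed.

Let lz n k : lip T ((z n)^~ k).
Proof.
by case: k => [i|j]; [case: (lI n i) => *|case: (lJ n j) => *]; exact: lipD.
Qed.

Let cz k : qcvg (HP T (rg k)) (fun n => (z n)^~ k) (zl^~ k).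
Proof.
case: k => [i|j].
  exact: (qcvg_D (HP_qnorm T alpha) (cb i) (CP_HP (cu i))).
exact: (qcvg_D (HP_qnorm T gamma) (cw j) (CP_HP (cv j))).
Qed.

Let cII i j := second_cvg T0 (X := fun s t => lev2 B s t (i, j)) a0 a0 aa2 (lI^~ i) (lI^~ j) (cb i) (cu i) (cb j) (cu j) (cB2 i j).
Let cIJ i j := second_cvg T0 (X := fun s t => Ibw s t (i, j)) a0 g0 ag2 (lI^~ i) (lJ^~ j) (cb i) (cu i) (cw j) (cv j) (cI i j).
Let cJI j i := second_cvg T0 (X := fun s t => ito_flip b w Ibw s t (j, i)) g0 a0 ga2 (lJ^~ j) (lI^~ i) (cw j) (cv j) (cb i) (cu i) (cflip j i).
Let cJJ i j := second_cvg T0 (X := fun s t => W2 s t (i, j)) g0 g0 gg2 (lJ^~ i) (lJ^~ j) (cw i) (cv i) (cw j) (cv j) (cW i j).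

Let cz2 k l : qcvg (Hb T (rg k + rg l)) (fun n => YI ((z n)^~ k) ((z n)^~ l))
  (fun s t => TS2 s t (k, l)).
Proof.
case: k => [i|i]; case: l => [j|j].
- by have [_ _ _ h] := cII i j; exact: h.
- by have [_ _ _ h] := cIJ i j; exact: h.
- by have [_ _ _ h] := cJI i j; exact: h.
- by have [_ _ _ h] := cJJ i j; exact: h.
Qed.

Let cIII i j k := third_cvg T0 a4' (lI^~ i) (lI^~ j) (lI^~ k)
  (cb i) (cb j) (cb k) (cu i) (cu j) (cu k) (cB2 i j) (cB2 j k) (cB3 i j k).

Let cz3 i j k : qcvg (Hb T (alpha + alpha + alpha))
  (fun n => T3 ((z n)^~ (inl i)) ((z n)^~ (inl j)) ((z n)^~ (inl k)))
  (fun s t => BU3 s t (i, j, k)).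
Proof. by have [_ _ _ _ [_ _ _ h]] := cIII i j k; exact: h. Qed.

(** Only the block over b is prescribed, since 3 alpha < 1 rules out sewing there. The block over w
    is taken as a sewing limit like the mixed ones: 3 gamma > 1 makes it the Lyons extension. *)
Definition ext_third : two_param R ((I + J) * (I + J) * (I + J)) := fun s t klm =>
  match klm with
  | (inl i, inl j, inl k) => BU3 s t (i, j, k)
  | (k, l, m) => ext_lim (fun s t => TS1 s t k) (fun s t => TS2 s t (l, m))
       (fun s t => TS2 s t (k, l)) (fun s t => TS1 s t m) s t
  end.

Let ext k l m (h : 1 < rg k + rg l + rg m) :
  (forall s t, 0 <= s -> s <= t -> t <= T ->
    ext_sum TS1 TS2 k l m s t @ mesh0 s t -->
      ext_lim (fun s t => TS1 s t k) (fun s t => TS2 s t (l, m))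
       (fun s t => TS2 s t (k, l)) (fun s t => TS1 s t m) s t) /\
  qcvg (Hb T (rg k + rg l + rg m)) (fun n => T3 ((z n)^~ k) ((z n)^~ l) ((z n)^~ m))
     (ext_lim (fun s t => TS1 s t k) (fun s t => TS2 s t (l, m))
       (fun s t => TS2 s t (k, l)) (fun s t => TS1 s t m)).
Proof.
have r0 q : 0 < rg q by case: q => ?; rewrite /rg /roughness; move: a4 g3; lra.
have r34 q : rg q <= 3 / 4 by case: q => ?; rewrite /rg /roughness; move: a3 g2; lra.
have [h1 h2] := ext_qcvg T0 (r0 k) (r0 l) (r0 m) (r34 k) (r34 l) h
  (fun n => And3 (lz n k) (lz n l) (lz n m)) (cz k) (cz l) (cz m) (cz2 l m) (cz2 k l).
split; last exact: h2.
move=> s t s0 st tT.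
rewrite (_ : ext_sum TS1 TS2 k l m s t = psum (ext_germ (fun s t => TS1 s t k)
  (fun s t => TS2 s t (l, m)) (fun s t => TS2 s t (k, l)) (fun s t => TS1 s t m) s) s).
  exact: h1.
by apply/funext => p; rewrite (psumE _ _ t).
Qed.

(** Every other block contains at least one exponent gamma, so its sum is at least 2 alpha +
    gamma. *)
Let mixed (k l m : I + J) : (forall i j q, (k, l, m) <> (inl i, inl j, inl q)) ->
  1 < rg k + rg l + rg m.
Proof.
case: k => [i|i]; case: l => [j|j]; case: m => [q|q] h; rewrite /rg /roughness;
  try (move: ag1 a4 g3; lra).
by case: (h i j q).
Qed.

Lemma translation_geometric :
  [/\ young_integrals_exist b u w v B T,
      geometric_aniso T alpha gamma (Aniso TS1 TS2 BU3),
      geometric_rough_path T alpha (Rough3 (incr (b + u)) (block11 TS2) BU3)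
    & exists TS3, is_Ext T gamma (Aniso TS1 TS2 BU3) (Rough3 TS1 TS2 TS3) /\
        geometric_rough_path T alpha (Rough3 TS1 TS2 TS3)].
Proof.
have a0' : 0 < alpha by move: a4; lra.
have ag : alpha <= gamma by move: a3 g3; lra.
have g2' : gamma <= 2^-1 by move: g2; lra.
have aaa : alpha + alpha + alpha <= 1 by move: a3; lra.
have cz1 k : qcvg (Hb T (rg k)) (fun n => dl ((z n)^~ k)) (fun s t => TS1 s t k).
  exact: (HP_qcvg (cz k)).
have rga k : alpha <= rg k by case: k => ?; rewrite /rg /roughness.
split.
- split.
  + split=> s t i j s0 st tT; have [h1 h2 h3 _] := cII i j.
    - exact: h1.
    - exact: h2.
    - exact: h3.
  + split=> s t i j s0 st tT; have [h1 h2 h3 _] := cIJ i j.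
    - exact: h1.
    - exact: h2.
    - exact: h3.
  + split=> s t i j s0 st tT; have [h1 h2 h3 _] := cJI i j.
    - exact: h1.
    - exact: h2.
    - exact: h3.
  + split=> s t i j s0 st tT; have [h1 h2 h3 _] := cJJ i j.
    - exact: h1.
    - exact: h2.
    - exact: h3.
  + split.
    * split=> s t [i j] k s0 st tT; have [h1 h2 h3 h4 _] := cIII i j k.
      - exact: h1.
      - exact: h2.
    * split=> s t [i j] k s0 st tT; have [h1 h2 h3 h4 _] := cIII i j k.
      - exact: h3.
      - exact: h4.
    * move=> s t i j k s0 st tT; have [_ _ _ _ [h _ _ _]] := cIII i j k; exact: h.
    * move=> s t [i j] k s0 st tT; have [_ _ _ _ [_ h _ _]] := cIII i j k; exact: h.
    * move=> s t i [j k] s0 st tT; have [_ _ _ _ [_ _ h _]] := cIII i j k; exact: h.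
- apply: (@geometric_aniso_of_cvg _ _ alpha gamma z) => //.
- apply: (geometric_of_cvg T0 (z := fun n => b_ n + u_ n) a0' aaa).
  + by move=> n i; exact: (lz n (inl i)).
  + by move=> i; exact: (cz1 (inl i)).
  + by move=> i j; exact: (cz2 (inl i) (inl j)).
  + exact: cz3.
- exists ext_third; split.
  + split => //.
    * have g1 : 1 < gamma + gamma + gamma by move: g3; lra.
      have c2 i j := cz2 (inr i) (inr j); have c1 i := cz1 (inr i).
      have c3 (i j k : J) := (@ext (inr i) (inr j) (inr k) g1).2.
      have l3 i j k := lev3_ok T0 a0' ag ag ag
        (fun n => And3 (lz n (inr i)) (lz n (inr j)) (lz n (inr k)))
        (c1 i) (c1 k) (c2 j k) (c2 i j) (c3 i j k).
      split.
      - by move=> [[i j] k]; exact: (l3 i j k).2.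
      - move=> s x t i j k s0 sx xt tT.
        have := (l3 i j k).1 s x t s0 sx xt tT; rewrite addrA; exact.
      - have -> : 3 * gamma = gamma + gamma + gamma by ring.
        by apply: hnorm_fin => -[[i j] k]; exact: (c3 i j k).1.
    * move=> s t [i|i] [j|j] [k|k] s0 st tT //; apply: (ext _).1 => //;
        by apply: mixed.
  + apply: (geometric_of_cvg T0 (z := z) a0' aaa) => //.
    + by move=> k; exact: (Hb_qcvg_weaken T0 a0 (rga k) (cz1 k)).
    + move=> k l; apply: (Hb_qcvg_weaken T0 _ _ (cz2 k l)); first exact: addr_ge0.
      by apply: lerD.
    + move=> k l m; have [[i [j [q [-> -> ->]]]]|h] := pselect (exists i j q,
      [/\ k = inl i, l = inl j & m = inl q]); first exact: cz3.
    have h1 : 1 < rg k + rg l + rg m.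
      by apply: mixed => i j q [k' l' m']; apply: h; exists i, j, q.
    have aaa0 : 0 <= alpha + alpha + alpha by rewrite !addr_ge0.
    have le3 : alpha + alpha + alpha <= rg k + rg l + rg m by rewrite !lerD.
    have := Hb_qcvg_weaken T0 aaa0 le3 (ext h1).2.
    by case: k h h1 le3 => [i|i]; case: l => [j|j]; case: m => [q|q] // h; case: h; exists i, j, q.
Qed.

End Translation.
End Deterministic.

(** * Dyadic interpolation and chaining *)

Section Grid.
Context {R : realType} (T : R).
Hypothesis T0 : 0 < T.
Implicit Types (s t u : R) (f g x y : R -> R) (n m k : nat).

Definition grid n k : R := k%:R * T / 2 ^+ n.

Definition step n : R := T / 2 ^+ n.

(** One coordinate of [dyadic], with the grid points named; the two are convertible. *)
Definition pl n x t :=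
  let tau := t * 2 ^+ n / T in
  let k := Num.truncn tau in
  x (grid n k) + (tau - k%:R) * (x (grid n k.+1) - x (grid n k)).

Lemma step_gt0 n : 0 < step n.
Proof. by rewrite divr_gt0 // exprn_gt0. Qed.

Lemma gridS n k : grid n k.+1 = grid n k + step n.
Proof. by rewrite /grid /step -natr1 !mulrDl mul1r. Qed.

Lemma gridE n k : grid n k = k%:R * step n.
Proof. by rewrite /grid /step mulrA. Qed.

Lemma grid0 n : grid n 0 = 0.
Proof. by rewrite /grid mul0r mul0r. Qed.

Lemma gridT n : grid n (2 ^ n) = T.
Proof. by rewrite /grid natrX mulrAC divff ?mul1r // expf_neq0. Qed.

Lemma grid_ge0 n k : 0 <= grid n k.
Proof. by rewrite gridE mulr_ge0 // ltW // step_gt0. Qed.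

Lemma grid_le n k l : (grid n k <= grid n l) = (k <= l)%N.
Proof. by rewrite !gridE ler_pM2r ?step_gt0 // ler_nat. Qed.

Lemma grid_lt n k l : (grid n k < grid n l) = (k < l)%N.
Proof. by rewrite !gridE ltr_pM2r ?step_gt0 // ltr_nat. Qed.

Lemma grid_leT n k : (grid n k <= T) = (k <= 2 ^ n)%N.
Proof. by rewrite -[leRHS](gridT n) grid_le. Qed.

Lemma grid_refine n m k : grid (n + m) (k * 2 ^ m) = grid n k.
Proof.
rewrite /grid natrM natrX exprD invfM -!mulrA; congr (_ * _).
by rewrite mulrCA [2 ^+ m * _]mulrCA [2 ^+ m * _]mulrC mulVf ?mulr1 // expf_neq0.
Qed.

Lemma stepS n : step n = 2 * step n.+1.
Proof. by rewrite /step exprS invfM mulrCA [2 * _]mulrA divff // mul1r. Qed.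

Lemma step_add n m : step n = 2 ^+ m * step (n + m).
Proof.
by rewrite /step exprD invfM mulrCA [2 ^+ m * (_ * _)]mulrCA divff ?mulr1 // expf_neq0.
Qed.

Lemma step_powR n a : step n `^ a = T `^ a * (2 `^ (- a)) ^+ n.
Proof.
elim: n => [|n IH]; first by rewrite /step !expr0 divr1 mulr1.
have -> : step n.+1 = step n / 2 by rewrite [step n]stepS; field.
by rewrite powR_half ?(ltW (step_gt0 n)) // IH exprSr mulrA.
Qed.

Lemma grid_cell n t : 0 <= t ->
  exists k, grid n k <= t < grid n k.+1.
Proof.
move=> t0; exists (Num.truncn (t / step n)).
have d0 := step_gt0 n.
have /truncn_itv/andP[h1 h2] : 0 <= t / step n by rewrite divr_ge0 // ltW.
by rewrite !gridE -ler_pdivlMr // -ltr_pdivrMr // h1 h2.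
Qed.

Lemma pl_cell n x k t : grid n k <= t -> t <= grid n k.+1 ->
  pl n x t = x (grid n k) + (t - grid n k) / step n * (x (grid n k.+1) - x (grid n k)).
Proof.
move=> kt tk; have d0 := step_gt0 n.
have t0 : 0 <= t by apply: le_trans kt; exact: grid_ge0.
have E : t * 2 ^+ n / T = t / step n by rewrite /step invf_div mulrA.
rewrite /pl E.
have E2 : (t - grid n k) / step n = t / step n - k%:R.
  by rewrite gridE mulrBl mulfK // gt_eqF.
(* At the right end of the cell the truncation already gives k + 1, and both expressions equal the
   value of x there. *)
rewrite E2; move: tk; rewrite le_eqVlt => /orP[/eqP->|tk].
  have -> : grid n k.+1 / step n = k.+1%:R by rewrite gridE mulfK // gt_eqF.
  by rewrite natrK subrr mul0r addr0 -natr1; ring.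
suff -> : Num.truncn (t / step n) = k by [].
apply: truncn_def.
by rewrite ler_pdivlMr // ltr_pdivrMr // -!gridE kt tk.
Qed.

Lemma pl_grid n x k : pl n x (grid n k) = x (grid n k).
Proof.
by rewrite (@pl_cell n x k) ?grid_le // subrr mul0r mul0r addr0.
Qed.

Lemma pl_lin n x k s t : grid n k <= s -> s <= t -> t <= grid n k.+1 ->
  dl (pl n x) s t = (t - s) / step n * dl x (grid n k) (grid n k.+1).
Proof.
move=> ks st tk; rewrite /dl !(@pl_cell n x k) // ?(le_trans ks) ?(le_trans st) //.
by ring.
Qed.

Lemma dl_pl_grid n x k l : dl (pl n x) (grid n k) (grid n l) = dl x (grid n k) (grid n l).
Proof. by rewrite /dl !pl_grid. Qed.

Lemma cell_ind n (P : R -> R -> Prop) :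
  (forall k s t, (k < 2 ^ n)%N -> grid n k <= s -> s <= t -> t <= grid n k.+1 -> P s t) ->
  (forall s u t, 0 <= s -> s <= u -> u <= t -> t <= T -> P s u -> P u t -> P s t) ->
  forall s t, 0 <= s -> s <= t -> t <= T -> P s t.
Proof.
move=> hc hs s t s0 st tT.
suff H j : (j < 2 ^ n)%N -> forall s t, 0 <= s -> s <= t -> t <= grid n j.+1 -> P s t.
  have e : (2 ^ n).-1.+1 = (2 ^ n)%N by rewrite prednK // expn_gt0.
  by apply: (H (2 ^ n).-1) => //; rewrite e ?gridT // ltnS.
elim: j => [|j IH] jn {tT}{}s {}t {}s0 {}st tj.
  by apply: (hc 0) => //; rewrite grid0.
have jn' : (j < 2 ^ n)%N by exact: ltnW.
have [js|sj] := leP (grid n j.+1) s; first exact: (hc j.+1).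
have [tj'|jt] := leP t (grid n j.+1); first exact: IH.
apply: (hs s (grid n j.+1) t) => //; first exact: ltW.
- exact: ltW.
- by apply: le_trans tj _; rewrite grid_leT.
- by apply: IH => //; exact: ltW.
- by apply: (hc j.+1) => //; exact: ltW.
Qed.

Lemma lip_pl n x : lip T (pl n x).
Proof.
pose M := \sum_(k < 2 ^ n) `|dl x (grid n k) (grid n k.+1)|.
have M0 : 0 <= M by exact: sumr_ge0.
have d0 := step_gt0 n.
exists (M / step n); split; first by rewrite divr_ge0 // ltW.
apply: (@cell_ind n) => [k s t kn ks st tk|s u t s0 su ut tT].
  rewrite powRr1 ?subr_ge0 // (@pl_lin n x k) // normrM ger0_norm; last first.
    by rewrite divr_ge0 ?subr_ge0 // ltW.
  rewrite mulrC -mulrA [(step n)^-1 * _]mulrC ler_wpM2r ?mulr_ge0 ?invr_ge0 ?subr_ge0 ?(ltW d0) //.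
  by rewrite /M (bigD1 (Ordinal kn)) //= lerDl sumr_ge0.
rewrite !powRr1 ?subr_ge0 ?(le_trans su) // => h1 h2.
have -> : dl (pl n x) s t = dl (pl n x) s u + dl (pl n x) u t by rewrite /dl; ring.
apply: le_trans (ler_normD _ _) _; apply: le_trans (lerD h1 h2) _.
by rewrite -mulrDr (_ : u - s + (t - u) = t - s) //; ring.
Qed.

(** As y vanishes on the grid, an increment over [s,t] reduces to those in the two end cells, whose
    lengths are at most the step: the surplus h - a turns into a power of the step. The weight N is
    constant for Hoelder paths and the square root of a control for Cameron-Martin paths. *)
Lemma zero_grid_bound n (y : R -> R) (N : R -> R -> R) a h : 0 <= a -> a <= h ->
  (forall k, (k <= 2 ^ n)%N -> y (grid n k) = 0) ->
  (forall s s' t' t, 0 <= s -> s <= s' -> s' <= t' -> t' <= t -> t <= T ->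
     0 <= N s' t' <= N s t) ->
  (forall k s t, (k < 2 ^ n)%N -> grid n k <= s -> s <= t -> t <= grid n k.+1 ->
     `|dl y s t| <= (t - s) `^ h * N s t) ->
  forall s t, 0 <= s -> s <= t -> t <= T ->
    `|dl y s t| <= 2 * step n `^ (h - a) * (t - s) `^ a * N s t.
Proof.
move=> a0 ah y0 Nm cell s t s0 st tT.
have d0 := step_gt0 n.
have half k s' t' : (k < 2 ^ n)%N -> grid n k <= s' -> s' <= t' -> t' <= grid n k.+1 ->
    s <= s' -> t' <= t -> `|dl y s' t'| <= step n `^ (h - a) * (t - s) `^ a * N s t.
  move=> kn ks st' tk ss tt; apply: le_trans (cell k s' t' kn ks st' tk) _.
  have /andP[N1 N2] := Nm s s' t' t s0 ss st' tt tT.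
  apply: ler_pM => //; first exact: powR_ge0.
  rewrite -[h in leLHS](subrK a) powR_addr ?subr_ge0 //.
  apply: ler_pM; rewrite ?powR_ge0 //; apply: ge0_ler_powR; rewrite ?nnegrE ?subr_ge0 //.
  - exact: ltW.
  - by move: tk ks; rewrite gridS; lra.
  - exact: lerB.
have Nst : 0 <= N s t by have /andP[] := Nm s s t t s0 (lexx _) st (lexx _) tT.
have [k /andP[ks sk]] := grid_cell n s0.
have [sT|sT] := eqVneq s T.
  have tT' : t = T by apply/eqP; rewrite eq_le tT -sT.
  by rewrite tT' sT in Nst *; rewrite /dl subrr normr0 !mulr_ge0 ?powR_ge0.
have kn : (k < 2 ^ n)%N.
  rewrite -(grid_lt n) gridT; apply: le_lt_trans ks _.
  by rewrite lt_neqAle sT (le_trans st).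
have p0 : 0 <= step n `^ (h - a) * (t - s) `^ a * N s t by rewrite !mulr_ge0 ?powR_ge0.
rewrite -!mulrA mulr_natl mulr2n !mulrA.
have [tk|kt] := leP t (grid n k.+1).
  by apply: le_trans (half k s t kn ks st tk (lexx _) (lexx _)) _; rewrite lerDl.
have t0 := le_trans s0 st.
(* For t = T the half-open cell has index 2^n, outside the grid; the last cell, closed on the right,
   is used instead. *)
have [j jt] : exists j, [/\ (j < 2 ^ n)%N, grid n j <= t & t <= grid n j.+1].
  have [j /andP[jt tj]] := grid_cell n t0.
  have [jn|nj] := ltnP j (2 ^ n); first by exists j; split => //; exact: ltW.
  exists (2 ^ n).-1; rewrite prednK ?expn_gt0 // gridT; split => //.
  by apply: le_trans jt; rewrite grid_le (leq_trans (leq_pred _)).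
case: jt => jn jt tj.
have kj : (k.+1 <= j)%N.
  by rewrite -ltnS -(grid_lt n); exact: lt_le_trans kt tj.
have -> : dl y s t = dl y s (grid n k.+1) + dl y (grid n j) t.
  by rewrite /dl !y0 ?subr0 ?sub0r //; [ring|exact: ltnW].
apply: le_trans (ler_normD _ _) _; apply: lerD.
  by apply: (half k) => //; exact: ltW.
apply: (half j) => //; apply: le_trans (ltW sk) _; by rewrite grid_le.
Qed.

Lemma step_powR_lt c e : 0 < c -> 0 < e ->
  exists n0, forall n, (n0 <= n)%N -> step n `^ c < e.
Proof.
move=> c0 e0.
have q1 : `|2 `^ (- c) : R| < 1.
  by rewrite ger0_norm ?powR_ge0 // two_powR_lt1 // oppr_lt0.
have := cvg_geometric (T `^ c) q1 => /cvgrPdist_lt/(_ _ e0)[n0 _ h].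
exists n0 => n /h /=; rewrite sub0r normrN step_powR.
by rewrite ger0_norm // mulr_ge0 ?powR_ge0 // exprn_ge0 ?powR_ge0.
Qed.

Lemma le_powR_unit (q h : R) : 0 <= q -> q <= 1 -> h <= 1 -> q <= q `^ h.
Proof.
move=> q0 q1 h1; have [->|qN0] := eqVneq q 0; first exact: powR_ge0.
rewrite -[leLHS]powRr1 //; apply: ger_powR => //.
by rewrite lt_def qN0 q0 q1.
Qed.

Lemma pl_qcvg_HP a h x : 0 <= a -> a < h -> h <= 1 ->
  (exists C, HP T h C x) -> qcvg (HP T a) (fun n => pl n x) x.
Proof.
move=> a0 ah h1 [C hx]; split.
  by eexists; exact: (Hb_weaken a0 (ltW ah) (ltW T0) hx).
have [C0 H] := hx => e e0.
have C1 : 0 < C + 1 by lra.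
have e1 : 0 < e / (4 * (C + 1)) by rewrite divr_gt0 // mulr_gt0.
have ha : 0 < h - a by lra.
have [n0 hn] := step_powR_lt ha e1.
exists n0 => n /hn sm; split; first exact: ltW.
move=> s t s0 st tT.
have h0 : 0 <= h by lra.
have d0 := step_gt0 n.
have := @zero_grid_bound n (pl n x - x) (fun _ _ => 2 * C) a h a0 (ltW ah) _ _ _ s t s0 st tT.
move=> hz; apply: le_trans (hz _ _ _) _.
- by move=> k kn; rewrite !fctE pl_grid subrr.
- by move=> *; rewrite lexx mulr_ge0.
- move=> k s' t' kn ks st' tk.
  have s'0 : 0 <= s' by apply: le_trans ks; exact: grid_ge0.
  have t'T : t' <= T by apply: le_trans tk _; rewrite grid_leT.
  rewrite dlB !fctE; apply: le_trans (ler_normB _ _) _.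
  have -> : (t' - s') `^ h * (2 * C) = C * (t' - s') `^ h + C * (t' - s') `^ h by ring.
  apply: lerD; last exact: H.
  rewrite (pl_lin x ks) // normrM.
  have q0 : 0 <= (t' - s') / step n by rewrite divr_ge0 ?subr_ge0 // ltW.
  rewrite ger0_norm //.
  have cl := H (grid n k) (grid n k.+1) (grid_ge0 n k) _ _.
  apply: le_trans (ler_wpM2l q0 (cl _ _)) _; rewrite ?grid_le ?grid_leT //.
  have -> : grid n k.+1 - grid n k = step n by rewrite gridS; ring.
  have q1 : (t' - s') / step n <= 1.
    by rewrite ler_pdivrMr // mul1r; move: tk ks; rewrite gridS; lra.
  rewrite -[in leRHS](_ : (t' - s') / step n * step n = t' - s'); last first.
    by rewrite divfK // gt_eqF.
  rewrite powRM ?(ltW d0) // mulrCA ler_wpM2l // ler_wpM2r ?powR_ge0 //.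
  exact: le_powR_unit.
have -> : 2 * step n `^ (h - a) * (t - s) `^ a * (2 * C) =
  4 * step n `^ (h - a) * C * (t - s) `^ a by ring.
rewrite ler_wpM2r ?powR_ge0 //.
move: sm; rewrite ltr_pdivlMr ?mulr_gt0 // => sm.
have := powR_ge0 (step n) (h - a); nra.
Qed.

(** The control w of x need not control its interpolation. The increments of g = w(0, .) dominate w
    by superadditivity and form an additive control, and the interpolation of g controls that of x.
    Their average still has mass at most 1. *)
Lemma pl_qcvg_CP a h x : 0 <= a -> a < h -> h <= 2^-1 ->
  (exists C, CP T h C x) -> qcvg (CP T a) (fun n => pl n x) x.
Proof.
move=> a0 ah h1 [C hx].
have [C0 [w [sw w1 H]]] := hx.
pose g t := w 0 t.
have gm s t : 0 <= s -> s <= t -> t <= T -> w s t <= dl g s t.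
  by move=> s0 st tT; rewrite /dl /g; have := sw.2 0 s t (lexx _) s0 st tT; lra.
have w0 s t : 0 <= s -> s <= t -> t <= T -> 0 <= w s t by exact: sw.1.
have g0 s t : 0 <= s -> s <= t -> t <= T -> 0 <= dl g s t.
  by move=> *; apply: le_trans (gm _ _ _ _ _) => //; exact: w0.
have h0 : 0 <= h by lra.
have gn0 n : forall s t, 0 <= s -> s <= t -> t <= T -> 0 <= dl (pl n g) s t.
  apply: (@cell_ind n) => [k s t kn ks st tk|s u t _ _ _ _ h2 h3].
    have d0 := ltW (step_gt0 n); rewrite (pl_lin g ks) //.
    apply: mulr_ge0; first by rewrite mulr_ge0 ?invr_ge0 ?subr_ge0.
    by apply: g0; rewrite ?grid_ge0 ?grid_le ?grid_leT.
  have -> : dl (pl n g) s t = dl (pl n g) s u + dl (pl n g) u t by rewrite /dl; ring.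
  exact: addr_ge0.
pose om n s t := (dl g s t + dl (pl n g) s t) / 2.
have som n : superadd 0 T (om n).
  split=> [u v u0 uv vT|u v z u0 uv vz zT].
    by rewrite /om; have := g0 u v u0 uv vT; have := gn0 n u v u0 uv vT; lra.
  by rewrite /om /dl; lra.
have gT1 : dl g 0 T <= 1.
  by rewrite /dl /g (superadd_diag sw) ?subr0 // ltW.
have om1 n : om n 0 T <= 1.
  have e : dl (pl n g) 0 T = dl g 0 T.
    by have := dl_pl_grid n g 0 (2 ^ n); rewrite grid0 gridT.
  by rewrite /om e; move: gT1; lra.
have om_ge n s t : 0 <= s -> s <= t -> t <= T ->
    Num.sqrt (dl g s t) <= 2 * Num.sqrt (om n s t) /\
    Num.sqrt (dl (pl n g) s t) <= 2 * Num.sqrt (om n s t).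
  move=> s0 st tT; have g1 := g0 s t s0 st tT; have g2 := gn0 n s t s0 st tT.
  have sq z : 0 <= z -> z <= 4 * om n s t -> Num.sqrt z <= 2 * Num.sqrt (om n s t).
    move=> z0 hz; have <- : Num.sqrt (2 ^+ 2) = 2 :> R by rewrite sqrtr_sqr ger0_norm.
    by rewrite -sqrtrM ?exprn_ge0 // ler_wsqrtr // (_ : 2 ^+ 2 = 4) //; ring.
  by split; apply: sq => //; rewrite /om; lra.
split.
  exists (C * T `^ (h - a)); split; first by rewrite mulr_ge0 ?powR_ge0.
  exists (fun s t => dl g s t); split => //.
    split=> [u v u0 uv vT|u v z u0 uv vz zT]; first exact: g0.
    by rewrite /dl; lra.
  move=> s t s0 st tT; apply: le_trans (H s t s0 st tT) _.
  rewrite /cbound; apply: ler_pM; rewrite ?mulr_ge0 ?powR_ge0 ?sqrtr_ge0 //.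
    rewrite -[h in leLHS](subrK a) powR_addr ?subr_ge0 ?(ltW ah) // mulrA.
    rewrite ler_wpM2r ?powR_ge0 // ler_wpM2l //.
    by apply: ge0_ler_powR; rewrite ?nnegrE ?subr_ge0 ?(ltW ah) ?(ltW T0) //; lra.
  by rewrite ler_wsqrtr // gm.
move=> e e0.
have C1 : 0 < C + 1 by lra.
have e1 : 0 < e / (8 * (C + 1)) by rewrite divr_gt0 // mulr_gt0.
have ha : 0 < h - a by lra.
have [n0 hn] := step_powR_lt ha e1.
exists n0 => n /hn sm; split; first exact: ltW.
exists (om n); split => // s t s0 st tT.
have d0 := step_gt0 n.
have := @zero_grid_bound n (pl n x - x) (fun s t => 4 * C * Num.sqrt (om n s t)) a h
  a0 (ltW ah) _ _ _ s t s0 st tT.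
move=> hz; apply: le_trans (hz _ _ _) _.
- by move=> k kn; rewrite !fctE pl_grid subrr.
- move=> p p' q' q p0 pp pq qq qT; rewrite !mulr_ge0 ?sqrtr_ge0 //=.
  by rewrite ler_wpM2l ?mulr_ge0 // ler_wsqrtr // (superadd_le (som n)).
- move=> k s' t' kn ks st' tk.
  have s'0 : 0 <= s' by apply: le_trans ks; exact: grid_ge0.
  have t'T : t' <= T by apply: le_trans tk _; rewrite grid_leT.
  have [og1 og2] := om_ge n s' t' s'0 st' t'T.
  have p0 : 0 <= (t' - s') `^ h * C by rewrite mulr_ge0 ?powR_ge0.
  rewrite dlB !fctE; apply: le_trans (ler_normB _ _) _.
  have -> : (t' - s') `^ h * (4 * C * Num.sqrt (om n s' t')) =
    (t' - s') `^ h * C * (2 * Num.sqrt (om n s' t')) +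
    (t' - s') `^ h * C * (2 * Num.sqrt (om n s' t')) by ring.
  apply: lerD; last first.
    apply: le_trans (H s' t' s'0 st' t'T) _; rewrite /cbound [C * _]mulrC ler_wpM2l //.
    by apply: le_trans og1; rewrite ler_wsqrtr // gm.
  apply: le_trans _ (ler_wpM2l p0 og2).
  rewrite (pl_lin x ks) // (pl_lin g ks) // normrM.
  have q0 : 0 <= (t' - s') / step n by rewrite divr_ge0 ?subr_ge0 // ltW.
  rewrite ger0_norm // sqrtrM //.
  have kT : grid n k.+1 <= T by rewrite grid_leT.
  have kk : grid n k <= grid n k.+1 by rewrite grid_le.
  apply: le_trans (ler_wpM2l q0 (H (grid n k) (grid n k.+1) (grid_ge0 n k) kk kT)) _.
  have -> : (t' - s') `^ h = ((t' - s') / step n) `^ h * step n `^ h.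
    by rewrite -powRM ?(ltW d0) // divfK // gt_eqF.
  rewrite /cbound (_ : grid n k.+1 - grid n k = step n); last by rewrite gridS; ring.
  have q1 : (t' - s') / step n <= 1.
    by rewrite ler_pdivrMr // mul1r; move: tk ks; rewrite gridS; lra.
  set q := (t' - s') / step n in q0 q1 *.
  have -> : q `^ h * step n `^ h * C * (Num.sqrt q * Num.sqrt (dl g (grid n k) (grid n k.+1))) =
    (q `^ h * Num.sqrt q) * (C * step n `^ h * Num.sqrt (dl g (grid n k) (grid n k.+1))) by ring.
  apply: ler_pM => //; first by rewrite !mulr_ge0 ?powR_ge0 ?sqrtr_ge0.
    (* The relative length q is at most q^(h + 1/2), because q <= 1 and h <= 1/2. *)
    rewrite -powR12_sqrt // -powR_addr ?invr_ge0 //.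
    by apply: le_powR_unit => //; lra.
  by rewrite ler_wpM2l ?mulr_ge0 ?powR_ge0 // ler_wsqrtr // gm // grid_ge0.
rewrite /cbound !mulrA ler_wpM2r ?sqrtr_ge0 //.
have -> : 2 * step n `^ (h - a) * (t - s) `^ a * 4 * C =
  8 * step n `^ (h - a) * C * (t - s) `^ a by ring.
rewrite ler_wpM2r ?powR_ge0 //.
move: sm; rewrite ltr_pdivlMr ?mulr_gt0 // => sm.
have := powR_ge0 (step n) (h - a); nra.
Qed.

End Grid.

(** * From bounds on dyadic cells to Hoelder bounds *)

Section Chaining.
Context {R : realType} (T : R).
Hypothesis T0 : 0 < T.
Implicit Types (s t u : R) (n m k l j : nat) (psi : R -> R -> R).

Definition simplex : set (R * R) := [set st | [/\ 0 <= st.1, st.1 <= st.2 & st.2 <= T]].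

Lemma simplex_near psi s t : {within simplex, continuous (fun st => psi st.1 st.2)} ->
  0 <= s -> s <= t -> t <= T -> forall e, 0 < e -> exists2 d, 0 < d &
  forall s' t', 0 <= s' -> s' <= t' -> t' <= T -> `|s' - s| < d -> `|t' - t| < d ->
    `|psi s' t' - psi s t| < e.
Proof.
move=> /subspace_continuousP cpsi s0 st tT e e0.
have /cvgrPdist_lt/(_ _ e0) := cpsi (s, t) (And3 s0 st tT).
move=> /nbhs_ballP[d d0 h]; exists d => // s' t' s'0 st' t'T h1 h2.
by rewrite distrC; apply: (h (s', t')) => //; split => /=; rewrite /ball /= distrC.
Qed.

(** Inner approximation: for s < t the grid points just right of s and just left of t span a shorter
    interval, so the power of its length only decreases; continuity does the rest. *)
Lemma simplex_dyadic_le psi (K c : R) : 0 <= K -> 0 <= c ->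
  {within simplex, continuous (fun st => psi st.1 st.2)} ->
  (forall s, 0 <= s -> s <= T -> psi s s = 0) ->
  (forall n k l, (k <= l)%N -> (l <= 2 ^ n)%N ->
    `|psi (grid T n k) (grid T n l)| <= K * (grid T n l - grid T n k) `^ c) ->
  forall s t, 0 <= s -> s <= t -> t <= T -> `|psi s t| <= K * (t - s) `^ c.
Proof.
move=> K0 c0 cpsi psi0 hd s t s0 st tT.
have [ts|lt_st] := leP t s.
  have -> : t = s by apply/eqP; rewrite eq_le ts st.
  by rewrite psi0 ?(le_trans st) // normr0 mulr_ge0 ?powR_ge0.
apply/ler_addgt0Pr => e e0.
have [d d0 hpsi] := simplex_near cpsi s0 st tT e0.
pose d' := Num.min d ((t - s) / 2).
have d'0 : 0 < d' by rewrite lt_min d0 divr_gt0 // subr_gt0.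
have [n0 hn] := step_powR_lt T0 ltr01 d'0.
have sn : step T n0 < d' by have := hn n0 (leqnn _); rewrite powRr1 // ltW // step_gt0.
have dd : d' <= d /\ d' <= (t - s) / 2 by rewrite /d' !ge_min !lexx orbT.
have t0 := le_trans s0 st.
have [k /andP[ks sk]] := grid_cell T0 n0 s0.
have [l /andP[lt tl]] := grid_cell T0 n0 t0.
have lT : (l <= 2 ^ n0)%N by rewrite -(grid_leT T0) (le_trans lt).
have kl : (k.+1 <= l)%N.
  rewrite -(grid_le T0 n0) gridS; move: tl ks dd sn; rewrite gridS.
  set x := grid T n0 k; set y := grid T n0 l; set z := step T n0 => h1 h2 [h3 h4] h5.
  have : k%:R * z < (l%:R : R) * z by move: h1 h2; rewrite /x /y !gridE -/z; lra.
  rewrite ltr_pM2r ?step_gt0 // ltr_nat => kl.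
  by rewrite /x /y -gridS (grid_le T0).
have h := hd n0 k.+1 l kl lT.
have [dd1 dd2] := dd.
have near : `|psi (grid T n0 k.+1) (grid T n0 l) - psi s t| < e.
  apply: hpsi; rewrite ?(grid_ge0 T0) ?(grid_le T0) ?(grid_leT T0) //.
    by rewrite ger0_norm; move: ks sk; rewrite gridS; lra.
  by rewrite ler0_norm; move: lt tl; rewrite gridS; lra.
have -> : psi s t = psi (grid T n0 k.+1) (grid T n0 l) -
  (psi (grid T n0 k.+1) (grid T n0 l) - psi s t) by ring.
apply: le_trans (ler_normB _ _) _; apply: lerD; last exact: ltW.
apply: le_trans h _; rewrite ler_wpM2l //; apply: ge0_ler_powR; rewrite ?nnegrE ?subr_ge0 //.
  by rewrite (grid_le T0).
by apply: lerB => //; exact: ltW.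
Qed.

Section Tree.
Variables (a c e : R) (psi : R -> R -> R).
Hypotheses (a0 : 0 < a) (c0 : 0 < c) (e0 : 0 <= e).
Hypothesis defect : forall s u t, 0 <= s -> s <= u -> u <= t -> t <= T ->
  `|psi s t - psi s u - psi u t| <= e * (u - s) `^ a * (t - u) `^ c.
Hypothesis cells : forall m k, (k < 2 ^ m)%N ->
  `|psi (grid T m k) (grid T m k.+1)| <= e * step T m `^ (a + c).

(** Chosen so that (2 + K) 2^(- th) <= K: one level down, a half cell, a defect and the remaining
    piece are absorbed by the bound of the parent. *)
Definition treeK (th : R) : R := 2 / (1 - 2 `^ (- th)).

Lemma treeK_ge0 th : 0 < th -> 0 <= treeK th.
Proof. by move=> h; rewrite divr_ge0 // subr_ge0 ltW // two_powR_lt1 // oppr_lt0. Qed.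

Let q : R := 2 `^ (- (a + c)).
Let K := treeK (a + c).

Let q01 : 0 <= q < 1.
Proof. by rewrite powR_ge0 two_powR_lt1 // oppr_lt0 addr_gt0. Qed.

Let K2 : 2 <= K.
Proof.
have /andP[h1 h2] := q01; rewrite /K /treeK -/q ler_pdivlMr ?subr_gt0 //.
by rewrite ler_piMr // lerBlDr lerDl.
Qed.

Let K0 : 0 <= K. Proof. exact: le_trans K2. Qed.

Let Ke0 : 0 <= K * e. Proof. exact: mulr_ge0. Qed.

Let Kq : (2 + K) * q <= K.
Proof.
have /andP[h1 h2] := q01; have h3 : 0 < 1 - q by rewrite subr_gt0.
have : K * (1 - q) = 2 by rewrite /K /treeK -/q divfK // gt_eqF.
nra.
Qed.

Lemma tree_diag s : 0 <= s -> s <= T -> psi s s = 0.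
Proof.
move=> s0 sT; have := defect s0 (lexx s) (lexx s) sT.
rewrite (subrr s) powR0 ?gt_eqF // powR0 ?gt_eqF // !mulr0 normr_le0 subrr sub0r.
by rewrite oppr_eq0 => /eqP.
Qed.

Let stepq m : step T m.+1 `^ (a + c) = q * step T m `^ (a + c).
Proof. by rewrite !step_powR // exprSr -/q; ring. Qed.

Let mid m k : grid T m k = grid T m.+1 (2 * k).
Proof. by rewrite -(grid_refine T m 1 k) addn1 expn1 mulnC. Qed.

(** Descent in the binary tree from the left end of a cell to a finer point in it. The bound is by
    the length of the cell, not yet by the distance of the two points. *)
Lemma tree_coarse j m k l : (k < 2 ^ m)%N -> (k * 2 ^ j <= l)%N ->
  (l <= k.+1 * 2 ^ j)%N ->
  `|psi (grid T m k) (grid T (m + j) l)| <= K * e * step T m `^ (a + c).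
Proof.
elim: j m k l => [|j IH] m k l km.
  rewrite expn0 !muln1 addn0 => kl lk.
  have [->|kN] := eqVneq l k.
    rewrite tree_diag ?(grid_ge0 T0) ?(grid_leT T0) 1?ltnW // normr0.
    by rewrite mulr_ge0 ?powR_ge0.
  have -> : l = k.+1 by move: kl lk kN; clear; lia.
  apply: le_trans (cells km) _; rewrite ler_wpM2r ?powR_ge0 // ler_peMl //.
  by move: K2; lra.
move=> kl lk; rewrite mid (addnS m) -(addSn m).
have k2 : (2 * k < 2 ^ m.+1)%N by rewrite expnS ltn_pmul2l.
have k21 : ((2 * k).+1 < 2 ^ m.+1)%N by rewrite expnS; move: km; clear; lia.
have e2 : (k.+1 * 2 ^ j.+1 = (2 * k).+2 * 2 ^ j)%N.
  by rewrite expnS mulnA; congr (_ * _)%N; rewrite mulnC mulnS.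
have [ll|ll] := leqP l ((2 * k).+1 * 2 ^ j).
  apply: le_trans (IH m.+1 (2 * k)%N l k2 _ ll) _; first by rewrite mulnAC -expnS mulnC.
  rewrite stepq; apply: ler_wpM2l => //; rewrite ler_piMl ?powR_ge0 //.
  by have /andP[_ /ltW] := q01.
have lT : (l <= 2 ^ (m.+1 + j))%N.
  rewrite addSnnS expnD; apply: leq_trans lk _; exact: leq_mul.
have rE : grid T m.+1 (2 * k).+1 = grid T (m.+1 + j) ((2 * k).+1 * 2 ^ j).
  by rewrite grid_refine.
have s0 := grid_ge0 T0 m.+1 (2 * k).
have su : grid T m.+1 (2 * k) <= grid T m.+1 (2 * k).+1 by rewrite grid_le.
have ut : grid T m.+1 (2 * k).+1 <= grid T (m.+1 + j) l by rewrite rE grid_le // ltnW.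
have tT : grid T (m.+1 + j) l <= T by rewrite grid_leT.
have tl : grid T (m.+1 + j) l - grid T m.+1 (2 * k).+1 <= step T m.+1.
  rewrite lerBlDr addrC -gridS -(grid_refine T m.+1 j) grid_le //.
  by rewrite -e2.
have := defect s0 su ut tT.
have h1 := cells k2.
have h2 : `|psi (grid T m.+1 (2 * k).+1) (grid T (m.+1 + j) l)| <= K * e * step T m.+1 `^ (a + c).
  apply: IH => //; first exact: ltnW.
  by rewrite -e2.
set d := psi _ _ - _ - _ => hd.
have -> : psi (grid T m.+1 (2 * k)) (grid T (m.+1 + j) l) = d +
  psi (grid T m.+1 (2 * k)) (grid T m.+1 (2 * k).+1) +
  psi (grid T m.+1 (2 * k).+1) (grid T (m.+1 + j) l) by rewrite /d; ring.
have hd' : `|d| <= e * step T m.+1 `^ (a + c).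
  apply: le_trans hd _; rewrite powR_addr ?(ltW a0) ?(ltW c0) // mulrA.
  apply: ler_pM; rewrite ?mulr_ge0 ?powR_ge0 //.
    by rewrite (_ : grid T m.+1 (2 * k).+1 - _ = step T m.+1) // gridS; ring.
  by apply: ge0_ler_powR; rewrite ?nnegrE ?subr_ge0 ?(ltW c0) // ltW // step_gt0.
apply: le_trans (ler_normD _ _) _.
have := lerD (ler_normD d (psi (grid T m.+1 (2 * k)) (grid T m.+1 (2 * k).+1))) h2.
move=> /le_trans; apply.
apply: le_trans (lerD (lerD hd' h1) (lexx _)) _.
have -> : e * step T m.+1 `^ (a + c) + e * step T m.+1 `^ (a + c) +
  K * e * step T m.+1 `^ (a + c) = ((2 + K) * q) * (e * step T m `^ (a + c)).
  by rewrite stepq; ring.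
by rewrite -[leRHS]mulrA; apply: ler_wpM2r => //; rewrite mulr_ge0 ?powR_ge0.
Qed.

(** Descend while the point lies in the left half. As soon as it lies in the right half, its
    distance to the left end is at least half of the cell, and [tree_coarse] gives the claim at the
    price of 2^(a + c). *)
Lemma tree_right j m k l : (k < 2 ^ m)%N -> (k * 2 ^ j <= l)%N ->
  (l <= k.+1 * 2 ^ j)%N ->
  `|psi (grid T m k) (grid T (m + j) l)| <=
    2 `^ (a + c) * K * e * (grid T (m + j) l - grid T m k) `^ (a + c).
Proof.
elim: j m k => [|j IH] m k km kl lk.
  have := tree_coarse km kl lk; rewrite addn0; move: kl lk; rewrite !muln1 => kl lk.
  have [->|lN] := eqVneq l k.
    rewrite tree_diag ?(grid_ge0 T0) ?(grid_leT T0) 1?ltnW // normr0.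
    by move=> _; rewrite mulr_ge0 ?powR_ge0 // -mulrA; apply: mulr_ge0; rewrite ?powR_ge0.
  have -> : l = k.+1 by move: kl lk lN; clear; lia.
  rewrite (_ : grid T m k.+1 - _ = step T m); last by rewrite gridS; ring.
  move=> /le_trans; apply; rewrite ler_wpM2r ?powR_ge0 // -mulrA ler_peMl //.
  by rewrite -[leLHS](powRr0 2) ler_powR ?ler1n // addr_ge0 ?ltW.
have [ll|ll] := leqP l ((2 * k).+1 * 2 ^ j).
  rewrite mid (addnS m) -(addSn m); apply: IH => //; first by rewrite expnS ltn_pmul2l.
  by rewrite mulnAC -expnS mulnC.
apply: le_trans (tree_coarse km kl lk) _.
have -> : 2 `^ (a + c) * K * e * (grid T (m + j.+1) l - grid T m k) `^ (a + c) =
  K * e * (2 `^ (a + c) * (grid T (m + j.+1) l - grid T m k) `^ (a + c)) by ring.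
have h : step T m.+1 <= grid T (m + j.+1) l - grid T m k.
  rewrite lerBrDr addrC mid -gridS addnS -addSn -(grid_refine T m.+1 j) grid_le //.
  exact: ltnW.
apply: ler_wpM2l => //; rewrite -powRM //; last first.
  by apply: le_trans h; rewrite ltW // step_gt0.
apply: ge0_ler_powR; rewrite ?nnegrE ?addr_ge0 ?(ltW a0) ?(ltW c0) //.
- by rewrite ltW // step_gt0.
- by rewrite mulr_ge0 //; apply: le_trans h; rewrite ltW // step_gt0.
- by rewrite [step T m]stepS ler_pM2l.
Qed.

End Tree.

(** Descend until a midpoint r separates the two points. The right part starts at r and falls under
    [tree_right]; the left part ends at r and does so after time reversal, which exchanges a and c.
    The constant counts two such parts and one defect. *)
Lemma tree_all psi a c e j m k p q : 0 < a -> 0 < c -> 0 <= e ->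
  (forall s u t, 0 <= s -> s <= u -> u <= t -> t <= T ->
    `|psi s t - psi s u - psi u t| <= e * (u - s) `^ a * (t - u) `^ c) ->
  (forall m k, (k < 2 ^ m)%N ->
    `|psi (grid T m k) (grid T m k.+1)| <= e * step T m `^ (a + c)) ->
  (k < 2 ^ m)%N -> (k * 2 ^ j <= p)%N -> (p <= q)%N -> (q <= k.+1 * 2 ^ j)%N ->
  `|psi (grid T (m + j) p) (grid T (m + j) q)| <=
    (2 * (2 `^ (a + c) * treeK (a + c)) + 1) * e *
    (grid T (m + j) q - grid T (m + j) p) `^ (a + c).
Proof.
move=> a0 c0 e0 defect cells.
pose phi s t := psi (T - t) (T - s).
have rev n l : (l <= 2 ^ n)%N -> T - grid T n l = grid T n (2 ^ n - l).
  by move=> l2; rewrite -[X in X - _](gridT T n) !gridE natrB //; ring.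
have defect' s u t : 0 <= s -> s <= u -> u <= t -> t <= T ->
    `|phi s t - phi s u - phi u t| <= e * (u - s) `^ c * (t - u) `^ a.
  move=> s0 su ut tT; rewrite /phi addrAC -[_ * _ `^ c * _]mulrAC.
  have -> : t - u = (T - u) - (T - t) by ring.
  have -> : u - s = (T - s) - (T - u) by ring.
  by apply: defect; lra.
have cells' n l : (l < 2 ^ n)%N ->
    `|phi (grid T n l) (grid T n l.+1)| <= e * step T n `^ (c + a).
  move=> ln; rewrite /phi rev // rev 1?ltnW // [c + a]addrC.
  by rewrite (_ : 2 ^ n - l = (2 ^ n - l.+1).+1)%N; [apply: cells; lia|lia].
have diag s : 0 <= s -> s <= T -> psi s s = 0 by exact: tree_diag a0 c0 defect s.
set K := 2 `^ (a + c) * treeK (a + c).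
have K0 : 0 <= K by apply: mulr_ge0; rewrite ?powR_ge0 // treeK_ge0 // addr_gt0.
elim: j m k => [|j IH] m k km kp pq qk.
  move: kp qk; rewrite !muln1 addn0 => kp qk.
  have [Epq|pN] := eqVneq p q.
    have qm : (q <= 2 ^ m)%N by lia.
    rewrite Epq diag ?(grid_ge0 T0) ?(grid_leT T0) // normr0.
    by rewrite mulr_ge0 ?powR_ge0 // mulr_ge0 // addr_ge0 // mulr_ge0.
  have -> : p = k by lia.
  have -> : q = k.+1 by lia.
  rewrite (_ : grid T m k.+1 - _ = step T m); last by rewrite gridS; ring.
  apply: le_trans (cells m k km) _; rewrite ler_wpM2r ?powR_ge0 // ler_peMl //.
  by rewrite lerDr mulr_ge0.
have k2 : (2 * k < 2 ^ m.+1)%N by rewrite expnS ltn_pmul2l.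
have k21 : ((2 * k).+1 < 2 ^ m.+1)%N by rewrite expnS; move: km; clear; lia.
have e1 : (k * 2 ^ j.+1 = 2 * k * 2 ^ j)%N by rewrite expnS; lia.
have e2 : (k.+1 * 2 ^ j.+1 = (2 * k).+2 * 2 ^ j)%N by rewrite expnS; lia.
rewrite (addnS m) -(addSn m).
have [ql|lq] := leqP q ((2 * k).+1 * 2 ^ j); first by apply: (IH m.+1 (2 * k)%N) => //; lia.
have [lp|pl] := leqP ((2 * k).+1 * 2 ^ j) p; first by apply: (IH m.+1 (2 * k).+1) => //; lia.
have q2 : (q <= 2 ^ (m.+1 + j))%N.
  by rewrite addSnnS expnD; apply: leq_trans qk _; exact: leq_mul.
have rE : grid T m.+1 (2 * k).+1 = grid T (m.+1 + j) ((2 * k).+1 * 2 ^ j).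
  by rewrite grid_refine.
have p2 := leq_trans pq q2.
set r := grid T m.+1 (2 * k).+1 in rE *.
set s := grid T (m.+1 + j) p; set t := grid T (m.+1 + j) q.
have s0 : 0 <= s by exact: grid_ge0.
have sr : s <= r by rewrite rE grid_le // ltnW.
have rt : r <= t by rewrite rE grid_le // ltnW.
have tT : t <= T by rewrite grid_leT.
have h1 : `|psi r t| <= K * e * (t - r) `^ (a + c).
  by apply: (tree_right a0 c0 e0 defect cells k21); rewrite -?e2 // ltnW.
have h2 : `|psi s r| <= K * e * (r - s) `^ (a + c).
  have h := tree_right c0 a0 e0 defect' cells' (j := j) (m := m.+1)
    (k := (2 ^ m.+1 - (2 * k).+1)%N) (l := (2 ^ (m.+1 + j) - p)%N).
  have e3 : T - grid T m.+1 (2 ^ m.+1 - (2 * k).+1) = r.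
    by rewrite rev ?leq_subr // subKn // ltnW.
  have e4 : T - grid T (m.+1 + j) (2 ^ (m.+1 + j) - p) = s.
    by rewrite rev ?leq_subr // subKn.
  move: h; rewrite /phi e3 e4 [c + a]addrC -/K.
  have -> : grid T (m.+1 + j) (2 ^ (m.+1 + j) - p) - grid T m.+1 (2 ^ m.+1 - (2 * k).+1) = r - s.
    by rewrite -e3 -e4; ring.
  apply.
  - by rewrite ltn_subrL expn_gt0.
  - by rewrite mulnBl -expnD leq_sub2l // ltnW.
  - by rewrite -(subSn (ltnW k21)) subSS mulnBl -expnD leq_sub2l // -e1.
have hd := defect s r t s0 sr rt tT.
have th0 : 0 <= a + c by rewrite addr_ge0 ?ltW.
have b1 : (t - r) `^ (a + c) <= (t - s) `^ (a + c).
  by apply: ge0_ler_powR; rewrite ?nnegrE ?subr_ge0 // ?(le_trans sr) // lerB.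
have b2 : (r - s) `^ (a + c) <= (t - s) `^ (a + c).
  by apply: ge0_ler_powR; rewrite ?nnegrE ?subr_ge0 // ?(le_trans sr) // lerB.
have b3 : (r - s) `^ a * (t - r) `^ c <= (t - s) `^ (a + c).
  rewrite powR_addr ?(ltW a0) ?(ltW c0) //; apply: ler_pM; rewrite ?powR_ge0 //.
    by apply: ge0_ler_powR; rewrite ?nnegrE ?subr_ge0 ?(ltW a0) // ?(le_trans sr) // lerB.
  by apply: ge0_ler_powR; rewrite ?nnegrE ?subr_ge0 ?(ltW c0) // ?(le_trans sr) // lerB.
have -> : psi s t = (psi s t - psi s r - psi r t) + psi s r + psi r t by ring.
apply: le_trans (ler_normD _ _) _; apply: le_trans (lerD (ler_normD _ _) (lexx _)) _.
apply: le_trans (lerD (lerD hd h2) h1) _.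
have Ke0 : 0 <= K * e by rewrite mulr_ge0.
have := lerD (lerD (ler_wpM2l e0 b3) (ler_wpM2l Ke0 b2)) (ler_wpM2l Ke0 b1).
rewrite mulrA => /le_trans; apply; rewrite le_eqVlt; apply/orP; left; apply/eqP; ring.
Qed.

Lemma chaining a c : 0 < a -> 0 < c -> exists2 K, 0 <= K &
  forall e psi, 0 <= e ->
  {within simplex, continuous (fun st => psi st.1 st.2)} ->
  (forall s u t, 0 <= s -> s <= u -> u <= t -> t <= T ->
    `|psi s t - psi s u - psi u t| <= e * (u - s) `^ a * (t - u) `^ c) ->
  (forall m k, (k < 2 ^ m)%N ->
    `|psi (grid T m k) (grid T m k.+1)| <= e * step T m `^ (a + c)) ->
  Hb T (a + c) (K * e) psi.
Proof.
move=> a0 c0; exists (2 * (2 `^ (a + c) * treeK (a + c)) + 1).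
  apply: addr_ge0 => //; apply: mulr_ge0 => //; apply: mulr_ge0; first exact: powR_ge0.
  by apply: treeK_ge0; rewrite addr_gt0.
set K := _ + 1 => e psi e0 cpsi defect cells.
have K0 : 0 <= K.
  apply: addr_ge0 => //; apply: mulr_ge0 => //; apply: mulr_ge0; first exact: powR_ge0.
  by apply: treeK_ge0; rewrite addr_gt0.
split; first by rewrite mulr_ge0.
apply: simplex_dyadic_le => //; [exact: mulr_ge0|by rewrite addr_ge0 ?ltW| |].
  exact: tree_diag a0 c0 defect.
move=> n k l kl ln; apply: (@tree_all psi a c e n 0%N 0%N k l) => //.
by rewrite mul1n.
Qed.

End Chaining.

(** * Iterated integrals of dyadic interpolations and their limits *)

Section Area.
Context {R : realType} (T : R).
Hypothesis T0 : 0 < T.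
Implicit Types (s t u : R) (n m k l j : nat) (x y : R -> R).

Local Notation grid := (grid T).
Local Notation step := (step T).
Local Notation pl := (pl T).

Definition dy n x y := YI (pl n x) (pl n y).

Lemma dy_chen n x y : chen_rel 0 T (dy n x y) (fun s u t => dl (pl n x) s u * dl (pl n y) u t).
Proof. by apply: YI_chen; have [] := lip_YI T0 (lip_pl T0 n x) (lip_pl T0 n y). Qed.

Lemma dy_cell n k x y s t : (k < 2 ^ n)%N -> grid n k <= s -> s <= t ->
  t <= grid n k.+1 -> dy n x y s t = dl (pl n x) s t * dl (pl n y) s t / 2.
Proof.
move=> kn ks st tk; apply: (YI_linear T0 (grid_ge0 T0 n k) _ (lip_pl T0 n x) (lip_pl T0 n y)
  _ _ ks st tk); first by rewrite (grid_leT T0).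
- exists (dl x (grid n k) (grid n k.+1) / step n) => s' t' h1 h2 h3.
  by rewrite (pl_lin T0 _ h1 h2 h3); ring.
- exists (dl y (grid n k) (grid n k.+1) / step n) => s' t' h1 h2 h3.
  by rewrite (pl_lin T0 _ h1 h2 h3); ring.
Qed.

Lemma dy_diag n x y s : 0 <= s -> s <= T -> dy n x y s s = 0.
Proof.
move=> s0 sT; have := dy_chen n x y s0 (lexx s) (lexx s) sT.
by rewrite /dl subrr mul0r addr0; lra.
Qed.

(** Between grid points the integral is the trapezoidal sum. This is a Stratonovich sum, and it
    differs from the Ito sum by half a discrete covariation. *)
Lemma dy_grid n x y k l : (k <= l)%N -> (l <= 2 ^ n)%N ->
  dy n x y (grid n k) (grid n l) =
  \sum_(k <= j < l) ((x (grid n j) - x (grid n k)) + (x (grid n j.+1) - x (grid n k))) / 2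
     * (y (grid n j.+1) - y (grid n j)).
Proof.
elim: l => [|l IH] kl ln.
  by move: kl; rewrite leqn0 => /eqP->; rewrite big_geq // dy_diag ?(grid_ge0 T0) ?(grid_leT T0).
move: kl; rewrite leq_eqVlt => /orP[/eqP->|kl].
  by rewrite big_geq // dy_diag ?(grid_ge0 T0) ?(grid_leT T0).
rewrite big_nat_recr //= -IH //; last exact: ltnW.
rewrite (dy_chen n x y (s := grid n k) (u := grid n l)) ?(grid_ge0 T0) ?(grid_le T0) ?(grid_leT T0) //.
by rewrite (@dy_cell n l x y (grid n l) (grid n l.+1)) ?(grid_le T0) // !(dl_pl_grid T0) // /dl; field.
Qed.

(* Passing from the grid of level n to level n+1 changes the discrete integral
   by the area of the triangle inscribed in each cell j. *)
Definition area_term n x y j :=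
  (dl x (grid n.+1 (2 * j)) (grid n.+1 (2 * j).+1) *
     dl y (grid n.+1 (2 * j).+1) (grid n.+1 (2 * j).+2) -
   dl x (grid n.+1 (2 * j).+1) (grid n.+1 (2 * j).+2) *
     dl y (grid n.+1 (2 * j)) (grid n.+1 (2 * j).+1)) / 2.

Lemma grid_double n j : grid n j = grid n.+1 (2 * j).
Proof. by rewrite -(grid_refine T n 1 j) addn1 expn1 mulnC. Qed.

Lemma grid_level n m p : (m <= n)%N -> grid m p = grid n (p * 2 ^ (n - m)).
Proof. by move=> mn; have := grid_refine T m (n - m) p; rewrite subnKC. Qed.

Lemma dy_succ n x y k l : (k <= l)%N -> (l <= 2 ^ n)%N ->
  dy n.+1 x y (grid n k) (grid n l) - dy n x y (grid n k) (grid n l) =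
  \sum_(k <= j < l) area_term n x y j.
Proof.
elim: l => [|l IH] kl ln.
  move: kl; rewrite leqn0 => /eqP->.
  by rewrite big_geq // !dy_diag ?(grid_ge0 T0) ?(grid_leT T0) ?subrr.
move: kl; rewrite leq_eqVlt => /orP[/eqP->|kl].
  by rewrite big_geq // !dy_diag ?(grid_ge0 T0) ?(grid_leT T0) ?subrr.
rewrite big_nat_recr //= -IH //; last exact: ltnW.
have le1 : grid n k <= grid n l by rewrite (grid_le T0).
have le2 : grid n l <= grid n l.+1 by rewrite (grid_le T0).
have leT : grid n l.+1 <= T by rewrite (grid_leT T0).
rewrite !(dy_chen _ x y (grid_ge0 T0 n k) le1 le2 leT).
rewrite (@dy_cell n l x y (grid n l) (grid n l.+1)) // !(dl_pl_grid T0) //.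
have E p q : dl (pl n.+1 p) (grid n q) = dl (pl n.+1 p) (grid n.+1 (2 * q)).
  by rewrite grid_double.
have E2 : (2 * l).+2 = (2 * l.+1)%N by rewrite mulnS.
have l2 : ((2 * l).+2 <= 2 ^ n.+1)%N by rewrite expnS E2 leq_mul2l.
have e1 : grid n l.+1 = grid n.+1 (2 * l).+2 by rewrite grid_double E2.
rewrite (_ : dl (pl n.+1 x) (grid n k) (grid n l) = dl x (grid n k) (grid n l)); last first.
  by rewrite (grid_double n k) (grid_double n l) (dl_pl_grid T0).
rewrite (_ : dl (pl n.+1 y) (grid n l) (grid n l.+1) = dl y (grid n l) (grid n l.+1)); last first.
  by rewrite (grid_double n l) (grid_double n l.+1) (dl_pl_grid T0).
have -> : dy n.+1 x y (grid n l) (grid n l.+1) =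
  dl x (grid n.+1 (2 * l)) (grid n.+1 (2 * l).+1) * dl y (grid n.+1 (2 * l)) (grid n.+1 (2 * l).+1) / 2
  + dl x (grid n.+1 (2 * l).+1) (grid n.+1 (2 * l).+2) * dl y (grid n.+1 (2 * l).+1) (grid n.+1 (2 * l).+2) / 2
  + dl x (grid n.+1 (2 * l)) (grid n.+1 (2 * l).+1) * dl y (grid n.+1 (2 * l).+1) (grid n.+1 (2 * l).+2).
  rewrite e1 [grid n l]grid_double.
  rewrite (dy_chen _ x y (u := grid n.+1 (2 * l).+1)) ?(grid_ge0 T0) ?(grid_le T0) ?(grid_leT T0) //.
  rewrite (@dy_cell n.+1 (2 * l) x y (grid n.+1 (2 * l)) (grid n.+1 (2 * l).+1)) ?(grid_le T0) //; last by rewrite ltnW.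
  rewrite (@dy_cell n.+1 (2 * l).+1 x y (grid n.+1 (2 * l).+1) (grid n.+1 (2 * l).+2)) ?(grid_le T0) //.
  by rewrite !(dl_pl_grid T0).
by rewrite /area_term e1 [grid n l]grid_double /dl; field.
Qed.


Definition fl n t := grid n (Num.truncn (t / step n)).

Lemma fl_itv n t : 0 <= t -> [/\ 0 <= fl n t, fl n t <= t & t < fl n t + step n].
Proof.
move=> t0; have d0 := step_gt0 T0 n.
have /truncn_itv/andP[h1 h2] : 0 <= t / step n by rewrite divr_ge0 // ltW.
split; first exact: grid_ge0.
  by rewrite /fl gridE -ler_pdivlMr.
by rewrite /fl -gridS gridE -ltr_pdivrMr.
Qed.

Lemma fl_mono n s t : 0 <= s -> s <= t -> fl n s <= fl n t.
Proof.
move=> s0 st; rewrite (grid_le T0); apply: le_truncn.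
by rewrite ler_pM2r // invr_gt0 (step_gt0 T0).
Qed.

Lemma fl_near t d : 0 <= t -> 0 < d -> \forall n \near \oo, `|fl n t - t| < d.
Proof.
move=> t0 d0; have [n0 hn] := step_powR_lt T0 ltr01 d0.
exists n0 => // n /= /hn; rewrite powRr1 ?(ltW (step_gt0 T0 n)) // => h.
by have [h1 h2 h3] := fl_itv n t0; rewrite ler0_norm; lra.
Qed.

Lemma simplex_fl (psi : R -> R -> R) s t : {within simplex T, continuous (fun st => psi st.1 st.2)} ->
  0 <= s -> s <= t -> t <= T -> psi (fl n s) (fl n t) @[n --> \oo] --> psi s t.
Proof.
move=> cpsi s0 st tT; apply/cvgrPdist_lt => e e0.
have [d d0 h] := simplex_near cpsi s0 st tT e0; have t0 := le_trans s0 st.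
near=> n; rewrite distrC; apply: h.
- by have [] := fl_itv n s0.
- exact: fl_mono.
- by have [_ h _] := fl_itv n t0; exact: le_trans h tT.
- by near: n; exact: fl_near.
- by near: n; exact: fl_near.
Unshelve. all: by end_near. Qed.

Lemma HP_fl a C x t : 0 < a -> HP T a C x -> 0 <= t -> t <= T ->
  x (fl n t) @[n --> \oo] --> x t.
Proof.
move=> a0 [C0 hx] t0 tT; apply/cvgrPdist_lt => e e0.
have C1 : 0 < C + 1 by lra.
have e1 : 0 < e / (C + 1) by rewrite divr_gt0.
have [n0 hn] := step_powR_lt T0 a0 e1; exists n0 => // n /= /hn h.
have [h1 h2 h3] := fl_itv n t0; apply: le_lt_trans (hx _ _ h1 h2 tT) _.
have h4 : (t - fl n t) `^ a <= step n `^ a.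
  by apply: ge0_ler_powR; rewrite ?nnegrE ?subr_ge0 ?(ltW a0) ?(ltW (step_gt0 T0 n)) //; lra.
move: h; rewrite ltr_pdivlMr // => h.
have := powR_ge0 (t - fl n t) a; nra.
Qed.

Section Criterion.
Variables (a c C q : R) (x y : R -> R) (Psi : R -> R -> R).
Hypotheses (a0 : 0 < a) (c0 : 0 < c) (C0 : 0 <= C) (q01 : 0 <= q < 1).
Hypotheses (cx : qcvg (HP T a) (fun n => pl n x) x) (cy : qcvg (HP T c) (fun n => pl n y) y).
Hypothesis cPsi : {within simplex T, continuous (fun st => Psi st.1 st.2)}.
Hypothesis area_le : forall n m k, (m <= n)%N -> (k < 2 ^ m)%N ->
  `|\sum_(k * 2 ^ (n - m) <= j < k.+1 * 2 ^ (n - m)) area_term n x y j| <=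
  C * step m `^ (a + c) * q ^+ n.
Hypothesis Psi_adh : forall m k l, (k <= l)%N -> (l <= 2 ^ m)%N -> forall e N, 0 < e ->
  exists2 n, (N <= n)%N & `|dy n x y (grid m k) (grid m l) - Psi (grid m k) (grid m l)| < e.

Let dy_succ_le n m k l : (m <= n)%N -> (k <= l)%N -> (l <= 2 ^ m)%N ->
  `|dy n.+1 x y (grid m k) (grid m l) - dy n x y (grid m k) (grid m l)| <=
  (l - k)%:R * (C * step m `^ (a + c)) * q ^+ n.
Proof.
move=> mn kl lm.
have E p : grid m p = grid n (p * 2 ^ (n - m)).
  exact: grid_level.
rewrite !E dy_succ; [|by rewrite leq_mul2r kl orbT|]; last first.
  by rewrite -[n in X in (_ <= X)%N](subnKC mn) expnD leq_mul2r lm orbT.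
elim: l kl lm => [|l IH] kl lm.
  by move: kl; rewrite leqn0 => /eqP->; rewrite mul0n big_geq // normr0 sub0n mul0r mul0r.
move: kl; rewrite leq_eqVlt => /orP[/eqP->|kl].
  by rewrite big_geq // normr0 subnn mul0r mul0r.
rewrite (@big_cat_nat _ _ _ (l * 2 ^ (n - m))) /=; [|by rewrite leq_mul2r -ltnS kl orbT|];
  last by rewrite leq_mul2r leqnSn orbT.
apply: le_trans (ler_normD _ _) _.
apply: le_trans (lerD (IH _ (ltnW lm)) (area_le mn lm)) _; first by rewrite -ltnS.
rewrite subSn; last by rewrite -ltnS.
by rewrite -[(l - k).+1%:R]natr1 mulrDl mulrDl mul1r.
Qed.

Let q1 : 0 < 1 - q. Proof. by move: q01 => /andP[_]; rewrite subr_gt0. Qed.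

(** The geometric bounds make the sequence Cauchy, so the cluster value given by [Psi_adh] must be
    its limit, with the tail of the geometric series as rate. *)
Lemma dy_Psi n m k l : (m <= n)%N -> (k <= l)%N -> (l <= 2 ^ m)%N ->
  `|dy n x y (grid m k) (grid m l) - Psi (grid m k) (grid m l)| <=
  (l - k)%:R * (C * step m `^ (a + c)) * q ^+ n / (1 - q).
Proof.
move=> mn kl lm; set D := _ * (C * _).
have D0 : 0 <= D by rewrite !mulr_ge0 ?powR_ge0.
have /andP[q0 _] := q01.
have H p : `|dy (n + p) x y (grid m k) (grid m l) - dy n x y (grid m k) (grid m l)| <=
    D * q ^+ n * (1 - q ^+ p) / (1 - q).
  elim: p => [|p IH]; first by rewrite addn0 subrr normr0 expr0 subrr mulr0 mul0r.
  have h := dy_succ_le (leq_trans mn (leq_addr p n)) kl lm.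
  rewrite addnS; set u := dy _.+1 _ _ _ _ in h *; set v := dy (n + p) _ _ _ _ in h IH.
  set z := dy n _ _ _ _ in IH *.
  have -> : u - z = (u - v) + (v - z) by ring.
  apply: le_trans (ler_normD _ _) _; apply: le_trans (lerD h IH) _.
  rewrite -/D exprD exprS le_eqVlt; apply/orP; left; apply/eqP; field.
  by rewrite gt_eqF.
apply/ler_addgt0Pr => e e0; have [p np hp] := Psi_adh kl lm n e0.
have := H (p - n)%N; rewrite subnKC // => h.
set u := dy n _ _ _ _ in h *; set v := dy p _ _ _ _ in h hp; set P := Psi _ _ in hp *.
have -> : u - P = - (v - u) + (v - P) by ring.
apply: le_trans (ler_normD _ _) _; rewrite normrN; apply: lerD; last exact: ltW.
apply: le_trans h _; rewrite ler_pM2r ?invr_gt0 //; apply: ler_piMr.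
  by apply: mulr_ge0 => //; exact: exprn_ge0.
by rewrite lerBlDr lerDl exprn_ge0.
Qed.

Let geo0 D e : 0 < e -> exists N, forall n, (N <= n)%N -> D * q ^+ n < e.
Proof.
move=> e0; have q1' : `|q| < 1 by have /andP[q0 ?] := q01; rewrite ger0_norm.
have := cvg_geometric D q1' => /cvgrPdist_lt/(_ _ e0)[N _ h]; exists N => n /h /=.
by rewrite sub0r normrN; apply: le_lt_trans; exact: ler_norm.
Qed.

(** Psi is only assumed continuous, without Chen's relation. The relation is inherited from the
    interpolations at dyadic times and then extended to all times by continuity in [Psi_chen]. *)
Let Psi_grid m k j l : (k <= j)%N -> (j <= l)%N -> (l <= 2 ^ m)%N ->
  Psi (grid m k) (grid m l) = Psi (grid m k) (grid m j) + Psi (grid m j) (grid m l)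
    + dl x (grid m k) (grid m j) * dl y (grid m j) (grid m l).
Proof.
move=> kj jl lm; apply/eqP; rewrite -subr_eq0; apply/eqP.
apply: eq_of_near => e e0; rewrite subr0.
pose D := 3 * ((l - k)%:R * (C * step m `^ (a + c)) / (1 - q)).
have [N hN] := geo0 D e0; pose n := maxn N m.
have mn : (m <= n)%N by rewrite leq_maxr.
have E p z : pl n z (grid m p) = z (grid m p).
  by rewrite (grid_level p mn) pl_grid.
have h1 := dy_Psi mn kj (leq_trans jl lm); have h2 := dy_Psi mn jl lm.
have h3 := dy_Psi mn (leq_trans kj jl) lm.
have := dy_chen n x y (grid_ge0 T0 m k) (u := grid m j) (t := grid m l).
rewrite !(grid_le T0) (grid_leT T0) => /(_ kj jl lm).
rewrite /dl !E -/(dl _ _ _) -/(dl _ _ _) => ch.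
set P1 := Psi (grid m k) (grid m l) in h3 *; set P2 := Psi _ _ in h1 *; set P3 := Psi _ _ in h2 *.
set A1 := dy n x y _ _ in h3 ch *; set A2 := dy n x y _ _ in h1 ch *.
set A3 := dy n x y _ _ in h2 ch *.
have -> : P1 - (P2 + P3 + dl x (grid m k) (grid m j) * dl y (grid m j) (grid m l)) =
  (A2 - P2) + (A3 - P3) - (A1 - P1) by rewrite ch; ring.
apply: le_trans (ler_normB _ _) _; apply: le_trans (lerD (ler_normD _ _) (lexx _)) _.
apply: le_trans (lerD (lerD h1 h2) h3) _; apply: le_trans _ (ltW (hN n (leq_maxl _ _))).
have Q0 : 0 <= C * step m `^ (a + c) * q ^+ n / (1 - q).
  by have /andP[q0 _] := q01; rewrite !mulr_ge0 ?powR_ge0 ?exprn_ge0 // invr_ge0 ltW.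
set Q := _ / (1 - q) in Q0.
have QE (i : R) : i * (C * step m `^ (a + c)) * q ^+ n / (1 - q) = i * Q by rewrite /Q; ring.
rewrite !QE (_ : D * q ^+ n = 3 * ((l - k)%:R * Q)); last by rewrite /D /Q; ring.
have i1 : (j - k)%:R * Q <= (l - k)%:R * Q by rewrite ler_wpM2r // ler_nat leq_sub2r.
have i2 : (l - j)%:R * Q <= (l - k)%:R * Q by rewrite ler_wpM2r // ler_nat leq_sub2l.
by lra.
Qed.

Let Psi_chen s u t : 0 <= s -> s <= u -> u <= t -> t <= T ->
  Psi s t = Psi s u + Psi u t + dl x s u * dl y u t.
Proof.
move=> s0 su ut tT; have u0 := le_trans s0 su; have t0 := le_trans u0 ut.
have uT := le_trans ut tT; have sT := le_trans su uT; have st := le_trans su ut.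
have [[Cx hx] _] := cx; have [[Cy hy] _] := cy.
have lx r : 0 <= r -> r <= T -> x (fl n r) @[n --> \oo] --> x r.
  by move=> r0 rT; exact: HP_fl a0 hx r0 rT.
have ly r : 0 <= r -> r <= T -> y (fl n r) @[n --> \oo] --> y r.
  by move=> r0 rT; exact: HP_fl c0 hy r0 rT.
have h1 := simplex_fl cPsi s0 st tT; apply: cvg_unique h1 _ => //.
rewrite (_ : (fun n => Psi (fl n s) (fl n t)) = (fun n => Psi (fl n s) (fl n u)
  + Psi (fl n u) (fl n t) + dl x (fl n s) (fl n u) * dl y (fl n u) (fl n t))); last first.
  apply/funext => n; have f1 := fl_mono n s0 su; have f2 := fl_mono n u0 ut.
  have [_ f3 _] := fl_itv n t0.
  apply: Psi_grid; rewrite -?(grid_le T0 n) //.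
  by rewrite gridT; exact: le_trans f3 tT.
apply: cvgD; first by apply: cvgD; exact: simplex_fl.
by apply: cvgM; apply: cvgB; [exact: lx|exact: lx|exact: ly|exact: ly].
Qed.

Let dy_simplex n : {within simplex T, continuous (fun st => dy n x y st.1 st.2)}.
Proof.
have [L [L0 hL]] := lip_pl T0 n x; have [M [M0 hM]] := lip_pl T0 n y.
have [_ [D hD]] := lip_YI T0 (lip_pl T0 n x) (lip_pl T0 n y).
have b1 : 1 <= 3 / 4 + 3 / 4 :> R by lra.
apply: (continuous_two_chen T0 ltr01 b1 (dy_chen n x y) hD (D := L * M)).
  exact: mulr_ge0.
move=> s u t s0 su ut tT; rewrite normrM.
apply: le_trans (ler_pM _ _ (hL s u s0 su (le_trans ut tT)) (hM u t (le_trans s0 su) ut tT)) _ => //.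
by rewrite mulrACA mulrA.
Qed.

(** Chaining is applied to Psi - [dy n x y]. Its defect is a difference of products of increments,
    small because the interpolations converge at the first level; its values on dyadic cells remain
    to be estimated. *)
Lemma area_cvg : a + c <= 1 -> qcvg (Hb T (a + c)) (fun n => dy n x y) Psi.
Proof.
move=> ac1; have [[Cx [Cx0 hx]] lx] := cx; have [[Cy [Cy0 hy]] ly] := cy.
have [K K0 hK] := chaining T0 a0 c0.
have ac0 : 0 <= a + c by rewrite addr_ge0 ?ltW.
have /andP[q0 _] := q01.
have key e : 0 < e -> exists n0, forall n, (n0 <= n)%N -> Hb T (a + c) e (Psi - dy n x y).
  move=> e0; have K1 : 0 < K + 1 by lra.
  (* M - 2 = Cx + Cy + 1 is the constant in the difference of products below, where d <= 1 bounds
     the quadratic error term. *)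
  pose M := Cx + Cy + 3.
  have M0 : 0 < M by rewrite /M; lra.
  pose d := Num.min 1 (e / ((K + 1) * (2 * M))).
  have d0 : 0 < d by rewrite lt_min ltr01 divr_gt0 ?mulr_gt0.
  have d1 : d <= 1 by rewrite ge_min lexx.
  have dM : (K + 1) * (2 * M * d) <= e.
    rewrite mulrA mulrC -ler_pdivlMr ?mulr_gt0 //.
    by rewrite ge_min lexx orbT.
  have [n1 h1] := lx d d0; have [n2 h2] := ly d d0.
  have [n3 h3] := geo0 (C / (1 - q)) d0.
  exists (maxn n1 (maxn n2 n3)) => n; rewrite !geq_max => /and3P[/h1 kx /h2 ky /h3 kq].
  have [_ {}kx] := kx; have [_ {}ky] := ky.
  have e1 : 0 <= 2 * M * d by rewrite !mulr_ge0 ?ltW.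
  apply: (@Hb_mono _ _ _ (K * (2 * M * d))).
    by apply: le_trans dM; rewrite ler_wpM2r // lerDl.
  have prod_diff s u r t : 0 <= s -> s <= u -> u <= T -> 0 <= r -> r <= t -> t <= T ->
      `|dl x s u * dl y r t - dl (pl n x) s u * dl (pl n y) r t| <=
      (M - 2) * d * (u - s) `^ a * (t - r) `^ c.
    move=> s0 su uT r0 rt tT.
    have := kx s u s0 su uT; have := ky r t r0 rt tT; rewrite !dlB !fctE => hy' hx'.
    have hxx := hx s u s0 su uT; have hyy := hy r t r0 rt tT.
    set X := dl x s u in hx' hxx *; set X' := dl (pl n x) s u in hx' *.
    set Y := dl y r t in hy' hyy *; set Y' := dl (pl n y) r t in hy' *.
    set A := (u - s) `^ a in hx' hxx *; set B := (t - r) `^ c in hy' hyy *.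
    have A0 : 0 <= A by exact: powR_ge0.
    have B0 : 0 <= B by exact: powR_ge0.
    have -> : X * Y - X' * Y' = - ((X' - X) * Y + X * (Y' - Y) + (X' - X) * (Y' - Y)) by ring.
    rewrite normrN; apply: le_trans (ler_normD _ _) _.
    apply: le_trans (lerD (ler_normD _ _) (lexx _)) _; rewrite !normrM.
    have p1 : `|X' - X| * `|Y| <= (d * A) * (Cy * B) by exact: ler_pM.
    have p2 : `|X| * `|Y' - Y| <= (Cx * A) * (d * B) by exact: ler_pM.
    have p3 : `|X' - X| * `|Y' - Y| <= (d * A) * (1 * B).
      by apply: ler_pM => //; apply: le_trans hy' _; rewrite ler_wpM2r.
    have -> : (M - 2) * d * A * B = (d * A) * (Cy * B) + (Cx * A) * (d * B) + (d * A) * (1 * B).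
      by rewrite /M; ring.
    by rewrite !lerD.
  have tail m k : (k < 2 ^ m)%N -> (n <= m)%N ->
      `|dy m x y (grid m k) (grid m k.+1) - Psi (grid m k) (grid m k.+1)| <=
      d * step m `^ (a + c).
    move=> km nm; have := dy_Psi (leqnn m) (leqnSn k) km.
    rewrite subSnn mul1r => /le_trans; apply.
    have -> : C * step m `^ (a + c) * q ^+ m / (1 - q) =
      C / (1 - q) * q ^+ m * step m `^ (a + c) by ring.
    rewrite ler_wpM2r ?powR_ge0 //; apply: le_trans (ltW kq).
    by rewrite ler_wpM2l ?divr_ge0 ?(ltW q1) // ler_wiXn2l // -subr_ge0 ltW.
  apply: hK => //.
  - by move=> st; apply: cvgB; [exact: cPsi|exact: dy_simplex].
  - move=> s u t s0 su ut tT; rewrite !fctE (Psi_chen s0 su ut tT) (dy_chen n x y s0 su ut tT).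
    set P1 := Psi s u; set P2 := Psi u t; set D1 := dy n x y s u; set D2 := dy n x y u t.
    set Z1 := dl x s u * _; set Z2 := dl (pl n x) _ _ * _.
    have -> : P1 + P2 + Z1 - (D1 + D2 + Z2) - (P1 - D1) - (P2 - D2) = Z1 - Z2 by ring.
    apply: le_trans (prod_diff s u u t s0 su (le_trans ut tT) (le_trans s0 su) ut tT) _.
    do 3 (apply: ler_wpM2r; first by rewrite ?powR_ge0 // ltW).
    by move: M0; lra.
  - move=> m k km; rewrite !fctE.
    have S0 : 0 <= step m `^ (a + c) by exact: powR_ge0.
    have S0d : 0 <= d * step m `^ (a + c) by rewrite mulr_ge0 // ltW.
    have M2 : d * step m `^ (a + c) <= 2 * M * d * step m `^ (a + c).
      by rewrite -[leRHS]mulrA ler_peMl // /M; lra.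
    (* On cells not finer than the grid of level n the geometric tail suffices. On finer cells both
       integrals, of level n and of level m, are half a product of increments; they differ little,
       and the one of level m is close to Psi. *)
    have [mn|/ltnW nm] := leqP m n.
      have := dy_Psi mn (leqnSn k) km; rewrite subSnn mul1r distrC => /le_trans; apply.
      apply: le_trans M2.
      have -> : C * step m `^ (a + c) * q ^+ n / (1 - q) =
        C / (1 - q) * q ^+ n * step m `^ (a + c) by ring.
      by rewrite ler_wpM2r // ltW.
    pose k' := (k %/ 2 ^ (m - n))%N.
    have p2 : (0 < 2 ^ (m - n))%N by rewrite expn_gt0.
    have k1 : grid n k' <= grid m k by rewrite (grid_level _ nm) (grid_le T0) leq_trunc_div.
    have k2 : grid m k.+1 <= grid n k'.+1 by rewrite (grid_level _ nm) (grid_le T0) ltn_ceil.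
    have kk : grid m k <= grid m k.+1 by rewrite (grid_le T0).
    have k'n : (k' < 2 ^ n)%N by rewrite ltn_divLR // -expnD subnKC.
    have kT : grid m k.+1 <= T by rewrite (grid_leT T0).
    have k0 := grid_ge0 T0 m k.
    have := tail m k km nm; rewrite distrC.
    have := prod_diff _ _ _ _ k0 kk kT k0 kk kT.
    have -> : grid m k.+1 - grid m k = step m by rewrite gridS; ring.
    rewrite -mulrA -powR_addr ?(ltW a0) ?(ltW c0) //.
    rewrite (dy_cell _ _ k'n k1 kk k2) (dy_cell _ _ km (lexx _) kk (lexx _)) !(dl_pl_grid T0).
    set P := Psi _ _; set Z1 := dl x _ _ * dl y _ _; set Z2 := dl (pl n x) _ _ * _ => b1 b2.
    have -> : P - Z2 / 2 = (P - Z1 / 2) + (Z1 - Z2) / 2 by field.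
    apply: le_trans (ler_normD _ _) _; rewrite normrM [`|2^-1|]ger0_norm //.
    have -> : 2 * M * d * step m `^ (a + c) = 2 * M * (d * step m `^ (a + c)) by ring.
    move: b1; rewrite -mulrA; set V := d * _ in b2 S0d *.
    have : 3 * V <= M * V by rewrite ler_wpM2r // /M; lra.
    lra.
have aC0 : 0 <= a + c by rewrite addr_ge0 ?ltW.
split.
  have [n0 h0] := key 1 ltr01; have h := h0 n0 (leqnn _).
  have [_ [D hD]] := lip_YI T0 (lip_pl T0 n0 x) (lip_pl T0 n0 y).
  have ac3 : a + c <= 3 / 4 + 3 / 4 by lra.
  have hD' := Hb_weaken aC0 ac3 (ltW T0) hD.
  rewrite (_ : Psi = (Psi - dy n0 x y) + dy n0 x y); last by rewrite subrK.
  by eexists; exact: HbD h hD'.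
move=> e /key[n0 h]; exists n0 => n /h; rewrite -opprB; exact: HbN.
Qed.

End Criterion.
End Area.

(** * Gaussian moments and the second chaos *)

Section Normal.
Context {R : realType}.
Local Notation mu := (@lebesgue_measure R).
Implicit Types (m s x y : R).

Lemma ge0_integral_normal m s (f : R -> \bar R) : measurable_fun [set: R] f ->
  (forall x, (0 <= f x)%E) ->
  (\int[normal_prob m s]_x f x = \int[mu]_x (f x * (normal_pdf m s x)%:E))%E.
Proof.
move=> mf f0; have dom := normal_prob_dominates m s.
rewrite -(Radon_Nikodym_SigmaFinite.change_of_variables dom f0 measurableT mf).
have iRN := Radon_Nikodym_SigmaFinite.f_integrable dom.
have ip := integrable_normal_pdf m s.
apply: ae_eq_integral => //.
- by apply: emeasurable_funM => //; exact: measurable_int iRN.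
- by apply: emeasurable_funM => //; exact: measurable_int ip.
- apply: ae_eqe_mul2l => /=; apply: integral_ae_eq => //=.
  + exact: measurable_int ip.
  + move=> E E01 mE.
    by rewrite -(Radon_Nikodym_SigmaFinite.f_integral dom mE).
Qed.

Lemma pow_le_expR (z : R) k : 0 <= z -> z ^+ k <= k%:R ^+ k * expR z.
Proof.
move=> z0; case: k => [|k].
  by rewrite !expr0 mul1r -[leLHS]expR0 ler_expR.
have k0 : 0 < k.+1%:R :> R by [].
have h : z / k.+1%:R <= expR (z / k.+1%:R).
  by apply: le_trans (expR_ge1Dx _); rewrite lerDr.
have -> : expR z = expR (z / k.+1%:R) ^+ k.+1.
  by rewrite -expRM_natl -mulr_natl mulrCA divff ?mulr1 // gt_eqF.
rewrite -exprMn lerXn2r ?nnegrE ?mulr_ge0 ?expR_ge0 //.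
by rewrite -ler_pdivrMl // mulrC.
Qed.

(** Doubling the deviation gains a factor exp(3 y^2 / (8 s^2)) with y = x - m, which absorbs any
    power of y. Thus every moment integrand is dominated by a normal density. *)
Lemma normal_moment_bound m s n : s != 0 -> exists2 C, 0 <= C & forall x,
  `|(x - m) ^+ n * normal_pdf m s x| <= C * normal_pdf m (2 * s) x.
Proof.
move=> s0; have s20 : 2 * s != 0 by rewrite mulf_neq0.
have p1 := normal_peak_gt0 s0; have p2 := normal_peak_gt0 s20.
have ss : 0 < s ^+ 2 by rewrite exprn_even_gt0.
pose K := (8 * s ^+ 2 / 3) ^+ n * n%:R ^+ n.
have K0 : 0 <= K by rewrite mulr_ge0 ?exprn_ge0 // divr_ge0 // mulr_ge0 // ltW.
exists ((1 + K) * normal_peak s / normal_peak (2 * s)).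
  by apply: divr_ge0; [apply: mulr_ge0; [exact: addr_ge0|exact: ltW]|exact: ltW].
move=> x; rewrite !normal_pdfE //; set y := x - m.
have -> : (1 + K) * normal_peak s / normal_peak (2 * s) * (normal_peak (2 * s) * normal_fun m (2 * s) x)
  = normal_peak s * ((1 + K) * normal_fun m (2 * s) x).
  by field; rewrite gt_eqF.
rewrite normrM normrX normrM (ger0_norm (normal_fun_ge0 _ _ _)) (ger0_norm (ltW p1)).
rewrite mulrCA ler_wpM2l ?(ltW p1) //.
pose z := 3 * y ^+ 2 / (8 * s ^+ 2).
have z0 : 0 <= z by apply: divr_ge0; rewrite mulr_ge0 ?sqr_ge0.
have e1 : 1 <= expR z by rewrite -[leLHS]expR0 ler_expR.
have yn : `|y| ^+ n <= (1 + K) * expR z.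
  have y2 : (y ^+ 2) ^+ n <= K * expR z.
    have -> : y ^+ 2 = 8 * s ^+ 2 / 3 * z by rewrite /z; field.
    rewrite exprMn /K -[leRHS]mulrA; apply: ler_wpM2l; last exact: pow_le_expR.
    by rewrite exprn_ge0 // divr_ge0 // mulr_ge0 // ltW.
  rewrite mulrDl mul1r; have [y1|y1] := leP `|y| 1.
    apply: le_trans (_ : 1 <= _); first by rewrite exprn_ile1.
    by rewrite -[leLHS]addr0 lerD // mulr_ge0 // expR_ge0.
  rewrite -[leLHS]add0r lerD ?expR_ge0 //; apply: le_trans y2.
  rewrite -(real_normK (num_real y)) -exprM; apply: ler_weXn2l; first exact: ltW.
  by rewrite leq_pmull.
apply: le_trans (ler_wpM2r (normal_fun_ge0 m s x) yn) _.
rewrite -mulrA ler_wpM2l ?addr_ge0 // /normal_fun -expRD ler_expR -/y /z.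
rewrite le_eqVlt; apply/orP; left; apply/eqP; field.
by rewrite s0.
Qed.

Lemma measurable_center_pow m n : measurable_fun setT (fun x => (x - m) ^+ n).
Proof. by apply: measurable_funX; apply: measurable_funB. Qed.

Lemma integrable_normal_moment m s n : s != 0 ->
  mu.-integrable setT (fun x => ((x - m) ^+ n * normal_pdf m s x)%:E).
Proof.
move=> s0; have [C C0 hC] := normal_moment_bound m n s0.
have i2 := integrableZl measurableT C (integrable_normal_pdf m (2 * s)).
apply: le_integrable i2 => //.
- apply/measurable_EFinP; apply: measurable_funM; first exact: measurable_center_pow.
  exact: measurable_normal_pdf.
- move=> x _; rewrite -EFinM !abse_EFin lee_fin.
  apply: le_trans (hC x) _; exact: ler_norm.
Qed.

Lemma normal_pdf_derive m s x k : s != 0 ->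
  is_derive x 1 (fun x => (x - m) ^+ k * normal_pdf m s x)
    (- (s ^+ 2)^-1 * (((x - m) ^+ k.+1 - k%:R * s ^+ 2 * (x - m) ^+ k.-1) * normal_pdf m s x)).
Proof.
move=> s0; rewrite normal_pdfE // /normal_fun; set pk := normal_peak s.
have dy : is_derive x (1 : R) (fun x => x - m) 1.
  have := is_deriveB (is_derive_id x (1 : R)) (is_derive_cst m x (1 : R)).
  by rewrite subr0.
have dk n : is_derive x (1 : R) (fun x => (x - m) ^+ n) (n%:R * (x - m) ^+ n.-1).
  have := is_deriveX n dy; rewrite exprfctE /= => h.
  by apply: is_derive_eq h _; rewrite /GRing.scale /= mulr1.
have de : is_derive x (1 : R) (fun x => - (x - m) ^+ 2 / (s ^+ 2 *+ 2))
    (- (x - m) / s ^+ 2).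
  have := is_deriveM (is_deriveN (dk 2)) (is_derive_cst (s ^+ 2 *+ 2)^-1 x (1 : R)) => h.
  apply: is_derive_eq h _; rewrite /GRing.scale /= mulr0 add0r expr1.
  by field.
have dE : is_derive x (1 : R) (fun x => pk * expR (- (x - m) ^+ 2 / (s ^+ 2 *+ 2)))
    (pk * (expR (- (x - m) ^+ 2 / (s ^+ 2 *+ 2)) * (- (x - m) / s ^+ 2))).
  have h := is_deriveZ pk (is_derive1_comp (is_derive_expR _) de).
  exact: is_derive_eq h _.
have h := is_deriveM (dk k) dE.
apply: is_derive_eq h _; rewrite /GRing.scale /= [_ ^+ k.+1]exprS.
set e := expR _; set y := x - m; set p := y ^+ k; set p' := y ^+ k.-1.
by field.
Qed.

Lemma integrable_moment_rec m s k : s != 0 -> mu.-integrable setT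
  (fun x => (((x - m) ^+ k.+1 - k%:R * s ^+ 2 * (x - m) ^+ k.-1) * normal_pdf m s x)%:E).
Proof.
move=> s0; have h1 := integrable_normal_moment m k.+1 s0.
have h2 := integrableZl measurableT (k%:R * s ^+ 2) (integrable_normal_moment m k.-1 s0).
have := integrableB measurableT h1 h2; apply: eq_integrable => // x _ /=.
by rewrite -EFinD; congr (_%:E); ring.
Qed.

(** Integration by parts: the integrand is the derivative of - s^2 (x - m)^k times the density. For
    k = 0 the truncated exponent is harmless, as its coefficient is 0. *)
Lemma normal_moment_rec m s k : s != 0 ->
  (\int[mu]_x (((x - m) ^+ k.+1 - k%:R * s ^+ 2 * (x - m) ^+ k.-1) * normal_pdf m s x)%:E = 0)%E.
Proof.
move=> s0; set f := fun x => ((x - m) ^+ k.+1 - k%:R * s ^+ 2 * (x - m) ^+ k.-1) * normal_pdf m s x.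
have fint : mu.-integrable setT (EFin \o f) by exact: integrable_moment_rec.
pose G x := - s ^+ 2 * ((x - m) ^+ k * normal_pdf m s x).
have dG x : is_derive x (1 : R) G (f x).
  have := is_deriveZ (- s ^+ 2) (normal_pdf_derive m x k s0) => h.
  apply: is_derive_eq h _; rewrite /GRing.scale /= /f; set p := _ * normal_pdf _ _ _.
  by field.
have cf : continuous f.
  move=> x; apply: cvgM; last exact: continuous_normal_pdf.
  have cp n : (y - m) ^+ n @[y --> x] --> (x - m) ^+ n.
    apply: (cvg_comp (fun y => y - m) (fun y => y ^+ n)); last exact: exprn_continuous.
    by apply: (@cvgB _ R^o); [exact: cvg_id|exact: cvg_cst].
  by apply: (@cvgB _ R^o); [exact: cp|apply: cvgM; [exact: cvg_cst|exact: cp]].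
have FTC (N : nat) : (0 < N)%N ->
    (\int[mu]_(x in `[(- N%:R)%R, (N%:R)%R]) (f x)%:E = (G N%:R - G (- N%:R))%R%:E)%E.
  move=> N0; have NN : - N%:R < N%:R :> R by have : 0 < N%:R :> R; [rewrite ltr0n|lra].
  rewrite EFinB; apply: continuous_FTC2 => //.
  - exact: continuous_subspaceT.
  - split=> [x _| |]; first exact: ex_derive.
      by apply: cvg_at_right_filter; apply: differentiable_continuous; apply/derivable1_diffP; exact: ex_derive.
    by apply: cvg_at_left_filter; apply: differentiable_continuous; apply/derivable1_diffP; exact: ex_derive.
  - by move=> x _; rewrite derive1E; exact: derive_val.
pose f_ N x := ((f \_ `[- N%:R, N%:R]) x)%:E.
have lim1 : (\int[mu]_x f_ N x @[N --> \oo] --> \int[mu]_x (f x)%:E)%E.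
  have mf : measurable_fun setT f by exact: continuous_measurable_fun.
  have [//|||||_ _] := @dominated_convergence _ _ _ mu setT measurableT f_ (EFin \o f)
    (fun x => `|f x|%:E).
  - move=> N; apply/measurable_EFinP/(measurable_restrictT _ _).1 => //.
    exact: measurable_funTS.
  - exact/measurable_EFinP.
  - apply: aeW => x _; apply: cvg_near_cst; exists (Num.truncn `|x|).+1 => // N /= xN.
    rewrite /f_ patchE ifT // inE /= in_itv /= -ler_norml.
    apply: le_trans (ltW (truncnS_gt _)) _; by rewrite ler_nat.
  - exact: integrable_abse fint.
  - apply: aeW => x N _; rewrite /f_ lee_fin patchE; case: ifP => // _; by rewrite normr0.
  - exact.
have [C C0 hC] := normal_moment_bound m k.+1 s0.
(* A bound for |x - m| |G x|, taken from the moment of order k + 1: the boundary terms decay like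
   1/|x|. *)
pose D := s ^+ 2 * (C * normal_peak (2 * s)).
have s20 : 2 * s != 0 by rewrite mulf_neq0.
have D0 : 0 <= D by apply: mulr_ge0; [exact: sqr_ge0|apply: mulr_ge0; [|exact: normal_peak_ge0]].
have Gb x : `|x - m| * `|G x| <= D.
  rewrite /G normrM normrN (ger0_norm (sqr_ge0 _)) mulrCA ler_wpM2l ?sqr_ge0 //.
  rewrite -normrM mulrA -exprS; apply: le_trans (hC x) _.
  by rewrite ler_wpM2l // normal_pdf_ub.
have lim2 : (G N%:R - G (- N%:R)) @[N --> \oo] --> (0 : R).
  apply/cvgrPdist_lt => e e0; pose x0 := `|m| + 2 * D / e + 1.
  exists (Num.truncn x0).+1 => // N /= xN.
  have hN : x0 < N%:R by apply: lt_le_trans (truncnS_gt _) _; rewrite ler_nat.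
  have De : 0 <= 2 * D / e by apply: divr_ge0; [exact: mulr_ge0|exact: ltW].
  have small x : `|x| = N%:R -> `|G x| < e / 2.
    move=> xE; have h1 : 2 * D / e < `|x - m|.
      have := lerB_dist x m; rewrite xE; move: hN; rewrite /x0; lra.
    have p0 : 0 < `|x - m| by exact: le_lt_trans h1.
    rewrite -(ltr_pM2l p0); apply: le_lt_trans (Gb x) _.
    by move: h1; rewrite ltr_pdivrMr //; lra.
  rewrite sub0r normrN; apply: le_lt_trans (ler_normB _ _) _.
  have h1 : `|G N%:R| < e / 2 by apply: small; rewrite ger0_norm.
  have h2 : `|G (- N%:R)| < e / 2 by apply: small; rewrite normrN ger0_norm.
  lra.
have lim3 : (\int[mu]_x f_ N x @[N --> \oo] --> 0%:E)%E.
  have : (G N%:R - G (- N%:R))%:E @[N --> \oo] --> 0%:E by apply: cvg_EFin => //; exact: nearW.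
  apply: cvg_trans; apply: near_eq_cvg; exists 1%N => // N /= N0.
  by rewrite -FTC // integral_mkcond; apply: eq_integral => x _; rewrite /f_ restrict_EFin.
exact: (cvg_unique _ lim1 lim3).
Qed.

End Normal.

(** * Variables with all moments, and centred Gaussian laws *)

Section Moments.
Context {d : measure_display} {Omega : measurableType d} {R : realType}
  (P : probability Omega R).
Implicit Types (X Y Z : Omega -> R).

(** These variables form an algebra, so expectations of polynomials can be manipulated without
    renewed integrability checks. *)
Definition LP X := measurable_fun setT X /\
  forall n, P.-integrable setT (fun w => (X w ^+ n)%:E).

Definition Ex X : R := fine (\int[P]_w (X w)%:E)%E.

Lemma LP_int X : LP X -> P.-integrable setT (fun w => (X w)%:E).
Proof. by move=> [_ /(_ 1%N)]. Qed.

Lemma integrable_dom X Y : measurable_fun setT X -> P.-integrable setT (fun w => (Y w)%:E) ->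
  (forall w, `|X w| <= Y w) -> P.-integrable setT (fun w => (X w)%:E).
Proof.
move=> mX iY XY; apply: le_integrable iY => //; first exact/measurable_EFinP.
by move=> w _; rewrite !abse_EFin lee_fin; apply: le_trans (XY w) _; exact: ler_norm.
Qed.

Lemma LP_cst c : LP (fun _ => c).
Proof.
split; first exact: measurable_cst.
move=> n; exact: finite_measure_integrable_cst.
Qed.

Lemma LP_pow_int X Y i j : LP X -> LP Y -> P.-integrable setT (fun w => (X w ^+ i * Y w ^+ j)%:E).
Proof.
move=> [mX iX] [mY iY].
have := integrableD measurableT (iX (2 * i)%N) (iY (2 * j)%N) => h.
apply: (@integrable_dom _ (fun w => X w ^+ (2 * i) + Y w ^+ (2 * j))).
- by apply: measurable_funM; exact: measurable_funX.
- exact: h.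
- move=> w; rewrite normrM !normrX mulnC exprM mulnC exprM.
  rewrite -[X w ^+ i ^+ 2]real_normK ?num_real // -[Y w ^+ j ^+ 2]real_normK ?num_real //.
  rewrite !normrX; set x := `|X w| ^+ i; set y := `|Y w| ^+ j.
  have xy0 : 0 <= x * y by rewrite mulr_ge0 ?exprn_ge0.
  by have := sqr_ge0 (x - y); rewrite sqrrB; lra.
Qed.

Lemma LPD X Y : LP X -> LP Y -> LP (fun w => X w + Y w).
Proof.
move=> lX lY; split; first by apply: measurable_funD; [case: lX|case: lY].
move=> n; rewrite (_ : (fun w => _) = (fun w => \sum_(i < n.+1)
    (('C(n, i))%:R%:E * (X w ^+ (n - i) * Y w ^+ i)%:E))%E).
  by apply: integrable_sum => // i _; apply: integrableZl => //; exact: LP_pow_int.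
apply/funext => w; rewrite exprDn -sumEFin; apply: eq_bigr => i _.
by rewrite -EFinM mulr_natl.
Qed.

Lemma LPM X Y : LP X -> LP Y -> LP (fun w => X w * Y w).
Proof.
move=> lX lY; split; first by apply: measurable_funM; [case: lX|case: lY].
by move=> n; under eq_fun do rewrite exprMn; exact: LP_pow_int.
Qed.

Lemma LPZ c X : LP X -> LP (fun w => c * X w).
Proof. by move=> lX; apply: LPM => //; exact: LP_cst. Qed.

Lemma LPB X Y : LP X -> LP Y -> LP (fun w => X w - Y w).
Proof.
move=> lX lY; rewrite (_ : (fun w => _) = (fun w => X w + (-1) * Y w)).
  by apply: LPD => //; exact: LPZ.
by apply/funext => w; rewrite mulN1r.
Qed.

Lemma LPX X n : LP X -> LP (fun w => X w ^+ n).
Proof.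
move=> lX; elim: n => [|n IH].
  by under eq_fun do rewrite expr0; exact: LP_cst.
by under eq_fun do rewrite exprS; exact: LPM.
Qed.

Lemma LP_sum (I : Type) (r : seq I) (p : pred I) (F : I -> Omega -> R) : (forall i, LP (F i)) ->
  LP (fun w => \sum_(i <- r | p i) F i w).
Proof.
move=> lF; elim: r => [|i r IH].
  by under eq_fun do rewrite big_nil; exact: LP_cst.
under eq_fun do rewrite big_cons; case: (p i) => //.
exact: LPD.
Qed.

Lemma LP_prod (I : Type) (r : seq I) (F : I -> Omega -> R) : (forall i, LP (F i)) ->
  LP (fun w => \prod_(i <- r) F i w).
Proof.
move=> lF; elim: r => [|i r IH].
  by under eq_fun do rewrite big_nil; exact: LP_cst.
by under eq_fun do rewrite big_cons; exact: LPM.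
Qed.

Lemma Ex_fin X : P.-integrable setT (fun w => (X w)%:E) -> (\int[P]_w (X w)%:E)%E = (Ex X)%:E.
Proof. by move=> iX; rewrite /Ex fineK //; exact: integrable_fin_num iX. Qed.

Lemma expectation_Ex X : LP X -> expectation P X = (Ex X)%:E.
Proof. by move=> /LP_int iX; rewrite unlock Ex_fin. Qed.

Lemma eq_Ex X Y : (forall w, X w = Y w) -> Ex X = Ex Y.
Proof. by move=> XY; congr Ex; apply/funext. Qed.

Lemma ExD X Y : LP X -> LP Y -> Ex (fun w => X w + Y w) = Ex X + Ex Y.
Proof.
move=> /LP_int iX /LP_int iY; apply: EFin_inj; rewrite EFinD -!Ex_fin //.
  by rewrite -integralD.
exact: (integrableD measurableT iX iY).
Qed.

Lemma ExZ c X : LP X -> Ex (fun w => c * X w) = c * Ex X.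
Proof.
move=> /LP_int iX; apply: EFin_inj; rewrite EFinM -!Ex_fin //.
  by rewrite -integralZl.
exact: (integrableZl measurableT c iX).
Qed.

Lemma ExB X Y : LP X -> LP Y -> Ex (fun w => X w - Y w) = Ex X - Ex Y.
Proof.
move=> lX lY; rewrite -mulN1r -ExZ // -ExD //; last exact: LPZ.
by apply: eq_Ex => w; rewrite mulN1r.
Qed.

Lemma Ex_cst c : Ex (fun _ => c) = c.
Proof. by rewrite /Ex integral_cst //= probability_setT mule1. Qed.

Lemma Ex_sum (I : Type) (r : seq I) (p : pred I) (F : I -> Omega -> R) : (forall i, LP (F i)) ->
  Ex (fun w => \sum_(i <- r | p i) F i w) = \sum_(i <- r | p i) Ex (F i).
Proof.
move=> lF; elim: r => [|i r IH].
  by rewrite big_nil; under eq_Ex do rewrite big_nil; exact: Ex_cst.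
rewrite big_cons; under eq_Ex do rewrite big_cons; case: (p i) => //.
by rewrite ExD ?IH //; exact: LP_sum.
Qed.

Lemma Ex_ge0 X : (forall w, 0 <= X w) -> 0 <= Ex X.
Proof. by move=> X0; rewrite /Ex fine_ge0 // integral_ge0 // => w _; rewrite lee_fin. Qed.

Lemma Ex_le X Y : LP X -> LP Y -> (forall w, X w <= Y w) -> Ex X <= Ex Y.
Proof.
by move=> lX lY XY; rewrite -subr_ge0 -ExB //; apply: Ex_ge0 => w; rewrite subr_ge0.
Qed.

Lemma LP_ext X Y : (forall w, X w = Y w) -> LP X -> LP Y.
Proof. by move=> XY; rewrite (_ : X = Y) //; apply/funext. Qed.

(** The moments of the standard normal law: (n - 1)!! for even n and 0 for odd n. *)
Fixpoint mom (n : nat) : R :=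
  match n with 0 => 1 | 1 => 0 | n'.+2 => n'.+1%:R * mom n' end.

Lemma momS n : mom n.+1 = n%:R * mom n.-1.
Proof. by case: n => [|n] /=; rewrite ?mul0r. Qed.

(* Centred Gaussian laws, possibly degenerate, known through their moments
   only: this is all that the chaos estimates use. *)
Definition gauss X := LP X /\ forall n, Ex (fun w => X w ^+ n) = mom n * Num.sqrt (Ex (fun w => X w ^+ 2)) ^+ n.

Lemma law_integral X (Q : probability (measurableTypeR R) R) (f : R -> R) :
  measurable_fun setT X -> (forall A : set R, measurable A -> P (X @^-1` A) = Q A) ->
  measurable_fun [set: R] f -> (forall x, 0 <= f x) ->
  (\int[P]_w (f (X w))%:E = \int[Q]_x (f x)%:E)%E.
Proof.
move=> mX PX mf f0.
have mX' : measurable_fun setT (X : Omega -> measurableTypeR R) := mX.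
pose X' : {mfun Omega >-> measurableTypeR R} := HB.pack (X : Omega -> measurableTypeR R)
  (isMeasurableFun.Build _ _ _ _ _ mX').
have := @ge0_integral_distribution _ _ _ _ _ P X' (EFin \o f) => /= <- //.
  by apply: eq_measure_integral => A mA _; exact: PX.
exact/measurable_EFinP.
Qed.

Lemma Ex_normal X m s (g : R -> R) : s != 0 -> measurable_fun setT X ->
  (forall A : set R, measurable A -> P (X @^-1` A) = normal_prob m s A) ->
  measurable_fun [set: R] g ->
  (@lebesgue_measure R).-integrable setT (fun x => (g x * normal_pdf m s x)%:E) ->
  P.-integrable setT (fun w => (g (X w))%:E) /\
  (\int[P]_w (g (X w))%:E = \int[@lebesgue_measure R]_x (g x * normal_pdf m s x)%:E)%E.
Proof.
move=> s0 mX PX mg ig.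
have tr (f : R -> R) : measurable_fun [set: R] f -> (forall x, 0 <= f x) ->
    (\int[P]_w (f (X w))%:E = \int[@lebesgue_measure R]_x (f x * normal_pdf m s x)%:E)%E.
  move=> mf f0; rewrite (law_integral mX PX mf f0).
  have := @ge0_integral_normal R m s (EFin \o f) => /= -> //.
  exact/measurable_EFinP.
have igX : P.-integrable setT (fun w => (g (X w))%:E).
  apply/integrableP; split; first by apply/measurable_EFinP; exact: measurableT_comp.
  under eq_integral do rewrite abse_EFin.
  rewrite (tr (fun x => `|g x|)) //; last exact: measurableT_comp.
  move: ig => /integrableP[_]; apply: le_lt_trans; rewrite le_eqVlt; apply/orP; left; apply/eqP.
  by apply: eq_integral => x _; rewrite abse_EFin normrM (ger0_norm (normal_pdf_ge0 _ _ _)).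
split => //.
have mag : measurable_fun [set: R] (fun x => `|g x|) by exact: measurableT_comp.
have h1 := tr (fun x => `|g x|) mag (fun x => normr_ge0 _).
have h2 : (\int[P]_w (`|g (X w)| + g (X w))%:E =
   \int[@lebesgue_measure R]_x ((`|g x| + g x) * normal_pdf m s x)%:E)%E.
  apply: (tr (fun x => `|g x| + g x)); first exact: measurable_funD.
  by move=> x; have := ler_norm (- g x); rewrite normrN; lra.
have igaX : P.-integrable setT (fun w => (`|g (X w)|)%:E) by exact: integrable_abse igX.
have iga : (@lebesgue_measure R).-integrable setT (fun x => (`|g x| * normal_pdf m s x)%:E).
  have := integrable_abse ig; apply: eq_integrable => // x _ /=.
  by rewrite normrM (ger0_norm (normal_pdf_ge0 _ _ _)).
move: h2; under eq_integral do rewrite EFinD.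
under [in RHS]eq_integral do rewrite mulrDl EFinD.
rewrite integralD // integralD // h1 => /(congr1 (fun z => z - \int[@lebesgue_measure R]_x (`|g x| * normal_pdf m s x)%:E))%E.
have f1 := integrable_fin_num measurableT iga.
by rewrite [X in (X - _)%E]addeC [X in _ = (X - _)%E]addeC !addeK.
Qed.

Lemma gauss_gaussian_rv X : measurable_fun setT X -> gaussian_rv P X ->
  expectation P X = 0%E -> gauss X.
Proof.
move=> mX [m [s PX]] EX0; have [s0|s0] := eqVneq s 0.
  have PX' (A : set R) : measurable A -> P (X @^-1` A) = \d_m A by move=> /PX; rewrite s0 eqxx.
  have tr (f : R -> R) : measurable_fun [set: R] f -> (forall x, 0 <= f x) ->
      (\int[P]_w (f (X w))%:E = (f m)%:E)%E.
    move=> mf f0; have := @law_integral X (dirac (m : measurableTypeR R)) f mX PX' mf f0 => ->.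
    rewrite integral_dirac ?diracT ?mul1e //; exact/measurable_EFinP.
  have mp n : measurable_fun [set: R] (fun x : R => x ^+ n) by exact: measurable_funX.
  have lX : LP X.
    split => // n; apply/integrableP; split; first by apply/measurable_EFinP; exact: measurable_funX.
    under eq_integral do rewrite abse_EFin.
    rewrite (tr (fun x => `|x ^+ n|)) //; first exact: ltry.
    exact: measurableT_comp.
  have E2 : Ex (fun w => X w ^+ 2) = m ^+ 2.
    by rewrite /Ex (tr (fun x => x ^+ 2)) // => x; exact: sqr_ge0.
  have E1 : Ex X = 0 by move: EX0; rewrite expectation_Ex // => -[].
  (* The transfer formula [tr] is available for nonnegative functions only, so the mean is read off
     from the square of X + 1. *)
  have m0 : m = 0.
    have : Ex (fun w => (X w + 1) ^+ 2) = (m + 1) ^+ 2.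
      rewrite /Ex (tr (fun x => (x + 1) ^+ 2)) //; last by move=> x; exact: sqr_ge0.
      by apply: measurable_funX; exact: measurable_funD.
    have -> : Ex (fun w => (X w + 1) ^+ 2) = m ^+ 2 + 1.
      rewrite (@eq_Ex _ (fun w => X w ^+ 2 + (2 * X w + 1))); last by move=> w; ring.
      have l1 := LP_cst 1; have l2 := LPZ 2 lX; have l3 := LPX 2 lX.
      by rewrite ExD //; [rewrite ExD // ExZ // E1 E2 Ex_cst; ring|exact: LPD].
    by rewrite sqrrD1 => /eqP; rewrite mulr2n; lra.
  split => // n; rewrite E2 m0 expr0n /= sqrtr0.
  have X0 : Ex (fun w => X w ^+ n) = 0 ^+ n.
    have l1 := LPX n lX; have l2 := LPX 2 l1; have l3 := LP_cst 1; have l4 := LPZ 2 l1.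
    have h1 : Ex (fun w => X w ^+ n ^+ 2) = (0 ^+ n) ^+ 2.
      rewrite /Ex (tr (fun x => x ^+ n ^+ 2)) ?m0 //; first exact: measurable_funX.
      by move=> x; exact: sqr_ge0.
    have : Ex (fun w => (X w ^+ n + 1) ^+ 2) = (0 ^+ n + 1) ^+ 2.
      rewrite /Ex (tr (fun x => (x ^+ n + 1) ^+ 2)) ?m0 //; last by move=> x; exact: sqr_ge0.
      by apply: measurable_funX; exact: measurable_funD.
    rewrite (@eq_Ex _ (fun w => X w ^+ n ^+ 2 + (2 * X w ^+ n + 1))); last by move=> w; ring.
    rewrite ExD //; last exact: LPD.
    rewrite ExD // ExZ // Ex_cst h1; set e := Ex _; set z := 0 ^+ n.
    have -> : (z + 1) ^+ 2 = z ^+ 2 + (2 * z + 1) by ring.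
    lra.
  rewrite X0; case: n {X0} => [|[|n]]; rewrite ?mulr1 ?mul0r ?expr0 //= ?expr0n //=.
  by rewrite mulr0.
have cen k : P.-integrable setT (fun w => ((X w - m) ^+ k)%:E).
  have PX' (A : set R) : measurable A -> P (X @^-1` A) = normal_prob m s A.
    by move=> /PX; rewrite (negbTE s0).
  by have [] := Ex_normal s0 mX PX' (measurable_center_pow m k) (integrable_normal_moment m k s0).
have lc : LP (fun w => X w - m) by split => //; exact: measurable_funB.
have lX : LP X by apply: LP_ext (LPD lc (LP_cst m)) => w; rewrite subrK.
have E1 : Ex X = 0 by move: EX0; rewrite expectation_Ex // => -[].
have rec k : Ex (fun w => (X w - m) ^+ k.+1) = k%:R * s ^+ 2 * Ex (fun w => (X w - m) ^+ k.-1).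
  have PX' (A : set R) : measurable A -> P (X @^-1` A) = normal_prob m s A.
    by move=> /PX; rewrite (negbTE s0).
  have mg : measurable_fun [set: R] (fun x => (x - m) ^+ k.+1 - k%:R * s ^+ 2 * (x - m) ^+ k.-1).
    by apply: measurable_funB; [|apply: measurable_funM => //]; exact: measurable_center_pow.
  have [_ e] := Ex_normal s0 mX PX' mg (integrable_moment_rec m k s0).
  have : Ex (fun w => (X w - m) ^+ k.+1 - k%:R * s ^+ 2 * (X w - m) ^+ k.-1) = 0.
    by rewrite /Ex e normal_moment_rec.
  have l1 := LPX k.+1 lc; have l2 := LPX k.-1 lc.
  by rewrite ExB //; [rewrite ExZ // => /eqP; rewrite subr_eq0 => /eqP|exact: LPZ].
(* The recursion for k = 0 says that X - m has mean 0. *)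
have m0 : m = 0.
  have := rec 0%N; rewrite !mul0r ExB //; last exact: LP_cst.
  by rewrite E1 Ex_cst; lra.
have rec' k : Ex (fun w => X w ^+ k.+1) = k%:R * s ^+ 2 * Ex (fun w => X w ^+ k.-1).
  have := rec k; rewrite m0 => e; rewrite (@eq_Ex _ (fun w => (X w - 0) ^+ k.+1)) ?e; last first.
    by move=> w; rewrite subr0.
  by congr (_ * _); apply: eq_Ex => w; rewrite subr0.
have E2 : Ex (fun w => X w ^+ 2) = `|s| ^+ 2.
  by rewrite rec' mul1r /= (@eq_Ex _ (fun=> 1)) ?Ex_cst ?mulr1 ?real_normK ?num_real.
split => // n; rewrite E2 sqrtr_sqr normr_id.
suff H k : Ex (fun w => X w ^+ k) = mom k * `|s| ^+ k /\ Ex (fun w => X w ^+ k.+1) = mom k.+1 * `|s| ^+ k.+1.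
  by have [] := H n.
elim: k => [|k [IH1 IH2]].
  split; first by rewrite (@eq_Ex _ (fun=> 1)) ?Ex_cst ?mulr1.
  by rewrite rec' !mul0r.
have ss : s ^+ 2 = `|s| ^+ 2 by rewrite real_normK ?num_real.
by split => //; rewrite rec' IH1 ss /= !exprSr; ring.
Qed.

End Moments.

Lemma poly_fun_inj (R : realType) n (c e : nat -> R) :
  (forall t, \sum_(j < n) c j * t ^+ j = \sum_(j < n) e j * t ^+ j) ->
  forall j, (j < n)%N -> c j = e j.
Proof.
move=> h j jn; pose p := \poly_(i < n) (c i - e i).
have pt t : p.[t] = 0.
  rewrite horner_poly; under eq_bigr do rewrite mulrBl.
  by rewrite sumrB h subrr.
have p0 : p = 0.
  apply/eqP/negPn/negP => pN0.
  pose s : seq R := [seq i%:R | i <- iota 0 (size p)].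
  have := max_poly_roots pN0 (rs := s).
  rewrite size_map size_iota ltnn => H; apply: notF; apply: H.
    by apply/allP => x _; rewrite /root pt.
  rewrite map_inj_uniq ?iota_uniq // => a b /eqP; rewrite eqr_nat => /eqP; exact.
have := congr1 (fun q : {poly R} => q`_j) p0; rewrite coef_poly jn coef0.
by move=> /eqP; rewrite subr_eq0 => /eqP.
Qed.

(** * Factorisation of joint moments *)

Section Joint.
Context {d : measure_display} {Omega : measurableType d} {R : realType}
  (P : probability Omega R).
Implicit Types (X Y Z G : Omega -> R).

Local Notation LP := (LP P).
Local Notation Ex := (Ex P).
Local Notation mom := (@mom R).

Lemma Ex_pow_expand Z x Y n t : LP Z -> LP x -> LP Y ->
  Ex (fun w => (Z w + t * x w) ^+ n * Y w) =
  \sum_(j < n.+1) ('C(n, j)%:R * Ex (fun w => Z w ^+ (n - j) * x w ^+ j * Y w)) * t ^+ j.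
Proof.
move=> lZ lx lY.
have lT i j : LP (fun w => Z w ^+ i * x w ^+ j * Y w).
  by apply: LPM => //; apply: LPM; exact: LPX.
rewrite (@eq_Ex _ _ _ _ _ (fun w => \sum_(j < n.+1) ('C(n, j)%:R * t ^+ j) *
    (Z w ^+ (n - j) * x w ^+ j * Y w))).
  rewrite Ex_sum; last by move=> j; exact: LPZ.
  by apply: eq_bigr => j _; rewrite ExZ //; ring.
move=> w; rewrite exprDn mulr_suml; apply: eq_bigr => j _.
by rewrite exprMn -mulr_natl; ring.
Qed.

Section Polarisation.
Variable U : (Omega -> R) -> Prop.
Hypothesis UL : forall Z x t, U Z -> U x -> U (fun w => Z w + t * x w).
Hypothesis ULP : forall Z, U Z -> LP Z.

(* Compare the coefficients of t in E[(Z + t F)^(k+1) Q G]. *)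
Lemma polarisation G c : LP G ->
  (forall Z r, U Z -> Ex (fun w => Z w ^+ r * G w) = c * Ex (fun w => Z w ^+ r)) ->
  forall (I : Type) (s : seq I) (F : I -> Omega -> R), (forall i, U (F i)) ->
  forall Z k, U Z -> Ex (fun w => Z w ^+ k * (\prod_(i <- s) F i w * G w)) =
    c * Ex (fun w => Z w ^+ k * \prod_(i <- s) F i w).
Proof.
move=> lG H I s F UF; have lF i := ULP (UF i).
elim: s => [|i s IH] Z k UZ.
  rewrite (@eq_Ex _ _ _ _ _ (fun w => Z w ^+ k * G w)); last by move=> w; rewrite big_nil mul1r.
  by rewrite H //; congr (_ * _); apply: eq_Ex => w; rewrite big_nil mulr1.
have lQ := LP_prod s lF; have lZ := ULP UZ.
have lQG : LP (fun w => \prod_(i <- s) F i w * G w) by exact: LPM.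
have E t := IH (fun w => Z w + t * F i w) k.+1 (UL t UZ (UF i)).
pose c1 j := 'C(k.+1, j)%:R * Ex (fun w => Z w ^+ (k.+1 - j) * F i w ^+ j * (\prod_(i <- s) F i w * G w)).
pose c2 j := c * ('C(k.+1, j)%:R * Ex (fun w => Z w ^+ (k.+1 - j) * F i w ^+ j * \prod_(i <- s) F i w)).
have E' t : \sum_(j < k.+2) c1 j * t ^+ j = \sum_(j < k.+2) c2 j * t ^+ j.
  rewrite -Ex_pow_expand // E Ex_pow_expand // mulr_sumr.
  by apply: eq_bigr => j _; rewrite mulrA.
have := poly_fun_inj E' (isT : (1 < k.+2)%N); rewrite /c1 /c2.
rewrite bin1 subn1 /= mulrCA => /mulfI; rewrite pnatr_eq0 => /(_ isT).
rewrite (@eq_Ex _ _ _ _ _ (fun w => Z w ^+ k * (\prod_(i <- i :: s) F i w * G w))); last first.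
  by move=> w; rewrite big_cons expr1; ring.
by move=> ->; congr (_ * _); apply: eq_Ex => w; rewrite big_cons expr1; ring.
Qed.

End Polarisation.

(** Powers of single elements of a linear space determine all products by polarisation. This is
    carried out first in U with a power of Y as spectator, then in V with the product over U as
    spectator. *)
Lemma factor_products (U V : (Omega -> R) -> Prop) :
  (forall Z x t, U Z -> U x -> U (fun w => Z w + t * x w)) -> (forall Z, U Z -> LP Z) ->
  (forall Z x t, V Z -> V x -> V (fun w => Z w + t * x w)) -> (forall Z, V Z -> LP Z) ->
  (forall Z Y r k, U Z -> V Y ->
     Ex (fun w => Z w ^+ r * Y w ^+ k) = Ex (fun w => Z w ^+ r) * Ex (fun w => Y w ^+ k)) ->
  forall (I J : Type) (s : seq I) (s' : seq J) (F : I -> Omega -> R) (F' : J -> Omega -> R),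
  (forall i, U (F i)) -> (forall j, V (F' j)) ->
  Ex (fun w => \prod_(i <- s) F i w * \prod_(j <- s') F' j w) =
  Ex (fun w => \prod_(i <- s) F i w) * Ex (fun w => \prod_(j <- s') F' j w).
Proof.
move=> UL ULP VL VLP H I J s s' F F' UF VF'.
have lF := LP_prod s (fun i => ULP _ (UF i)).
have h1 Y k : V Y -> Ex (fun w => Y w ^+ k * \prod_(i <- s) F i w) =
    Ex (fun w => \prod_(i <- s) F i w) * Ex (fun w => Y w ^+ k).
  move=> VY; have lY := LPX k (VLP _ VY).
  (* Polarisation needs some element of U as base point, even with exponent 0; the empty list
     provides none. *)
  case: s lF => [|i0 s0] lF.
    rewrite (@eq_Ex _ _ _ _ _ (fun w => Y w ^+ k)); last by move=> w; rewrite big_nil mulr1.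
    by rewrite (@eq_Ex _ _ _ _ (fun w => \prod_(i <- [::]) F i w) (fun=> 1)) ?Ex_cst ?mul1r // => w;
      rewrite big_nil.
  have H' Z r : U Z -> Ex (fun w => Z w ^+ r * Y w ^+ k) = Ex (fun w => Y w ^+ k) * Ex (fun w => Z w ^+ r).
    by move=> UZ; rewrite H // mulrC.
  have := polarisation UL ULP lY H' (i0 :: s0) UF 0 (UF i0).
  rewrite (@eq_Ex _ _ _ _ _ (fun w => Y w ^+ k * \prod_(i <- i0 :: s0) F i w)); last first.
    by move=> w; rewrite expr0 mul1r mulrC.
  by move=> ->; rewrite mulrC; congr (_ * _); apply: eq_Ex => w; rewrite expr0 mul1r.
case: s' => [|j0 s'].
  rewrite (@eq_Ex _ _ _ _ _ (fun w => \prod_(i <- s) F i w)); last by move=> w; rewrite big_nil mulr1.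
  by rewrite [X in _ * X](@eq_Ex _ _ _ _ _ (fun=> 1)) ?Ex_cst ?mulr1 // => w; rewrite big_nil.
have := polarisation VL VLP lF h1 (j0 :: s') VF' 0 (VF' j0).
rewrite (@eq_Ex _ _ _ _ _ (fun w => \prod_(i <- s) F i w * \prod_(j <- j0 :: s') F' j w)); last first.
  by move=> w; rewrite expr0 mul1r mulrC.
by move=> ->; congr (_ * _); apply: eq_Ex => w; rewrite expr0 mul1r.
Qed.

Lemma binD_rec (A B : nat -> R) n :
  \sum_(j < n.+2) 'C(n.+1, j)%:R * (A (n.+1 - j)%N * B j) =
  \sum_(j < n.+1) 'C(n, j)%:R * (A (n - j).+1 * B j) +
  \sum_(j < n.+1) 'C(n, j)%:R * (A (n - j)%N * B j.+1).
Proof.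
rewrite big_ord_recl /= bin0 subn0 big_ord_recr /= binn subnn.
rewrite [in RHS]big_ord_recl /= bin0 subn0 [X in _ = _ + X]big_ord_recr /= binn subnn.
rewrite (eq_bigr (fun i : 'I_n => 'C(n, i.+1)%:R * (A (n - i)%N * B i.+1) +
   'C(n, i)%:R * (A (n - i)%N * B i.+1))); last first.
  by move=> i _; rewrite /bump /= add1n binS natrD mulrDl subSS.
rewrite big_split /= (eq_bigr (fun i : 'I_n => 'C(n, bump 0 i)%:R * (A (n - bump 0 i).+1 * B (bump 0 i)))).
  by rewrite !addrA.
by move=> i _; rewrite /bump /= add1n subnSK.
Qed.

(** The moments of a sum of independent normal variables, proved without probability: the binomial
    convolution obeys the two-step recursion of the moments with variance a^2 + b^2. *)
Lemma gauss_umbral (a b : R) n :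
  \sum_(j < n.+1) 'C(n, j)%:R * ((mom (n - j) * a ^+ (n - j)) * (mom j * b ^+ j)) =
  mom n * Num.sqrt (a ^+ 2 + b ^+ 2) ^+ n.
Proof.
pose A k := mom k * a ^+ k; pose B k := mom k * b ^+ k.
pose S n := \sum_(j < n.+1) 'C(n, j)%:R * (A (n - j)%N * B j).
rewrite -[LHS]/(S n).
have AS k : A k.+1 = k%:R * a ^+ 2 * A k.-1.
  by rewrite /A momS; case: k => [|k] /=; rewrite ?mul0r // !exprS; ring.
have BS k : B k.+1 = k%:R * b ^+ 2 * B k.-1.
  by rewrite /B momS; case: k => [|k] /=; rewrite ?mul0r // !exprS; ring.
have rec k : S k.+2 = k.+1%:R * (a ^+ 2 + b ^+ 2) * S k.
  rewrite {1}/S binD_rec big_ord_recr /= binn subnn AS mul0r mul0r mul0r mulr0 addr0.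
  rewrite [X in _ + X]big_ord_recl /= BS mul0r mul0r mulr0 mulr0 add0r.
  rewrite [_ * (_ + _)]mulrDr mulrDl; congr (_ + _); rewrite /S mulr_sumr; apply: eq_bigr => j _.
    have jk : (j <= k)%N by rewrite -ltnS.
    rewrite AS subSn //=.
    have : (k.+1 - j)%:R * 'C(k.+1, j)%:R = k.+1%:R * 'C(k, j)%:R :> R.
      by rewrite -!natrM mul_bin_down.
    rewrite subSn // => e.
    have -> : 'C(k.+1, j)%:R * ((k - j).+1%:R * a ^+ 2 * A (k - j)%N * B j) =
      ((k - j).+1%:R * 'C(k.+1, j)%:R) * (a ^+ 2 * A (k - j)%N * B j) by ring.
    by rewrite e; ring.
  rewrite /bump /= add1n subSS BS /=.
  have e : j.+1%:R * 'C(k.+1, j.+1)%:R = k.+1%:R * 'C(k, j)%:R :> R.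
    by rewrite -!natrM mul_bin_diag.
  have -> : 'C(k.+1, j.+1)%:R * (A (k - j)%N * (j.+1%:R * b ^+ 2 * B j)) =
    (j.+1%:R * 'C(k.+1, j.+1)%:R) * (b ^+ 2 * A (k - j)%N * B j) by ring.
  by rewrite e; ring.
have s2 : Num.sqrt (a ^+ 2 + b ^+ 2) ^+ 2 = a ^+ 2 + b ^+ 2.
  by rewrite sqr_sqrtr // addr_ge0 ?sqr_ge0.
suff H k : S k = mom k * Num.sqrt (a ^+ 2 + b ^+ 2) ^+ k /\
    S k.+1 = mom k.+1 * Num.sqrt (a ^+ 2 + b ^+ 2) ^+ k.+1 by have [] := H n.
elim: k => [|k [IH1 IH2]].
  split; first by rewrite /S big_ord_recl big_ord0 /A /B subnn bin0 /= !expr0 !mulr1 addr0.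
  rewrite /S !big_ord_recl big_ord0 /= /bump /= addn0 subn0 subnn /A /B /=.
  by rewrite !mul0r !mulr0 addr0 addr0.
split => //; rewrite rec IH1 /= -[in RHS](addn2 k) exprD s2; ring.
Qed.

(** Without correlation the variance of Z + t Y is E[Z^2] + t^2 E[Y^2], so its moment of order r + k
    is known as a polynomial in t. The coefficient of t^k is the claim. *)
Lemma uncorrelated_factor Z Y : gauss P Z -> gauss P Y ->
  (forall t, gauss P (fun w => Z w + t * Y w)) -> Ex (fun w => Z w * Y w) = 0 ->
  forall r k, Ex (fun w => Z w ^+ r * Y w ^+ k) = Ex (fun w => Z w ^+ r) * Ex (fun w => Y w ^+ k).
Proof.
move=> [lZ gZ] [lY gY] gZY ZY0 r k.
set a := Num.sqrt (Ex (fun w => Z w ^+ 2)) in gZ; set b := Num.sqrt (Ex (fun w => Y w ^+ 2)) in gY.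
have a2 : a ^+ 2 = Ex (fun w => Z w ^+ 2) by rewrite sqr_sqrtr // Ex_ge0 // => w; exact: sqr_ge0.
have b2 : b ^+ 2 = Ex (fun w => Y w ^+ 2) by rewrite sqr_sqrtr // Ex_ge0 // => w; exact: sqr_ge0.
pose n := (r + k)%N.
have l1 := LP_cst P 1.
have E2 t : Ex (fun w => (Z w + t * Y w) ^+ 2) = a ^+ 2 + (b * t) ^+ 2.
  rewrite (@eq_Ex _ _ _ _ _ (fun w => Z w ^+ 2 + ((2 * t) * (Z w * Y w) + t ^+ 2 * Y w ^+ 2))); last first.
    by move=> w; ring.
  have m1 := LPX 2 lZ; have m2 := LPX 2 lY; have m3 := LPM lZ lY.
  have m4 := LPZ (2 * t) m3; have m5 := LPZ (t ^+ 2) m2; have m6 := LPD m4 m5.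
  by rewrite ExD // ExD // !ExZ // ZY0 a2 exprMn b2; ring.
pose c1 j := 'C(n, j)%:R * Ex (fun w => Z w ^+ (n - j) * Y w ^+ j).
pose c2 j := 'C(n, j)%:R * (Ex (fun w => Z w ^+ (n - j)) * Ex (fun w => Y w ^+ j)).
have E t : \sum_(j < n.+1) c1 j * t ^+ j = \sum_(j < n.+1) c2 j * t ^+ j.
  transitivity (Ex (fun w => (Z w + t * Y w) ^+ n)).
    have := Ex_pow_expand n t lZ lY l1.
    rewrite (@eq_Ex _ _ _ _ _ (fun w => (Z w + t * Y w) ^+ n)); last by move=> w; rewrite mulr1.
    move=> ->; apply: eq_bigr => j _; congr (_ * _ * _).
    by apply: eq_Ex => w; rewrite mulr1.
  have [_ ->] := gZY t; rewrite E2 -gauss_umbral; apply: eq_bigr => j _.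
  by rewrite /c2 gZ gY exprMn; ring.
have kn : (k < n.+1)%N by rewrite ltnS leq_addl.
have := poly_fun_inj E kn; rewrite /c1 /c2 /n addnK.
have bN : 'C(r + k, k)%:R != 0 :> R by rewrite pnatr_eq0 -lt0n bin_gt0 leq_addl.
by move=> /(mulfI bN).
Qed.

Lemma indep_Ex X Y : LP X -> LP Y ->
  (forall A B : set R, measurable A -> measurable B ->
    P (X @^-1` A `&` Y @^-1` B) = (P (X @^-1` A) * P (Y @^-1` B))%E) ->
  Ex (fun w => X w * Y w) = Ex X * Ex Y.
Proof.
move=> lX lY ind; have [mX _] := lX; have [mY _] := lY.
pose X' : {mfun Omega >-> R} := HB.pack X (isMeasurableFun.Build _ _ _ _ _ mX).
pose Y' : {mfun Omega >-> R} := HB.pack Y (isMeasurableFun.Build _ _ _ _ _ mY).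
have mXY : measurable_fun setT (fun w => (X w, Y w)) by exact: measurable_fun_pair.
pose Z' : {mfun Omega >-> (R * R)%type} := HB.pack (fun w => (X w, Y w)) (isMeasurableFun.Build _ _ _ _ _ mXY).
pose m1 := distribution P X'; pose m2 := distribution P Y'; pose m' := distribution P Z'.
have E A : measurable A -> (m1 \x m2)%E A = m' A.
  apply: product_measure_unique => B C mB mC; rewrite /m' /m1 /m2 /distribution /pushforward /=.
  by rewrite -ind //; congr (P _); apply/seteqP; split=> w.
pose f (z : R * R) := (z.1 * z.2)%:E.
have mf : measurable_fun setT f.
  by apply/measurable_EFinP; apply: measurable_funM; [exact: measurable_fst|exact: measurable_snd].
have iXY : P.-integrable setT (f \o Z') by exact: (LP_int (LPM lX lY)).
have eqm (g : R * R -> \bar R) : (\int[m1 \x m2]_z g z = \int[m']_z g z)%E.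
  by apply: eq_measure_integral => A mA _; exact: E.
have fint : (m1 \x m2)%E.-integrable setT f.
  apply/integrableP; split => //; rewrite eqm ge0_integral_distribution //.
    by move: iXY => /integrableP[].
  exact: measurableT_comp.
have int_law (V : {mfun Omega >-> R}) : LP V -> (distribution P V).-integrable setT (fun x : R => x%:E)
    /\ (\int[distribution P V]_x x%:E)%E = (Ex V)%:E.
  move=> lV; have iV := LP_int lV; split; last by rewrite integral_distribution // Ex_fin.
  apply/integrableP; split; first exact/measurable_EFinP.
  rewrite ge0_integral_distribution //; last by apply: measurableT_comp => //; exact/measurable_EFinP.
  by move: iV => /integrableP[].
have [iX eX] := int_law X' lX; have [iY eY] := int_law Y' lY.
apply: EFin_inj; rewrite -Ex_fin; last exact: iXY.
have -> : (\int[P]_w (X w * Y w)%:E)%E = (\int[m']_z f z)%E.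
  by rewrite integral_distribution.
rewrite -eqm -integral12_prod_meas1 //.
rewrite (@eq_integral _ _ _ _ _ (fun x : R => (x%:E * (Ex Y)%:E)%E)); last first.
  by move=> x _; rewrite /fubini_F /f -eY -integralZl //; apply: eq_integral => y _; rewrite EFinM.
by rewrite integralZr // eX.
Qed.

End Joint.

Lemma prod_le_sum_pow (R : realType) n (y : 'I_n.+1 -> R) : (forall i, 0 <= y i) ->
  \prod_(i < n.+1) y i <= \sum_(i < n.+1) y i ^+ n.+1.
Proof.
move=> y0; have [i0 hi] : exists i0, forall i, y i <= y i0.
  have [i0 _ hi] := @arg_maxP _ _ _ (@ord0 n) xpredT y isT.
  by exists i0 => i; exact: hi.
apply: le_trans (_ : y i0 ^+ n.+1 <= _); last first.
  by rewrite (bigD1 i0) //= lerDl sumr_ge0 // => i _; exact: exprn_ge0.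
rewrite -[n.+1 in leRHS]card_ord -prodr_const; apply: ler_prod => i _.
by rewrite y0 hi.
Qed.

(** * Moments of decoupled quadratic forms *)

Section Chaos.
Context {d : measure_display} {Omega : measurableType d} {R : realType}
  (P : probability Omega R).
Local Notation LP := (LP P).
Local Notation Ex := (Ex P).
Local Notation mom := (@mom R).

Lemma pow_sum_ffun (K : finType) (F : K -> R) n :
  (\sum_k F k) ^+ n = \sum_(f : {ffun 'I_n -> K}) \prod_(i < n) F (f i).
Proof. by rewrite -(bigA_distr_bigA (fun _ k => F k)) prodr_const card_ord. Qed.

Lemma mom_ge0 n : 0 <= mom n.
Proof.
suff H k : 0 <= mom k /\ 0 <= mom k.+1 by have [] := H n.
elim: k => [|k [IH1 IH2]]; first by split => //=; exact: lexx.
by split => //=; rewrite mulr_ge0.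
Qed.

Lemma sqrt_pow2 (x : R) p : 0 <= x -> Num.sqrt x ^+ (2 * p) = x ^+ p.
Proof. by move=> x0; rewrite exprM sqr_sqrtr. Qed.

(* Given the M_k, the sum of M_k eta_k is Gaussian of variance v * sum M_k^2.
   Instead of conditioning, expand the power, factorize the expectations of
   products and reassemble with M_k frozen at a value m_k. *)
Lemma chaos_moment (K : finType) (M eta : K -> Omega -> R) (v : R) p :
  (forall k, LP (M k)) -> (forall k, LP (eta k)) ->
  (forall f : {ffun 'I_(2 * p) -> K},
    Ex (fun w => \prod_(i < 2 * p) M (f i) w * \prod_(i < 2 * p) eta (f i) w) =
    Ex (fun w => \prod_(i < 2 * p) M (f i) w) * Ex (fun w => \prod_(i < 2 * p) eta (f i) w)) ->
  (forall m : K -> R, gauss P (fun w => \sum_k m k * eta k w)) ->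
  (forall k l, Ex (fun w => eta k w * eta l w) = if k == l then v else 0) ->
  Ex (fun w => (\sum_k M k w * eta k w) ^+ (2 * p)) =
  mom (2 * p) * v ^+ p * Ex (fun w => (\sum_k M k w ^+ 2) ^+ p).
Proof.
move=> lM le fact ge cov; set n := (2 * p)%N in fact *.
have lpM (f : {ffun 'I_n -> K}) : LP (fun w => \prod_(i < n) M (f i) w) by exact: LP_prod.
have lpe (f : {ffun 'I_n -> K}) : LP (fun w => \prod_(i < n) eta (f i) w) by exact: LP_prod.
have key (m : K -> R) : \sum_(f : {ffun 'I_n -> K}) \prod_(i < n) m (f i) *
     Ex (fun w => \prod_(i < n) eta (f i) w) = mom n * v ^+ p * (\sum_k m k ^+ 2) ^+ p.
  have E2 : Ex (fun w => (\sum_k m k * eta k w) ^+ 2) = v * \sum_k m k ^+ 2.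
    rewrite (@eq_Ex _ _ _ _ _ (fun w => \sum_k \sum_l (m k * m l) * (eta k w * eta l w))); last first.
      move=> w; rewrite expr2 mulr_suml; apply: eq_bigr => k _; rewrite mulr_sumr.
      by apply: eq_bigr => l _; ring.
    have lkl k l : LP (fun w => (m k * m l) * (eta k w * eta l w)) by apply: LPZ; exact: LPM.
    rewrite Ex_sum; last by move=> k; exact: LP_sum.
    rewrite mulr_sumr; apply: eq_bigr => k _; rewrite Ex_sum //.
    rewrite (bigD1 k) //= big1 ?addr0 => [|l lk].
      by rewrite ExZ ?cov ?eqxx; [ring|exact: LPM].
    by rewrite ExZ ?cov 1?eq_sym ?(negbTE lk) ?mulr0 //; exact: LPM.
  have v0 : 0 <= v * \sum_k m k ^+ 2 by rewrite -E2 Ex_ge0 // => w; exact: sqr_ge0.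
  rewrite -mulrA -exprMn -sqrt_pow2 // -/n -E2; have [_ <-] := ge m.
  rewrite (@eq_Ex _ _ _ _ _ (fun w => \sum_(f : {ffun 'I_n -> K}) \prod_(i < n) m (f i) *
     \prod_(i < n) eta (f i) w)).
    by rewrite Ex_sum => [|f]; [apply: eq_bigr => f _; rewrite ExZ|exact: LPZ].
  by move=> w; rewrite pow_sum_ffun; apply: eq_bigr => f _; rewrite big_split.
rewrite (@eq_Ex _ _ _ _ _ (fun w => \sum_(f : {ffun 'I_n -> K}) \prod_(i < n) M (f i) w *
     \prod_(i < n) eta (f i) w)); last first.
  by move=> w; rewrite pow_sum_ffun; apply: eq_bigr => f _; rewrite big_split.
rewrite Ex_sum; last by move=> f; exact: LPM.
under eq_bigr do rewrite fact.
have lS : LP (fun w => (\sum_k M k w ^+ 2) ^+ p).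
  by apply: LPX; apply: LP_sum => k; exact: LPX.
rewrite -ExZ //; rewrite (@eq_Ex _ _ _ _ (fun w => mom n * v ^+ p * (\sum_k M k w ^+ 2) ^+ p)
  (fun w => \sum_(f : {ffun 'I_n -> K}) Ex (fun w => \prod_(i < n) eta (f i) w) * \prod_(i < n) M (f i) w)).
  by rewrite Ex_sum => [|f]; [apply: eq_bigr => f _; rewrite ExZ // mulrC|exact: LPZ].
by move=> w; rewrite -(key (fun k => M k w)); apply: eq_bigr => f _; rewrite mulrC.
Qed.

Lemma chaos_bound (K : finType) (M : K -> Omega -> R) (B : R) p :
  (forall k, LP (M k)) -> (forall k, Ex (fun w => M k w ^+ (2 * p.+1)) <= B) ->
  Ex (fun w => (\sum_k M k w ^+ 2) ^+ p.+1) <= (#|K| ^ p.+1)%:R * (p.+1%:R * B).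
Proof.
move=> lM MB; have l2 k : LP (fun w => M k w ^+ 2) by exact: LPX.
rewrite (@eq_Ex _ _ _ _ _ (fun w => \sum_(f : {ffun 'I_p.+1 -> K}) \prod_(i < p.+1) M (f i) w ^+ 2));
  last by move=> w; rewrite (pow_sum_ffun (fun k => M k w ^+ 2)).
rewrite Ex_sum; last by move=> f; apply: LP_prod => i.
have -> : (#|K| ^ p.+1)%:R * (p.+1%:R * B) = \sum_(f : {ffun 'I_p.+1 -> K}) (p.+1%:R * B).
  by rewrite sumr_const card_ffun card_ord mulr_natl.
apply: ler_sum => f _.
apply: le_trans (_ : Ex (fun w => \sum_(i < p.+1) M (f i) w ^+ (2 * p.+1)) <= _).
  apply: Ex_le; [by apply: LP_prod|by apply: LP_sum => i; exact: LPX|move=> w].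
  have := @prod_le_sum_pow R p (fun i => M (f i) w ^+ 2) (fun i => sqr_ge0 _).
  by move=> /le_trans; apply; apply: ler_sum => i _; rewrite -exprM.
rewrite Ex_sum; last by move=> i; exact: LPX.
apply: le_trans (ler_sum _ (fun i _ => MB (f i))) _.
by rewrite sumr_const card_ord mulr_natl.
Qed.

End Chaos.

Lemma mem_In (A : eqType) (x : A) (s : seq A) : x \in s -> List.In x s.
Proof.
elim: s => //= y s IH; rewrite in_cons => /orP[/eqP->|/IH]; [by left|by right].
Qed.

(** * Linear functionals of a Gaussian process *)

Section Process.
Context {d : measure_display} {Omega : measurableType d} {R : realType}
  (P : probability Omega R) (T : R).
Local Notation LP := (LP P).
Local Notation Ex := (Ex P).
Local Notation mom := (@mom R).

(** Membership is [List.In] because the index type I need not have decidable equality. *)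
Definition lin (I : Type) (X : process R Omega I) (Z : Omega -> R) :=
  exists s : seq (R * R * I), (forall q, List.In q s -> 0 <= q.1.2 <= T) /\
    forall w, Z w = \sum_(q <- s) q.1.1 * X q.1.2 w q.2.

Definition lin1 (I : Type) (X : process R Omega I) (i : I) (Z : Omega -> R) :=
  exists s : seq (R * R), (forall q, List.In q s -> 0 <= q.2 <= T) /\
    forall w, Z w = \sum_(q <- s) q.1 * X q.2 w i.

Lemma lin_comb (I : Type) (X : process R Omega I) Z Y t : lin X Z -> lin X Y ->
  lin X (fun w => Z w + t * Y w).
Proof.
move=> [s [hs Zs]] [s' [hs' Ys]].
exists (s ++ [seq (t * q.1.1, q.1.2, q.2) | q <- s']); split.
  move=> q /(@List.in_app_or _ s _ q)[/hs //|].
  by move=> /List.in_map_iff[q' [<- /hs']].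
move=> w; rewrite big_cat big_map /= Zs Ys mulr_sumr; congr (_ + _).
by apply: eq_bigr => q _; rewrite mulrA.
Qed.

Lemma lin1_comb (I : Type) (X : process R Omega I) i Z Y t : lin1 X i Z -> lin1 X i Y ->
  lin1 X i (fun w => Z w + t * Y w).
Proof.
move=> [s [hs Zs]] [s' [hs' Ys]].
exists (s ++ [seq (t * q.1, q.2) | q <- s']); split.
  move=> q /(@List.in_app_or _ s _ q)[/hs //|].
  by move=> /List.in_map_iff[q' [<- /hs']].
move=> w; rewrite big_cat big_map /= Zs Ys mulr_sumr; congr (_ + _).
by apply: eq_bigr => q _; rewrite mulrA.
Qed.

Lemma lin1_lin (I : Type) (X : process R Omega I) i Z : lin1 X i Z -> lin X Z.
Proof.
move=> [s [hs Zs]]; exists [seq (q.1, q.2, i) | q <- s]; split.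
  by move=> q /List.in_map_iff[q' [<- /hs]].
by move=> w; rewrite Zs big_map.
Qed.

Lemma lin1_pt (I : Type) (X : process R Omega I) i t c : 0 <= t <= T ->
  lin1 X i (fun w => c * X t w i).
Proof.
move=> t0; exists [:: (c, t)]; split; first by move=> q [<-|[]].
by move=> w; rewrite big_seq1.
Qed.

Definition dX (I : Type) (X : process R Omega I) i s t : Omega -> R := fun w => X t w i - X s w i.

Lemma lin1_dX (I : Type) (X : process R Omega I) i s t c : 0 <= s <= T -> 0 <= t <= T ->
  lin1 X i (fun w => c * dX X i s t w).
Proof.
move=> s0 t0; have := lin1_comb 1 (lin1_pt X i c t0) (lin1_pt X i (- c) s0).
move=> [r [hr e]]; exists r; split => // w; rewrite -e /dX; ring.
Qed.

Variables (I : finType) (X : process R Omega I) (K : R -> R -> R).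
Hypothesis GX : centered_gaussian_process P T K X.

Lemma gauss_pt t i : 0 <= t <= T -> gauss P (fun w => X t w i).
Proof.
move=> t0; have [mX gX EX _] := GX; apply: gauss_gaussian_rv; [exact: mX| |exact: EX].
have [m [s h]] := gX 1%N (fun=> 1) (fun=> t) (fun=> i) (fun=> t0).
exists m, s => A mA; rewrite -h //; congr (P _); apply/seteqP.
by split=> w /=; rewrite big_ord1 mul1r.
Qed.

Lemma lin_gauss Z : lin X Z -> gauss P Z.
Proof.
move=> [s [hs Zs]]; have [mX gX EX _] := GX.
have hs' (k : 'I_(size s)) : 0 <= (tnth (in_tuple s) k).1.2 <= T.
  by apply: hs; apply: mem_In; exact: mem_tnth.
have lk (k : 'I_(size s)) : LP (fun w => (tnth (in_tuple s) k).1.1 * X (tnth (in_tuple s) k).1.2 w (tnth (in_tuple s) k).2).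
  by apply: LPZ; have [] := gauss_pt (tnth (in_tuple s) k).2 (hs' k).
have E w : Z w = \sum_(k < size s) (tnth (in_tuple s) k).1.1 * X (tnth (in_tuple s) k).1.2 w (tnth (in_tuple s) k).2.
  by rewrite Zs big_tnth.
have lZ : LP Z by apply: LP_ext (LP_sum _ _ lk) => w; rewrite E.
apply: gauss_gaussian_rv; first by case: lZ.
  have [m [sg h]] := gX _ (fun k => (tnth (in_tuple s) k).1.1) (fun k => (tnth (in_tuple s) k).1.2)
    (fun k => (tnth (in_tuple s) k).2) hs'.
  exists m, sg => A mA; rewrite -h //; congr (P _); apply/seteqP.
  by split=> w /=; rewrite E.
rewrite expectation_Ex // (eq_Ex P E) Ex_sum // big1 // => k _.
rewrite ExZ; last by have [] := gauss_pt (tnth (in_tuple s) k).2 (hs' k).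
have := EX (tnth (in_tuple s) k).1.2 (tnth (in_tuple s) k).2 (hs' k).
rewrite expectation_Ex; last by have [] := gauss_pt (tnth (in_tuple s) k).2 (hs' k).
by move=> [->]; rewrite mulr0.
Qed.

Lemma cov_pt s t i j : 0 <= s <= T -> 0 <= t <= T ->
  Ex (fun w => X s w i * X t w j) = if i == j then K s t else 0.
Proof.
move=> s0 t0; have [_ _ _ cX] := GX; have [l1 _] := gauss_pt i s0; have [l2 _] := gauss_pt j t0.
by have := cX s t i j s0 t0; rewrite expectation_Ex; [move=> [->]|exact: LPM].
Qed.

Lemma LP_dX i s t : 0 <= s <= T -> 0 <= t <= T -> LP (dX X i s t).
Proof.
by move=> s0 t0; apply: LPB; [have [] := gauss_pt i t0|have [] := gauss_pt i s0].
Qed.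

Lemma cov_dX s t s' t' i j : 0 <= s <= T -> 0 <= t <= T -> 0 <= s' <= T -> 0 <= t' <= T ->
  Ex (fun w => dX X i s t w * dX X j s' t' w) =
  if i == j then K t t' - K t s' - K s t' + K s s' else 0.
Proof.
move=> s0 t0 s0' t0'.
have [ls _] := gauss_pt i s0; have [lt _] := gauss_pt i t0.
have [ls' _] := gauss_pt j s0'; have [lt' _] := gauss_pt j t0'.
have a1 := LPM lt lt'; have a2 := LPM lt ls'; have a3 := LPM ls lt'; have a4 := LPM ls ls'.
have a12 := LPB a1 a2; have a34 := LPB a3 a4.
rewrite (@eq_Ex _ _ _ _ _ (fun w => (X t w i * X t' w j - X t w i * X s' w j) -
   (X s w i * X t' w j - X s w i * X s' w j))); last by move=> w; rewrite /dX; ring.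
rewrite ExB // !ExB // !cov_pt //; case: eqP => // _; ring.
Qed.

Lemma uncorrelated_lin1 i j Z Y : i != j -> lin1 X i Z -> lin1 X j Y -> Ex (fun w => Z w * Y w) = 0.
Proof.
move=> ij [s [hs Zs]] [s' [hs' Ys]].
have [_ hE] : LP (fun w => Z w * Y w) /\ Ex (fun w => Z w * Y w) = 0; last exact: hE.
elim: s Z hs Zs => [|q s IH] Z hs Zs.
  split; first by apply: LP_ext (LP_cst P 0) => w; rewrite Zs big_nil mul0r.
  by rewrite (@eq_Ex _ _ _ _ _ (fun=> 0)) ?Ex_cst // => w; rewrite Zs big_nil mul0r.
have [l0 e0] := IH (fun w => \sum_(q <- s) q.1 * X q.2 w i) (fun q hq => hs q (or_intror hq)) (fun=> erefl).
have q0 := hs q (or_introl erefl).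
have [l1 e1] : LP (fun w => X q.2 w i * Y w) /\ Ex (fun w => X q.2 w i * Y w) = 0.
  elim: s' Y hs' Ys {IH l0 e0} => [|r s' IH] Y hs' Ys.
    split; first by apply: LP_ext (LP_cst P 0) => w; rewrite Ys big_nil mulr0.
    by rewrite (@eq_Ex _ _ _ _ _ (fun=> 0)) ?Ex_cst // => w; rewrite Ys big_nil mulr0.
  have [l0 e0] := IH (fun w => \sum_(q <- s') q.1 * X q.2 w j) (fun q hq => hs' q (or_intror hq)) (fun=> erefl).
  have r0 := hs' r (or_introl erefl).
  have l2 : LP (fun w => X q.2 w i * X r.2 w j).
    by apply: LPM; [have [] := gauss_pt i q0|have [] := gauss_pt j r0].
  have E w : r.1 * (X q.2 w i * X r.2 w j) + X q.2 w i * (\sum_(q <- s') q.1 * X q.2 w j) = X q.2 w i * Y w.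
    by rewrite Ys big_cons; ring.
  split; first by apply: LP_ext E _; apply: LPD => //; exact: LPZ.
  by rewrite -(eq_Ex P E) ExD ?ExZ ?e0 ?cov_pt ?(negbTE ij) ?mulr0 ?addr0 //; exact: LPZ.
have E w : q.1 * (X q.2 w i * Y w) + (\sum_(q <- s) q.1 * X q.2 w i) * Y w = Z w * Y w.
  by rewrite Zs big_cons; ring.
split; first by apply: LP_ext E _; apply: LPD => //; exact: LPZ.
by rewrite -(eq_Ex P E) ExD ?ExZ ?e0 ?e1 ?mulr0 ?addr0 //; exact: LPZ.
Qed.

Lemma process_factor i j Z Y r k : i != j -> lin1 X i Z -> lin1 X j Y ->
  Ex (fun w => Z w ^+ r * Y w ^+ k) = Ex (fun w => Z w ^+ r) * Ex (fun w => Y w ^+ k).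
Proof.
move=> ij lZ lY; apply: uncorrelated_factor.
- by apply: lin_gauss; exact: lin1_lin lZ.
- by apply: lin_gauss; exact: lin1_lin lY.
- by move=> t; apply: lin_gauss; apply: lin_comb; [exact: lin1_lin lZ|exact: lin1_lin lY].
- exact: uncorrelated_lin1 ij lZ lY.
Qed.

End Process.

(** * Almost sure convergence of the second level *)

Lemma lt2_powR (R : realType) (a b : R) : a < b -> 2 `^ a < 2 `^ b.
Proof.
move=> ab; have -> : b = a + (b - a) by ring.
rewrite powRD ?pnatr_eq0 ?implybT // ltr_pMr ?powR_gt0 //.
rewrite -[ltLHS](_ : 1 `^ (b - a) = 1); last by rewrite powR1.
by apply: gt0_ltr_powR; rewrite ?subr_gt0 ?nnegrE ?ler0n ?ltr1n.
Qed.

Section AlmostSure.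
Context {d : measure_display} {Omega : measurableType d} {R : realType}
  (P : probability Omega R).

Lemma ae_bounded (F : nat -> Omega -> R) C : (forall n, LP P (F n)) ->
  (forall n w, 0 <= F n w) -> (forall n, Ex P (F n) <= C * 2^-1 ^+ n) ->
  {ae P, forall w, exists K, forall n, F n w <= K}.
Proof.
move=> lF F0 EF; pose G w := (\sum_(n <oo) (F n w)%:E)%E.
have mF n : measurable_fun setT (fun w => (F n w)%:E).
  by apply/measurable_EFinP; have [] := lF n.
have F0' n w : setT w -> (0 <= (F n w)%:E)%E by rewrite lee_fin.
have C0 : 0 <= C.
  by have := le_trans (Ex_ge0 P (F0 0%N)) (EF 0%N); rewrite expr0 mulr1.
have IG : (\int[P]_w G w <= (2 * C)%:E)%E.
  rewrite integral_nneseries //; apply: lime_le.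
    by apply: is_cvg_nneseries => n _ _; apply: integral_ge0 => w _; exact: F0'.
  apply: nearW => n; rewrite (eq_bigr (fun k => (Ex P (F k))%:E)); last first.
    by move=> k _; rewrite Ex_fin //; exact: LP_int.
  rewrite sumEFin lee_fin; apply: le_trans (ler_sum _ (fun k _ => EF k)) _.
  have H m : \sum_(0 <= k < m) C * 2^-1 ^+ k = 2 * C * (1 - 2^-1 ^+ m).
    elim: m => [|m IH]; first by rewrite big_geq // expr0 subrr mulr0.
    by rewrite big_nat_recr //= IH exprSr; field.
  rewrite H ler_piMr ?mulr_ge0 // lerBlDr lerDl exprn_ge0 //.
have mG : measurable_fun setT G.
  by apply: ge0_emeasurable_sum => // k w _ _; exact: F0'.
have G0 w : (0 <= G w)%E by apply: nneseries_ge0 => n _ _; rewrite lee_fin.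
have iG : P.-integrable setT G.
  apply/integrableP; split => //; under eq_integral do rewrite gee0_abs //.
  exact: le_lt_trans IG (ltry _).
have := integrable_ae measurableT iG; apply: filterS => w /(_ I) fG.
exists (fine (G w)) => n; rewrite -lee_fin fineK //.
apply: le_trans (nneseries_lim_ge n.+1 _); last by move=> k _ _; rewrite lee_fin.
by rewrite big_nat_recr //= leeDr // sume_ge0 // => k _; rewrite lee_fin.
Qed.

(** Convergence in L^2 does not give almost sure convergence, but staying above a threshold from
    some rank on has probability 0 by Chebyshev's inequality. Hence 0 is almost surely a cluster
    value. *)
Lemma ae_adherent (f : nat -> Omega -> R) : (forall n, measurable_fun setT (f n)) ->
  (fun n => expectation P (fun w => f n w ^+ 2)) @ \oo --> 0%E ->
  {ae P, forall w, forall e N, 0 < e -> exists2 n, (N <= n)%N & `|f n w| < e}.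
Proof.
move=> mf lim; pose A j N := [set w | forall n, (N <= n)%N -> j.+1%:R^-1 <= `|f n w|].
have mA j N : measurable (A j N).
  have -> : A j N = \bigcap_(n in [set n | (N <= n)%N]) [set w | j.+1%:R^-1 <= `|f n w|].
    by apply/seteqP; split=> w /= h n /= Nn; exact: h.
  apply: bigcap_measurable; [by exists N => /=|move=> n _].
  rewrite (_ : [set w | _] = setT `&` (fun w => `|f n w|) @^-1` `[j.+1%:R^-1, +oo[).
    by apply: measurableT_comp => //; exact: measurable_itv.
  by rewrite setTI; apply/seteqP; split=> w /=; rewrite in_itv /= andbT.
have A0 j N : P (A j N) = 0%E.
  apply/eqP; rewrite eq_le measure_ge0 andbT.
  have j0 : 0 < j.+1%:R^-1 :> R by rewrite invr_gt0.
  have H n : (N <= n)%N -> ((j.+1%:R^-1 ^+ 2)%:E * P (A j N) <= expectation P (fun w => f n w ^+ 2)%R)%E.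
    move=> Nn; rewrite unlock.
    have m2 : measurable_fun setT (fun w => (f n w ^+ 2)%:E).
      by apply/measurable_EFinP; exact: measurable_funX.
    have p2 w : setT w -> (0 <= (f n w ^+ 2)%:E)%E by rewrite lee_fin sqr_ge0.
    have := ge0_subset_integral P (mA j N) measurableT m2 p2 (@subsetT _ _).
    apply: le_trans; rewrite -integral_cst //; apply: ge0_le_integral => //.
    - by move=> w _; rewrite lee_fin sqr_ge0.
    - exact: measurable_funTS.
    - move=> w /(_ n Nn) h; rewrite lee_fin -(real_normK (num_real (f n w))).
      by rewrite lerXn2r ?nnegrE // ltW.
  have : ((j.+1%:R^-1 ^+ 2)%:E * P (A j N) <= 0)%E.
    by apply: (cvge_ge _ lim); exists N => // n /= Nn; exact: H.
  by rewrite pmule_rle0 // lte_fin exprn_gt0.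
have neg : P.-negligible (\bigcup_j \bigcup_N A j N).
  apply: negligible_bigcup => j; apply: negligible_bigcup => N.
  by apply/negligibleP; [exact: mA|exact: A0].
apply: negligibleS neg => w /= /existsNP[e /existsNP[N /not_implyP[e0 h]]].
exists (Num.truncn e^-1) => //; exists N => // n Nn /=.
rewrite leNgt; apply/negP => fn; apply: h; exists n => //; apply: lt_trans fn _.
rewrite invf_plt ?posrE //; exact: truncnS_gt.
Qed.

(** At stage n there are fewer than 2^(n+1) variables. A moment high enough to decay like 4^(-n)
    leaves 2^(-n) for their sum, and [ae_bounded] applies. *)
Lemma ae_dyadic_bounded (G : nat -> nat -> nat -> Omega -> R) (C : nat -> R) s : 0 <= s < 1 ->
  (forall n m k, (m <= n)%N -> (k < 2 ^ m)%N -> LP P (G n m k)) ->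
  (forall p n m k, (m <= n)%N -> (k < 2 ^ m)%N ->
    Ex P (fun w => G n m k w ^+ (2 * p.+1)) <= C p * (s ^+ n) ^+ p.+1) ->
  {ae P, forall w, exists K, forall n m k, (m <= n)%N -> (k < 2 ^ m)%N -> `|G n m k w| <= K}.
Proof.
move=> /andP[s0 s1] lG EG.
(* The decay s^n may be arbitrarily slow; the choice of p is where all moments are used. *)
have [p sp] : exists p, s ^+ p.+1 <= 4^-1.
  have : `|s| < 1 by rewrite ger0_norm.
  move=> /cvg_expr /cvgrPdist_le /(_ 4^-1) []; first by [].
  move=> p _ /(_ p.+1 (leqnSn p)); rewrite sub0r normrN => h.
  by exists p; apply: le_trans h; exact: ler_norm.
pose F n w := \sum_(m < n.+1) \sum_(k < 2 ^ m) G n m k w ^+ (2 * p.+1).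
have lF n (m : 'I_n.+1) (k : 'I_(2 ^ m)) : LP P (fun w => G n m k w ^+ (2 * p.+1)).
  by apply: LPX; apply: lG => //; rewrite -ltnS.
have F1 n m k w : 0 <= G n m k w ^+ (2 * p.+1) by rewrite exprM exprn_ge0 // sqr_ge0.
have : {ae P, forall w, exists K, forall n, F n w <= K}.
  apply: (ae_bounded (C := 2 * `|C p|)).
  - by move=> n; apply: LP_sum => m; apply: LP_sum => k.
  - by move=> n w; apply: sumr_ge0 => m _; apply: sumr_ge0.
  - move=> n; rewrite Ex_sum; last by move=> m; apply: LP_sum.
    have H (m : 'I_n.+1) : Ex P (fun w => \sum_(k < 2 ^ m) G n m k w ^+ (2 * p.+1)) <=
        2 ^+ m * (`|C p| * 4^-1 ^+ n).
      rewrite Ex_sum //; apply: le_trans (_ : \sum_(k < 2 ^ m) `|C p| * 4^-1 ^+ n <= _).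
        apply: ler_sum => k _; apply: le_trans (EG p _ _ _ _ _) _ => //; first by rewrite -ltnS.
        apply: le_trans (ler_wpM2r _ (ler_norm _)) _; first by rewrite !exprn_ge0.
        rewrite ler_wpM2l // ?normr_ge0 //.
        by rewrite -exprM mulnC exprM lerXn2r ?nnegrE ?exprn_ge0.
      by rewrite sumr_const card_ord -[leLHS]mulr_natl natrX.
    apply: le_trans (ler_sum _ (fun m _ => H m)) _; rewrite -mulr_suml.
    have -> : \sum_(m < n.+1) 2 ^+ m = 2 ^+ n.+1 - 1 :> R.
      elim: n.+1 => [|k IH]; first by rewrite big_ord0 expr0 subrr.
      by rewrite big_ord_recr /= IH exprS; ring.
    apply: le_trans (_ : 2 ^+ n.+1 * (`|C p| * 4^-1 ^+ n) <= _).
      by rewrite ler_wpM2r ?mulr_ge0 ?exprn_ge0 // lerBlDr lerDl.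
    have -> : 4^-1 = 2^-1 * 2^-1 :> R by field.
    rewrite exprMn exprS exprVn le_eqVlt; apply/orP; left; apply/eqP; field.
    by rewrite expf_neq0.
apply: filterS => w [K hK]; exists (1 + K) => n m k mn km.
have g : G n m k w ^+ (2 * p.+1) <= K.
  apply: le_trans (hK n).
  have mn' : (m < n.+1)%N by rewrite ltnS.
  rewrite /F (bigD1 (Ordinal mn')) //= (bigD1 (Ordinal km)) //= -addrA lerDl.
  by rewrite addr_ge0 // ?sumr_ge0 // => i _; apply: sumr_ge0.
have K0 : 0 <= K by apply: le_trans g.
have [h|/ltW h] := leP `|G n m k w| 1; first by apply: le_trans h _; rewrite lerDl.
apply: le_trans (_ : K <= _); last by rewrite lerDr.
apply: le_trans g; rewrite -[leRHS]ger0_norm // normrX; exact: ler_eXnr.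
Qed.

End AlmostSure.

(** * Moment bounds for the area between consecutive dyadic levels *)

Section AreaMoments.
Context {d : measure_display} {Omega : measurableType d} {R : realType}
  (P : probability Omega R) (T h : R).
Hypothesis T0 : 0 < T.
Hypothesis h0 : 0 < h.
Local Notation Ex := (Ex P).
Local Notation mom := (@mom R).
Local Notation grid := (grid T).
Local Notation step := (step T).
Variables (I J : Type) (X : process R Omega I) (Y : process R Omega J) (i : I) (j : J).

Lemma lin1_sum (A : Type) (Z : process R Omega A) a (K : Type) (r : seq K) (m : K -> R)
    (F : K -> Omega -> R) : (forall k, lin1 T Z a (F k)) ->
  lin1 T Z a (fun w => \sum_(k <- r) m k * F k w).
Proof.
move=> lF; elim: r => [|k r IH].
  by exists [::]; split => // w; rewrite !big_nil.
have := lin1_comb (m k) IH (lF k) => -[s [hs e]]; exists s; split => // w.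
by rewrite big_cons -e addrC.
Qed.

Hypothesis gX : forall Z, lin1 T X i Z -> gauss P Z.
Hypothesis gY : forall Z, lin1 T Y j Z -> gauss P Z.
Hypothesis fac : forall Z V r k, lin1 T X i Z -> lin1 T Y j V ->
  Ex (fun w => Z w ^+ r * V w ^+ k) = Ex (fun w => Z w ^+ r) * Ex (fun w => V w ^+ k).
Hypothesis vX : forall s t, 0 <= s -> s <= t -> t <= T ->
  Ex (fun w => dX X i s t w ^+ 2) = (t - s) `^ (2 * h).
Hypothesis vY : forall s t, 0 <= s -> s <= t -> t <= T ->
  Ex (fun w => dX Y j s t w ^+ 2) = t - s.
Hypothesis oY : forall s t s' t', 0 <= s -> s <= t -> t <= s' -> s' <= t' -> t' <= T ->
  Ex (fun w => dX Y j s t w * dX Y j s' t' w) = 0.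

Let gridI n k : (k <= 2 ^ n)%N -> 0 <= grid n k <= T.
Proof. by move=> kn; rewrite (grid_ge0 T0) (grid_leT T0). Qed.

Definition chaosC p : R := mom (2 * p.+1) * (p.+1%:R * mom (2 * p.+1)).

Lemma chaosC_ge0 p : 0 <= chaosC p.
Proof. by rewrite mulr_ge0 ?mom_ge0 // mulr_ge0 // mom_ge0. Qed.

(** Injectivity of a makes the increments of Y pairwise orthogonal, as [chaos_moment] requires.
    Nothing similar is asked of b: the increments of X may be correlated, and only their individual
    moments enter. *)
Lemma chaos_incr (K : finType) (c : K -> R) (b a : K -> nat) n p :
  (forall k, `|c k| <= 1) -> injective a -> (forall k, (a k < 2 ^ n)%N) -> (forall k, (b k < 2 ^ n)%N) ->
  Ex (fun w => (\sum_k (c k * dX X i (grid n (b k)) (grid n (b k).+1) w) *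
     dX Y j (grid n (a k)) (grid n (a k).+1) w) ^+ (2 * p.+1)) <=
  chaosC p * (#|K|%:R * step n * step n `^ (2 * h)) ^+ p.+1.
Proof.
move=> c1 ia an bn.
pose M k w := c k * dX X i (grid n (b k)) (grid n (b k).+1) w.
pose eta k w := dX Y j (grid n (a k)) (grid n (a k).+1) w.
have lM k : lin1 T X i (M k) by apply: lin1_dX; apply: gridI; [exact: ltnW|exact: bn].
have le k : lin1 T Y j (eta k).
  have [s [hs e]] : lin1 T Y j (fun w => 1 * eta k w).
    by apply: lin1_dX; apply: gridI; [exact: ltnW|exact: an].
  by exists s; split => // w; rewrite -e mul1r.
have d0 := step_gt0 T0 n.
have gS l : grid n l.+1 - grid n l = step n by rewrite gridS; ring.
have := @chaos_moment _ _ _ P K M eta (step n) p.+1 (fun k => (gX (lM k)).1) (fun k => (gY (le k)).1).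
move=> ->.
- have := @chaos_bound _ _ _ P K M (mom (2 * p.+1) * (step n `^ (2 * h)) ^+ p.+1) p (fun k => (gX (lM k)).1).
  move=> hb; have {}hb := hb _.
  apply: le_trans (ler_wpM2l _ (hb _)) _.
  + by rewrite mulr_ge0 ?mom_ge0 // exprn_ge0 // ltW.
  + move=> k; have [lMk ->] := gX (lM k).
    have v0 : 0 <= Ex (fun w => M k w ^+ 2) by apply: Ex_ge0 => w; exact: sqr_ge0.
    rewrite sqrt_pow2 // ler_wpM2l ?mom_ge0 // lerXn2r ?nnegrE ?powR_ge0 //.
    have lD : LP P (fun w => dX X i (grid n (b k)) (grid n (b k).+1) w ^+ 2).
      have [s [hs e]] : lin1 T X i (fun w => 1 * dX X i (grid n (b k)) (grid n (b k).+1) w).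
        by apply: lin1_dX; apply: gridI; [exact: ltnW|exact: bn].
      apply: LPX; have [lD _] : gauss P (dX X i (grid n (b k)) (grid n (b k).+1)).
        by apply: gX; exists s; split => // w; rewrite -e mul1r.
      exact: lD.
    rewrite (@eq_Ex _ _ _ _ _ (fun w => c k ^+ 2 * dX X i (grid n (b k)) (grid n (b k).+1) w ^+ 2)); last first.
      by move=> w; rewrite /M exprMn.
    rewrite ExZ // vX ?(grid_ge0 T0) ?(grid_le T0) ?(grid_leT T0) // gS.
    by rewrite ler_piMl ?powR_ge0 // -(real_normK (num_real (c k))) exprn_ile1.
  + rewrite le_eqVlt; apply/orP; left; apply/eqP.
    by rewrite /chaosC !exprMn natrX; ring.
- move=> f; apply: (@factor_products _ _ _ P (lin1 T X i) (lin1 T Y j)) => //.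
  + by move=> Z x t; exact: lin1_comb.
  + by move=> Z /gX[].
  + by move=> Z x t; exact: lin1_comb.
  + by move=> Z /gY[].
- by move=> m; apply: gY; exact: lin1_sum.
- move=> k l; have [->|kl] := eqVneq k l.
    rewrite (@eq_Ex _ _ _ _ _ (fun w => eta l w ^+ 2)) ?vY ?(grid_ge0 T0) ?(grid_le T0) ?(grid_leT T0) //.
  have akl : a k != a l by apply: contra kl => /eqP/ia ->.
  rewrite /eta; have [kl'|lk] := ltnP (a k) (a l).
    by apply: oY; rewrite ?(grid_ge0 T0) ?(grid_le T0) ?(grid_leT T0).
  rewrite (@eq_Ex _ _ _ _ _ (fun w => eta l w * eta k w)); last by move=> w; rewrite mulrC.
  apply: oY; rewrite ?(grid_ge0 T0) ?(grid_le T0) ?(grid_leT T0) //.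
  by rewrite ltn_neqAle eq_sym akl lk.
Qed.

Definition path1 (A : Type) (Z : process R Omega A) a w : R -> R := fun t => Z t w a.

Definition area n m k : Omega -> R := fun w =>
  \sum_(k * 2 ^ (n - m) <= l < k.+1 * 2 ^ (n - m)) area_term T n (path1 X i w) (path1 Y j w) l.

Lemma area_moment n m k p : (m <= n)%N -> (k < 2 ^ m)%N ->
  Ex (fun w => area n m k w ^+ (2 * p.+1)) <=
  chaosC p * (step m * step n.+1 `^ (2 * h)) ^+ p.+1.
Proof.
move=> mn km; pose N := (2 ^ (n - m))%N.
(* The triangle in a cell is a difference of two products. The boolean selects one: [true] pairs the
   left half of X with the right half of Y, [false] the opposite with a minus sign. *)
pose K : finType := ('I_N * bool)%type.
pose a (q : K) := (2 * (k * N + q.1) + q.2)%N.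
pose b (q : K) := (2 * (k * N + q.1) + ~~ q.2)%N.
pose c (q : K) : R := if q.2 then 2^-1 else - 2^-1.
have lim (q : K) (e : bool) : (2 * (k * N + q.1) + e < 2 ^ n.+1)%N.
  have h1 : (k * N + q.1 < 2 ^ n)%N.
    have -> : (2 ^ n = 2 ^ m * N)%N by rewrite -expnD subnKC.
    apply: leq_trans (_ : k * N + N <= _)%N; first by rewrite ltn_add2l.
    by rewrite -mulSnr leq_mul2r km orbT.
  by rewrite expnS; case: e; lia.
have := @chaos_incr K c b a n.+1 p.
have -> : #|K|%:R * step n.+1 = step m.
  rewrite card_prod card_ord card_bool natrM -mulrA -stepS /N natrX.
  by rewrite [step m](step_add _ _ (n - m)) subnKC.
move=> H; apply: le_trans (H _ _ _ _).
- rewrite le_eqVlt; apply/orP; left; apply/eqP; apply: eq_Ex => w; congr (_ ^+ _).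
  rewrite /area -/N.
  rewrite (_ : k.+1 * N = N + k * N)%N // -{1}[(k * N)%N]add0n big_addn addnK big_mkord.
  rewrite (eq_bigr (fun l : 'I_N => \sum_(e : bool) (c (l, e) * dX X i (grid n.+1 (b (l, e))) (grid n.+1 (b (l, e)).+1) w) *
     dX Y j (grid n.+1 (a (l, e))) (grid n.+1 (a (l, e)).+1) w)).
    by rewrite pair_big /=; apply: eq_bigr => -[l e] _.
  move=> l _; rewrite big_bool /= /a /b /c /= !addn0 !addn1 [(l + _)%N]addnC.
  by rewrite /area_term /dl /dX /path1; field.
- by move=> q; rewrite /c; case: q.2; rewrite ?normrN ger0_norm //; lra.
- move=> [l e] [l' e']; rewrite /a /= => E.
  have [E1 E2] : l = l' :> nat /\ e = e' by case: e E; case: e'; split; lia.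
  by rewrite E2; congr (_, _); exact: val_inj.
- by move=> q; exact: lim.
- by move=> q; exact: lim.
Qed.

Lemma lin1_dX1 (A : Type) (Z : process R Omega A) a s t : 0 <= s <= T -> 0 <= t <= T ->
  lin1 T Z a (dX Z a s t).
Proof.
move=> hs ht; have [r [hr e]] := lin1_dX Z a 1 hs ht.
by exists r; split => // w; rewrite -e mul1r.
Qed.

Lemma LP_area n m k : (m <= n)%N -> (k < 2 ^ m)%N -> LP P (area n m k).
Proof.
move=> mn km; rewrite /area; set N := (2 ^ (n - m))%N.
have E w : \sum_(0 <= l < N) area_term T n (path1 X i w) (path1 Y j w) (l + k * N) = 
    \sum_(k * N <= l < k.+1 * N) area_term T n (path1 X i w) (path1 Y j w) l.
  by rewrite (_ : k.+1 * N = N + k * N)%N // -{2}[(k * N)%N]add0n big_addn addnK.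
apply: (LP_ext E); apply: (@LP_ext _ _ _ P (fun w => \sum_(l < N) area_term T n (path1 X i w) (path1 Y j w) (l + k * N))).
  by move=> w; rewrite big_mkord.
apply: LP_sum => l.
have lim : (2 * (l + k * N) < 2 ^ n.+1)%N /\ (2 * (l + k * N) + 1 < 2 ^ n.+1)%N.
  have h1' : (k * N + l < 2 ^ n)%N.
    have -> : (2 ^ n = 2 ^ m * N)%N by rewrite -expnD subnKC.
    apply: leq_trans (_ : k * N + N <= _)%N; first by rewrite ltn_add2l.
    by rewrite -mulSnr leq_mul2r km orbT.
  by rewrite expnS; lia.
have lX s t : 0 <= s <= T -> 0 <= t <= T -> LP P (dX X i s t).
  by move=> hs ht; have /gX[] : lin1 T X i (dX X i s t) by exact: lin1_dX1.
have lY s t : 0 <= s <= T -> 0 <= t <= T -> LP P (dX Y j s t).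
  by move=> hs ht; have /gY[] : lin1 T Y j (dX Y j s t) by exact: lin1_dX1.
have [l1 l2] := lim; rewrite addn1 in l2.
apply: (@LP_ext _ _ _ P (fun w => 2^-1 * (dX X i (grid n.+1 (2 * (l + k * N))) (grid n.+1 (2 * (l + k * N)).+1) w *
  dX Y j (grid n.+1 (2 * (l + k * N)).+1) (grid n.+1 (2 * (l + k * N)).+2) w -
  dX X i (grid n.+1 (2 * (l + k * N)).+1) (grid n.+1 (2 * (l + k * N)).+2) w *
  dX Y j (grid n.+1 (2 * (l + k * N))) (grid n.+1 (2 * (l + k * N)).+1) w))).
  by move=> w; rewrite /area_term mulrC.
by apply: LPZ; apply: LPB; apply: LPM; (apply: lX || apply: lY); apply: gridI => //; exact: ltnW.
Qed.

Lemma ae_area th : 0 <= th -> th < 2^-1 + h -> exists2 q, 0 <= q < 1 &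
  {ae P, forall w, exists2 C, 0 <= C & forall n m k, (m <= n)%N -> (k < 2 ^ m)%N ->
    `|area n m k w| <= C * step m `^ th * q ^+ n}.
Proof.
move=> th0 thh.
(* The factor [step m] ^ (1 - 2 th) grows with m when th > 1/2; mu^n bounds its growth for m <= n in
   either case. The condition th < 1/2 + h is what makes be < 1. *)
pose mu : R := Num.max 1 (2 `^ (2 * th - 1)).
pose be := mu * 2 `^ (- (2 * h)).
have mu0 : 0 < mu by rewrite lt_max ltr01.
have be0 : 0 < be by rewrite mulr_gt0 // powR_gt0.
have be1 : be < 1.
  have p1 : 0 < 2 `^ (2 * h) :> R by rewrite powR_gt0.
  rewrite /be powRN -/(_ / _) ltr_pdivrMr // mul1r /mu gt_max; apply/andP; split.
    by rewrite -[ltLHS](powRr0 2); apply: lt2_powR; move: h0; lra.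
  by apply: lt2_powR; lra.
(* The decay be^n = s^n (q^n)^2 is shared: (q^n)^2 goes into the pathwise bound and s^n makes the
   moments summable. *)
pose s := Num.sqrt be; pose q := Num.sqrt s.
have s0 : 0 < s by rewrite sqrtr_gt0.
have q0 : 0 < q by rewrite sqrtr_gt0.
have s1 : s < 1 by rewrite -sqrtr1 ltr_sqrt.
have q1 : q < 1 by rewrite -sqrtr1 ltr_sqrt.
have ss : s ^+ 2 = be by rewrite sqr_sqrtr // ltW.
have qq : q ^+ 2 = s by rewrite sqr_sqrtr // ltW.
exists q; first by rewrite q1 ltW.
pose D n m := step m `^ th * q ^+ n.
have D0 n m : 0 < D n m by rewrite mulr_gt0 ?exprn_gt0 ?powR_gt0 ?step_gt0.
pose G n m k w := (D n m)^-1 * area n m k w.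
pose A := T `^ (1 - 2 * th) * (T `^ (2 * h)).
have A0 : 0 <= A by rewrite mulr_ge0 // powR_ge0.
have ratio n m : (m <= n)%N -> (step m * step n.+1 `^ (2 * h)) / D n m ^+ 2 <= A * s ^+ n.
  move=> mn; rewrite ler_pdivrMr ?exprn_gt0 //.
  have E : step m = step m `^ (1 - 2 * th) * (step m `^ th) ^+ 2.
    rewrite -[_ ^+ 2]powR_mulrn ?powR_ge0 // -powRrM -powRD.
      by rewrite (_ : _ + th * 2 = 1) ?powRr1 ?ltW ?step_gt0 //; ring.
    by rewrite (gt_eqF (step_gt0 T0 m)) implybT.
  have -> : A * s ^+ n * D n m ^+ 2 =
      (T `^ (1 - 2 * th) * mu ^+ n) * (step m `^ th) ^+ 2 * (T `^ (2 * h) * (2 `^ (- (2 * h))) ^+ n).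
    rewrite /D exprMn -exprM mulnC exprM qq.
    have -> : mu ^+ n = be ^+ n / (2 `^ (- (2 * h))) ^+ n.
      by rewrite /be exprMn mulfK // expf_neq0 // gt_eqF // powR_gt0.
    rewrite -ss /A -exprM mulnC exprM; field.
    by rewrite expf_neq0 // gt_eqF // powR_gt0.
  have b1 : step m `^ (1 - 2 * th) <= T `^ (1 - 2 * th) * mu ^+ n.
    rewrite step_powR // ler_wpM2l ?powR_ge0 // opprB.
    apply: le_trans (_ : mu ^+ m <= _).
      by rewrite lerXn2r ?nnegrE ?powR_ge0 ?(ltW mu0) // /mu le_max lexx orbT.
    by apply: ler_weXn2l => //; rewrite /mu le_max lexx.
  have b2 : step n.+1 `^ (2 * h) <= T `^ (2 * h) * (2 `^ (- (2 * h))) ^+ n.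
    rewrite step_powR // ler_wpM2l ?powR_ge0 // exprS ler_piMl ?exprn_ge0 ?powR_ge0 //.
    by rewrite -[leRHS](powRr0 2) ler_powR ?ler1n //; move: h0; lra.
  rewrite {1}E; apply: ler_pM => //; rewrite ?mulr_ge0 ?exprn_ge0 ?powR_ge0 //.
  by rewrite ler_wpM2r // exprn_ge0 // powR_ge0.
have : {ae P, forall w, exists K, forall n m k, (m <= n)%N -> (k < 2 ^ m)%N -> `|G n m k w| <= K}.
  apply: (ae_dyadic_bounded (s := s) (C := fun p => chaosC p * A ^+ p.+1)).
  - by rewrite s1 ltW.
  - by move=> n m k mn km; apply: LPZ; exact: LP_area.
  - move=> p n m k mn km; rewrite (@eq_Ex _ _ _ _ _ (fun w => (D n m)^-1 ^+ (2 * p.+1) * area n m k w ^+ (2 * p.+1))); last first.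
      by move=> w; rewrite /G exprMn.
    rewrite ExZ; last by apply: LPX; exact: LP_area.
    apply: le_trans (ler_wpM2l _ (area_moment p mn km)) _.
      by rewrite exprn_ge0 // invr_ge0 ltW.
    rewrite mulrCA -mulrA ler_wpM2l //.
      by rewrite mulr_ge0 ?mom_ge0 // mulr_ge0 // mom_ge0.
    have sm := ltW (step_gt0 T0 m).
    have sn : 0 <= step n.+1 `^ (2 * h) by exact: powR_ge0.
    have Di : 0 <= (D n m)^-1 by rewrite invr_ge0 ltW.
    rewrite exprM -!exprMn lerXn2r ?nnegrE //.
    + by apply: mulr_ge0; [exact: exprn_ge0|exact: mulr_ge0].
    + by apply: mulr_ge0 => //; apply: exprn_ge0; exact: ltW.
    + by apply: le_trans (ratio n m mn); rewrite exprVn mulrC.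
apply: filterS => w [K hK]; exists `|K| => // n m k mn km.
have := hK n m k mn km; rewrite /G normrM normfV (gtr0_norm (D0 n m)) mulrC ler_pdivrMr // => hG.
by apply: le_trans hG _; rewrite /D mulrA ler_wpM2r ?exprn_ge0 ?(ltW q0) // ler_wpM2r ?powR_ge0 // ler_norm.
Qed.

(** Half the discrete covariation of X and Y: the excess of the trapezoidal sum over the Ito sum. It
    tends to 0 in L^2 because it is again a decoupled form. *)
Definition ito_rem n k N w := \sum_(l < N)
  (2^-1 * dX X i (grid n (l + k)) (grid n (l + k).+1) w) * dX Y j (grid n (l + k)) (grid n (l + k).+1) w.

Let ito_rem_lt n k N (l : 'I_N) : (k + N <= 2 ^ n)%N -> (l + k < 2 ^ n)%N.
Proof. by apply: leq_trans; rewrite addnC ltn_add2l. Qed.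

Lemma LP_ito_rem n k N : (k + N <= 2 ^ n)%N -> LP P (ito_rem n k N).
Proof.
move=> kN; apply: LP_sum => l; have lt := ito_rem_lt l kN.
have hs := gridI (ltnW lt); have ht := gridI lt.
apply: LPM; first by apply: LPZ; have /gX[] := lin1_dX1 X i hs ht.
by have /gY[] := lin1_dX1 Y j hs ht.
Qed.

Lemma ito_rem_L2 m k l : (k <= l)%N -> (l <= 2 ^ m)%N ->
  (fun n => expectation P (fun w => ito_rem (m + n) (k * 2 ^ n) ((l - k) * 2 ^ n) w ^+ 2)) @ \oo --> 0%E.
Proof.
move=> kl lm.
have lim n : (k * 2 ^ n + (l - k) * 2 ^ n <= 2 ^ (m + n))%N.
  by rewrite -mulnDl subnKC // expnD leq_mul2r lm orbT.
pose D := chaosC 0 * ((l - k)%:R * step m * T `^ (2 * h)).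
have D0 : 0 <= D.
  have sm := ltW (step_gt0 T0 m).
  apply: mulr_ge0; first exact: chaosC_ge0.
  by apply: mulr_ge0; [exact: mulr_ge0|exact: powR_ge0].
pose rh : R := 2 `^ (- (2 * h)).
have rh1 : `|rh| < 1.
  rewrite ger0_norm ?powR_ge0 // -[ltRHS](powRr0 2); apply: lt2_powR.
  by move: h0; lra.
apply: (@squeeze_cvge _ _ _ _ (cst 0%E) _ (fun n => (D * rh ^+ n)%:E)); last 2 first.
- exact: cvg_cst.
- apply: cvg_EFin; first exact: nearW.
  rewrite -[X in _ --> X](mulr0 D); apply: cvgMr; exact: cvg_expr.
apply: nearW => n; rewrite expectation_Ex; last by apply: LPX; apply: LP_ito_rem.
rewrite !lee_fin; apply/andP; split; first by apply: Ex_ge0 => w; exact: sqr_ge0.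
pose a (q : 'I_((l - k) * 2 ^ n)) := (q + k * 2 ^ n)%N.
have c1 (q : 'I_((l - k) * 2 ^ n)) : `|2^-1| <= 1 :> R by rewrite ger0_norm //; lra.
have ia : injective a by move=> q q' /addIn /val_inj.
have an q : (a q < 2 ^ (m + n))%N by exact: ito_rem_lt.
apply: le_trans (chaos_incr 0 c1 ia an an) _.
have -> : #|'I_((l - k) * 2 ^ n)|%:R * step (m + n) = (l - k)%:R * step m.
  by rewrite card_ord natrM natrX -mulrA -step_add.
have rm : rh ^+ (m + n) <= rh ^+ n.
  rewrite exprD ler_piMl ?exprn_ge0 ?powR_ge0 //.
  by rewrite exprn_ile1 ?powR_ge0 // ltW // -[ltLHS](ger0_norm (powR_ge0 _ _)).
rewrite [(_ * step (m + n) `^ _) ^+ 1]expr1 step_powR // -/rh.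
apply: le_trans (_ : chaosC 0 * ((l - k)%:R * step m * T `^ (2 * h) * rh ^+ n) <= _); last first.
  by rewrite /D mulrA.
rewrite ler_wpM2l ?chaosC_ge0 // -[leRHS]mulrA ler_wpM2l //.
  by apply: mulr_ge0 => //; exact: ltW (step_gt0 T0 m).
by rewrite ler_wpM2l ?powR_ge0.
Qed.

End AreaMoments.

Lemma sum_shift (R : zmodType) k N (F : nat -> R) :
  \sum_(k <= j < k + N) F j = \sum_(0 <= l < N) F (l + k)%N.
Proof. by rewrite -{1}[k]add0n big_addn addKn. Qed.

(** * Uniform grids as partitions *)

Section GridPartition.
Context {R : realType} (T : R).
Hypothesis T0 : 0 < T.
Local Notation grid := (grid T).
Local Notation step := (step T).

Definition gridp n k N : seq R := [seq grid n j | j <- iota k.+1 N].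

Lemma gridp_itv n k N : itv_partition (grid n k) (grid n (k + N)) (gridp n k N).
Proof.
rewrite /itv_partition /gridp; elim: N k => [|N IH] k; first by rewrite addn0 /= eqxx.
have [h1 h2] := IH k.+1; split; first by rewrite /= (grid_lt T0) ltnSn.
by move: h2; rewrite addSnnS.
Qed.

Lemma gridp_mesh n k N delta : step n < delta -> mesh (grid n k) (grid n (k + N)) (gridp n k N) < delta.
Proof.
move=> sd; have d0 : 0 < delta by apply: lt_trans sd; exact: step_gt0.
rewrite mesh_ltP // /gridp; elim: N k => [|N IH] k //=.
by rewrite IH andbT gridS addrAC subrr add0r.
Qed.

(** Limits over all partitions of vanishing mesh specialise to the sequence of dyadic grids. The
    truncated n - m matters only from rank m on. *)
Lemma gridp_mesh0 m k l : (k <= l)%N ->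
  (fun n => gridp n (k * 2 ^ (n - m)) ((l - k) * 2 ^ (n - m))) @ \oo --> mesh0 (grid m k) (grid m l).
Proof.
move=> kl A [delta /= d0 dA].
have [n0 hn] := step_powR_lt T0 ltr01 d0.
exists (maxn m n0) => // n /=; rewrite geq_max => /andP[mn nn]; apply: dA.
have El : (l * 2 ^ (n - m) = k * 2 ^ (n - m) + (l - k) * 2 ^ (n - m))%N.
  by rewrite -mulnDl subnKC.
rewrite !(grid_level T _ mn) El; split; first exact: gridp_itv.
apply: gridp_mesh; have := hn n nn; rewrite powRr1 // ltW // step_gt0 //.
Qed.

Lemma gridp_point n k N t j : (j <= N)%N -> part_point (grid n k) t (gridp n k N) j = grid n (k + j).
Proof.
move=> jN; rewrite /part_point /gridp -[_ :: _]/(map (grid n) (iota k N.+1)).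
by rewrite (nth_map 0%N) ?size_iota // nth_iota.
Qed.

Lemma gridp_sum n k N t (th : R -> R -> R) :
  \sum_(0 <= l < size (gridp n k N)) th (part_point (grid n k) t (gridp n k N) l)
     (part_point (grid n k) t (gridp n k N) l.+1) =
  \sum_(k <= j < k + N) th (grid n j) (grid n j.+1).
Proof.
rewrite size_map size_iota [RHS]sum_shift [LHS]big_nat [RHS]big_nat.
by apply: eq_bigr => l /andP[_ lN]; rewrite !gridp_point ?(ltnW lN) // addnS [(k + l)%N]addnC.
Qed.

End GridPartition.

Section LevelTwo.
Context {d : measure_display} {Omega : measurableType d} {R : realType}
  (P : probability Omega R).

Lemma L2_add (f g : nat -> Omega -> R) :
  (forall n, measurable_fun setT (f n)) -> (forall n, measurable_fun setT (g n)) ->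
  (fun n => expectation P (fun w => f n w ^+ 2)) @ \oo --> 0%E ->
  (fun n => expectation P (fun w => g n w ^+ 2)) @ \oo --> 0%E ->
  (fun n => expectation P (fun w => (f n w + g n w) ^+ 2)) @ \oo --> 0%E.
Proof.
move=> mf mg hf hg; rewrite unlock in hf hg *.
have m2 (h : Omega -> R) : measurable_fun setT h -> measurable_fun setT (fun w => (h w ^+ 2)%:E).
  by move=> mh; apply/measurable_EFinP; exact: measurable_funX.
have p2 (h : Omega -> R) w : setT w -> (0 <= (h w ^+ 2)%:E)%E by rewrite lee_fin sqr_ge0.
apply: (@squeeze_cvge _ _ _ _ (cst 0%E) _
  (fun n => 2%:E * (\int[P]_w (f n w ^+ 2)%:E + \int[P]_w (g n w ^+ 2)%:E))%E); last 2 first.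
- exact: cvg_cst.
- rewrite -[X in _ --> X](mule0 2%:E); apply: cvgeZl => //.
  by rewrite -[X in _ --> X](adde0 0%E); apply: cvgeD.
apply: nearW => n; apply/andP; split; first by apply: integral_ge0 => w _; rewrite lee_fin sqr_ge0.
rewrite -ge0_integralD //; [|exact: p2|exact: m2|exact: p2|exact: m2].
rewrite -ge0_integralZl_EFin //; last 2 first.
- by move=> w _; rewrite adde_ge0 // lee_fin sqr_ge0.
- by apply: emeasurable_funD; exact: m2.
apply: ge0_le_integral => //.
- exact: p2.
- by apply: m2; exact: measurable_funD.
- by apply: measurable_funeM; apply: emeasurable_funD; exact: m2.
- move=> w _; rewrite -EFinD -EFinM lee_fin; have := sqr_ge0 (f n w - g n w); nra.
Qed.

Variables (T : R) (I J : Type) (X : process R Omega I) (Y : process R Omega J) (i : I) (j : J).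
Hypothesis T0 : 0 < T.
Local Notation grid := (grid T).
Variables (A : Omega -> R -> R -> R) (S : Omega -> R -> R -> seq R -> R)
  (rem : nat -> nat -> nat -> Omega -> R).
Hypothesis mX : forall t, 0 <= t <= T -> measurable_fun setT (fun w => X t w i).
Hypothesis mY : forall t, 0 <= t <= T -> measurable_fun setT (fun w => Y t w j).
Hypothesis hA : forall s t, 0 <= s -> s <= t -> t <= T ->
  measurable_fun setT (fun w => A w s t) /\
  (fun p => expectation P (fun w => (S w s t p - A w s t) ^+ 2)) @ mesh0 s t --> 0%E.
Hypothesis hS : forall n k N w, (k + N <= 2 ^ n)%N ->
  dy T n (path1 X i w) (path1 Y j w) (grid n k) (grid n (k + N)) =
  S w (grid n k) (grid n (k + N)) (gridp T n k N) + rem n k N w.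
Hypothesis mrem : forall n k N, (k + N <= 2 ^ n)%N -> measurable_fun setT (rem n k N).
Hypothesis hrem : forall m k l, (k <= l)%N -> (l <= 2 ^ m)%N ->
  (fun n => expectation P (fun w => rem (m + n) (k * 2 ^ n) ((l - k) * 2 ^ n) w ^+ 2)) @ \oo --> 0%E.

Lemma measurable_dy n k N : (k + N <= 2 ^ n)%N ->
  measurable_fun setT (fun w => dy T n (path1 X i w) (path1 Y j w) (grid n k) (grid n (k + N))).
Proof.
move=> kN; have gI l : (l <= k + N)%N -> 0 <= grid n l <= T.
  by move=> lk; rewrite (grid_ge0 T0) (grid_leT T0) (leq_trans lk).
apply: (@eq_measurable_fun _ _ _ _ _ (fun w => \sum_(l < N)
   ((X (grid n (l + k)) w i - X (grid n k) w i) + (X (grid n (l + k).+1) w i - X (grid n k) w i)) / 2 *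
   (Y (grid n (l + k).+1) w j - Y (grid n (l + k)) w j))).
  move=> w _; rewrite (dy_grid T0) ?leq_addr // sum_shift big_mkord.
  by [].
apply: measurable_sum => l.
have l1 : (l + k < k + N)%N by rewrite addnC ltn_add2l.
apply: measurable_funM; last by apply: measurable_funB; apply: mY; apply: gI => //; exact: ltnW.
apply: measurable_funM => //.
by apply: measurable_funD; apply: measurable_funB; apply: mX; apply: gI; rewrite ?leq_addr // ltnW.
Qed.

(** Common to the Ito and Stratonovich cases, where [rem] is the half covariation and 0
    respectively. It provides the hypothesis [Psi_adh] of the convergence criterion. *)
Lemma ae_level_adh : {ae P, forall w, forall m k l, (k <= l)%N -> (l <= 2 ^ m)%N ->
  forall e N, 0 < e -> exists2 n, (N <= n)%N &
    `|dy T n (path1 X i w) (path1 Y j w) (grid m k) (grid m l) - A w (grid m k) (grid m l)| < e}.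
Proof.
(* Only countably many pairs of dyadic times occur, so a single null set suffices. *)
apply: ae_foralln => m; apply: ae_foralln => k; apply: ae_foralln => l.
have [kl|lk] := leqP k l; last first.
  by apply: nearW => w.
have [lm|ml] := leqP l (2 ^ m); last by apply: nearW => w.
have lim n : (k * 2 ^ n + (l - k) * 2 ^ n <= 2 ^ (m + n))%N.
  by rewrite -mulnDl subnKC // expnD leq_mul2r lm orbT.
have g1 n : grid m k = grid (m + n) (k * 2 ^ n) by rewrite grid_refine.
have g2 n : grid m l = grid (m + n) (k * 2 ^ n + (l - k) * 2 ^ n).
  by rewrite -mulnDl subnKC // grid_refine.
have [mA hAl] : _ /\ _ := hA (grid_ge0 T0 m k) (eqbRL (grid_le T0 m k l) kl) (eqbRL (grid_leT T0 m l) lm).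
pose Sn n w := S w (grid m k) (grid m l) (gridp T (m + n) (k * 2 ^ n) ((l - k) * 2 ^ n)).
pose rn n := rem (m + n) (k * 2 ^ n) ((l - k) * 2 ^ n).
have E n w : dy T (m + n) (path1 X i w) (path1 Y j w) (grid m k) (grid m l) = Sn n w + rn n w.
  by rewrite /Sn (g1 n) (g2 n) hS.
have mr n : measurable_fun setT (rn n) by exact: mrem.
have md n : measurable_fun setT (fun w => dy T (m + n) (path1 X i w) (path1 Y j w) (grid m k) (grid m l)).
  by rewrite (g1 n) (g2 n); exact: measurable_dy.
have mS n : measurable_fun setT (Sn n).
  apply: (@eq_measurable_fun _ _ _ _ _ (fun w => dy T (m + n) (path1 X i w) (path1 Y j w) (grid m k) (grid m l) - rn n w)).
    by move=> w _; rewrite E addrK.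
  exact: measurable_funB.
have := @ae_adherent _ _ _ P (fun n w => (Sn n w - A w (grid m k) (grid m l)) + rn n w).
case.
- by move=> n; apply: measurable_funD => //; exact: measurable_funB.
- apply: L2_add => //; [by move=> n; exact: measurable_funB| |exact: hrem].
  have H := cvg_comp _ _ (gridp_mesh0 T0 (m := m) kl) hAl.
  have := cvg_comp _ _ (cvg_addnl m) H; apply: cvg_trans; apply: near_eq_cvg; apply: nearW => n.
  by rewrite /= addKn.
move=> B [mB PB hB]; exists B; split => // w /= hw; apply: hB => /= h; apply: hw => _ _ e N e0.
have [n Nn hn] := h e N e0; exists (m + n)%N; first by rewrite (leq_trans Nn) // leq_addl.
by rewrite E addrAC.
Qed.

End LevelTwo.

Section PathRegularity.
Context {R : realType} (T : R).

Lemma simplex_incr (x : R -> R) : {within `[0, T], continuous x} ->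
  {within simplex T, continuous (fun st => dl x st.1 st.2)}.
Proof.
move=> /subspace_continuousP cx; apply/subspace_continuousP => -[s t] [/= s0 st tT].
have C r : 0 <= r -> r <= T -> x @ within `[0, T]%classic (nbhs r) --> x r.
  by move=> r0 rT; apply: cx; rewrite /= in_itv /= r0.
apply: cvgB.
- apply: (cvg_comp _ _ _ (C t (le_trans s0 st) tT)) => A /nbhs_ballP[e e0 h].
  apply/nbhs_ballP; exists e => // -[s' t'] [_ /= ht] [/= s'0 st' t'T].
  by apply: h => //; rewrite /= in_itv /= t'T (le_trans s'0).
- apply: (cvg_comp _ _ _ (C s s0 (le_trans st tT))) => A /nbhs_ballP[e e0 h].
  apply/nbhs_ballP; exists e => // -[s' t'] [/= hs _] [/= s'0 st' t'T].
  by apply: h => //; rewrite /= in_itv /= s'0 (le_trans st').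
Qed.

End PathRegularity.

(** * Covariances of increments and Hoelder continuity of Brownian paths *)

Section GaussianPaths.
Context {d : measure_display} {Omega : measurableType d} {R : realType}
  (P : probability Omega R) (T : R).
Hypothesis T0 : 0 < T.
Local Notation Ex := (Ex P).
Local Notation grid := (grid T).
Local Notation step := (step T).

Lemma sum_measurable (d' : measure_display) (O' : measurableType d') (K : Type) (s : seq K) (F : K -> O' -> R) :
  (forall q, List.In q s -> measurable_fun setT (F q)) ->
  measurable_fun setT (fun w => \sum_(q <- s) F q w).
Proof.
elim: s => [|q s IH] h.
  rewrite (_ : (fun _ => _) = cst 0); last by apply/funext => w; rewrite big_nil.
  exact: measurable_cst.
rewrite (_ : (fun _ => _) = fun w => F q w + \sum_(q <- s) F q w); last first.
  by apply/funext => w; rewrite big_cons.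
by apply: measurable_funD; [apply: h; left|apply: IH => q' hq; apply: h; right].
Qed.

Lemma lin1_sigma (I : Type) (X : process R Omega I) i Z r (B : set R) : lin1 T X i Z -> measurable B ->
  process_sigma T X ((fun w => Z w ^+ r) @^-1` B).
Proof.
move=> [s [hs Zs]] mB.
pose G := [set A | exists t i (B : set R), [/\ 0 <= t <= T, measurable B &
         A = (fun omega => X t omega i) @^-1` B]].
have mZ : measurable_fun setT (Z : g_sigma_algebraType G -> R).
  rewrite (_ : Z = fun w => \sum_(q <- s) q.1 * X q.2 w i); last exact/funext.
  apply: sum_measurable => q /hs hq; apply: measurable_funM => //.
  move=> _ C mC; rewrite setTI; apply: sub_gen_smallest.
  by exists q.2, i, C.
by have := measurable_funX r mZ measurableT mB; rewrite setTI.
Qed.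

Lemma independent_factor (I J : finType) (X : process R Omega I) (Y : process R Omega J) KX KY :
  centered_gaussian_process P T KX X -> centered_gaussian_process P T KY Y ->
  independent_processes P T X Y ->
  forall i j Z V r k, lin1 T X i Z -> lin1 T Y j V ->
  Ex (fun w => Z w ^+ r * V w ^+ k) = Ex (fun w => Z w ^+ r) * Ex (fun w => V w ^+ k).
Proof.
move=> GX GY ind i j Z V r k lZ lV; apply: indep_Ex.
- by apply: LPX; have [] := lin_gauss GX (lin1_lin lZ).
- by apply: LPX; have [] := lin_gauss GY (lin1_lin lV).
- by move=> A B mA mB; apply: ind; [exact: (lin1_sigma r lZ mA)|exact: (lin1_sigma k lV mB)].
Qed.

Lemma brownian_var (I : finType) (X : process R Omega I) i s t :
  centered_gaussian_process P T (fun s t => Num.min s t) X ->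
  0 <= s -> s <= t -> t <= T -> Ex (fun w => dX X i s t w ^+ 2) = t - s.
Proof.
move=> GX s0 st tT; rewrite (@eq_Ex _ _ _ _ _ (fun w => dX X i s t w * dX X i s t w)); last by [].
have sT := le_trans st tT; have t0 := le_trans s0 st.
rewrite (cov_dX GX) ?s0 ?t0 ?sT // eqxx !minxx (min_r st) (min_l st); ring.
Qed.

Lemma brownian_orth (I : finType) (X : process R Omega I) i s t s' t' :
  centered_gaussian_process P T (fun s t => Num.min s t) X ->
  0 <= s -> s <= t -> t <= s' -> s' <= t' -> t' <= T ->
  Ex (fun w => dX X i s t w * dX X i s' t' w) = 0.
Proof.
move=> GX s0 st ts st' tT.
have t0 := le_trans s0 st; have s'0 := le_trans t0 ts; have t'0 := le_trans s'0 st'.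
have s'T := le_trans st' tT; have t_T := le_trans ts s'T; have sT := le_trans st t_T.
rewrite (cov_dX GX) ?s0 ?t0 ?sT ?s'0 ?t'0 ?t_T ?s'T //  eqxx.
by rewrite !min_l ?(le_trans st) ?(le_trans ts) //; ring.
Qed.

Lemma fbm_var (I : finType) (X : process R Omega I) H i s t : 0 < H ->
  centered_gaussian_process P T
    (fun s t => (s `^ (2 * H) + t `^ (2 * H) - `|t - s| `^ (2 * H)) / 2) X ->
  0 <= s -> s <= t -> t <= T -> Ex (fun w => dX X i s t w ^+ 2) = (t - s) `^ (2 * H).
Proof.
move=> H0 GX s0 st tT; rewrite (@eq_Ex _ _ _ _ _ (fun w => dX X i s t w * dX X i s t w)); last by [].
have sT := le_trans st tT; have t0 := le_trans s0 st.
rewrite (cov_dX GX) ?s0 ?t0 ?sT // eqxx !subrr normr0 powR0; last by lra.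
rewrite [`|s - t|]distrC ger0_norm ?subr_ge0 //; by field.
Qed.

(** High moments bound the increments over dyadic cells, and chaining applies with zero defect,
    since increments are additive; the exponent is split as h/2 + h/2. *)
Lemma ae_holder (I : finType) (X : process R Omega I) i h : 0 < h -> h < 2^-1 ->
  centered_gaussian_process P T (fun s t => Num.min s t) X -> continuous_from0 P T X ->
  {ae P, forall w, exists C, HP T h C (path1 X i w)}.
Proof.
move=> h0 h1 GX cX.
(* The index m is a dummy that gives the family the shape of [ae_dyadic_bounded]; the bound is used
   for m = n. *)
pose G n (m : nat) k w := (step n `^ h)^-1 * dX X i (grid n k) (grid n k.+1) w.
have gI n k : (k <= 2 ^ n)%N -> 0 <= grid n k <= T.
  by move=> kn; rewrite (grid_ge0 T0) (grid_leT T0).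
have kn n m k : (m <= n)%N -> (k < 2 ^ m)%N -> (k < 2 ^ n)%N.
  by move=> mn km; apply: leq_trans km _; rewrite leq_exp2l.
have gd n k : (k < 2 ^ n)%N -> gauss P (dX X i (grid n k) (grid n k.+1)).
  by move=> lt; apply: (lin_gauss GX); apply: (@lin1_lin _ _ _ _ _ _ i); apply: lin1_dX1; apply: gI => //; exact: ltnW.
have : {ae P, forall w, exists K, forall n m k, (m <= n)%N -> (k < 2 ^ m)%N -> `|G n m k w| <= K}.
  apply: (ae_dyadic_bounded (s := 2 `^ (- (1 - 2 * h))) (C := fun p => @mom R (2 * p.+1) * (T `^ (1 - 2 * h)) ^+ p.+1)).
  - by rewrite powR_ge0 /= -[ltRHS](powRr0 2); apply: lt2_powR; lra.
  - by move=> n m k mn km; apply: LPZ; have [] := gd n k (kn _ _ _ mn km).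
  - move=> p n m k mn km; have lt := kn _ _ _ mn km.
    have [lD eD] := gd n k lt.
    rewrite (@eq_Ex _ _ _ _ _ (fun w => (step n `^ h)^-1 ^+ (2 * p.+1) *
       dX X i (grid n k) (grid n k.+1) w ^+ (2 * p.+1))); last first.
      by move=> w; rewrite /G exprMn.
    rewrite ExZ; last exact: LPX.
    rewrite eD brownian_var ?(grid_ge0 T0) ?(grid_le T0) ?(grid_leT T0) //.
    rewrite gridS addrAC subrr add0r sqrt_pow2; last exact: ltW (step_gt0 T0 n).
    rewrite mulrCA -[leRHS]mulrA ler_wpM2l ?mom_ge0 // exprM -!exprMn -step_powR //.
    rewrite le_eqVlt; apply/orP; left; apply/eqP; congr (_ ^+ _).
    have sn := step_gt0 T0 n.
    rewrite powRB ?(gt_eqF sn) ?implybT // powRr1 ?(ltW sn) // mulrC; congr (_ * _).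
    by rewrite exprVn -powR_mulrn ?powR_ge0 // -powRrM mulrC.
have [K K0 hK] := chaining T0 (divr_gt0 h0 (ltr0Sn R 1)) (divr_gt0 h0 (ltr0Sn R 1)).
move: cX; rewrite /continuous_from0; apply: filterS2 => w cw [M hM].
have M0 : 0 <= M.
  by apply: le_trans (hM 0%N 0%N 0%N _ _) => //; rewrite expn0.
have hh : h / 2 + h / 2 = h by field.
exists (K * M); rewrite /HP; rewrite hh in hK; apply: hK => //.
- by apply: simplex_incr; have [] := cw i.
- move=> s u t _ su ut _; rewrite /dl (_ : _ - _ = 0) ?normr0; last by ring.
  by rewrite mulr_ge0 ?powR_ge0 // mulr_ge0 ?powR_ge0.
- move=> m k km; have := hM m m k (leqnn m) km.
  have sm : 0 < step m `^ h by rewrite powR_gt0 // step_gt0.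
  by rewrite /G normrM normfV (gtr0_norm sm) mulrC ler_pdivrMr.
Qed.

End GaussianPaths.

(** * Convergence of the Ito and Stratonovich second levels *)

Section SecondLevel.
Context {d : measure_display} {Omega : measurableType d} {R : realType}
  (P : probability Omega R) (T : R).
Hypothesis T0 : 0 < T.
Local Notation Ex := (Ex P).
Local Notation grid := (grid T).
Local Notation step := (step T).

Lemma dy_ito n (x y : R -> R) k N : (k + N <= 2 ^ n)%N ->
  dy T n x y (grid n k) (grid n (k + N)) =
  ito_sum (fun r => x r - x (grid n k)) y (grid n k) (grid n (k + N)) (gridp T n k N) +
  \sum_(l < N) (2^-1 * (x (grid n (l + k).+1) - x (grid n (l + k)))) *
     (y (grid n (l + k).+1) - y (grid n (l + k))).
Proof.
move=> kN; rewrite (dy_grid T0) ?leq_addr //.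
rewrite /ito_sum (@gridp_sum _ T n k N _ (fun s t => (x s - x (grid n k)) * (y t - y s))).
rewrite [LHS]sum_shift [X in X + _]sum_shift !big_mkord -big_split.
by apply: eq_bigr => l _ /=; field.
Qed.

Lemma dy_stratonovich n (x y : R -> R) k N : (k + N <= 2 ^ n)%N ->
  dy T n x y (grid n k) (grid n (k + N)) =
  stratonovich_sum (fun r => x r - x (grid n k)) y (grid n k) (grid n (k + N)) (gridp T n k N).
Proof.
move=> kN; rewrite (dy_grid T0) ?leq_addr //.
by rewrite /stratonovich_sum (@gridp_sum _ T n k N _ (fun s t => ((x s - x (grid n k)) + (x t - x (grid n k))) / 2 * (y t - y s))).
Qed.

Lemma ae_path_forall (I : finType) (F : I -> Omega -> Prop) :
  (forall i, {ae P, forall w, F i w}) -> {ae P, forall w, forall i, F i w}.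
Proof. by move=> h; apply: filter_forall. Qed.

Lemma ito_level_cvg (I J : finType) (b : process R Omega I) (w : process R Omega J)
    (Ibw : Omega -> two_param R (I * J)) H a c :
  0 < a -> a < H -> 0 < c -> c < 2^-1 -> a + c <= 1 ->
  fractional_brownian P T H b -> brownian P T w -> independent_processes P T b w ->
  ito_iint P T b w Ibw ->
  {ae P, forall om, (forall i, qcvg (HP T a) (fun n => pl T n (path1 b i om)) (path1 b i om)) ->
    (forall j, qcvg (HP T c) (fun n => pl T n (path1 w j om)) (path1 w j om)) ->
    forall i j, qcvg (Hb T (a + c)) (fun n => dy T n (path1 b i om) (path1 w j om))
      (fun s t => Ibw om s t (i, j))}.
Proof.
move=> a0 aH c0 c2 ac [Gb _] [Gw _] ind [hI cI].
have H0 : 0 < H := lt_trans a0 aH.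
have gb i Z : lin1 T b i Z -> gauss P Z by move=> hZ; exact: (lin_gauss Gb (lin1_lin hZ)).
have gw j Z : lin1 T w j Z -> gauss P Z by move=> hZ; exact: (lin_gauss Gw (lin1_lin hZ)).
have fac i j := independent_factor Gb Gw ind (i := i) (j := j).
have vb i := fun s t => @fbm_var _ _ _ P T _ b H i s t H0 Gb.
have vw j := fun s t => @brownian_var _ _ _ P T _ w j s t Gw.
have ow j := fun s t s' t' => @brownian_orth _ _ _ P T _ w j s t s' t' Gw.
have [mb _ _ _] := Gb; have [mw _ _ _] := Gw.
have A1 : {ae P, forall om, forall i j, exists q, 0 <= q < 1 /\ exists2 C, 0 <= C & forall n m k, (m <= n)%N -> (k < 2 ^ m)%N ->
    `|area T b w i j n m k om| <= C * step m `^ (a + c) * q ^+ n}.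
  apply: ae_path_forall => i; apply: ae_path_forall => j.
  have [||q q01 hq] := ae_area T0 H0 (gb i) (gw j) (fac i j) (vb i) (vw j) (ow j) (th := a + c).
  - by rewrite addr_ge0 ?ltW.
  - lra.
  by move: hq; apply: filterS => om hC; exists q.
have A2 : {ae P, forall om, forall i j, forall m k l, (k <= l)%N -> (l <= 2 ^ m)%N ->
  forall e N, 0 < e -> exists2 n, (N <= n)%N &
    `|dy T n (path1 b i om) (path1 w j om) (grid m k) (grid m l) - Ibw om (grid m k) (grid m l) (i, j)| < e}.
  apply: ae_path_forall => i; apply: ae_path_forall => j.
  apply: (@ae_level_adh _ _ _ P T _ _ b w i j T0 (fun om s t => Ibw om s t (i, j))
    (fun om s t p => ito_sum (fun r => incr (sample b om) s r i) (fun r => w r om j) s t p)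
    (ito_rem T b w i j)).
  - by move=> t tT; exact: mb.
  - by move=> t tT; exact: mw.
  - by move=> s t s0 st tT; exact: hI.
  - by move=> n k N om kN; rewrite dy_ito.
  - move=> n k N kN; have [] := LP_ito_rem T0 (gb i) (gw j) kN; by [].
  - move=> m k l; exact: (ito_rem_L2 T0 H0 (gb i) (gw j) (fac i j) (vb i) (vw j) (ow j)).
move: A1 A2 cI; apply: filterS3 => om hA hP cI cb cw i j.
have [q [q01 [C C0 hC]]] := hA i j.
exact: (area_cvg T0 a0 c0 C0 q01 (cb i) (cw j) (cI (i, j)) hC (hP i j) ac).
Qed.

Lemma stratonovich_level_cvg (J : finType) (w : process R Omega J)
    (W2 : Omega -> two_param R (J * J)) c :
  0 < c -> c < 2^-1 -> brownian P T w -> stratonovich_iint P T w w W2 ->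
  {ae P, forall om,
    (forall j, qcvg (HP T c) (fun n => pl T n (path1 w j om)) (path1 w j om)) ->
    forall i j, qcvg (Hb T (c + c)) (fun n => dy T n (path1 w i om) (path1 w j om))
      (fun s t => W2 om s t (i, j))}.
Proof.
move=> c0 c2 [Gw _] [hI cI].
have half0 : 0 < 2^-1 :> R by [].
have gw j Z : lin1 T w j Z -> gauss P Z by move=> hZ; exact: (lin_gauss Gw (lin1_lin hZ)).
have vw j := fun s t => @brownian_var _ _ _ P T _ w j s t Gw.
have ow j := fun s t s' t' => @brownian_orth _ _ _ P T _ w j s t s' t' Gw.
have vw' j s t : 0 <= s -> s <= t -> t <= T -> Ex (fun om => dX w j s t om ^+ 2) = (t - s) `^ (2 * 2^-1).
  move=> s0 st tT; rewrite vw // mulfV ?powRr1 ?subr_ge0 //.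
have [mw _ _ _] := Gw.
have A1 : {ae P, forall om, forall i j, exists q, 0 <= q < 1 /\ exists2 C, 0 <= C & forall n m k, (m <= n)%N -> (k < 2 ^ m)%N ->
    `|area T w w i j n m k om| <= C * step m `^ (c + c) * q ^+ n}.
  apply: ae_path_forall => i; apply: ae_path_forall => j.
  (* On the diagonal the area terms vanish identically. Off the diagonal the two components are
     uncorrelated linear functionals of one Gaussian process, hence their moments factorise. *)
  have [->|ij] := eqVneq i j.
    apply: nearW => om; exists 0; split; first by rewrite lexx ltr01.
    exists 0 => // n m k mn km; rewrite /area big1 ?normr0 ?mul0r // => l _.
    by rewrite /area_term [X in X - _]mulrC subrr mul0r.
  have fac Z V r k := @process_factor _ _ _ P T _ w _ Gw i j Z V r k ij.
  have [||q q01 hq] := ae_area T0 half0 (gw i) (gw j) fac (vw' i) (vw j) (ow j) (th := c + c).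
  - by rewrite addr_ge0 ?ltW.
  - lra.
  by move: hq; apply: filterS => om hC; exists q.
have A2 : {ae P, forall om, forall i j, forall m k l, (k <= l)%N -> (l <= 2 ^ m)%N ->
  forall e N, 0 < e -> exists2 n, (N <= n)%N &
    `|dy T n (path1 w i om) (path1 w j om) (grid m k) (grid m l) - W2 om (grid m k) (grid m l) (i, j)| < e}.
  apply: ae_path_forall => i; apply: ae_path_forall => j.
  apply: (@ae_level_adh _ _ _ P T _ _ w w i j T0 (fun om s t => W2 om s t (i, j))
    (fun om s t p => stratonovich_sum (fun r => incr (sample w om) s r i) (fun r => w r om j) s t p)
    (fun _ _ _ => cst 0)).
  - by move=> t tT; exact: mw.
  - by move=> t tT; exact: mw.
  - by move=> s t s0 st tT; exact: hI.
  - by move=> n k N om kN; rewrite addr0 dy_stratonovich.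
  - by move=> n k N _.
  - move=> m k l _ _; rewrite [X in cst X @ _ --> _](_ : _ = 0%E) //; first exact: cvg_cst.
    by rewrite unlock integral0_eq // => om _; rewrite /= expr0n.
have cc : c + c <= 1 by lra.
move: A1 A2 cI; apply: filterS3 => om hA hP cI cw i j.
have [q [q01 [C C0 hC]]] := hA i j.
exact: (area_cvg T0 c0 c0 C0 q01 (cw i) (cw j) (cI (i, j)) hC (hP i j) cc).
Qed.

End SecondLevel.

(** * Cameron-Martin paths *)

Section VariationControl.
Context {R : realType} (T h : R).
Hypothesis T0 : 0 < T.

(** The supremum of the normalised sums over partitions is superadditive by concatenation and at
    most 1 in total. The partition with a single cell gives the bound on the increment. *)
Lemma control_of_variation (x : R -> R) M :
  (forall s t p, 0 <= s -> t <= T -> itv_partition s t p ->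
    psum (fun a b => dl x a b ^+ 2 / (b - a) `^ (2 * h)) s p <= M) ->
  exists C, CP T h C x.
Proof.
move=> hM; pose D := `|M| + 1; have D0 : 0 < D by rewrite ltr_wpDl.
pose th a b := dl x a b ^+ 2 / (b - a) `^ (2 * h).
pose E s t := [set psum th s p / D | p in [set p | itv_partition s t p]].
pose w s t := sup (E s t).
have th0 a b : 0 <= th a b by rewrite divr_ge0 ?sqr_ge0 ?powR_ge0.
have ps0 s p : 0 <= psum th s p.
  by elim: p s => [|y p IH] s //=; rewrite addr_ge0.
have E0 s t : s <= t -> E s t !=set0.
  by move=> st; have [p pp _] := itvp_mesh st ltr01; exists (psum th s p / D); exists p.
have Eub s t : 0 <= s -> t <= T -> ubound (E s t) 1.
  move=> s0 tT _ [p pp <-]; rewrite ler_pdivrMr // mul1r.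
  by apply: le_trans (hM _ _ _ s0 tT pp) _; apply: le_trans (ler_norm _) _; rewrite lerDl.
have wE s t p : 0 <= s -> t <= T -> itv_partition s t p -> psum th s p / D <= w s t.
  by move=> s0 tT pp; apply: ub_le_sup; [exists 1; exact: Eub|exists p].
have catp u m v p q : itv_partition u m p -> itv_partition m v q -> itv_partition u v (p ++ q).
  move=> [p1 /eqP p2] [q1 q2]; split; first by rewrite cat_path p1 p2.
  by rewrite last_cat p2.
have w0 u v : 0 <= u -> u <= v -> v <= T -> 0 <= w u v.
  move=> u0 uv vT; have [p pp _] := itvp_mesh uv ltr01.
  by apply: le_trans (wE _ _ _ u0 vT pp); rewrite divr_ge0 // ltW.
exists (Num.sqrt D); split; first exact: sqrtr_ge0.
exists w; split.
- split=> // u m v u0 um mv vT; rewrite -lerBrDr; apply: ge_sup; first exact: E0.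
  move=> _ [p pp <-]; rewrite lerBrDr -lerBrDl; apply: ge_sup; first exact: E0.
  move=> _ [q qq <-]; rewrite lerBrDl -mulrDl.
  have pq : itv_partition u v (p ++ q) by apply: catp qq; exact: pp.
  have := wE u v (p ++ q) u0 vT pq.
  by rewrite psum_cat; case: pp => _ /eqP ->.
- apply: ge_sup; first by apply: E0; exact: ltW.
  exact: Eub.
- move=> s t s0 st tT; move: st; rewrite le_eqVlt => /orP[/eqP <-|st].
    by rewrite /dl subrr normr0 /cbound mulr_ge0 ?sqrtr_ge0 // mulr_ge0 ?sqrtr_ge0 ?powR_ge0.
  have pp : itv_partition s t [:: t] by exact: itv_partition1.
  have := wE _ _ _ s0 tT pp; rewrite /= addr0 /th.
  have tsp : 0 < (t - s) `^ (2 * h) by rewrite powR_gt0 // subr_gt0.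
  rewrite ler_pdivrMr // ler_pdivrMr // => hw.
  have -> : cbound w h (Num.sqrt D) s t = Num.sqrt (D * (t - s) `^ (2 * h) * w s t).
    rewrite /cbound; have -> : (t - s) `^ h = Num.sqrt ((t - s) `^ (2 * h)).
      by rewrite mulrC powRrM powR_mulrn ?powR_ge0 // sqrtr_sqr ger0_norm // powR_ge0.
    by rewrite sqrtrM ?sqrtrM ?(ltW D0) // mulr_ge0 ?(ltW D0) ?powR_ge0.
  rewrite -sqrtr_sqr ler_wsqrtr //; apply: le_trans hw _.
  by rewrite le_eqVlt; apply/orP; left; apply/eqP; ring.
Qed.

End VariationControl.

(** Off the diagonal c <= 0, so be_l be_m c_lm <= - (be_l^2 + be_m^2) c_lm / 2. Including the
    diagonal in the sum of the right-hand sides gives minus the row sums weighted by be_l^2, which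
    is nonpositive; the correction on the diagonal produces the factor 2. *)
Lemma dominant_diagonal (R : realFieldType) (N : nat) (c : 'I_N -> 'I_N -> R) (be : 'I_N -> R) :
  (forall l m, c l m = c m l) -> (forall l m, l != m -> c l m <= 0) ->
  (forall l, 0 <= \sum_m c l m) ->
  \sum_l \sum_m be l * be m * c l m <= 2 * \sum_l be l ^+ 2 * c l l.
Proof.
move=> cs c0 cr.
have H l m : be l * be m * c l m <= (2 * be l ^+ 2 * c l l) *+ (l == m) - (be l ^+ 2 + be m ^+ 2) / 2 * c l m.
  case: eqVneq => [<-|lm]; first by rewrite mulr1n le_eqVlt; apply/orP; left; apply/eqP; field.
  rewrite mulr0n sub0r -mulNr; have := c0 _ _ lm; have := sqr_ge0 (be l + be m); nra.
apply: le_trans (ler_sum _ (fun l _ => ler_sum _ (fun m _ => H l m))) _.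
under eq_bigr do rewrite sumrB.
rewrite sumrB.
have -> : \sum_(l < N) \sum_m (2 * be l ^+ 2 * c l l) *+ (l == m) = 2 * \sum_l be l ^+ 2 * c l l.
  rewrite mulr_sumr; apply: eq_bigr => l _; rewrite (bigD1 l) //= eqxx mulr1n big1 ?addr0 ?mulrA //.
  by move=> m; rewrite eq_sym => /negPf ->.
rewrite lerBlDr lerDl.
have -> : \sum_l \sum_m (be l ^+ 2 + be m ^+ 2) / 2 * c l m = \sum_l be l ^+ 2 * \sum_m c l m.
  have E : \sum_l \sum_m be m ^+ 2 / 2 * c l m = \sum_l be l ^+ 2 / 2 * \sum_m c l m.
    by rewrite exchange_big /=; apply: eq_bigr => l _; rewrite mulr_sumr; apply: eq_bigr => m _; rewrite cs.
  rewrite (eq_bigr (fun l => \sum_m be l ^+ 2 / 2 * c l m + \sum_m be m ^+ 2 / 2 * c l m)).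
    rewrite big_split /= E -big_split /=; apply: eq_bigr => l _.
    by rewrite -mulr_sumr -mulrDl; congr (_ * _); field.
  by move=> l _; rewrite -big_split /=; apply: eq_bigr => m _; field.
by apply: sumr_ge0 => l _; rewrite mulr_ge0 ?sqr_ge0.
Qed.

(** The points a + p and a + q are convex combinations of a and a + p + q with exchanged weights.
    Concavity of the power r follows from convexity of its inverse, the power 1/r. *)
Lemma powR_concave (R : realType) (r a p q : R) : 0 < r -> r <= 1 -> 0 <= a -> 0 <= p -> 0 <= q ->
  (a + p + q) `^ r + a `^ r <= (a + p) `^ r + (a + q) `^ r.
Proof.
move=> r0 r1 a0 p0 q0.
have [->|pN] := eqVneq p 0; first by rewrite !addr0 addrC.
have pq : 0 < p + q by rewrite ltr_pwDl // lt_def pN.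
have ri : 1 <= r^-1 by rewrite invf_ge1.
have key (l : R) (l0 : 0 <= l) (l1 : l <= 1) (x y : R) : 0 <= x -> 0 <= y ->
    l * x `^ r + (1 - l) * y `^ r <= (l * x + (1 - l) * y) `^ r.
  move=> x0 y0; have xr := powR_ge0 x r; have yr := powR_ge0 y r.
  have := @convex_powR R _ ri (Itv01 l0 l1) (x `^ r) (y `^ r).
  rewrite !inE /= !in_itv /= !andbT => /(_ xr yr).
  have pK (z : R) : 0 <= z -> (z `^ r) `^ r^-1 = z.
    by move=> z0; rewrite -powRrM mulfV ?gt_eqF // powRr1.
  have pK' (z : R) : 0 <= z -> (z `^ r^-1) `^ r = z.
    by move=> z0; rewrite -powRrM mulVf ?gt_eqF // powRr1.
  rewrite !pK // => H.
  have {}H : (l * x `^ r + (1 - l) * y `^ r) `^ r^-1 <= l * x + (1 - l) * y by exact: H.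
  have l1' : 0 <= 1 - l by rewrite subr_ge0.
  have L0 : 0 <= l * x `^ r + (1 - l) * y `^ r by rewrite addr_ge0 // mulr_ge0.
  rewrite -[leLHS]pK' //; apply: ge0_ler_powR => //; first exact: ltW.
    by rewrite nnegrE powR_ge0.
  by rewrite nnegrE addr_ge0 // mulr_ge0.
pose l := q / (p + q).
have l0 : 0 <= l by rewrite divr_ge0 // ltW.
have l1 : l <= 1 by rewrite ler_pdivrMr // mul1r lerDr.
have aq0 : 0 <= a + p + q by rewrite !addr_ge0.
have K1 := key l l0 l1 a (a + p + q) a0 aq0.
have K2 := key l l0 l1 (a + p + q) a aq0 a0.
have e1 : l * a + (1 - l) * (a + p + q) = a + p by rewrite /l; field; rewrite gt_eqF.
have e2 : l * (a + p + q) + (1 - l) * a = a + q by rewrite /l; field; rewrite gt_eqF.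
by rewrite e1 in K1; rewrite e2 in K2; have := lerD K1 K2; apply: le_trans; rewrite le_eqVlt; apply/orP; left; apply/eqP; ring.
Qed.

(** * Variation of Cameron-Martin paths by duality *)

Section CameronMartin.
Context {d : measure_display} {Omega : measurableType d} {R : realType}
  (P : probability Omega R) (T h : R).
Hypothesis T0 : 0 < T.
Local Notation Ex := (Ex P).
Local Notation LP := (LP P).

Lemma integrable_L2 (Z : Omega -> R) : measurable_fun setT Z ->
  (exists S, LP S /\ (expectation P (fun w => (Z w - S w) ^+ 2)%R < +oo)%E) ->
  P.-integrable setT (fun w => (Z w ^+ 2)%:E).
Proof.
move=> mZ [S [lS fS]].
have i1 : P.-integrable setT (fun w => ((Z w - S w) ^+ 2)%:E).
  apply/integrableP; split.
    by apply/measurable_EFinP; apply: measurable_funX; apply: measurable_funB => //; have [] := lS.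
  rewrite unlock in fS; rewrite (eq_integral (fun w => ((Z w - S w) ^+ 2)%:E)) // => w _.
  by rewrite gee0_abs // lee_fin sqr_ge0.
have i2 : P.-integrable setT (fun w => (S w ^+ 2)%:E) by have [_] := lS.
have i3 := integrableZl measurableT 2 (integrableD measurableT i1 i2).
apply: (@integrable_dom _ _ _ _ _ (fun w => 2 * ((Z w - S w) ^+ 2 + S w ^+ 2))) => //.
  exact: measurable_funX.
move=> w; rewrite ger0_norm ?sqr_ge0 //; have := sqr_ge0 (Z w - 2 * S w); nra.
Qed.

Lemma integrable_LP_mul (Z Y : Omega -> R) : measurable_fun setT Z ->
  P.-integrable setT (fun w => (Z w ^+ 2)%:E) -> LP Y ->
  P.-integrable setT (fun w => (Z w * Y w)%:E).
Proof.
move=> mZ iZ lY; have i2 : P.-integrable setT (fun w => (Y w ^+ 2)%:E) by have [_] := lY.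
have i3 := integrableD measurableT iZ i2.
apply: (@integrable_dom _ _ _ _ _ (fun w => Z w ^+ 2 + Y w ^+ 2)) => //.
  by apply: measurable_funM => //; have [] := lY.
move=> w; rewrite ler_norml; apply/andP; split.
  have := sqr_ge0 (Z w + Y w); have := sqr_ge0 (Z w); have := sqr_ge0 (Y w); nra.
have := sqr_ge0 (Z w - Y w); have := sqr_ge0 (Z w); have := sqr_ge0 (Y w); nra.
Qed.

Lemma Ex_mul_sum (Z : Omega -> R) N (be : 'I_N -> R) (D : 'I_N -> Omega -> R) : measurable_fun setT Z ->
  P.-integrable setT (fun w => (Z w ^+ 2)%:E) -> (forall l, LP (D l)) ->
  Ex (fun w => Z w * \sum_l be l * D l w) = \sum_l be l * Ex (fun w => Z w * D l w).
Proof.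
move=> mZ iZ lD.
have iD l : P.-integrable setT (fun w => (Z w * D l w)%:E) by exact: integrable_LP_mul.
apply: EFin_inj; rewrite -Ex_fin; last first.
  by apply: integrable_LP_mul => //; apply: LP_sum => l; exact: LPZ.
transitivity (\int[P]_w (\sum_l (be l)%:E * (Z w * D l w)%:E))%E.
  apply: eq_integral => w _; rewrite mulr_sumr -sumEFin; apply: eq_bigr => l _.
  by rewrite -EFinM; congr (_%:E); ring.
rewrite integral_sum //; last by move=> l; exact: integrableZl.
rewrite -sumEFin; apply: eq_bigr => l _.
by rewrite integralZl // EFinM -Ex_fin.
Qed.

Variables (I : finType) (X : process R Omega I) (K : R -> R -> R).
Hypothesis GX : centered_gaussian_process P T K X.
Hypothesis vX : forall i s t, 0 <= s -> s <= t -> t <= T ->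
  Ex (fun w => dX X i s t w ^+ 2) = (t - s) `^ (2 * h).
Hypothesis negX : forall i s t s' t', 0 <= s -> s <= t -> t <= s' -> s' <= t' -> t' <= T ->
  Ex (fun w => dX X i s t w * dX X i s' t' w) <= 0.
Hypothesis posX : forall i s t s' t', 0 <= s -> s <= s' -> s' <= t' -> t' <= t -> t <= T ->
  0 <= Ex (fun w => dX X i s' t' w * dX X i s t w).

(* With increments h_j of u and X_j of X over cells of length D_j, test
   Z against Y = sum h_j X_j / (2 D_j^(2h)): Q = sum h_j^2 / D_j^(2h) satisfies
   Q = 2 E[Z Y] <= E[Z^2] + E[Y^2] <= E[Z^2] + Q / 2. *)
Lemma cameron_martin_variation u i : cameron_martin P T X u ->
  exists C, CP T h C (u^~ i).
Proof.
move=> [Z [mZ apx] hu].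
have iZ : P.-integrable setT (fun w => (Z w ^+ 2)%:E).
  apply: integrable_L2 => //; have [n [c [ts [is_ [hts lt1]]]]] := apx 1 ltr01.
  exists (fun w => \sum_k c k * X (ts k) w (is_ k)); split; last exact: lt_trans lt1 (ltry _).
  by apply: LP_sum => k; apply: LPZ; have [] := gauss_pt GX (is_ k) (hts k).
have lX t : 0 <= t <= T -> LP (fun w => X t w i) by move=> ht; have [] := gauss_pt GX i ht.
have uE t : 0 <= t <= T -> u t i = Ex (fun w => Z w * X t w i).
  by move=> ht; apply: EFin_inj; rewrite hu // unlock Ex_fin //; apply: integrable_LP_mul => //; exact: lX.
have duE s t : 0 <= s <= T -> 0 <= t <= T -> dl (u^~ i) s t = Ex (fun w => Z w * dX X i s t w).
  move=> hs ht; rewrite /dl uE // uE //; apply: EFin_inj.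
  have i1 := integrable_LP_mul mZ iZ (lX t ht); have i2 := integrable_LP_mul mZ iZ (lX s hs).
  rewrite EFinB -!Ex_fin // ?(integrable_LP_mul mZ iZ (LP_dX GX i hs ht)) //.
  rewrite -integralB_EFin //; apply: eq_integral => w _.
  by rewrite -EFinB /dX mulrBr.
apply: (control_of_variation T0 (M := 2 * Ex (fun w => Z w ^+ 2))) => s t p s0 tT pp.
rewrite (psumE _ s t p) big_mkord.
set N := size p; pose tt (l : nat) := part_point s t p l.
have ttS l : (l < N)%N -> [/\ s <= tt l, tt l < tt l.+1 & tt l.+1 <= t] by exact: part_point_le.
have mono l m : (l <= m)%N -> (m <= N)%N -> tt l <= tt m.
  elim: m => [|m IH]; first by rewrite leqn0 => /eqP ->.
  rewrite leq_eqVlt => /orP[/eqP -> //|lm mN]; have [_ /ltW hm _] := ttS m mN.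
  by apply: le_trans hm; apply: IH; [rewrite -ltnS|exact: ltnW].
have inT l : (l < N)%N -> 0 <= tt l <= T /\ 0 <= tt l.+1 <= T.
  move=> lN; have [a1 /ltW a2 a3] := ttS l lN; have := le_trans s0 a1; have := le_trans a3 tT => b1 b2.
  by rewrite b1 b2 (le_trans b2 a2) (le_trans a2 b1).
pose D (l : 'I_N) := dX X i (tt l) (tt l.+1).
pose a (l : 'I_N) := (tt l.+1 - tt l) `^ (2 * h).
have a0 l : 0 < a l by rewrite powR_gt0 // subr_gt0; have [] := ttS l (ltn_ord l).
have lD l : LP (D l) by have [h1 h2] := inT l (ltn_ord l); exact: (LP_dX GX i h1 h2).
pose hh (l : 'I_N) := dl (u^~ i) (tt l) (tt l.+1).
pose be (l : 'I_N) := hh l / (2 * a l).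
pose Q := \sum_(l < N) hh l ^+ 2 / a l.
rewrite -[leLHS]/Q.
pose Y w := \sum_l be l * D l w.
have lY : LP Y by apply: LP_sum => l; exact: LPZ.
have EZY : Ex (fun w => Z w * Y w) = Q / 2.
  rewrite Ex_mul_sum // /Q mulr_suml; apply: eq_bigr => l _.
  have [h1 h2] := inT l (ltn_ord l); rewrite -duE // -/(hh l) /be; field.
  exact: lt0r_neq0.
have EYY : Ex (fun w => Y w ^+ 2) <= Q / 2.
  rewrite (@eq_Ex _ _ _ _ _ (fun w => \sum_l \sum_m be l * be m * (D l w * D m w))); last first.
    move=> w; rewrite expr2 /Y mulr_suml; apply: eq_bigr => l _; rewrite mulr_sumr; apply: eq_bigr => m _.
    by ring.
  have lDD l m : LP (fun w => be l * be m * (D l w * D m w)) by apply: LPZ; exact: LPM.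
  rewrite Ex_sum; last by move=> l; exact: LP_sum.
  rewrite (eq_bigr (fun l => \sum_m be l * be m * Ex (fun w => D l w * D m w))); last first.
    by move=> l _; rewrite Ex_sum //; apply: eq_bigr => m _; rewrite ExZ //; exact: LPM.
  apply: le_trans (dominant_diagonal _ _ _ _) _.
  - by move=> l m; apply: eq_Ex => w; rewrite mulrC.
  - have lt (l m : 'I_N) : (l < m)%N -> Ex (fun w => D l w * D m w) <= 0.
      move=> lm; have [h1 h2] := inT l (ltn_ord l); have [h3 h4] := inT m (ltn_ord m).
      have [_ /ltW st1 _] := ttS l (ltn_ord l); have [_ /ltW st2 _] := ttS m (ltn_ord m).
      move: h1 h4 => /andP[h1 _] /andP[_ h4]; apply: negX => //.
      by apply: mono => //; exact: ltnW.
    move=> l m; rewrite -val_eqE neq_ltn => /orP[/lt //|/lt].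
    by rewrite (@eq_Ex _ _ _ _ _ (fun w => D l w * D m w)) // => w; rewrite mulrC.
  (* The increments over the cells telescope, so a row sum is the covariance of one cell with the
     whole interval [s,t], which is nonnegative by [posX]. *)
  - move=> l; rewrite -Ex_sum; last by move=> m; exact: LPM.
    rewrite (@eq_Ex _ _ _ _ _ (fun w => D l w * dX X i s t w)); last first.
      move=> w; rewrite -mulr_sumr; congr (_ * _).
      by rewrite /dX -(psum_tel (fun r => X r w i) pp) (psumE _ s t p) big_mkord.
    have [h1 h2 h3] := ttS l (ltn_ord l).
    by apply: posX => //; exact: ltW.
  - rewrite le_eqVlt; apply/orP; left; apply/eqP; rewrite /Q mulr_sumr mulr_suml; apply: eq_bigr => l _.
    rewrite (@eq_Ex _ _ _ _ _ (fun w => D l w ^+ 2)) // vX //; last first.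
    + by have [_ /andP[]] := inT l (ltn_ord l).
    + by have [_ /ltW] := ttS l (ltn_ord l).
    + by have [/andP[]] := inT l (ltn_ord l).
    by rewrite -/(a l) /be; field; exact: lt0r_neq0.
have : 2 * Ex (fun w => Z w * Y w) <= Ex (fun w => Z w ^+ 2) + Ex (fun w => Y w ^+ 2).
  have iZY := integrable_LP_mul mZ iZ lY.
  have iY : P.-integrable setT (fun w => (Y w ^+ 2)%:E) by have [_] := lY.
  rewrite -lee_fin EFinD EFinM -!Ex_fin // -integralZl // -integralD //.
  apply: le_integral => //; [exact: integrableZl|exact: integrableD|].
  move=> w _; rewrite -EFinM -EFinD lee_fin; have := sqr_ge0 (Z w - Y w); nra.
by rewrite EZY; lra.
Qed.

End CameronMartin.

(** * Sign of the covariances for Brownian and fractional Brownian motion *)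

Section Covariances.
Context {d : measure_display} {Omega : measurableType d} {R : realType}
  (P : probability Omega R) (T : R) (I : finType) (X : process R Omega I).
Hypothesis T0 : 0 < T.
Local Notation Ex := (Ex P).

Lemma brownian_cameron_martin u i : brownian P T X -> cameron_martin P T X u ->
  exists C, CP T 2^-1 C (u^~ i).
Proof.
move=> [GX _]; apply: (cameron_martin_variation T0 GX) => //.
- by move=> j s t s0 st tT; rewrite (brownian_var j GX) // mulfV ?powRr1 ?subr_ge0.
- by move=> j s t s' t' s0 st ts st' tT; rewrite (brownian_orth j GX).
- move=> j s t s' t' s0 ss st' tt tT.
  have s'0 := le_trans s0 ss; have t'0 := le_trans s'0 st'; have t0 := le_trans t'0 tt.
  have t'T := le_trans tt tT; have s'T := le_trans st' t'T; have sT := le_trans ss s'T.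
  rewrite (cov_dX GX) ?s0 ?t0 ?sT ?s'0 ?t'0 ?t'T ?s'T // eqxx.
  rewrite (min_l tt) (min_r (le_trans ss st')) (min_l (le_trans st' tt)) (min_r ss); lra.
Qed.

Lemma fbm_cameron_martin H u i : 0 < H -> 2 * H <= 1 ->
  fractional_brownian P T H X -> cameron_martin P T X u ->
  exists C, CP T H C (u^~ i).
Proof.
move=> H0 H1 [GX _]; apply: (cameron_martin_variation T0 GX).
- by move=> j s t s0 st tT; exact: (fbm_var j H0 GX).
- move=> j s t s' t' s0 st ts st' tT.
  have t0 := le_trans s0 st; have s'0 := le_trans t0 ts; have t'0 := le_trans s'0 st'.
  have s'T := le_trans st' tT; have t_T := le_trans ts s'T; have sT := le_trans st t_T.
  rewrite (cov_dX GX) ?s0 ?t0 ?sT ?s'0 ?t'0 ?t_T ?s'T // eqxx.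
  have H20 : 0 < 2 * H by rewrite mulr_gt0.
  have a0 : 0 <= s' - t by rewrite subr_ge0.
  have p0 : 0 <= t - s by rewrite subr_ge0.
  have q0 : 0 <= t' - s' by rewrite subr_ge0.
  (* Taken with the gap s' - t and the two interval lengths: the concavity defect is minus twice the
     covariance of the increments. *)
  have := powR_concave H20 H1 a0 p0 q0.
  rewrite (_ : s' - t + (t - s) + (t' - s') = t' - s); last by ring.
  rewrite (_ : s' - t + (t - s) = s' - s); last by ring.
  rewrite (_ : s' - t + (t' - s') = t' - t); last by ring.
  rewrite !ger0_norm ?subr_ge0 ?(le_trans st) ?(le_trans ts) // => C; lra.
- move=> j s t s' t' s0 ss st' tt tT.
  have s'0 := le_trans s0 ss; have t'0 := le_trans s'0 st'; have t0 := le_trans t'0 tt.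
  have t'T := le_trans tt tT; have s'T := le_trans st' t'T; have sT := le_trans ss s'T.
  rewrite (cov_dX GX) ?s0 ?t0 ?sT ?s'0 ?t'0 ?t'T ?s'T // eqxx.
  have st := le_trans ss st'; have s't := le_trans st' tt.
  rewrite (ger0_norm (_ : 0 <= t - t')) ?subr_ge0 // (distrC s t') (distrC s s').
  rewrite !ger0_norm ?subr_ge0 //.
  have H20 : 0 <= 2 * H by rewrite mulr_ge0 // ltW.
  have m1 : (t - t') `^ (2 * H) <= (t - s') `^ (2 * H).
    by apply: ge0_ler_powR => //; rewrite ?nnegrE ?subr_ge0 //; lra.
  have m2 : (s' - s) `^ (2 * H) <= (t' - s) `^ (2 * H).
    by apply: ge0_ler_powR => //; rewrite ?nnegrE ?subr_ge0 //; lra.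
  lra.
Qed.

End Covariances.

(** * The translated mixed fractional Brownian motion *)

Section Canonical.
Context {R : realType} (T : R).
Hypothesis T0 : 0 < T.

(** The norm sees only s < t, so the vanishing on the diagonal has to be supplied; Chen's relation
    provides it for rough paths. *)
Lemma hnorm_Hb (I : finType) eta C (psi : two_param R I) i :
  (forall s, 0 <= s -> s <= T -> psi s s i = 0) -> (hnorm T eta psi < C%:E)%E ->
  Hb T eta C (fun s t => psi s t i).
Proof.
move=> p0 hC; have H := hnorm_lt hC i.
have C0 : 0 <= C.
  have := H 0 T (lexx 0) T0 (lexx T); rewrite subr0 => h.
  by rewrite -(pmulr_lge0 _ (powR_gt0 eta T0)); apply: le_trans h.
split => // s t s0 st tT; move: st; rewrite le_eqVlt => /orP[/eqP st|st]; last exact: H.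
by rewrite -st p0 ?normr0 ?mulr_ge0 ?powR_ge0 // st.
Qed.

Lemma hnorm_fin_Hb (I : finType) eta (psi : two_param R I) i :
  (forall s, 0 <= s -> s <= T -> psi s s i = 0) -> (hnorm T eta psi < +oo)%E ->
  exists C, Hb T eta C (fun s t => psi s t i).
Proof.
move=> p0 h; suff [C hC] : exists C : R, (hnorm T eta psi < C%:E)%E.
  by exists C; exact: hnorm_Hb.
case: (hnorm T eta psi) h => [r _||] //; last by exists 0; rewrite ltNy0.
by exists (r + 1); rewrite lte_fin ltrDl.
Qed.

Lemma hnorm_ge0 (I : finType) eta (psi : two_param R I) : (0 <= hnorm T eta psi)%E.
Proof.
apply: (@le_trans _ _ (tnorm (psi 0 T) / (T - 0) `^ eta)%:E).
  by rewrite lee_fin divr_ge0 ?powR_ge0 // /tnorm sqrtr_ge0.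
by apply: ereal_sup_ubound; exists (0, T).
Qed.

Section RoughPath.
Variables (I : finType) (alpha : R) (x : path_in R I) (B : rough3 R I).
Hypothesis a0 : 0 < alpha.
Hypothesis cx : forall i, {within `[0, T], continuous (x^~ i)}.
Hypothesis rB : rough_path T alpha B.
Hypothesis hB : (fun n => rho T alpha (S3 (dyadic T n x)) B) @ \oo --> 0%E.

Lemma lev1_diag s i : 0 <= s -> s <= T -> lev1 B s s i = 0.
Proof.
have [_ _ [c1 _ _]] := rB => s0 sT.
by have := c1 s s s i s0 (lexx s) (lexx s) sT; lra.
Qed.

Lemma lev2_diag s ij : 0 <= s -> s <= T -> lev2 B s s ij = 0.
Proof.
have [_ _ [_ c2 _]] := rB => s0 sT; case: ij => i j.
by have := c2 s s s i j s0 (lexx s) (lexx s) sT; rewrite lev1_diag // mul0r; lra.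
Qed.

Lemma lev3_diag s ijk : 0 <= s -> s <= T -> lev3 B s s ijk = 0.
Proof.
have [_ _ [_ _ c3]] := rB => s0 sT; case: ijk => [[i j] k].
have := c3 s s s i j k s0 (lexx s) (lexx s) sT.
by rewrite !lev1_diag // !lev2_diag // !mul0r; lra.
Qed.

Lemma rho_small e : 0 < e -> exists n0, forall n, (n0 <= n)%N ->
  [/\ (hnorm T alpha (lev1 (S3 (dyadic T n x)) - lev1 B) < e%:E)%E,
      (hnorm T (2 * alpha) (lev2 (S3 (dyadic T n x)) - lev2 B) < e%:E)%E
    & (hnorm T (3 * alpha) (lev3 (S3 (dyadic T n x)) - lev3 B) < e%:E)%E].
Proof.
move=> e0; have : \forall n \near \oo, (rho T alpha (S3 (dyadic T n x)) B < e%:E)%E.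
  have e0' : (0 < e%:E)%E by rewrite lte_fin.
  exact: (@hB _ (open_ereal_lt' e0')).
move=> [n0 _ hn]; exists n0 => n nn; have := hn n nn; rewrite /rho /= => h.
have p1 := hnorm_ge0 alpha (incr (dyadic T n x) - lev1 B).
have p2 := hnorm_ge0 (2 * alpha) (iint (dyadic T n x) (dyadic T n x) - lev2 B).
have p3 := hnorm_ge0 (3 * alpha) (iint_r (iint (dyadic T n x) (dyadic T n x)) (dyadic T n x) - lev3 B).
split; apply: le_lt_trans h.
- by rewrite -addeA leeDl // adde_ge0.
- by rewrite addeAC leeDr // adde_ge0.
- by rewrite leeDr // adde_ge0.
Qed.

Let lipd n i : lip T ((dyadic T n x)^~ i).
Proof. exact: (lip_pl T0 n (x^~ i)). Qed.

(** A canonical rough path is tied to x only through the limit of the interpolated lifts. At dyadic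
    times the interpolations eventually agree with x; continuity extends the identity, as
    [simplex_dyadic_le] with constant 0. *)
Lemma lev1_incr s t i : 0 <= s -> s <= t -> t <= T -> lev1 B s t i = dl (x^~ i) s t.
Proof.
have [[cB _ _] _ [ch1 _ _]] := rB.
pose psi s t := lev1 B s t i - dl (x^~ i) s t.
have H : forall s t, 0 <= s -> s <= t -> t <= T -> `|psi s t| <= 0 * (t - s) `^ 1.
  apply: (simplex_dyadic_le T0 (lexx 0) ler01).
  - have /subspace_continuousP h1 := cB i.
    have /subspace_continuousP h2 := simplex_incr (@cx i).
    by apply/subspace_continuousP => st hst; apply: cvgB; [exact: h1|exact: h2].
  - by move=> r r0 rT; rewrite /psi lev1_diag // /dl subrr subr0.
  - move=> m k l kl lm; rewrite mul0r.
    apply/ler_addgt0Pl => e e0; rewrite addr0.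
    have Tp : 0 < T `^ alpha + 1 by rewrite ltr_wpDl ?powR_ge0.
    have [n0 hn] := rho_small (divr_gt0 e0 Tp).
    have mn := leq_maxl m n0; have nn := leq_maxr m n0; set n := maxn m n0 in mn nn.
    have [h1 _ _] := hn n nn.
    have [|_ /(_ (grid T m k) (grid T m l)) h2] := hnorm_Hb (i := i) _ h1.
      by move=> r r0 rT; rewrite !fctE /= /incr subrr lev1_diag // subr0.
    have gl : grid T m k <= grid T m l by rewrite (grid_le T0).
    have := h2 (grid_ge0 T0 m k) gl; rewrite (grid_leT T0) => /(_ lm) {}h2.
    rewrite /psi distrC; apply: le_trans (_ : e / (T `^ alpha + 1) * (grid T m l - grid T m k) `^ alpha <= _).
      apply: le_trans h2; rewrite le_eqVlt; apply/orP; left; apply/eqP; congr (`|_|).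
      rewrite !fctE /= /incr; congr (_ - _).
      by rewrite !(grid_level T _ mn) -(dl_pl_grid T0 n (x^~ i)).
    rewrite mulrAC ler_pdivrMr // ler_wpM2l ?(ltW e0) //.
    apply: le_trans (_ : T `^ alpha <= _); last by rewrite lerDl.
    apply: ge0_ler_powR; rewrite ?nnegrE ?subr_ge0 ?(ltW a0) ?(ltW T0) //.
    by rewrite lerBlDr (le_trans (y := T)) ?(grid_leT T0) // lerDl (grid_ge0 T0).
move=> s0 st tT; have := H s t s0 st tT; rewrite mul0r normr_le0 subr_eq0 => /eqP //.
Qed.

Lemma canonical_lev1_cvg i : qcvg (HP T alpha) (fun n => (dyadic T n x)^~ i) (x^~ i).
Proof.
have [_ [f1 _ _] _] := rB; split.
  have [C [C0 hC]] := hnorm_fin_Hb (i := i) (fun s h h' => lev1_diag i h h') f1.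
  by exists C; split => // s t s0 st tT; rewrite -lev1_incr //; exact: hC.
move=> e e0; have [n0 hn] := rho_small e0; exists n0 => n /hn[h1 _ _].
have [|C0 hC] := hnorm_Hb (i := i) _ h1.
  by move=> r r0 rT; rewrite !fctE /= /incr subrr lev1_diag // subr0.
split => // s t s0 st tT; apply: le_trans (hC s t s0 st tT).
have -> : (lev1 (S3 (dyadic T n x)) - lev1 B) s t i =
    dl ((dyadic T n x)^~ i) s t - lev1 B s t i by [].
rewrite lev1_incr // le_eqVlt; apply/orP; left; apply/eqP; congr (`|_|).
have -> : dl ((dyadic T n x)^~ i - x^~ i) s t =
    (dyadic T n x t i - x t i) - (dyadic T n x s i - x s i) by [].
by rewrite /dl; ring.
Qed.

Lemma canonical_lev2_cvg i j : qcvg (Hb T (alpha + alpha))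
  (fun n => YI ((dyadic T n x)^~ i) ((dyadic T n x)^~ j)) (fun s t => lev2 B s t (i, j)).
Proof.
have -> : alpha + alpha = 2 * alpha by ring.
have [_ [_ f2 _] _] := rB; split.
  by apply: (hnorm_fin_Hb (i := (i, j)) _ f2) => s; exact: lev2_diag.
move=> e e0; have [n0 hn] := rho_small e0; exists n0 => n /hn[_ h2 _].
apply: (hnorm_Hb (i := (i, j)) _ h2) => r r0 rT; rewrite !fctE /= lev2_diag // subr0.
exact: (dy_diag T0 n (x^~ i) (x^~ j) r0 rT).
Qed.

Lemma canonical_lev3_cvg i j k : qcvg (Hb T (alpha + alpha + alpha))
  (fun n => T3 ((dyadic T n x)^~ i) ((dyadic T n x)^~ j) ((dyadic T n x)^~ k))
  (fun s t => lev3 B s t (i, j, k)).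
Proof.
have -> : alpha + alpha + alpha = 3 * alpha by ring.
have [_ [_ _ f3] _] := rB; split.
  by apply: (hnorm_fin_Hb (i := (i, j, k)) _ f3) => s; exact: lev3_diag.
move=> e e0; have [n0 hn] := rho_small e0; exists n0 => n /hn[_ _ h3].
apply: (hnorm_Hb (i := (i, j, k)) _ h3) => r r0 rT; rewrite !fctE /= lev3_diag // subr0.
have [_ [C [_ hC]]] := lip_J T0 (lip_Bb1 T0 (lipd n i) (lipd n j)) (lipd n k).
apply/eqP; rewrite -normr_le0; apply: le_trans (hC r r r0 (lexx r) rT) _.
by rewrite subrr powR0 ?mulr0 //; lra.
Qed.

End RoughPath.
End Canonical.

Theorem proposition3p8 (R : realType) (T H alpha gamma : R) (d e : nat)
    (disp : measure_display) (Omega : measurableType disp)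
    (P : probability Omega R)
    (b : process R Omega 'I_d) (w : process R Omega 'I_e)
    (u : path_in R 'I_d) (v : path_in R 'I_e)
    (B : Omega -> rough3 R 'I_d)
    (Ibw : Omega -> two_param R ('I_d * 'I_e))
    (W2 : Omega -> two_param R ('I_e * 'I_e)) :
  0 < T ->
  1 / 4 < H < 1 / 3 ->
  1 / 4 < alpha < H ->
  1 / 3 < gamma < 1 / 2 ->
  1 < 2 * alpha + gamma ->
  mixed_fbm P T H b w ->
  cameron_martin P T b u ->
  cameron_martin P T w v ->
  canonical_rough_path P T alpha b B ->
  ito_iint P T b w Ibw ->
  stratonovich_iint P T w w W2 ->
  {ae P, forall omega,
    let b' := sample b omega in
    let w' := sample w omega in
    let TS1 := transl1 b' u w' v in
    let TS2 := transl2 b' u w' v (B omega) (Ibw omega) (W2 omega) in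
    let BU3 := transl3 b' u (B omega) in
    [/\ young_integrals_exist b' u w' v (B omega) T,
        geometric_aniso T alpha gamma (Aniso TS1 TS2 BU3),
        geometric_rough_path T alpha (Rough3 (incr (b' + u)) (block11 TS2) BU3)
      & exists TS3, is_Ext T gamma (Aniso TS1 TS2 BU3) (Rough3 TS1 TS2 TS3) /\
          geometric_rough_path T alpha (Rough3 TS1 TS2 TS3)]}.

Proof.
move=> T0 /andP[H4 H3] /andP[a4 aH] /andP[g3 g2] ag [fb bw ind] cmu cmv cB cI cW.
have H0 : 0 < H by lra.
have a0 : 0 < alpha by lra.
have gam0 : 0 < gamma by lra.
have g2' : gamma < 2^-1 by lra.
(* Interpolation converges only in exponents strictly below the regularity of the path, so Brownian
   paths are taken Hoelder of an exponent strictly between gamma and 1/2. *)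
pose g' := (gamma + 2^-1) / 2.
have hw : {ae P, forall om, forall j, exists C, HP T g' C (path1 w j om)}.
  apply: ae_path_forall => j; have [Gw cw] := bw.
  by apply: (ae_holder T0 j _ _ Gw cw); rewrite /g'; lra.
have hI : {ae P, forall om, _} := ito_level_cvg T0 a0 aH gam0 g2' (ltac:(lra)) fb bw ind cI.
have hW : {ae P, forall om, _} := stratonovich_level_cvg T0 gam0 g2' bw cW.
have hb : {ae P, forall om, forall i, {within `[0, T], continuous (fun t => b t om i)}}.
  by have [_] := fb; apply: filterS => om h i; have [] := h i.
have hu i : qcvg (CP T alpha) (fun n => pl T n (u^~ i)) (u^~ i).
  apply: (pl_qcvg_CP T0 (ltW a0) aH); first by lra.
  by apply: (fbm_cameron_martin T0 i H0 _ fb cmu); lra.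
have hv j : qcvg (CP T gamma) (fun n => pl T n (v^~ j)) (v^~ j).
  apply: (pl_qcvg_CP T0 (ltW gam0) g2') => //.
  exact: (brownian_cameron_martin T0 j bw cmv).
have hbB : {ae P, forall om, [/\ forall i, qcvg (HP T alpha) (fun n => (dyadic T n (sample b om))^~ i) ((sample b om)^~ i),
    forall i j, qcvg (Hb T (alpha + alpha))
      (fun n => YI ((dyadic T n (sample b om))^~ i) ((dyadic T n (sample b om))^~ j)) (fun s t => lev2 (B om) s t (i, j))
  & forall i j k, qcvg (Hb T (alpha + alpha + alpha))
      (fun n => T3 ((dyadic T n (sample b om))^~ i) ((dyadic T n (sample b om))^~ j) ((dyadic T n (sample b om))^~ k))
      (fun s t => lev3 (B om) s t (i, j, k))]}.
  move: hb cB; apply: filterS2 => om hb' [[rB _] lB]; split.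
  - by move=> i; exact: (canonical_lev1_cvg T0 a0 hb' rB lB).
  - by move=> i j; exact: (canonical_lev2_cvg T0 rB lB).
  - by move=> i j k; exact: (canonical_lev3_cvg T0 rB lB).
have hwW : {ae P, forall om, (forall j, qcvg (HP T gamma) (fun n => pl T n (path1 w j om)) (path1 w j om)) /\
  forall i j, qcvg (Hb T (gamma + gamma)) (fun n => dy T n (path1 w i om) (path1 w j om))
    (fun s t => W2 om s t (i, j))}.
  move: hw hW; apply: filterS2 => om hw' hW'.
  have cw j : qcvg (HP T gamma) (fun n => pl T n (path1 w j om)) (path1 w j om).
    by apply: (pl_qcvg_HP T0 (ltW gam0) _ _ (hw' j)); rewrite /g'; lra.
  by split => //; exact: hW'.
move: hbB hwW hI; apply: filterS3 => om [cb cB2 cB3] [cw cW2] hI' /=.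
apply: (@translation_geometric _ T T0 _ _ _ _ a4 _ _ g2 ag _ _ _ _ _ _ _
  (fun n => dyadic T n (sample b om)) (fun n => dyadic T n u) (fun n => dyadic T n (sample w om)) (fun n => dyadic T n v)).
- lra.
- exact: g3.
- by move=> n i; split; [exact: (lip_pl T0 n ((sample b om)^~ i))|exact: (lip_pl T0 n (u^~ i))].
- by move=> n j; split; [exact: (lip_pl T0 n ((sample w om)^~ j))|exact: (lip_pl T0 n (v^~ j))].
- exact: cb.
- exact: hu.
- exact: cw.
- exact: hv.
- exact: cB2.
- exact: cB3.
- exact: (hI' cb cw).
- exact: cW2.
Qed.
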